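(* The following problem is 2ExpTime-complete: given Horn-$\mathcal{ALC}$ TBoxes $\mathcal{T}_1,\mathcal{T}_2$ and a pair of signatures $\Theta=(\Sigma_1,\Sigma_2)$, decide whether $\mathcal{T}_1$ $\Theta$-CQ entails $\mathcal{T}_2$. The 2ExpTime lower bound already holds when restricted to pairs of the form $\Theta=(\Sigma,\Sigma)$.
   Context: A TBox is a finite set of inclusions between $\mathcal{ALC}$ concepts (built from concept names, $\top$, $\neg$, $\sqcap$, $\exists R.C$); it is Horn-$\mathcal{ALC}$ if no $\neg C$ occurs negatively and no $\exists R.\neg C$ occurs positively. An ABox is a finite set of assertions $A(a)$, $R(a,b)$; a $\Sigma_1$-ABox uses only names in $\Sigma_1$. Interpretations satisfy $a^{\mathcal{I}}=a$. A CQ is $\exists\vec y\,\varphi(\vec x,\vec y)$ with $\varphi$ a conjunction of atoms $A(z)$, $R(z,z')$; $(\mathcal{T},\mathcal{A})\models q(\vec a)$ means all models satisfy $q(\vec a)$. $\mathcal{T}_1$ $\Theta$-CQ entails $\mathcal{T}_2$ if for every $\Sigma_1$-ABox $\mathcal{A}$ consistent with both $\mathcal{T}_1$ and $\mathcal{T}_2$, every CQ $q(\vec x)$ over names in $\Sigma_2$ and every tuple $\vec a$ from $\mathsf{ind}(\mathcal{A})$, $(\mathcal{T}_2,\mathcal{A})\models q(\vec a)$ implies $(\mathcal{T}_1,\mathcal{A})\models q(\vec a)$.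
   Formalization: In the definition of Horn-ALC, ¬∃R.¬C is treated as the unit ∀R.C when counting occurrences, so ∀R.C is allowed on right-hand sides; read literally, the condition leaves only EL with ⊥, where the problem is in ExpTime and the 2ExpTime lower bound fails. *)

(* Defs.v *)
From HB Require Import structures.
From Stdlib Require List.
From mathcomp Require Import all_boot.

Set Implicit Arguments.
Unset Strict Implicit.
Unset Printing Implicit Defensive.

(** * ALC *)

(* The countably infinite supplies of concept and role names are both indexed
   by bit strings; sorts are separated syntactically. *)
Definition name := seq bool.

Inductive concept :=
| CName of name
| CTop
| CNot of concept
| CAnd of concept & concept
| CEx of name & concept.

(* [(C, D)] is the inclusion "C is subsumed by D". *)
Definition tbox := seq (concept * concept).

(* [occ p X C]: the concept [X] occurs in [C], positively if [p = true] and
   negatively if [p = false].  The concept (not exists R. not D) is the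
   abbreviation of (forall R. D) and is treated as a unit: its occurrences are
   itself and the ones in D, with the same sign.  This is the standard notion
   of polarity.  If the abbreviation were expanded when looking for
   occurrences, then the inner negation of every (forall R. D) on a right-hand
   side would be a negative occurrence of (not D), and [horn] below would
   exclude the value restrictions that distinguish Horn-ALC from EL with
   disjointness. *)
Fixpoint occ (p : bool) (X C : concept) {struct C} : Prop :=
  (p /\ X = C) \/
  match C with
  | CName _ | CTop => False
  | CNot (CEx _ (CNot D)) => occ p X D
  | CNot D => occ (~~ p) X D
  | CAnd D E => occ p X D \/ occ p X E
  | CEx _ D => occ p X D
  end.

Definition occ_tbox (p : bool) (X : concept) (T : tbox) : Prop :=
  List.Exists (fun i => occ (~~ p) X i.1 \/ occ p X i.2) T.

Definition horn (T : tbox) : Prop :=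
  (forall C, ~ occ_tbox false (CNot C) T) /\
  (forall R C, ~ occ_tbox true (CEx R (CNot C)) T).

(** * Semantics *)

Definition ind := nat.

(* Individual names denote themselves ([a^I = a]); as domains are arbitrary
   types, this is rendered by an embedding of the names into the domain. *)
Record interp := Interp {
  idom : Type;
  iind : ind -> idom;
  iind_inj : injective iind;
  icon : name -> idom -> Prop;
  irol : name -> idom -> idom -> Prop
}.

Fixpoint ext (I : interp) (C : concept) (d : idom I) : Prop :=
  match C with
  | CName A => icon A d
  | CTop => True
  | CNot D => ~ ext D d
  | CAnd D E => ext D d /\ ext E d
  | CEx R D => exists e, irol R d e /\ ext D e
  end.

Definition model_tbox (I : interp) (T : tbox) : Prop :=
  List.Forall (fun i => forall d : idom I, ext i.1 d -> ext i.2 d) T.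

(* Atoms A(t), R(t,t'), over individuals in ABoxes, over variables in CQs. *)
Inductive atom (X : Type) :=
| AtC of name & X
| AtR of name & X & X.

Definition sat (X : Type) (I : interp) (f : X -> idom I) (at_ : atom X) : Prop :=
  match at_ with
  | AtC A t => icon A (f t)
  | AtR R t t' => irol R (f t) (f t')
  end.

Definition terms (X : Type) (at_ : atom X) : seq X :=
  match at_ with AtC _ t => [:: t] | AtR _ t t' => [:: t; t'] end.

Definition abox := seq (atom ind).

Definition inds (A : abox) : seq ind := flatten (map (@terms ind) A).

Definition model_abox (I : interp) (A : abox) : Prop :=
  List.Forall (sat (@iind I)) A.

Definition consistent (T : tbox) (A : abox) : Prop :=
  exists I : interp, model_tbox I T /\ model_abox I A.

(* Concept names and role names. *)
Definition signature := (seq name * seq name)%type.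

Definition over (X : Type) (S : signature) (at_ : atom X) : bool :=
  match at_ with AtC A _ => A \in S.1 | AtR R _ _ => R \in S.2 end.

Definition var := nat.

(* The variables of [body] that are not in [ans] are quantified. *)
Record cq := CQ { ans : seq var; body : seq (atom var) }.

Definition holds (I : interp) (q : cq) (a : seq ind) : Prop :=
  exists pi : var -> idom I,
    map pi (ans q) = map (@iind I) a /\ List.Forall (sat pi) (body q).

Definition certain (T : tbox) (A : abox) (q : cq) (a : seq ind) : Prop :=
  forall I : interp, model_tbox I T -> model_abox I A -> holds I q a.

Definition cq_entails (Theta : signature * signature) (T1 T2 : tbox) : Prop :=
  forall A : abox, all (over Theta.1) A ->
  consistent T1 A -> consistent T2 A ->
  forall q : cq, uniq (ans q) -> all (over Theta.2) (body q) ->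
  forall a : seq ind, size a = size (ans q) -> {subset a <= inds A} ->
  certain T2 A q a -> certain T1 A q a.

(** * Turing machines and complexity *)

Inductive move := GoLeft | Stay | GoRight.

(* Deterministic machines with one two-way infinite tape.  A cell holds
   [None] (blank), an input symbol, an output symbol, or an auxiliary one. *)
Record tm (I O : finType) := TM {
  tm_state : finType;
  tm_aux : finType;
  tm_init : tm_state;
  tm_halt : pred tm_state;
  tm_acc : pred tm_state;
  tm_step : tm_state -> option (I + O + tm_aux) ->
            tm_state * option (I + O + tm_aux) * move
}.

Section Run.
Variables (I O : finType) (M : tm I O).

Definition cell := option (I + O + tm_aux M).

Record config := Config {
  cstate : tm_state M;
  cleft : seq cell;   (* cells left of the head, nearest first *)
  cright : seq cell   (* scanned cell, then the cells to its right *)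
}.

Definition start (w : seq I) : config :=
  Config (tm_init M) [::] [seq Some (inl (inl x)) | x <- w].

Definition next (c : config) : config :=
  if tm_halt (cstate c) then c else
  let: (s, b, m) := tm_step (cstate c) (head None (cright c)) in
  let r := b :: behead (cright c) in
  match m with
  | GoLeft => Config s (behead (cleft c)) (head None (cleft c) :: r)
  | Stay => Config s (cleft c) r
  | GoRight => Config s (b :: cleft c) (behead r)
  end.

Definition run (t : nat) (w : seq I) : config := iter t next (start w).

(* The output starts at the head and ends before the first cell that does not
   hold an output symbol. *)
Fixpoint read (r : seq cell) : seq O :=
  match r with
  | Some (inl (inr y)) :: r' => y :: read r'
  | _ => [::]
  end.

Definition decides (L : seq I -> Prop) (t : nat -> nat) : Prop :=
  forall w, let c := run (t (size w)) w in
  tm_halt (cstate c) /\ (L w <-> tm_acc (cstate c)).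

Definition computes (f : seq I -> seq O) (t : nat -> nat) : Prop :=
  forall w, let c := run (t (size w)) w in
  tm_halt (cstate c) /\ read (cright c) = f w.

End Run.

(* Every polynomial is dominated by some [n ^ k + k]. *)
Definition polytime (I O : finType) (f : seq I -> seq O) : Prop :=
  exists (M : tm I O) (k : nat), computes M f (fun n => n ^ k + k).

Definition in_2exptime (I : finType) (L : seq I -> Prop) : Prop :=
  exists (M : tm I void) (k : nat),
    decides M L (fun n => 2 ^ (2 ^ (n ^ k + k))).

Definition hard_2exptime (O : finType) (L : seq O -> Prop) : Prop :=
  forall (I : finType) (L' : seq I -> Prop), in_2exptime L' ->
  exists f : seq I -> seq O, polytime f /\ forall w, L' w <-> L (f w).

Definition complete_2exptime (O : finType) (L : seq O -> Prop) : Prop :=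
  in_2exptime L /\ hard_2exptime L.

(** * The decision problem *)

Inductive token := KBit of bool | KSep | KTop | KNot | KAnd | KEx | KEnd.

Definition token_code (k : token) : option (bool + 'I_5) :=
  match k with
  | KBit b => Some (inl b)
  | KSep => None
  | KTop => Some (inr (@Ordinal 5 0 isT))
  | KNot => Some (inr (@Ordinal 5 1 isT))
  | KAnd => Some (inr (@Ordinal 5 2 isT))
  | KEx => Some (inr (@Ordinal 5 3 isT))
  | KEnd => Some (inr (@Ordinal 5 4 isT))
  end.

Definition token_decode (x : option (bool + 'I_5)) : token :=
  match x with
  | Some (inl b) => KBit b
  | None => KSep
  | Some (inr i) => nth KEnd [:: KTop; KNot; KAnd; KEx; KEnd] i
  end.

Lemma token_codeK : cancel token_code token_decode.
Proof. by case. Qed.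

HB.instance Definition _ := Finite.copy token (can_type token_codeK).

Definition enc_name (A : name) : seq token := rcons (map KBit A) KSep.

Fixpoint enc_concept (C : concept) : seq token :=
  match C with
  | CName A => enc_name A
  | CTop => [:: KTop]
  | CNot D => KNot :: enc_concept D
  | CAnd D E => KAnd :: enc_concept D ++ enc_concept E
  | CEx R D => KEx :: enc_name R ++ enc_concept D
  end.

Definition enc_list (X : Type) (e : X -> seq token) (s : seq X) : seq token :=
  rcons (flatten (map e s)) KEnd.

Definition enc_tbox (T : tbox) : seq token :=
  enc_list (fun i => enc_concept i.1 ++ enc_concept i.2) T.

Definition enc_signature (S : signature) : seq token :=
  enc_list enc_name S.1 ++ enc_list enc_name S.2.

(* [T1], [T2] and the pair of signatures *)
Definition instance := (tbox * tbox * (signature * signature))%type.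

Definition enc_instance (x : instance) : seq token :=
  let: (T1, T2, Theta) := x in
  enc_tbox T1 ++ enc_tbox T2 ++ enc_signature Theta.1 ++ enc_signature Theta.2.

Definition horn_cq_entailment (x : instance) : Prop :=
  let: (T1, T2, Theta) := x in
  [/\ horn T1, horn T2 & cq_entails Theta T1 T2].

Definition same_signature (x : instance) : Prop := x.2.1 = x.2.2.

(* The language of a problem: the encodings of its yes-instances. *)
Definition language (P : instance -> Prop) (w : seq token) : Prop :=
  exists x, P x /\ w = enc_instance x.

(* Main.v *)
From HB Require Import structures.
From Stdlib Require List.
From Stdlib Require Import Classical ClassicalEpsilon.
Require Import Defs.
From mathcomp Require Import all_boot zify.

Set Implicit Arguments.
Unset Strict Implicit.
Unset Printing Implicit Defensive.

(** Upper bound. Horn-ALC has canonical models: closing the types of the individuals under deduction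
    and unravelling existential restrictions into trees yields a model in which a negation-free
    concept holds only where it is derived ([canon_neg], [canon_pos], [canon_model]). So what must
    be refuted can be taken to be a finite piece of a tree generated by T2, and refuting it means
    that this tree is not simulated, over Sigma2, in some model of T1. An individual is abstracted
    to a state: its type in a model of T1, its type in a model of T2, and a set of T2-types that are
    not simulated at it, each with a reason. Reasons are checked locally, against anonymous
    successors by the fixed point [na] and along role assertions by [edge]. Besides, a set Z of
    types that are simulated nowhere is tried out; it accounts for Boolean queries matched in parts
    that hang on roles outside Sigma2.

    For fixed Z the states that pass the checks form one largest ABox, on which the consequences of
    T2 are computed. Entailment fails iff, for some Z, a state derives a type recorded there as not
    simulated, or a type from which a member of Z is generated ([nonentP]). A failure becomes a
    genuine finite ABox by stacking layers of copies of the states, which makes the recorded reasons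
    well-founded ([layered_nonent]). If there is no failure, the canonical model over the derived
    facts maps over Sigma2 into the given model of T1 ([complete_holds]). There are doubly
    exponentially many states and sets Z, and everything else is polynomial in these numbers
    ([horn_in_2exptime]).

    Lower bound. T1 is empty and both signatures consist of three concept names S, E, Root and one
    role. A doubly exponentially long run of a deterministic machine is described by rules that
    derive judgements about a time t and a tape position p ([prov_mean], [prov_cell]). Both numbers
    have exponentially many bits, so a pair is a word of exponential length, and a derivation is a
    tree of words in which neighbouring words are compared by a finite automaton ([Qd]). An ABox
    writes each word, next to a copy of its parent word, as a block of L nodes, and T2 runs a
    counter modulo L and the automaton along it. A copying error is visible as an S-node with an
    E-node exactly L steps further. When T2 derives the root judgement it creates a fresh chain with
    just this pattern. If the ABox has an error, the chain adds nothing new; if it has none, the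
    pattern is a query entailed by T2 and not by T1. Hence entailment fails iff the judgement of
    rejection has a derivation ([Qd_entails], [Qd_nonentails], [prov_reject]).

    Machines. Complexity is established with combinators for functions on binary trees; these are
    compiled to programs over four stacks and then to one-tape machines ([pf_polytime],
    [bf_in_2exptime]). *)

(** * Structured programs over four stacks *)

Inductive reg := RM | RA | RB | RC.

Section Quad.
Variable X : Type.
Definition quad := (X * X * X * X)%type.
Definition get (q : quad) (i : reg) : X :=
  match i with RM => q.1.1.1 | RA => q.1.1.2 | RB => q.1.2 | RC => q.2 end.
Definition put (q : quad) (i : reg) (x : X) : quad :=
  let: (m, a, b, c) := q in
  match i with
  | RM => (x, a, b, c) | RA => (m, x, b, c) | RB => (m, a, x, c) | RC => (m, a, b, x)
  end.
Definition build (f : reg -> X) : quad := (f RM, f RA, f RB, f RC).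
Lemma get_build f i : get (build f) i = f i. Proof. by case: i. Qed.
Lemma quadP q q' : (forall i, get q i = get q' i) -> q = q'.
Proof.
case: q => [[[a b] c] d]; case: q' => [[[a' b'] c'] d'] H.
by move: (H RM) (H RA) (H RB) (H RC) => /= -> -> -> ->.
Qed.
End Quad.

Definition reg_eqb (i j : reg) : bool :=
  match i, j with RM, RM | RA, RA | RB, RB | RC, RC => true | _, _ => false end.

Lemma get_put X (q : quad X) i x j : get (put q i x) j = if reg_eqb i j then x else get q j.
Proof. by case: q => [[[a b] c] d]; case: i; case: j. Qed.

Lemma reg_eqbP i j : reflect (i = j) (reg_eqb i j).
Proof. by case: i; case: j; constructor. Qed.

Section Com.
Variable G : Type.

Inductive com :=
| Push of reg & G
| Pop of reg
| Seq of com & com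
| If of reg & pred (option G) & com & com
| While of reg & pred (option G) & com.

Definition stacks := quad (seq G).

Inductive exec : com -> stacks -> nat -> stacks -> Prop :=
| EPush i g s : exec (Push i g) s 1 (put s i (g :: get s i))
| EPop i s : exec (Pop i) s 1 (put s i (behead (get s i)))
| ESeq c1 c2 s t1 s1 t2 s2 :
    exec c1 s t1 s1 -> exec c2 s1 t2 s2 -> exec (Seq c1 c2) s (t1 + t2) s2
| EIfT i (p : pred (option G)) c1 c2 s t s' :
    p (ohead (get s i)) -> exec c1 s t s' -> exec (If i p c1 c2) s t.+1 s'
| EIfF i (p : pred (option G)) c1 c2 s t s' :
    ~~ p (ohead (get s i)) -> exec c2 s t s' -> exec (If i p c1 c2) s t.+1 s'
| EWhileF i (p : pred (option G)) c s : ~~ p (ohead (get s i)) -> exec (While i p c) s 1 s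
| EWhileT i (p : pred (option G)) c s t1 s1 t2 s2 :
    p (ohead (get s i)) -> exec c s t1 s1 -> exec (While i p c) s1 t2 s2 ->
    exec (While i p c) s (t1 + t2).+1 s2.

Inductive ins (X : Type) :=
| IPush of reg & G & X
| IPop of reg & X
| ITest of reg & pred (option G) & X & X
| IHalt of bool.

Fixpoint pts (c : com) : finType :=
  match c with
  | Push _ _ | Pop _ => unit
  | Seq c1 c2 => (pts c1 + pts c2)%type
  | If _ _ c1 c2 => (unit + (pts c1 + pts c2))%type
  | While _ _ c => (unit + pts c)%type
  end.

Fixpoint entry (c : com) : pts c :=
  match c return pts c with
  | Push _ _ | Pop _ => tt
  | Seq c1 c2 => inl (entry c1)
  | If _ _ c1 c2 => inl tt
  | While _ _ c => inl tt
  end.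

(** [emb] places the control points of a subprogram among those of the whole program and [ex] is the
    label reached on exit, so nesting needs no renumbering of labels. *)
Fixpoint code_of (X : Type) (c : com) : (pts c -> X) -> X -> pts c -> ins X :=
  match c return (pts c -> X) -> X -> pts c -> ins X with
  | Push i g => fun _ ex _ => IPush i g ex
  | Pop i => fun _ ex _ => IPop i ex
  | Seq c1 c2 => fun emb ex x =>
      match x with
      | inl y => code_of (fun z => emb (inl z)) (emb (inr (entry c2))) y
      | inr y => code_of (fun z => emb (inr z)) ex y
      end
  | If i p c1 c2 => fun emb ex x =>
      match x with
      | inl _ => ITest i p (emb (inr (inl (entry c1)))) (emb (inr (inr (entry c2))))
      | inr (inl y) => code_of (fun z => emb (inr (inl z))) ex y
      | inr (inr y) => code_of (fun z => emb (inr (inr z))) ex y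
      end
  | While i p c => fun emb ex x =>
      match x with
      | inl _ => ITest i p (emb (inr (entry c))) ex
      | inr y => code_of (fun z => emb (inr z)) (emb (inl tt)) y
      end
  end.

Section Small.
Variables (X : Type) (prog : X -> ins X).

Definition sm_step (xs : X * stacks) : X * stacks :=
  let: (x, s) := xs in
  match prog x with
  | IPush i g y => (y, put s i (g :: get s i))
  | IPop i y => (y, put s i (behead (get s i)))
  | ITest i p y z => (if p (ohead (get s i)) then y else z, s)
  | IHalt _ => (x, s)
  end.

Lemma exec_small c s t s' : exec c s t s' ->
  forall (emb : pts c -> X) (ex : X),
  (forall x, prog (emb x) = code_of emb ex x) ->
  iter t sm_step (emb (entry c), s) = (ex, s').
Proof.
elim=> {c s t s'}.
- by move=> i g s emb ex H; rewrite /= (H tt).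
- by move=> i s emb ex H; rewrite /= (H tt).
- move=> c1 c2 s t1 s1 t2 s2 _ IH1 _ IH2 emb ex H.
  rewrite addnC iterD.
  rewrite (IH1 (fun z => emb (inl z)) (emb (inr (entry c2)))); last by move=> x; rewrite (H (inl x)).
  by rewrite (IH2 (fun z => emb (inr z)) ex) // => x; rewrite (H (inr x)).
- move=> i p c1 c2 s t s' Hp _ IH emb ex H.
  rewrite iterSr /= (H (inl tt)) /= Hp.
  by rewrite (IH (fun z => emb (inr (inl z))) ex) // => x; rewrite (H (inr (inl x))).
- move=> i p c1 c2 s t s' Hp _ IH emb ex H.
  rewrite iterSr /= (H (inl tt)) /= (negbTE Hp).
  by rewrite (IH (fun z => emb (inr (inr z))) ex) // => x; rewrite (H (inr (inr x))).
- by move=> i p c s Hp emb ex H; rewrite /= (H (inl tt)) /= (negbTE Hp).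
- move=> i p c s t1 s1 t2 s2 Hp _ IH1 _ IH2 emb ex H.
  rewrite iterSr /= (H (inl tt)) /= Hp addnC iterD.
  rewrite (IH1 (fun z => emb (inr z)) (emb (inl tt))); last by move=> x; rewrite (H (inr x)).
  by rewrite (IH2 emb ex).
Qed.
End Small.

Definition tot (s : stacks) := size (get s RM) + size (get s RA) + size (get s RB) + size (get s RC).

(** Only a push lengthens a stack, and by one. Through this lemma every bound on time is also a
    bound on the size of the result. *)
Lemma exec_tot c s t s' : exec c s t s' -> tot s' <= tot s + t.
Proof.
elim=> {c s t s'} //=; try (move=> *; lia).
- by move=> i g [[[a b] c] d]; rewrite /tot; case: i => /=; lia.
- by move=> i [[[a b] c] d]; rewrite /tot; case: i => /=; rewrite size_behead; lia.
Qed.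

Lemma exec_gt0 c s t s' : exec c s t s' -> 0 < t.
Proof. elim=> {c s t s'} //=; move=> *; lia. Qed.

End Com.
Arguments IHalt {G X}.

(** * Change of the stack alphabet *)

Section Lift.
Variables (G H : Type) (f : G -> H) (g : H -> option G).
Hypothesis fK : pcancel f g.

(** Tests read a symbol back through [g]; a symbol outside the image of [f] looks like an empty
    stack. *)
Fixpoint lift (c : com G) : com H :=
  match c with
  | Push i x => Push i (f x)
  | Pop i => Pop _ i
  | Seq c1 c2 => Seq (lift c1) (lift c2)
  | If i p c1 c2 => If i (fun o => p (obind g o)) (lift c1) (lift c2)
  | While i p c => While i (fun o => p (obind g o)) (lift c)
  end.

Definition smap (s : stacks G) : stacks H := build (fun i => map f (get s i)).

Lemma smap_put s i l : smap (put s i l) = put (smap s) i (map f l).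
Proof. by apply: quadP => j; rewrite /smap get_build !get_put get_build; case: reg_eqb. Qed.

Lemma obind_ohead s i : obind g (ohead (get (smap s) i)) = ohead (get s i).
Proof. by rewrite get_build; case: (get s i) => //= x l; rewrite fK. Qed.

Lemma exec_lift c s t s' : exec c s t s' -> exec (lift c) (smap s) t (smap s').
Proof.
elim=> {c s t s'} /=.
- move=> i x s; rewrite smap_put.
  have -> : map f (x :: get s i) = f x :: get (smap s) i by rewrite get_build.
  exact: EPush.
- move=> i s; rewrite smap_put.
  have -> : map f (behead (get s i)) = behead (get (smap s) i) by rewrite get_build behead_map.
  exact: EPop.
- move=> c1 c2 s t1 s1 t2 s2 _ H1 _ H2; exact: ESeq H1 H2.
- by move=> i p c1 c2 s t s' Hp _ IH; apply: EIfT => //; rewrite obind_ohead.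
- by move=> i p c1 c2 s t s' Hp _ IH; apply: EIfF => //; rewrite obind_ohead.
- by move=> i p c s Hp; apply: EWhileF; rewrite obind_ohead.
- by move=> i p c s t1 s1 t2 s2 Hp _ H1 _ H2; apply: EWhileT H1 H2; rewrite obind_ohead.
Qed.
End Lift.

(** * Simulation of four stacks on one tape *)

Inductive phase := Seek | Look | Back | Init0 | Init1 | Init2 | Out | OutBack | Fin.

Definition phase_code (k : phase) : 'I_9 :=
  match k with
  | Seek => @Ordinal 9 0 isT | Look => @Ordinal 9 1 isT | Back => @Ordinal 9 2 isT
  | Init0 => @Ordinal 9 3 isT | Init1 => @Ordinal 9 4 isT | Init2 => @Ordinal 9 5 isT
  | Out => @Ordinal 9 6 isT | OutBack => @Ordinal 9 7 isT | Fin => @Ordinal 9 8 isT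
  end.
Definition phase_decode (i : 'I_9) : phase :=
  nth Fin [:: Seek; Look; Back; Init0; Init1; Init2; Out; OutBack; Fin] i.
Lemma phase_codeK : cancel phase_code phase_decode. Proof. by case. Qed.
HB.instance Definition _ := Finite.copy phase (can_type phase_codeK).

Section Machine.
Variables (I O : finType).

Definition sym := (bool + (I + O))%type.
Definition trk : finType := quad (option sym).
Definition empty_trk : trk := (None, None, None, None).
(** [None] is the marker at the left end; [Some t] is a cell with one track per stack. *)
Definition aux : finType := option trk.

Variables (X : finType) (prog : X -> ins sym X) (x0 : X).

Notation tcell := (option (I + O + aux)).

Definition mark : tcell := Some (inr None).
Definition wr (t : trk) : tcell := Some (inr (Some t)).
(** Blank, input and output cells read as cells with empty tracks, so unvisited tape needs no
    initialisation. *)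
Definition rd (b : tcell) : option trk :=
  match b with
  | Some (inr a) => a
  | _ => Some empty_trk
  end.

(** Stacks grow from the marker to the right. [Seek] runs to the first cell whose track [i] is
    empty, where a push writes; [Look] is one cell to the left, on the top of the stack or on the
    marker if the stack is empty; [Back] returns to the marker. *)
Definition tstep (q : X * phase) (b : tcell) : (X * phase) * tcell * move :=
  let: (x, ph) := q in
  match ph with
  | Init0 => ((x, Init1), b, GoLeft)
  | Init1 => ((x, Init2), mark, GoRight)
  | Init2 =>
      match b with
      | Some (inl (inl a)) => ((x, Init2), wr (put empty_trk RA (Some (inr (inl a)))), GoRight)
      | _ => ((x, Back), b, GoLeft)
      end
  | Seek =>
      match rd b, prog x with
      | Some t, IPush i g y =>
          if get t i is None then ((y, Back), wr (put t i (Some g)), GoLeft)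
          else ((x, Seek), b, GoRight)
      | Some t, IPop i _ | Some t, ITest i _ _ _ =>
          if get t i is None then ((x, Look), b, GoLeft) else ((x, Seek), b, GoRight)
      | _, _ => ((x, Out), b, Stay)
      end
  | Look =>
      match rd b, prog x with
      | None, IPop _ y => ((y, Seek), b, GoRight)
      | None, ITest _ p y z => ((if p None then y else z, Seek), b, GoRight)
      | Some t, IPop i y => ((y, Back), wr (put t i None), GoLeft)
      | Some t, ITest i p y z => ((if p (get t i) then y else z, Back), b, GoLeft)
      | _, _ => ((x, Out), b, Stay)
      end
  | Back => if rd b is None then ((x, Seek), b, GoRight) else ((x, Back), b, GoLeft)
  | Out =>
      match rd b with
      | Some t => match get t RA with
                  | Some (inr (inr o)) => ((x, Out), Some (inl (inr o)), GoRight)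
                  | _ => ((x, OutBack), None, GoLeft)
                  end
      | None => ((x, OutBack), None, GoLeft)
      end
  | OutBack => if rd b is None then ((x, Fin), b, GoRight) else ((x, OutBack), b, GoLeft)
  | Fin => ((x, Fin), b, Stay)
  end.

Definition is_fin (q : X * phase) : bool := if q.2 is Fin then true else false.

Definition machine : tm I O :=
  @TM I O (X * phase)%type aux (x0, Init0) is_fin
    (fun q => is_fin q && if prog q.1 is IHalt b then b else false) tstep.

Notation conf := (config machine).
Notation cfg q l r := (@Config I O machine q l r).
Notation nx := (@Defs.next I O machine).

Lemma nxE q l r : ~~ is_fin q -> nx (cfg q l r) =
  let: (q', b, m) := tstep q (head None r) in
  match m with
  | GoLeft => cfg q' (behead l) (head None l :: b :: behead r)
  | Stay => cfg q' l (b :: behead r)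
  | GoRight => cfg q' (b :: l) (behead r)
  end.
Proof. by move=> /negbTE H; rewrite /Defs.next [tm_halt _]H. Qed.

(** The bottom of each stack lies next to the marker, hence the [rev]. *)
Definition cellat (s : stacks sym) (j : nat) : trk :=
  build (fun i => nth None (map Some (rev (get s i))) j).

Definition rep (s : stacks sym) (r : seq tcell) := forall j, rd (nth None r j) = Some (cellat s j).

Definition fwd r n : seq tcell := rev (mkseq (nth None r) n).

Lemma fwdS r n : fwd r n.+1 = fwd (behead r) n ++ [:: head None r].
Proof.
rewrite /fwd cats1 -rev_cons; congr rev; rewrite /mkseq -[n.+1]/(1 + n) iotaD map_cat /=.
congr cons.
rewrite addnC iotaDl -map_comp; apply: eq_map => j /=.
by rewrite nth_behead.
Qed.

Lemma size_fwd r n : size (fwd r n) = n.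
Proof. by rewrite size_rev size_mkseq. Qed.

Lemma drop_behead (T : Type) n (s : seq T) : drop n (behead s) = drop n.+1 s.
Proof. by case: s => //; rewrite drop_nil. Qed.

Lemma move_right q l r n :
  (forall j, j < n -> ~~ is_fin q /\ tstep q (nth None r j) = (q, nth None r j, GoRight)) ->
  iter n nx (cfg q l r) = cfg q (fwd r n ++ l) (drop n r).
Proof.
elim: n l r => [|n IH] l r H; first by rewrite drop0.
rewrite iterSr fwdS -catA /=.
have [Hq E] := H 0 isT; rewrite nxE // -nth0 E IH ?drop_behead //.
by move=> j Hj; rewrite nth_behead; apply: H.
Qed.

Lemma move_left q l pre b r :
  ~~ is_fin q ->
  (forall c, c \in b :: pre -> tstep q c = (q, c, GoLeft)) ->
  iter (size pre).+1 nx (cfg q (pre ++ mark :: l) (b :: r)) =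
  cfg q l (mark :: rev pre ++ b :: r).
Proof.
move=> Hq; elim: pre b r => [|c pre IH] b r H.
  by rewrite [iter _ _ _]/= nxE // H ?inE ?eqxx.
rewrite iterSr nxE // (H b) ?inE ?eqxx //.
have IH' := IH c (b :: r).
rewrite [in LHS]IH' => [|d Hd]; last by rewrite H // inE Hd orbT.
by rewrite rev_cons cat_rcons.
Qed.

Lemma rd_marker b : rd b = None -> b = mark.
Proof. by case: b => [[[]|[]]|]. Qed.

Lemma back_home x pre b r :
  (forall c, c \in b :: pre -> rd c <> None) ->
  iter (size pre).+2 nx (cfg (x, Back) (pre ++ [:: mark]) (b :: r)) =
  cfg (x, Seek) [:: mark] (rev pre ++ b :: r).
Proof.
move=> H; rewrite iterS move_left //.
by move=> c /H /=; case: (rd c).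
Qed.

Lemma fwd_nth r n j : j < n -> nth None (rev (fwd r n)) j = nth None r j.
Proof. by move=> H; rewrite /fwd revK nth_mkseq. Qed.

Lemma rep_rd s r c n b : rep s r -> rd b <> None -> c \in b :: fwd r n -> rd c <> None.
Proof.
move=> Hr Hb; rewrite inE => /orP[/eqP->//|].
by rewrite /fwd mem_rev => /mapP[j _ ->]; rewrite Hr.
Qed.

Lemma rep_update s s' r n b k : rep s r -> k = size (fwd r n) ->
  rd b = Some (cellat s' n) -> (forall j, j != n -> cellat s' j = cellat s j) ->
  rep s' (rev (fwd r n) ++ b :: drop n.+1 r).
Proof.
move=> Hr _ Hb Hs j; rewrite nth_cat size_rev size_fwd.
case: ltnP => Hj; first by rewrite fwd_nth // Hr Hs //; apply/eqP; lia.
case: (ltngtP n j) Hj => // [Hj _|<- _]; last by rewrite subnn /= Hb.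
have -> : j - n = (j - n.+1).+1 by lia.
by rewrite /= nth_drop subnKC // Hr Hs //; apply/eqP; lia.
Qed.

Lemma cellat_None s i j : get (cellat s j) i = None <-> size (get s i) <= j.
Proof.
rewrite /cellat get_build; split=> [|H]; last by rewrite nth_default // size_map size_rev.
case: leqP => // H; have Hg : 0 < size (get s i) by lia.
case E : (get s i) H Hg => [//|g l] H _.
by rewrite (nth_map g) // size_rev.
Qed.

Lemma cellat_top s i : get (cellat s (size (get s i)).-1) i = ohead (get s i).
Proof.
rewrite /cellat get_build; case: (get s i) => [|g l] //=.
by rewrite rev_cons map_rcons nth_rcons size_map size_rev ltnn eqxx.
Qed.

Lemma cellat_put s i l j :
  cellat (put s i l) j = put (cellat s j) i (nth None (map Some (rev l)) j).
Proof.
apply: quadP => i'; rewrite get_put /cellat !get_build get_put.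
by case: reg_eqbP => // ->.
Qed.

Lemma put_same (T : Type) (q : quad T) i : put q i (get q i) = q.
Proof. by apply: quadP => j; rewrite get_put; case: reg_eqbP => // ->. Qed.

(* One step of the stack machine costs two sweeps over the tape. *)
Lemma sim_step s r x : rep s r -> (if prog x is IHalt _ then false else true) ->
  exists n r', [/\ n <= (tot s).*2 + 6,
    iter n nx (cfg (x, Seek) [:: mark] r) =
      cfg ((sm_step prog (x, s)).1, Seek) [:: mark] r' &
    rep (sm_step prog (x, s)).2 r'].
Proof.
move=> Hr Hx.
have Hget i : size (get s i) <= tot s by rewrite /tot; case: i; lia.
have seek i h : h = size (get s i) ->
    (forall b, tstep (x, Seek) b = if rd b is Some t then
       (if get t i is None then tstep (x, Seek) b else ((x, Seek), b, GoRight))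
       else tstep (x, Seek) b) ->
    iter h nx (cfg (x, Seek) [:: mark] r) = cfg (x, Seek) (fwd r h ++ [:: mark]) (drop h r).
  move=> -> Hs; apply: move_right => j Hj; split=> //.
  rewrite Hs Hr; case E : (get (cellat s j) i) => //.
  by move/cellat_None: E; lia.
have hd h : head None (drop h r) = nth None r h by rewrite -nth0 nth_drop addn0.
have bh h : behead (drop h r) = drop h.+1 r by rewrite -drop1 drop_drop add1n.
(* After the seek the head steps left: onto the top of stack [i], or onto the marker when that stack
   is empty. *)
have look i h : h = size (get s i) ->
    (forall b, tstep (x, Seek) b = if rd b is Some t then
       (if get t i is None then ((x, Look), b, GoLeft) else ((x, Seek), b, GoRight))
       else tstep (x, Seek) b) ->
    iter h.+1 nx (cfg (x, Seek) [:: mark] r) =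
    if h is h'.+1 then cfg (x, Look) (fwd r h' ++ [:: mark])
      (nth None r h' :: nth None r h :: drop h.+1 r)
    else cfg (x, Look) [::] (mark :: nth None r 0 :: drop 1 r).
  move=> Hh Hs; rewrite iterS (seek i) // => [|b]; last first.
    by rewrite Hs; case: (rd b) => // t; case: (get t i).
  rewrite nxE // hd bh Hs Hr.
  have /cellat_None -> : size (get s i) <= h by rewrite Hh.
  case: (h) => [|h'] //=.
  by rewrite {1 2}/fwd -addn1 /mkseq iotaD map_cat rev_cat /= add0n.
case E : (prog x) Hx => [i g y|i y|i p y z|b] // _.
- pose h := size (get s i).
  set s' := (sm_step prog (x, s)).2.
  have Es : s' = put s i (g :: get s i) by rewrite /s' /= E.
  have Hc : get (cellat s h) i = None by apply/cellat_None.
  pose b := wr (put (cellat s h) i (Some g)).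
  exists (h.+1 + h.+1), (rev (fwd r h) ++ b :: drop h.+1 r); split.
  + by have := Hget i; rewrite -/h; lia.
  + have P1 : iter h.+1 nx (cfg (x, Seek) [:: mark] r) =
        nx (cfg (x, Seek) (fwd r h ++ [:: mark]) (drop h r)).
      rewrite iterS (seek i h erefl) // => c /=.
      by rewrite E; case: (rd c) => // t; case: (get t i).
    rewrite iterD P1 nxE // hd bh [tstep _ _]/= E Hr Hc.
    case Eh : h => [|h'].
      by rewrite [iter 1 _ _]/= nxE // /b Eh /= E.
    have -> : fwd r h'.+1 = nth None r h' :: fwd r h'.
      by rewrite /fwd -addn1 /mkseq iotaD map_cat rev_cat /= add0n.
    have := @back_home y (fwd r h') (nth None r h') (b :: drop h'.+2 r).
    rewrite size_fwd /b Eh /= E => ->; first by rewrite rev_cons cat_rcons.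
    by move=> c; apply: (rep_rd Hr); rewrite Hr.
  + apply: (@rep_update s s' r h b _ Hr erefl).
      rewrite Es cellat_put -[rd b]/(Some (put (cellat s h) i (Some g))).
      congr (Some (put _ _ _)).
      by rewrite rev_cons map_rcons nth_rcons size_map size_rev ltnn eqxx.
    move=> j Hj; rewrite Es cellat_put.
    rewrite -[RHS](put_same _ i); congr put.
    rewrite /cellat get_build rev_cons map_rcons nth_rcons size_map size_rev.
    case: ltnP => // Hj'; rewrite (negbTE Hj) nth_default //.
    by rewrite size_map size_rev.
- pose h := size (get s i).
  set s' := (sm_step prog (x, s)).2.
  have Es : s' = put s i (behead (get s i)) by rewrite /s' /= E.
  have L := look i h erefl.
  have {}L := L (fun c => _).
  case Eh : h => [|h'].
    have E0 : get s i = [::] by apply/nilP; rewrite /nilp -/h Eh.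
    exists 2, (nth None r 0 :: drop 1 r); split; first by lia.
      rewrite iterS -[1]/(0.+1) -Eh L; last first.
        by move=> c /=; rewrite E; case: (rd c) => // t; case: (get t i).
      by rewrite Eh nxE //= E.
    have -> : s' = s by rewrite Es E0 -{2}(put_same s i) E0.
    by move=> j; case: j => [|j]; rewrite /= ?nth_drop ?add1n Hr.
  pose b := wr (put (cellat s h') i None).
  exists (h'.+3 + h'.+1), (rev (fwd r h') ++ b :: nth None r h :: drop h.+1 r); split.
  + by have := Hget i; rewrite -/h; lia.
  + rewrite addnC iterD.
    have -> : h'.+3 = 1 + h.+1 by rewrite Eh.
    rewrite iterD L; last first.
      by move=> c /=; rewrite E; case: (rd c) => // t; case: (get t i).
    rewrite Eh [iter 1 _ _]/= nxE // [tstep _ _]/= Hr E.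
    case: h' Eh @b => [|h''] Eh b.
      by rewrite [iter 1 _ _]/= nxE //= E.
    have -> : fwd r h''.+1 = nth None r h'' :: fwd r h''.
      by rewrite /fwd -addn1 /mkseq iotaD map_cat rev_cat /= add0n.
    have := @back_home y (fwd r h'') (nth None r h'') (b :: nth None r h :: drop h.+1 r).
    rewrite size_fwd /b Eh /= E => ->; first by rewrite rev_cons cat_rcons.
    by move=> c; apply: (rep_rd Hr); rewrite Hr.
  + have -> : nth None r h :: drop h.+1 r = behead (nth None r h' :: nth None r h :: drop h.+1 r) by [].
    have Hs' j : j != h' -> cellat s' j = cellat s j.
      move=> Hj; rewrite Es cellat_put -[RHS](put_same _ i); congr put.
      rewrite /cellat get_build; case El : (get s i) => [//|g l] /=.
      rewrite rev_cons map_rcons nth_rcons size_map size_rev.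
      have Hl : h' = size l by move: Eh; rewrite /h El => -[].
      case: ltnP => // Hj'; rewrite -Hl (negbTE Hj) nth_default //.
      by rewrite size_map size_rev.
    move=> j; have := @rep_update s s' r h' b _ Hr erefl _ Hs' j.
    have Hb : rd b = Some (cellat s' h').
      rewrite Es cellat_put -[rd b]/(Some (put (cellat s h') i None)).
      congr (Some (put _ _ _)).
      rewrite nth_default // size_map size_rev size_behead -/h Eh //.
    move=> /(_ Hb) <-; congr rd; rewrite !nth_cat; case: ltnP => // _.
    rewrite size_rev size_fwd; case: (j - h') => [|k] //=; rewrite Eh.
    by case: k => [|k] /=; rewrite !nth_drop; congr nth; lia.
- pose h := size (get s i).
  have L := look i h erefl.
  have {}L := L (fun c => _).
  case Eh : h => [|h'].
    have E0 : get s i = [::] by apply/nilP; rewrite /nilp -/h Eh.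
    exists 2, (nth None r 0 :: drop 1 r); split; first by lia.
      rewrite iterS -[1]/(0.+1) -Eh L; last first.
        by move=> c /=; rewrite E; case: (rd c) => // t; case: (get t i).
      by rewrite Eh nxE //= E E0.
    by rewrite /= E => j; case: j => [|j]; rewrite /= ?nth_drop ?add1n Hr.
  exists (h'.+3 + h'.+1), (rev (fwd r h') ++ nth None r h' :: nth None r h :: drop h.+1 r); split.
  + by have := Hget i; rewrite -/h; lia.
  + rewrite addnC iterD.
    have -> : h'.+3 = 1 + h.+1 by rewrite Eh.
    rewrite iterD L; last first.
      by move=> c /=; rewrite E; case: (rd c) => // t; case: (get t i).
    have Etop : get (cellat s h') i = ohead (get s i) by rewrite -cellat_top -/h Eh.
    rewrite Eh [iter 1 _ _]/= nxE // [tstep _ _]/= Hr E Etop.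
    case: h' Eh Etop => [|h''] Eh Etop.
      by rewrite [iter 1 _ _]/= nxE //= E.
    have -> : fwd r h''.+1 = nth None r h'' :: fwd r h''.
      by rewrite /fwd -addn1 /mkseq iotaD map_cat rev_cat /= add0n.
    have := @back_home (if p (ohead (get s i)) then y else z)
       (fwd r h'') (nth None r h'') (nth None r h''.+1 :: nth None r h :: drop h.+1 r).
    rewrite size_fwd Eh /= E => ->; first by rewrite rev_cons cat_rcons.
    by move=> c; apply: (rep_rd Hr); rewrite Hr.
  + rewrite /= E => j; rewrite -(Hr j); congr rd; rewrite nth_cat size_rev size_fwd.
    case: ltnP => Hj; first by rewrite fwd_nth.
    rewrite Eh; case Ej : (j - h') => [|[|k]] /=; last rewrite nth_drop.
    all: by congr nth; lia.
Qed.

Lemma tot_step xs : tot (sm_step prog xs).2 <= (tot xs.2).+1.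
Proof.
case: xs => x [[[a b] c] d]; rewrite /sm_step.
case: (prog x) => [[] g y|[] y|i p y z|h]; rewrite /tot /= ?size_behead; lia.
Qed.

(** Stacks grow by at most one symbol per step, so [tot s + t] bounds the length of each of the [t]
    sweeps. *)
Lemma sim_run t s r x : rep s r -> exists n r',
  [/\ n <= t * ((tot s + t).*2 + 6),
    iter n nx (cfg (x, Seek) [:: mark] r) =
      cfg ((iter t (sm_step prog) (x, s)).1, Seek) [:: mark] r' &
    rep (iter t (sm_step prog) (x, s)).2 r'].
Proof.
elim: t s r x => [|t IH] s r x Hr; first by exists 0, r.
(* A halting instruction leaves the stack machine unchanged, so its remaining steps cost nothing. *)
case Hx : (if prog x is IHalt _ then false else true); last first.
  have E : sm_step prog (x, s) = (x, s) by move: Hx; rewrite /sm_step; case: (prog x).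
  have [n [r' [H1 H2 H3]]] := IH s r x Hr.
  exists n, r'; rewrite iterSr E; split=> //; nia.
have [n1 [r1 [H1 H2 H3]]] := sim_step Hr Hx.
have := tot_step (x, s); move: H2 H3; rewrite iterSr.
case: (sm_step prog (x, s)) => x1 s1 /= H2 H3 Ht.
have [n2 [r2 [H4 H5 H6]]] := IH s1 r1 x1 H3.
exists (n2 + n1), r2; split=> //; last by rewrite iterD H2.
nia.
Qed.

Definition conv (a : I) : tcell := wr (put empty_trk RA (Some (inr (inl a)))).
Definition stacks0 (w : seq I) : stacks sym :=
  ([::], rev (map (fun a => inr (inl a)) w), [::], [::]).

Lemma init2_run w l r :
  iter (size w) nx (cfg (x0, Init2) l ([seq Some (inl (inl a)) | a <- w] ++ r)) =
  cfg (x0, Init2) (rev (map conv w) ++ l) r.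
Proof.
elim: w l => [|a w IH] l //.
rewrite [size _]/= iterSr nxE // [tstep _ _]/= [behead _]/= IH.
by rewrite /= rev_cons cat_rcons.
Qed.

Lemma rep_init w : rep (stacks0 w) (map conv w ++ [:: None]).
Proof.
move=> j; rewrite nth_cat size_map; case: ltnP => Hj; last first.
  have -> : nth None [:: None] (j - size w) = (None : tcell) by case: (_ - _) => [|[]].
  congr Some; apply: quadP => -[]; rewrite /cellat get_build /= ?nth_nil //.
  by rewrite nth_default // revK !size_map.
case: w Hj => // a w Hj; rewrite (nth_map a) //.
congr Some; apply: quadP => -[]; rewrite /cellat get_build ?nth_nil //.
by rewrite revK -map_comp (nth_map a).
Qed.

Lemma init_run w : iter (size w).*2.+4 nx (start machine w) =
  cfg (x0, Seek) [:: mark] (map conv w ++ [:: None]).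
Proof.
set r := [seq Some (inl (inl a)) | a <- w] : seq tcell.
have -> : (size w).*2.+4 = ((size w).+1 + (1 + size w)).+2 by lia.
have -> : start machine w = cfg (x0, Init0) [::] r by [].
rewrite 2!iterSr nxE // [tstep _ _]/= nxE // [tstep _ _]/= [behead (_ :: _)]/=.
have [E|[a [v Ew]]] : w = [::] \/ exists a v, w = rcons v a.
- by case/lastP: (w) => [|v a]; [left|right; exists a, v].
- rewrite /r E; rewrite [iter _ _ _]/= nxE // [tstep _ _]/= nxE //.
have -> : head None r :: behead r = r ++ [::].
  by rewrite cats0 /r Ew; case: (v).
rewrite iterD iterD init2_run [iter 1 _ _]/= nxE // [tstep _ _]/=.
rewrite Ew map_rcons rev_rcons [behead _]/= [head _ _]/= size_rcons.
have := @back_home x0 (rev (map conv v)) (conv a) [:: None].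
rewrite size_rev size_map revK -cats1 -catA => -> //.
by move=> c; rewrite inE mem_rev => /orP[/eqP->|/mapP[b _ ->]].
Qed.

Definition oinj (o : O) : sym := inr (inr o).
Definition ocell (o : O) : tcell := Some (inl (inr o)).

Lemma out_run x y l r : (forall j, j < size y ->
    get (odflt empty_trk (rd (nth None r j))) RA = nth None (map (Some \o oinj) y) j) ->
  (forall j, rd (nth None r j) <> None) ->
  iter (size y) nx (cfg (x, Out) l r) = cfg (x, Out) (rev (map ocell y) ++ l) (drop (size y) r).
Proof.
elim: y l r => [|o y IH] l r H1 H2; first by rewrite drop0.
rewrite [size _]/= iterSr nxE // [tstep _ _]/= -nth0.
have := H1 0 isT; have := H2 0; case: (rd _) => //= t _ ->.
rewrite IH => [|j Hj|j]; rewrite ?nth_behead ?H1 //.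
by rewrite drop_behead rev_cons cat_rcons.
Qed.

Notation rdo := (@read I O machine).

Lemma read_ocell y r : rdo (map ocell y ++ None :: r) = y.
Proof. by elim: y => //= o y ->. Qed.

(** The track of [RA] is overwritten in place by output symbols; the blank written behind them is
    what stops [read]. *)
Lemma final_run x b s r y : prog x = IHalt b -> rep s r -> get s RA = rev (map oinj y) ->
  exists r', iter (size y).*2.+4 nx (cfg (x, Seek) [:: mark] r) = cfg (x, Fin) [:: mark] r'
    /\ rdo r' = y.
Proof.
move=> Hx Hr Hs.
have Hcell j : rd (nth None r j) = Some (cellat s j) by rewrite Hr.
exists (map ocell y ++ None :: drop (size y).+1 r); split; last exact: read_ocell.
have -> : (size y).*2.+4 = ((size y).+2 + (1 + size y)).+1 by lia.
rewrite iterSr nxE // [tstep _ _]/= -nth0 Hcell Hx.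
rewrite iterD iterD; have Ey : nth None r 0 :: behead r = r \/ r = [::].
  by case: (r); [right|left].
have HA j : get (cellat s j) RA = nth None (map (Some \o oinj) y) j.
  by rewrite /cellat get_build Hs revK -map_comp.
have nE j : nth None (nth None r 0 :: behead r) j = nth None r j.
  by case: j => //= j; rewrite nth_behead.
rewrite out_run; first last.
- by move=> j; rewrite nE Hcell.
- by move=> j _; rewrite nE Hcell [odflt _ _]/= HA.
have hd : head None (drop (size y) (nth None r 0 :: behead r)) = nth None r (size y).
  by rewrite -nth0 nth_drop addn0 nE.
have T1 c t : rd c = Some t -> get t RA = None -> tstep (x, Out) c = ((x, OutBack), None, GoLeft).
  by rewrite /= => -> /= ->.
have N1 : get (cellat s (size y)) RA = None by rewrite HA nth_default ?size_map.
rewrite [iter 1 _ _]/= nxE // hd (T1 _ _ (Hcell _) N1).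
have -> : behead (drop (size y) (nth None r 0 :: behead r)) = drop (size y).+1 r.
  by rewrite -drop1 drop_drop add1n; case: (r) => //=; rewrite !drop_nil.
have OutBackE pre c l : (forall d, d \in c :: pre -> rd d <> None) ->
    iter (size pre).+2 nx (cfg (x, OutBack) (pre ++ [:: mark]) (c :: l)) =
    cfg (x, Fin) [:: mark] (rev pre ++ c :: l).
  move=> H; rewrite iterS move_left //.
  by move=> d /H /=; case: (rd d).
case/lastP: (y) => [|y' o]; first by rewrite [iter _ _ _]/= nxE // [tstep _ _]/= nxE.
rewrite size_rcons map_rcons rev_rcons [behead _]/= [head _ _]/=.
have := OutBackE (rev (map ocell y')) (ocell o) (None :: drop (size y').+2 r).
rewrite size_rev size_map revK => H; rewrite iterS {}H //; last first.
  by move=> c; rewrite inE mem_rev => /orP[/eqP->|/mapP[d _ ->]].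
by rewrite cat_rcons.
Qed.

Lemma machine_run w t xh s b y :
  iter t (sm_step prog) (x0, stacks0 w) = (xh, s) -> prog xh = IHalt b ->
  get s RA = rev (map oinj y) ->
  forall N, (size w).*2 + t * ((size w + t).*2 + 6) + (size y).*2 + 8 <= N ->
  exists r, iter N nx (start machine w) = cfg (xh, Fin) [:: mark] r /\ rdo r = y.
Proof.
move=> Hrun Hx Hs N HN.
have [n [r [H1 H2 H3]]] := sim_run t x0 (rep_init w).
rewrite Hrun /= in H2 H3.
have [r' [H4 H5]] := final_run Hx H3 Hs.
have Htot : tot (stacks0 w) = size w by rewrite /tot /= size_rev size_map; lia.
rewrite Htot in H1.
exists r'; split=> //.
(* The surplus steps are spent in the phase [Fin], where nothing changes. *)
have -> : N = (N - ((size y).*2.+4 + (n + (size w).*2.+4))) + ((size y).*2.+4 + (n + (size w).*2.+4)) by lia.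
rewrite iterD iterD iterD init_run H2 H4.
by elim: (N - _) => // k /= ->.
Qed.

End Machine.

(** * Binary trees on a stack *)

Lemma reg_eqbxx i : reg_eqb i i. Proof. by case: i. Qed.

Inductive tree := Leaf | Node of tree & tree.

Fixpoint tree_eqb (x y : tree) : bool :=
  match x, y with
  | Leaf, Leaf => true
  | Node a b, Node c d => tree_eqb a c && tree_eqb b d
  | _, _ => false
  end.
Lemma tree_eqbP : Equality.axiom tree_eqb.
Proof.
elim=> [|a IHa b IHb] [|c d] /=; try by constructor.
by apply: (iffP andP) => [[/IHa-> /IHb->]|[/IHa? /IHb?]].
Qed.
HB.instance Definition _ := hasDecEq.Build tree tree_eqbP.

(** Prefix notation is self-delimiting, so a tree on top of a stack needs no end marker
    ([str_inj]). *)
Fixpoint str (t : tree) : seq bool :=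
  match t with Leaf => [:: false] | Node a b => true :: str a ++ str b end.

Definition tsize t := size (str t).

Lemma tsize_gt0 t : 0 < tsize t. Proof. by case: t. Qed.

Definition tcode := com bool.
Definition st (m : seq bool) : stacks bool := (m, [::], [::], [::]).

Section Run.
Variable G : Type.

Definition runT (c : com G) s T s' := exists2 t, t <= T & exec c s t s'.

Lemma run_seq c1 c2 s s1 s2 T1 T2 T : runT c1 s T1 s1 -> runT c2 s1 T2 s2 ->
  T1 + T2 <= T -> runT (Seq c1 c2) s T s2.
Proof.
move=> [t1 H1 E1] [t2 H2 E2] HT; exists (t1 + t2); [lia|exact: ESeq E1 E2].
Qed.
Lemma run_push i g s T : 0 < T -> runT (Push i g) s T (put s i (g :: get s i)).
Proof. by move=> H; exists 1 => //; exact: EPush. Qed.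
Lemma run_pop i s T : 0 < T -> runT (Pop _ i) s T (put s i (behead (get s i))).
Proof. by move=> H; exists 1 => //; exact: EPop. Qed.
Lemma run_if i (p : pred (option G)) c1 c2 s T s' :
  runT (if p (ohead (get s i)) then c1 else c2) s T s' -> runT (If i p c1 c2) s T.+1 s'.
Proof.
case: ifP => Hp [t Ht E]; exists t.+1 => //; first exact: EIfT E.
by apply: EIfF E; rewrite Hp.
Qed.
Lemma run_weak c s T T' s' : runT c s T s' -> T <= T' -> runT c s T' s'.
Proof. by move=> [t Ht E] H; exists t => //; lia. Qed.
Lemma run_wF i (p : pred (option G)) c s : ~~ p (ohead (get s i)) -> runT (While i p c) s 1 s.
Proof. by move=> H; exists 1 => //; exact: EWhileF. Qed.
Lemma run_wT i (p : pred (option G)) c s T1 s1 T2 s2 : p (ohead (get s i)) ->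
  runT c s T1 s1 -> runT (While i p c) s1 T2 s2 -> runT (While i p c) s (T1 + T2).+1 s2.
Proof.
move=> H [t1 H1 E1] [t2 H2 E2]; exists (t1 + t2).+1; first lia.
exact: EWhileT H E1 E2.
Qed.

End Run.

Notation isb b := (fun o : option bool => o == Some b).
Notation some := (fun o : option bool => isSome o).

Definition rg (p : bool) := if p then RA else RB.
Definition sab (m : seq bool) p x y c : stacks bool := if p then (m, x, y, c) else (m, y, x, c).

(** [RC] counts in unary the subtrees still to be moved: an inner node replaces one pending subtree
    by two, a leaf completes one. *)
Definition mvbody p : tcode :=
  Seq (Pop _ RC) (If RM (isb true)
    (Seq (Pop _ RM) (Seq (Push (rg p) true) (Seq (Push RC true) (Push RC true))))
    (Seq (Pop _ RM) (Push (rg p) false))).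
Definition mv p : tcode := Seq (Push RC true) (While RC some (mvbody p)).

(** Stated for an arbitrary continuation of the loop, so that the induction hypotheses for the two
    subtrees of a node can be chained. *)
Lemma mv_loop p t n r x y T s' :
  runT (While RC some (mvbody p)) (sab r p (rev (str t) ++ x) y (nseq n true)) T s' ->
  runT (While RC some (mvbody p)) (sab (str t ++ r) p x y (nseq n.+1 true)) (T + 8 * tsize t) s'.
Proof.
have E q : get (sab q p x y (nseq n.+1 true)) RC = nseq n.+1 true by rewrite /sab; case: p.
elim: t n r x T s' {E} => [|a IHa b IHb] n r x T s' H.
  apply: (run_weak (T := (4 + T).+1)); last by rewrite /tsize /=; lia.
  apply: run_wT H; first by case: (p).
  apply: (run_seq (T1 := 1) (T2 := 3)) => //; first exact: run_pop.
  apply: run_if; case: p => /=.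
    by apply: (run_seq (T1 := 1) (T2 := 1)) => //; first [exact: run_pop|exact: run_push].
  by apply: (run_seq (T1 := 1) (T2 := 1)) => //; first [exact: run_pop|exact: run_push].
have {}H : runT (While RC some (mvbody p))
    (sab r p (rev (str b) ++ rev (str a) ++ true :: x) y (nseq n true)) T s'.
  by move: H; rewrite /= rev_cons rev_cat -cats1 -!catA.
apply: (run_weak (T := (7 + (T + 8 * tsize b + 8 * tsize a)).+1)); last first.
  by rewrite {3}/tsize /= size_cat -!/(tsize _); lia.
apply: (@run_wT _ _ _ _ _ 7 (sab (str a ++ str b ++ r) p (true :: x) y (nseq n.+2 true))); first by case: (p).
  apply: (run_seq (T1 := 1) (T2 := 6)) => //; first exact: run_pop.
  apply: run_if; rewrite /= -catA; case: p {H IHa IHb} => /=.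
    apply: (run_seq (T1 := 1) (T2 := 4)) => //; first exact: run_pop.
    apply: (run_seq (T1 := 1) (T2 := 3)) => //; first exact: run_push.
    by apply: (run_seq (T1 := 1) (T2 := 1)) => //; exact: run_push.
  apply: (run_seq (T1 := 1) (T2 := 4)) => //; first exact: run_pop.
  apply: (run_seq (T1 := 1) (T2 := 3)) => //; first exact: run_push.
  by apply: (run_seq (T1 := 1) (T2 := 1)) => //; exact: run_push.
by apply: IHa; apply: IHb.
Qed.

Lemma run_mv p t r x y : runT (mv p) (sab (str t ++ r) p x y [::]) (8 * tsize t + 2)
  (sab r p (rev (str t) ++ x) y [::]).
Proof.
apply: (run_seq (T1 := 1) (T2 := 8 * tsize t + 1)); last lia.
  exact: run_push.
have -> : put (sab (str t ++ r) p x y [::]) RC [:: true & get (sab (str t ++ r) p x y [::]) RC] =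
  sab (str t ++ r) p x y (nseq 1 true) by case: p.
rewrite addnC; apply: mv_loop; apply: run_wF; by case: p.
Qed.

Definition pour i j : tcode := While i some (If i (isb true)
  (Seq (Pop _ i) (Push j true)) (Seq (Pop _ i) (Push j false))).

Lemma run_pour i j s : ~~ reg_eqb i j ->
  runT (pour i j) s (4 * size (get s i) + 1)
    (put (put s j (rev (get s i) ++ get s j)) i [::]).
Proof.
move=> Hij; have Hji : reg_eqb j i = false by move: Hij; case: i; case: j.
case E : (get s i) => [|b l].
  have -> : put (put s j (rev [::] ++ get s j)) i [::] = s.
    by apply: quadP => k; rewrite !get_put; case: reg_eqbP => [<-|_]; [rewrite E|case: reg_eqbP => // <-].
  by apply: run_weak (run_wF _ _) _ => //; rewrite E.
elim: l s b E => [|b' l IH] s b E.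
  apply: (run_weak (T := (3 + 1).+1)) => //.
  apply: (@run_wT _ _ _ _ _ 3 (put (put s j (rev [:: b] ++ get s j)) i [::])); first by rewrite E.
    apply: run_if; rewrite E /= .
    have -> : put (put s j [:: b & get s j]) i [::] =
      put (put s i (behead (get s i))) j (b :: get (put s i (behead (get s i))) j).
      apply: quadP => k; rewrite !get_put E (negbTE Hij) /=.
      by case: reg_eqbP => [<-|]; [rewrite Hji|case: reg_eqbP].
    case: b E => E /=.
      by apply: (run_seq (T1 := 1) (T2 := 1)) => //; first [exact: run_pop|exact: run_push].
    by apply: (run_seq (T1 := 1) (T2 := 1)) => //; first [exact: run_pop|exact: run_push].
  by apply: run_wF; rewrite get_put reg_eqbxx.
pose s1 := put (put s i (b' :: l)) j (b :: get s j).
have E1 : get s1 i = b' :: l.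
  by rewrite /s1 !get_put Hji reg_eqbxx.
apply: (run_weak (T := (3 + (4 * size (b' :: l) + 1)).+1)); last by rewrite /=; lia.
apply: (@run_wT _ _ _ _ _ 3 s1); first by rewrite E.
  apply: run_if; rewrite E /=.
  have -> : s1 = put (put s i (behead (get s i))) j (b :: get (put s i (behead (get s i))) j).
    by rewrite /s1 E get_put (negbTE Hij).
  case: b E @s1 E1 => E s1 E1 /=.
    by apply: (run_seq (T1 := 1) (T2 := 1)) => //; first [exact: run_pop|exact: run_push].
  by apply: (run_seq (T1 := 1) (T2 := 1)) => //; first [exact: run_pop|exact: run_push].
have := IH s1 b' E1.
have -> // : put (put s1 j (rev (b' :: l) ++ get s1 j)) i [::] =
  put (put s j (rev [:: b, b' & l] ++ get s j)) i [::].
apply: quadP => k; rewrite !get_put; case: reg_eqbP => // ik.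
by case: reg_eqbP => // jk; rewrite reg_eqbxx (rev_cons b) cat_rcons.
Qed.

Definition copyA : tcode := While RA some (If RA (isb true)
  (Seq (Pop _ RA) (Seq (Push RM true) (Push RB true)))
  (Seq (Pop _ RA) (Seq (Push RM false) (Push RB false)))).

Lemma run_copyA m a b : runT copyA (m, a, b, [::]) (5 * size a + 1) (rev a ++ m, [::], rev a ++ b, [::]).
Proof.
elim: a m b => [|x a IH] m b; first by apply: run_weak (run_wF _ _) _.
apply: (run_weak (T := (4 + (5 * size a + 1)).+1)); last by rewrite /=; lia.
rewrite rev_cons !cat_rcons.
apply: (@run_wT _ _ _ _ _ 4 (x :: m, a, x :: b, [::])) => //.
apply: run_if => /=; case: x => /=.
  apply: (run_seq (T1 := 1) (T2 := 2)) => //; first exact: run_pop.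
  by apply: (run_seq (T1 := 1) (T2 := 1)) => //; exact: run_push.
apply: (run_seq (T1 := 1) (T2 := 2)) => //; first exact: run_pop.
by apply: (run_seq (T1 := 1) (T2 := 1)) => //; exact: run_push.
Qed.

Definition dup : tcode := Seq (mv true) (Seq copyA (Seq (pour RB RA) (pour RA RM))).

Lemma run_dup t r : runT dup (st (str t ++ r)) (21 * tsize t + 5) (st (str t ++ str t ++ r)).
Proof.
apply: (run_seq (T1 := 8 * tsize t + 2) (T2 := 13 * tsize t + 3)); [exact: (@run_mv true)| |lia].
apply: (run_seq (T1 := 5 * tsize t + 1) (T2 := 8 * tsize t + 2)); last by lia.
  by have := run_copyA r (rev (str t) ++ [::]) [::]; rewrite cats0 size_rev revK; apply.
rewrite cats0.
apply: (run_seq (T1 := 4 * tsize t + 1) (T2 := 4 * tsize t + 1)); last by lia.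
  exact: run_pour.
have /= := @run_pour RA RM (str t ++ r, rev (str t) ++ [::], [::], [::]) isT.
by rewrite cats0 size_rev revK.
Qed.

Definition swap : tcode := Seq (mv true) (Seq (mv false) (Seq (pour RA RM) (pour RB RM))).

Lemma run_swap a b r : runT swap (st (str a ++ str b ++ r))
  (12 * (tsize a + tsize b) + 6) (st (str b ++ str a ++ r)).
Proof.
apply: (run_seq (T1 := 8 * tsize a + 2) (T2 := 4 * tsize a + 12 * tsize b + 4)); last by lia.
  exact: (@run_mv true).
apply: (run_seq (T1 := 8 * tsize b + 2) (T2 := 4 * tsize a + 4 * tsize b + 2)); last by lia.
  exact: (@run_mv false).
rewrite !cats0.
apply: (run_seq (T1 := 4 * tsize a + 1) (T2 := 4 * tsize b + 1)); last by lia.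
  by have := @run_pour RA RM (r, rev (str a), rev (str b), [::]) isT; rewrite /= size_rev; apply.
have := @run_pour RB RM (rev (rev (str a)) ++ r, [::], rev (str b), [::]) isT.
by rewrite /= size_rev !revK.
Qed.

Definition clear i : tcode := While i some (Pop _ i).

Lemma run_clear i s : runT (clear i) s (2 * size (get s i) + 1) (put s i [::]).
Proof.
move E : (get s i) => l; elim: l s E => [|x l IH] s E.
  by rewrite -{2}E put_same; apply: run_weak (run_wF _ _) _; rewrite ?E.
apply: (run_weak (T := (1 + (2 * size l + 1)).+1)); last by rewrite /=; lia.
apply: (@run_wT _ _ _ _ _ 1 (put s i l)); first by rewrite E.
  by rewrite -[l]/(behead (x :: l)) -E; exact: run_pop.
have := IH (put s i l); rewrite get_put reg_eqbxx.
have -> : put (put s i l) i [::] = put s i [::] by case: (s) => [[[? ?] ?] ?]; case: (i).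
by apply.
Qed.

Definition drp : tcode := Seq (mv true) (clear RA).
Lemma run_drp t r : runT drp (st (str t ++ r)) (10 * tsize t + 3) (st r).
Proof.
apply: (run_seq (T1 := 8 * tsize t + 2) (T2 := 2 * tsize t + 1)); last by lia.
  exact: (@run_mv true).
have /= := run_clear RA (r, rev (str t) ++ [::], [::], [::]).
by rewrite cats0 size_rev.
Qed.

(** * Codes of data and running times *)

Class code (X : Type) := Code { enc : X -> tree; enc_inj : injective enc }.
#[export] Instance code_tree : code tree := @Code tree id (@inj_id tree).

Notation esz x := (tsize (enc x)).

Lemma tbool_inj : injective (fun b : bool => if b then Node Leaf Leaf else Leaf).
Proof. by move=> [] []. Qed.
#[export] Instance code_bool : code bool := Code tbool_inj.

Lemma code_prod_inj X Y {cX : code X} {cY : code Y} :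
  injective (fun p : X * Y => Node (enc p.1) (enc p.2)).
Proof. by move=> [a b] [c d] /= [/(@enc_inj X _)-> /(@enc_inj Y _)->]. Qed.
#[export] Instance code_prod X Y {cX : code X} {cY : code Y} : code (X * Y) := Code (@code_prod_inj X Y cX cY).

Fixpoint tlist (l : seq tree) : tree := if l is x :: l' then Node x (tlist l') else Leaf.

Lemma code_seq_inj X {cX : code X} : injective (fun l : seq X => tlist (map enc l)).
Proof. by elim=> [|x l IH] [|y l'] //= [/(@enc_inj X _)-> /IH->]. Qed.
#[export] Instance code_seq X {cX : code X} : code (seq X) := Code (@code_seq_inj X cX).

(** The code lies on an arbitrary rest [r], and the auxiliary stacks are empty before and after;
    this makes programs composable. *)
Definition runs X Y {cX : code X} {cY : code Y} (c : tcode) (f : X -> Y) (T : X -> nat) :=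
  forall x r, runT c (st (str (enc x) ++ r)) (T x) (st (str (enc (f x)) ++ r)).

Lemma runs_size X Y {cX : code X} {cY : code Y} c (f : X -> Y) T x :
  runs c f T -> esz (f x) <= esz x + T x.
Proof.
move=> /(_ x [::])[t Ht /exec_tot]; rewrite /tot /= !cats0 -!/(tsize _); lia.
Qed.

(** * Polynomial bounds and polynomial-time combinators *)

Section PolyBound.
Variables (X : Type) (S : X -> nat).
Implicit Types T : X -> nat.

(** The base is at least two, so the bounds are monotone in the exponent and a sum of two powers is
    below a single one. *)
Definition pb T := exists k, forall x, T x <= (S x + 2) ^ k.

Lemma pb_le T T' : pb T -> (forall x, T' x <= T x) -> pb T'.
Proof. by move=> [k H] H'; exists k => x; exact: leq_trans (H' x) (H x). Qed.

Lemma pow_le n a b : a <= b -> (n + 2) ^ a <= (n + 2) ^ b.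
Proof. by move=> H; rewrite leq_exp2l //; lia. Qed.

Lemma pow_add n a b : (n + 2) ^ a + (n + 2) ^ b <= (n + 2) ^ (a + b + 1).
Proof.
have Ha : (n + 2) ^ a <= (n + 2) ^ (a + b) by apply: pow_le; lia.
have Hb : (n + 2) ^ b <= (n + 2) ^ (a + b) by apply: pow_le; lia.
rewrite [_ ^ (a + b + 1)]expnD expn1 mulnDr muln2 -addnn.
by apply: leq_trans (leq_add Ha Hb) _; rewrite leq_addl.
Qed.

Lemma pb_const c : pb (fun _ => c).
Proof.
exists c => x; apply: leq_trans (ltnW (ltn_expl c (isT : 1 < 2))) _.
by case: c => // c; rewrite leq_exp2r // leq_addl.
Qed.

Lemma pb_self : pb S.
Proof. by exists 1 => x; rewrite expn1 leq_addr. Qed.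

Lemma pb_add T T' : pb T -> pb T' -> pb (fun x => T x + T' x).
Proof.
move=> [a H] [b H']; exists (a + b + 1) => x.
exact: leq_trans (leq_add (H x) (H' x)) (pow_add _ _ _).
Qed.

Lemma pb_mul T T' : pb T -> pb T' -> pb (fun x => T x * T' x).
Proof.
move=> [a H] [b H']; exists (a + b) => x.
by rewrite expnD; exact: leq_mul (H x) (H' x).
Qed.

Lemma pb_pow T k : pb T -> pb (fun x => T x ^ k).
Proof.
move=> H; elim: k => [|k IH]; first exact: pb_const.
by apply: pb_le (pb_mul H IH) _ => x; rewrite expnS.
Qed.

Lemma pb_S T : pb T -> pb (fun x => (T x).+1).
Proof. by move=> H; apply: pb_le (pb_add H (pb_const 1)) _ => x; rewrite addn1. Qed.
End PolyBound.

Lemma pb_comp X Y (S : X -> nat) (S' : Y -> nat) T (f : X -> Y) :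
  pb S' T -> pb S (fun x => S' (f x)) -> pb S (fun x => T (f x)).
Proof.
move=> [k H] H'; apply: pb_le (pb_pow k (pb_add H' (pb_const _ 2))) _ => x.
exact: H.
Qed.

Ltac pbs := repeat first
  [ exact: pb_self | exact: pb_const | assumption
  | apply: pb_add | apply: pb_mul | apply: pb_S | apply: pb_pow ].

Notation size_of X := (fun x : X => tsize (enc x)).

(** The measure [S] is separate from the size of the input. With a doubly exponential [S],
    exponentially larger tables can first be built and then be processed by functions that are
    polynomial in the size of those tables. *)
Definition bf X Y {cX : code X} {cY : code Y} (S : X -> nat) (f : X -> Y) :=
  exists c T, pb S T /\ runs c f T.
Definition pf X Y {cX : code X} {cY : code Y} (f : X -> Y) := bf (size_of X) f.
Notation polyf := (@pf tree tree _ _).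

Lemma pf_size X Y {cX : code X} {cY : code Y} (f : X -> Y) : pf f -> pb (size_of X) (fun x => esz (f x)).
Proof.
move=> [c [T [H1 H2]]]; apply: pb_le (pb_add (pb_self _) H1) _ => x.
exact: runs_size H2.
Qed.

Lemma bf_ext X Y {cX : code X} {cY : code Y} S (f g : X -> Y) : f =1 g -> bf S f -> bf S g.
Proof. by move=> E [c [T [H0 H]]]; exists c, T; split=> // x r; rewrite -E; exact: H. Qed.

Lemma pf_ext X Y {cX : code X} {cY : code Y} (f g : X -> Y) : f =1 g -> pf f -> pf g.
Proof. exact: bf_ext. Qed.

Lemma pf_tree X Y {cX : code X} {cY : code Y} (g : tree -> tree) (f : X -> Y) :
  polyf g -> (forall x, g (enc x) = enc (f x)) -> pf f.
Proof.
move=> [c [T [H0 H]]] E; exists c, (fun x => T (enc x)); split; last by move=> x r; rewrite -E; exact: H.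
by have [k Hk] := H0; exists k => x; exact: Hk.
Qed.

Definition skip : tcode := Seq (Push RC true) (Pop _ RC).
Lemma run_skip m : runT skip (st m) 2 (st m).
Proof. by apply: (run_seq (T1 := 1) (T2 := 1)) => //; [exact: run_push|exact: run_pop]. Qed.

Lemma polyf_id : polyf id.
Proof. by exists skip, (fun _ => 2); split; [pbs|move=> x r; exact: run_skip]. Qed.

Lemma pf_retype X Y {cX : code X} {cY : code Y} (f : X -> Y) : (forall x, enc (f x) = enc x) -> pf f.
Proof. by move=> E; apply: pf_tree polyf_id _ => x /=; rewrite E. Qed.

Lemma bf_comp X Y Z {cX : code X} {cY : code Y} {cZ : code Z} S (f : X -> Y) (g : Y -> Z) :
  pb S (size_of X) -> bf S f -> pf g -> bf S (fun x => g (f x)).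
Proof.
move=> HS [c [T [B Hf]]] [d [T' [B' Hg]]].
exists (Seq c d), (fun x => T x + T' (f x)); split.
  apply: pb_add => //; apply: pb_comp B' _.
  by apply: pb_le (pb_add HS B) _ => x; exact: runs_size Hf.
by move=> x r; exact: run_seq (Hf x r) (Hg (f x) r) _.
Qed.

Lemma pf_comp X Y Z {cX : code X} {cY : code Y} {cZ : code Z} (g : Y -> Z) (f : X -> Y) :
  pf g -> pf f -> pf (fun x => g (f x)).
Proof. by move=> H1 H2; apply: bf_comp => //; exact: pb_self. Qed.

Lemma bf_pair X Y Z {cX : code X} {cY : code Y} {cZ : code Z} S (f : X -> Y) (g : X -> Z) :
  pb S (size_of X) -> bf S f -> bf S g -> bf S (fun x => (f x, g x)).
Proof.
move=> HS [c [T [B Hf]]] [d [T' [B' Hg]]].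
have Sg : pb S (fun x => esz (g x)).
  by apply: pb_le (pb_add HS B') _ => x; exact: runs_size Hg.
(* [g x] is computed first and swapped below the input, so that [f x] ends on top and one [true]
   joins the two codes into a node. *)
exists (Seq dup (Seq d (Seq swap (Seq c (Push RM true))))).
exists (fun x => 21 * esz x + 5 + (T' x + (12 * (esz (g x) + esz x) + 6 + (T x + 1)))).
split; first by pbs.
move=> x r; apply: run_seq (run_dup (enc x) r) _ (leqnn _).
apply: run_seq (Hg x _) _ (leqnn _); apply: run_seq (run_swap (enc (g x)) (enc x) r) _ (leqnn _).
apply: run_seq (Hf x _) _ (leqnn _).
by have := @run_push _ RM true (st (str (enc (f x)) ++ str (enc (g x)) ++ r)) 1; rewrite /= -catA; apply.
Qed.

Lemma pf_pair X Y Z {cX : code X} {cY : code Y} {cZ : code Z} (f : X -> Y) (g : X -> Z) :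
  pf f -> pf g -> pf (fun x => (f x, g x)).
Proof. by apply: bf_pair; exact: pb_self. Qed.

Fixpoint pushes (l : seq bool) : tcode :=
  if l is b :: l' then Seq (pushes l') (Push RM b) else skip.
Lemma run_pushes l r : runT (pushes l) (st r) (size l + 2) (st (l ++ r)).
Proof.
elim: l => [|b l IH] /=; first exact: run_skip.
by apply: run_seq IH (run_push _ _ _ (T := 1) _) _ => //; lia.
Qed.

Lemma polyf_const t : polyf (fun _ => t).
Proof.
exists (Seq drp (pushes (str t))), (fun x => 10 * tsize x + 3 + (tsize t + 2)); split; first by pbs.
by move=> x r; exact: run_seq (run_drp x r) (run_pushes _ _) _.
Qed.

Definition tfst x := if x is Node a b then a else Leaf.
Definition tsnd x := if x is Node a b then b else Leaf.

Lemma tsizeN a b : tsize (Node a b) = (tsize a + tsize b).+1.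
Proof. by rewrite /tsize /= size_cat. Qed.

Lemma polyf_fst : polyf tfst.
Proof.
exists (If RM (isb true) (Seq (Pop _ RM) (Seq swap drp)) skip), (fun x => 22 * tsize x + 20).
split; first by pbs.
move=> [|a b] r; first by apply: run_weak (run_if _) _; [exact: run_skip|].
apply: (run_weak (T := (1 + (12 * (tsize a + tsize b) + 6 + (10 * tsize b + 3))).+1)).
  apply: run_if; rewrite /= -catA.
  apply: (run_seq (run_pop _ _ (T := 1) _) _ (leqnn _)) => //.
  exact: run_seq (run_swap a b r) (run_drp b _) (leqnn _).
by rewrite tsizeN; lia.
Qed.

Lemma polyf_snd : polyf tsnd.
Proof.
exists (If RM (isb true) (Seq (Pop _ RM) drp) skip), (fun x => 10 * tsize x + 5); split; first by pbs.
move=> [|a b] r; first by apply: run_weak (run_if _) _; [exact: run_skip|].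
apply: (run_weak (T := (1 + (10 * tsize a + 3)).+1)).
  apply: run_if; rewrite /= -catA.
  by apply: (run_seq (run_pop _ _ (T := 1) _) _ (leqnn _)) => //; exact: run_drp.
by rewrite tsizeN; lia.
Qed.

Definition isnode t := if t is Node _ _ then true else false.

Lemma ohead_str t r : ohead (str t ++ r) = Some (isnode t).
Proof. by case: t. Qed.

Lemma pf_if X Y {cX : code X} {cY : code Y} (p : X -> bool) (f g : X -> Y) : pf p -> pf f -> pf g ->
  pf (fun x => if p x then f x else g x).
Proof.
move=> Pp [d [T1 [B1 Hf]]] [e [T2 [B2 Hg]]].
have Sp := pf_size Pp; have [c [T [B Hp]]] := Pp.
exists (Seq dup (Seq c (If RM (isb true) (Seq drp d) (Seq drp e)))).
exists (fun x => 21 * esz x + 5 + (T x + (10 * esz (p x) + 3 + (T1 x + T2 x)).+1)).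
split; first by pbs.
move=> x r; apply: run_seq (run_dup (enc x) r) _ (leqnn _).
apply: run_seq (Hp x _) _ (leqnn _); apply: run_if; rewrite [get _ _]/= ohead_str.
have -> : isnode (enc (p x)) = p x by case: (p x).
rewrite (inj_eq (fun b c : bool => fun E : Some b = Some c => let: erefl := E in erefl)) eqb_id.
case: ifP => _.
  by apply: run_seq (run_drp _ _) (Hf x r) _; lia.
by apply: run_seq (run_drp _ _) (Hg x r) _; lia.
Qed.

Notation tbool := (@enc bool _).

Definition teq x := tbool (if x is Node a b then a == b else true).

Definition cmpbody : tcode := If RA (isb true)
  (Seq (Pop _ RA) (If RB (isb true) (Pop _ RB) (Push RC true)))
  (Seq (Pop _ RA) (If RB (isb false) (Pop _ RB) (Push RC true))).

(** Every mismatch leaves a symbol on [RC], and surplus symbols stay on [RB]; the words agree iff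
    both are empty at the end. *)
Lemma run_cmp m a b c : exists b' c',
  [/\ runT (While RA some cmpbody) (m, a, b, c) (5 * size a + 1) (m, [::], b', c'),
     nilp b' && nilp c' = nilp c && (a == b) & size b' + size c' <= size a + size b + size c].
Proof.
elim: a b c => [|x a IH] b c.
  exists b, c; split; last by lia.
    by apply: run_weak (run_wF _ _) _.
  by rewrite andbC; case: b.
pose b1 := if b is y :: b' then if x == y then b' else b else b.
pose c1 := if b is y :: b' then if x == y then c else true :: c else true :: c.
have [b' [c' [H1 H2 H3]]] := IH b1 c1; exists b', c'; split.
- apply: (run_weak (T := (4 + (5 * size a + 1)).+1)); last by rewrite /=; lia.
  apply: (@run_wT _ _ _ _ _ 4 (m, a, b1, c1)) => //.
  apply: run_if => /=; rewrite /b1 /c1.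
  case: x {b1 c1 H1 H2 H3} => /=.
    apply: (run_seq (T1 := 1) (T2 := 2)) => //; first exact: run_pop.
    by apply: run_if; case: b => [|[] b] /=; first [exact: run_push|exact: run_pop].
  apply: (run_seq (T1 := 1) (T2 := 2)) => //; first exact: run_pop.
  by apply: run_if; case: b => [|[] b] /=; first [exact: run_push|exact: run_pop].
- rewrite H2 /b1 /c1; case: b {b1 c1 H1 H2 H3} => [|y b] /=; first by rewrite andbF.
  by rewrite eqseq_cons; case: eqVneq => //=; rewrite andbF.
- move: H3; rewrite /b1 /c1; case: b {b1 c1 H1 H2} => [|y b] /=; first lia.
  by case: eqP => _ /=; lia.
Qed.

Lemma str_inj t t' r r' : str t ++ r = str t' ++ r' -> t = t' /\ r = r'.
Proof.
elim: t t' r r' => [|a IHa b IHb] [|a' b'] r r' //=; first by case.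
by case; rewrite -!catA => /IHa[-> /IHb[-> ->]].
Qed.

Lemma polyf_eq : polyf teq.
Proof.
exists (If RM (isb true) (Seq (Pop _ RM) (Seq (mv true) (Seq (mv false)
  (Seq (While RA some cmpbody) (Seq (If RC some (Push RM false)
     (If RB some (Push RM false) (pushes (str (tbool true)))))
  (Seq (clear RB) (clear RC))))))) (Seq drp (pushes (str (tbool true))))).
exists (fun x => 30 * tsize x + 30); split; first by pbs.
move=> [|a b] r.
  apply: run_weak (run_if _) _; first exact: run_seq (run_drp Leaf r) (run_pushes _ _) (leqnn _).
  by [].
have [b' [c' [H1 H2 H3]]] := run_cmp r (rev (str a)) (rev (str b)) [::].
have E : nilp b' && nilp c' = (a == b).
  rewrite H2 (inj_eq (can_inj (@revK _))) /=; apply/eqP/eqP => [|->//] E.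
  by have [] := @str_inj a b [::] [::] _; rewrite ?cats0.
move: H1 H3; rewrite !size_rev -!/(tsize _) => H1 H3.
apply: (run_weak (T := (1 + ((8 * tsize a + 2) + ((8 * tsize b + 2) + ((5 * tsize a + 1) +
   (7 + ((2 * size b' + 1) + (2 * size c' + 1))))))).+1)); last by rewrite tsizeN; move: H3; rewrite /=; lia.
apply: run_if; rewrite /= -catA.
apply: (run_seq (run_pop _ _ (T := 1) _) _ (leqnn _)) => //.
apply: run_seq (@run_mv true _ _ _ _) _ (leqnn _).
apply: run_seq (@run_mv false _ _ _ _) _ (leqnn _); rewrite !cats0.
apply: run_seq H1 _ (leqnn _).
have -> : teq (Node a b) = tbool (nilp b' && nilp c') by rewrite E.
apply: (run_seq (T1 := 7) (s1 := (str (tbool (nilp b' && nilp c')) ++ r, [::], b', c')) _ _ (leqnn _)).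
  apply: run_weak (run_if _ (T := 6)) _ => //=.
  case: c' {H2 H3 E} => [|y c'] /=; last by rewrite andbF; exact: run_push.
  apply: run_if => /=; case: b' => [|y b'] /=; last exact: run_push.
  exact: (run_pushes [:: true; false; false]).
by apply: run_seq (run_clear RB _) (run_clear RC _) _.
Qed.

(** Spells the code of a value as a list of bits; the concept names of the reduction are produced
    this way. *)
Definition tflat x := tlist (map tbool (str x)).

Definition flatbody : tcode := If RA (isb true)
  (Seq (Pop _ RA) (pushes [:: true; true; false; false]))
  (Seq (Pop _ RA) (pushes [:: true; false])).

Lemma run_flat a t r : runT (While RA some flatbody) (str t ++ r, a, [::], [::]) (9 * size a + 1)
  (st (str (foldl (fun t b => Node (tbool b) t) t a) ++ r)).
Proof.
elim: a t => [|x a IH] t; first by apply: run_weak (run_wF _ _) _.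
apply: (run_weak (T := (8 + (9 * size a + 1)).+1)); last by rewrite /=; lia.
apply: run_wT => //; last exact: IH.
apply: run_if; have H l m a' T : size l + 2 <= T ->
    runT (pushes l) (m, a', [::], [::]) T (l ++ m, a', [::], [::]).
  elim: l T => [|b l IHl] T HT /=.
    by apply: (run_seq (T1 := 1) (T2 := 1)) HT; [exact: run_push|exact: run_pop].
  by apply: run_seq (IHl _ (leqnn _)) (run_push _ _ _ (T := 1) _) _ => //; move: HT; rewrite /=; lia.
case: x => /=.
  by apply: (run_seq (T1 := 1) (T2 := 6)) => //; [exact: run_pop|exact: (H [:: true; true; false; false])].
by apply: (run_seq (T1 := 1) (T2 := 4)) => //; [exact: run_pop|exact: (H [:: true; false])].
Qed.

Lemma polyf_flat : polyf tflat.
Proof.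
exists (Seq (mv true) (Seq (Push RM false) (While RA some flatbody))).
exists (fun x => 8 * tsize x + 2 + (1 + (9 * tsize x + 1))); split; first by pbs.
move=> x r; apply: run_seq (@run_mv true _ _ _ _) _ (leqnn _); rewrite cats0.
apply: run_seq (run_push _ _ _ (T := 1) _) _ (leqnn _) => //=.
have := run_flat (rev (str x)) Leaf r; rewrite size_rev foldl_rev.
have -> // : foldr (fun b t => Node (tbool b) t) Leaf (str x) = tflat x.
by rewrite /tflat; elim: (str x) => //= b l ->.
Qed.

(** The loop runs while the first component of the pair on top is an inner node. The leading [true]
    of the pair is taken off for the test and put back for the body. *)
Definition wh (c : tcode) : tcode :=
  Seq (Pop _ RM) (Seq (While RM (isb true) (Seq (Push RM true) (Seq c (Pop _ RM)))) (Push RM true)).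

Lemma run_wh c T n (x : nat -> tree) s r :
  (forall i, i < n -> runT c (st (str (x i) ++ r)) T (st (str (x i.+1) ++ r))) ->
  (forall i, i < n -> isnode (tfst (x i))) -> x n = Node Leaf s -> isnode (x 0) ->
  runT (wh c) (st (str (x 0) ++ r)) (n * (T + 3) + 3) (st (str (x n) ++ r)).
Proof.
move=> Hc H1 H2 Hx.
have -> : n * (T + 3) + 3 = 1 + ((n * (T + 3) + 1) + 1) by lia.
apply: (run_seq (run_pop _ _ (T := 1) _) _ (leqnn _)) => //.
have L m : m <= n -> runT (While RM (isb true) (Seq (Push RM true) (Seq c (Pop _ RM))))
   (st (behead (str (x (n - m)) ++ r))) (m * (T + 3) + 1) (st (str Leaf ++ str s ++ r)).
  elim: m => [|m IH] Hm.
    by rewrite subn0 H2; exact: run_wF.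
  have Hlt : n - m.+1 < n by lia.
  have E : (n - m.+1).+1 = n - m by lia.
  move: (H1 _ Hlt) (Hc _ Hlt) (IH (ltnW Hm)); rewrite E.
  case Ey : (x (n - m.+1)) => [//|[//|a b] y] _ {}Hc {}IH.
  apply: run_weak (run_wT _ (T1 := T + 2) _ IH) _ => //; last by lia.
  apply: (run_seq (T1 := 1) (T2 := T + 1)); last by lia.
    exact: run_push.
  by apply: (run_seq Hc (run_pop _ _ (T := 1) _)).
apply: (run_seq (s1 := st (str Leaf ++ str s ++ r)) (T2 := 1)) (leqnn _).
  by have := L n (leqnn n); rewrite subnn; apply.
by rewrite H2; exact: run_push.
Qed.

Lemma code_option_inj X {cX : code X} :
  injective (fun o : option X => if o is Some x then Node (enc x) Leaf else Leaf).
Proof. by move=> [x|] [y|] // [/(@enc_inj X _)->]. Qed.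
#[export] Instance code_option X {cX : code X} : code (option X) := Code (@code_option_inj X cX).

Section Basic.
Context {X Y Z : Type} {cX : code X} {cY : code Y} {cZ : code Z}.

Lemma pf_id : pf (fun x : X => x). Proof. exact: pf_retype. Qed.
Lemma pf_const (y : Y) : pf (fun _ : X => y).
Proof. exact: pf_tree (polyf_const (enc y)) _. Qed.
Lemma pf_fst (f : X -> Y * Z) : pf f -> pf (fun x => (f x).1).
Proof. by apply: (pf_comp (g := fst)); exact: pf_tree polyf_fst _. Qed.
Lemma pf_snd (f : X -> Y * Z) : pf f -> pf (fun x => (f x).2).
Proof. by apply: (pf_comp (g := snd)); exact: pf_tree polyf_snd _. Qed.
Lemma pf_cons (f : X -> Y) (g : X -> seq Y) : pf f -> pf g -> pf (fun x => f x :: g x).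
Proof.
move=> Hf Hg; apply: (pf_comp (g := fun p => p.1 :: p.2)) (pf_pair Hf Hg).
exact: pf_retype.
Qed.
Lemma pf_behead (f : X -> seq Y) : pf f -> pf (fun x => behead (f x)).
Proof. by apply: (pf_comp (g := behead)); apply: pf_tree polyf_snd _ => -[]. Qed.

End Basic.

Lemma pf_isnode : pf isnode.
Proof.
exists (If RM (isb true) (Seq drp (pushes [:: true; false; false])) skip), (fun x => 10 * esz x + 10).
split; first by do ![exact: pb_const|exact: pb_self|apply: pb_add|apply: pb_mul].
move=> [|a b] r; first by apply: run_weak (run_if _) _; [exact: run_skip|].
apply: run_weak (run_if _ (T := 10 * esz (Node a b) + 3 + 5)) _; last by lia.
exact: run_seq (run_drp (Node a b) r) (run_pushes _ _) (leqnn _).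
Qed.

Lemma polyf_node X {cX : code X} (f g : X -> tree) : pf f -> pf g -> pf (fun x => Node (f x) (g x)).
Proof.
move=> Hf Hg; apply: (pf_comp (g := fun p => Node p.1 p.2)) (pf_pair Hf Hg).
exact: pf_retype.
Qed.

Lemma pf_ohead X A {cX : code X} {cA : code A} (f : X -> seq A) : pf f -> pf (fun x => ohead (f x)).
Proof.
apply: (pf_comp (g := ohead)).
apply: (pf_tree (g := fun t => if isnode t then Node (tfst t) Leaf else Leaf)); last by case.
by apply: pf_if; [exact: pf_isnode|apply: polyf_node; [exact: polyf_fst|exact: polyf_const]|exact: polyf_const].
Qed.

Section Case.
Context {X A Y : Type} {cX : code X} {cA : code A} {cY : code Y}.

Lemma pf_ocase (o : X -> option A) (f : X -> A -> Y) (g : X -> Y) :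
  pf o -> pf (fun p : X * A => f p.1 p.2) -> pf g ->
  pf (fun x => if o x is Some a then f x a else g x).
Proof.
move=> Ho [c [Tf [Bf Hf]]] [d [Tg [Bg Hg]]].
have [e [T [B He]]] := pf_pair Ho pf_id.
have So := pf_size Ho.
pose Tf' x := if o x is Some a then Tf (x, a) else 0.
have Bf' : pb (size_of X) Tf'.
  have [k Hk] := Bf; apply: pb_le (pb_pow k (pb_add (pb_add (pb_self _) So) (pb_const _ 3))) _ => x.
  rewrite /Tf'; case E : (o x) => [a|] //; apply: leq_trans (Hk _) _.
  by case: k {Hk} => // k; rewrite leq_exp2r // [enc _]/= !tsizeN; lia.
exists (Seq e (Seq (Pop _ RM) (If RM (isb true)
  (Seq (Pop _ RM) (Seq swap (Seq (Pop _ RM) (Seq swap (Seq (Push RM true) c)))))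
  (Seq (Pop _ RM) d)))).
exists (fun x => T x + (24 * (esz x + esz (o x)) + 40 + Tf' x + Tg x)); split.
  by do ![exact: pb_const|exact: pb_self|assumption|apply: pb_add|apply: pb_mul].
move=> x r; apply: run_seq (He x r) _ (leqnn _).
apply: run_weak (run_seq (run_pop _ _ (T := 1) _) (run_if _ (T := 24 * (esz x + esz (o x)) + 30 + Tf' x + Tg x)) (leqnn _)) _ => //; last by lia.
rewrite /= -catA /Tf'; case E : (o x) => [a|] /=.
  rewrite -catA.
  apply: (run_weak (T := 1 + ((12 * (esz a + tsize Leaf) + 6) + (1 + ((12 * (esz a + esz x) + 6) + (1 + Tf (x, a)))))));
    last by rewrite tsizeN /tsize /=; lia.
  apply: run_seq (run_pop _ _ (T := 1) _) _ (leqnn _) => //.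
  apply: run_seq (run_swap _ Leaf _) _ (leqnn _).
  apply: run_seq (run_pop _ _ (T := 1) _) _ (leqnn _) => //.
  apply: run_seq (run_swap (enc a) (enc x) r) _ (leqnn _).
  apply: run_seq (run_push _ _ _ (T := 1) _) _ (leqnn _) => //.
  by have := Hf (x, a) r; rewrite /= -catA.
apply: (run_weak (T := 1 + Tg x)); last by lia.
by apply: run_seq (run_pop _ _ (T := 1) _) _ (leqnn _) => //; exact: Hg.
Qed.
End Case.

(** Rearranges a loop state (a :: l, (x, b)) into (l, (x, ((x, b), a))): the rest of the list is set
    aside, and the argument of the step function is formed next to a copy of [x] that survives the
    step. *)
Lemma polyf_swapstate : polyf (fun t => Node (tsnd (tfst t))
  (Node (tfst (tsnd t)) (Node (tsnd t) (tfst (tfst t))))).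
Proof.
have F : polyf tfst := polyf_fst; have S : polyf tsnd := polyf_snd.
have FC f : polyf f -> polyf (fun t => tfst (f t)) by exact: pf_comp.
have SC f : polyf f -> polyf (fun t => tsnd (f t)) by exact: pf_comp.
by do ![apply: polyf_node]; do ?[exact: F|exact: S|apply: FC|apply: SC].
Qed.

Lemma esz_cons A {cA : code A} (a : A) (l : seq A) : esz (a :: l) = (esz a + esz l).+1.
Proof. exact: tsizeN. Qed.
Lemma esz_nil A {cA : code A} : esz (@nil A) = 1. Proof. by []. Qed.
Lemma esz_pair A B {cA : code A} {cB : code B} (a : A) (b : B) : esz (a, b) = (esz a + esz b).+1.
Proof. exact: tsizeN. Qed.

Lemma str_node y z r : str (Node y z) ++ r = true :: str y ++ str z ++ r.
Proof. by rewrite /= -catA. Qed.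

Section Fold.
Context {X A B : Type} {cX : code X} {cA : code A} {cB : code B}.
Variable S : X -> nat.
Variables (F : X -> B -> A -> B) (l : X -> seq A) (s : X -> B).

(** Iterating a polynomial function can blow up the accumulator, hence the bound [K] on every
    intermediate value. *)
Lemma bf_foldl K : pf (fun p : (X * B) * A => F p.1.1 p.1.2 p.2) ->
  pb S (size_of X) -> bf S l -> bf S s ->
  pb S K -> (forall x i, esz (foldl (F x) (s x) (take i (l x))) <= K x) ->
  bf S (fun x => foldl (F x) (s x) (l x)).
Proof.
move=> PF HX Pl Ps PK HK.
have [ci [Ti [Bi Hi]]] := bf_pair HX Pl (bf_pair HX (ex_intro _ _ (ex_intro _ _ (conj (pb_const _ 2) (fun x r => run_skip _)))) Ps : bf S (fun x => (x, s x))).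
have PG : pf (fun q : X * ((X * B) * A) => (q.1, F q.2.1.1 q.2.1.2 q.2.2)).
  by apply: pf_pair; [apply: pf_fst pf_id|apply: (pf_comp PF); apply: pf_snd pf_id].
have [cG [TG [[kG HkG] HG]]] := PG.
have [cr [Tr [[kr Hkr] Hr]]] := polyf_swapstate.
pose body := Seq cr (Seq (Pop _ RM) (Seq swap (Seq cG (Seq swap (Push RM true))))).
have Sl : pb S (fun x => esz (l x)).
  by have [c [T [H1 H2]]] := Pl; apply: pb_le (pb_add HX H1) _ => x; exact: runs_size H2.
(* [M] bounds the parts of the loop state and [T] the time of one round. *)
pose (M := fun x : X => 2 * esz x + K x + esz (l x) + 10).
have PM : pb S M by pbs.
pose T (x : X) := (M x + 2) ^ kr + (48 * M x + 20) + (2 * M x + 2) ^ kG.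
have PT : pb S T by pbs.
have dropS x : drop (size (l x)) (l x) = [::] by rewrite drop_size.
exists (Seq ci (Seq (wh body) (Seq (Pop _ RM) (Seq (Pop _ RM) (Seq (Pop _ RM) drp))))).
exists (fun x => Ti x + ((esz (l x) * (T x + 3) + 3) + (3 + (10 * esz x + 3)))).
split; first by pbs.
move=> x r; apply: run_seq (Hi x r) _ (leqnn _).
pose b i := foldl (F x) (s x) (take i (l x)).
pose (xs := fun i => enc (drop i (l x), (x, b i))).
have Ex0 : enc (l x, (x, s x)) = xs 0 by rewrite /xs drop0 /b take0.
have Exn : xs (size (l x)) = Node Leaf (enc (x, foldl (F x) (s x) (l x))).
  by rewrite /xs /b drop_size take_size.
have Hlen : size (l x) <= esz (l x).
  by elim: (l x) => // a l' IH; rewrite esz_cons [size _]/=; lia.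
have Hdrop i : esz (drop i (l x)) <= esz (l x).
  by elim: (l x) i => // a l' IH [|i] //; rewrite esz_cons [drop _ _]/=; have := IH i; lia.
apply: (run_seq (s1 := st (str (xs (size (l x))) ++ r)) _ _ (leqnn _)); last first.
  rewrite Exn.
  apply: (run_weak (T := 1 + (1 + (1 + (10 * esz x + 3))))); last by lia.
  do 3![apply: run_seq (run_pop _ _ (T := 1) _) _ (leqnn _) => //].
  by rewrite /= -catA; exact: run_drp.
have Edrop i : i < size (l x) -> exists a l', drop i (l x) = a :: l'.
  move=> Hi'; case E : (drop i (l x)) => [|a l']; last by exists a, l'.
  by move: (size_drop i (l x)); rewrite E /=; lia.
rewrite Ex0; apply: run_weak (run_wh (T := T x) _ _ Exn _) _ => //; last first.
- by have := leq_mul Hlen (leqnn (T x + 3)); lia.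
- by move=> i /Edrop [a [l' El]]; rewrite /xs El.
move=> i Hi'; have [a [l' El]] := Edrop i Hi'.
have El' : drop i.+1 (l x) = l' by rewrite -add1n -drop_drop El /= drop0.
have En : nth a (l x) i = a by have := nth_drop i a (l x) 0; rewrite El addn0 /= => <-.
have Eb : b i.+1 = F x (b i) a by rewrite /b (take_nth a Hi') foldl_rcons En.
have Sa : esz a + esz l' <= esz (l x) by have := Hdrop i; rewrite El esz_cons; lia.
have Sb : esz (b i) <= K x by exact: HK.
rewrite /xs El El' Eb.
pose (t0 := enc (a :: l', (x, b i))); pose q := (x, ((x, b i), a)).
have Rt : forall y z : tree, runT swap (st (str y ++ str z ++ r)) (12 * (tsize y + tsize z) + 6)
    (st (str z ++ str y ++ r)) by move=> y z; exact: run_swap.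
refine (run_weak (T := Tr t0 + (1 + ((12 * (esz l' + esz q) + 6) + (TG q +
   ((12 * (esz (x, F x (b i) a) + esz l') + 6) + 1))))) _ _).
  apply: run_seq (Hr t0 r) _ (leqnn _).
  refine (run_seq (s1 := st (str (enc l') ++ str (enc q) ++ r)) (T1 := 1) _ _ (leqnn _)).
    have -> : str (enc l') ++ str (enc q) ++ r = behead (str (Node (enc l') (enc q)) ++ r) by rewrite str_node.
    exact: run_pop.
   apply: run_seq (Rt (enc l') (enc q)) _ (leqnn _).
  refine (run_seq (HG q (str (enc l') ++ r)) _ (leqnn _)).
  apply: run_seq (Rt (enc (x, F x (b i) a)) (enc l')) _ (leqnn _).
  have -> : str (enc (l', (x, F x (b i) a))) ++ r =
      true :: str (enc l') ++ str (enc (x, F x (b i) a)) ++ r by exact: str_node.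
  exact: run_push.
have S1 : esz (x, F x (b i) a) <= M x.
  by rewrite esz_pair -Eb; have := HK x i.+1; rewrite -/(b i.+1) /M; lia.
have S2 : esz q <= 2 * M x by rewrite !esz_pair /M; lia.
have S3 : tsize t0 <= M x by rewrite /t0 !esz_pair esz_cons /M; lia.
have S4 : Tr t0 <= (M x + 2) ^ kr.
  apply: leq_trans (Hkr _) _; case: (kr) => // k; rewrite leq_exp2r //; move: S3.
  by rewrite /=; lia.
have S5 : TG q <= (2 * M x + 2) ^ kG.
  by apply: leq_trans (HkG _) _; case: (kG) => // k; rewrite leq_exp2r //; lia.
rewrite /T.
have S6 : esz (x, F x (b i) a) + esz l' <= 2 * M x.
  rewrite esz_pair -Eb; have := HK x i.+1; rewrite -/(b i.+1) /M; lia.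
have S7 : esz l' + esz q <= 2 * M x.
  rewrite !esz_pair /M; lia.
lia.
Qed.
End Fold.

(** * Lists, fixed points and power sets *)

Section Lists.
Context {A : Type} {cA : code A}.
Implicit Types l : seq A.

Lemma esz_gt0 (X : Type) {cX : code X} (x : X) : 0 < esz x. Proof. exact: tsize_gt0. Qed.

Lemma esz_cat l1 l2 : (esz (l1 ++ l2)).+1 = esz l1 + esz l2.
Proof.
elim: l1 => [|a l1 IH]; first by rewrite esz_nil.
by rewrite cat_cons !esz_cons; lia.
Qed.

Lemma esz_drop i l : esz (drop i l) <= esz l.
Proof. by elim: l i => [|a l IH] [|i] //; have := IH i; rewrite esz_cons /drop -/drop; lia. Qed.

Lemma esz_take i l : esz (take i l) <= esz l.
Proof.
generalize (esz_cat (take i l) (drop i l)); rewrite cat_take_drop.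
by generalize (esz_gt0 (drop i l)); lia.
Qed.

Lemma esz_catrev l1 l2 : (esz (catrev l1 l2)).+1 = esz l1 + esz l2.
Proof.
elim: l1 l2 => [|a l1 IH] l2; first by rewrite esz_nil.
by rewrite [catrev _ _]/= IH !esz_cons; lia.
Qed.

Lemma esz_rev l : esz (rev l) = esz l.
Proof. generalize (esz_catrev l [::]); rewrite esz_nil /rev; lia. Qed.

Lemma size_esz l : size l < esz l.
Proof. by elim: l => // a l IH; rewrite esz_cons [size _]/=; lia. Qed.

Lemma esz_filter p l : esz (filter p l) <= esz l.
Proof.
elim: l => // a l IH; rewrite [filter _ _]/=; case: ifP => _; rewrite ?esz_cons; lia.
Qed.

Lemma esz_map B {cB : code B} (f : A -> B) m M l : (forall a, esz a <= m -> esz (f a) <= M) ->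
  esz l <= m -> esz (map f l) <= esz l * (M + 1).
Proof.
move=> H; elim: l => [|a l IH] Hm; first by rewrite esz_nil mul1n addn1.
move: Hm; rewrite [map _ _]/= !esz_cons => Hm.
have := IH ltac:(lia); have := H a ltac:(lia); rewrite mulSn mulnDl.
set P := esz a * _; set Q := esz l * _ => Hu Hv; lia.
Qed.

Lemma foldl_catrev l s : foldl (fun t a => a :: t) s l = catrev l s.
Proof. by elim: l s => /=. Qed.
End Lists.

Lemma pf_foldl X A B {cX : code X} {cA : code A} {cB : code B}
    (F : X -> B -> A -> B) (l : X -> seq A) (s : X -> B) K :
  pb (size_of X) K -> (forall x i, esz (foldl (F x) (s x) (take i (l x))) <= K x) ->
  pf (fun p : (X * B) * A => F p.1.1 p.1.2 p.2) -> pf l -> pf s ->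
  pf (fun x => foldl (F x) (s x) (l x)).
Proof. by move=> H1 H2 H3 H4 H5; apply: bf_foldl (H1) _ => //; exact: pb_self. Qed.

Lemma pf_app2 X A B C {cX : code X} {cA : code A} {cB : code B} {cC : code C} (F : A -> B -> C) (f : X -> A) (g : X -> B) :
  pf (fun p : A * B => F p.1 p.2) -> pf f -> pf g -> pf (fun x => F (f x) (g x)).
Proof. by move=> HF Hf Hg; exact: pf_comp HF (pf_pair Hf Hg). Qed.

Lemma pf_app3 X A B C D {cX : code X} {cA : code A} {cB : code B} {cC : code C} {cD : code D}
    (F : A -> B -> C -> D) (f : X -> A) (g : X -> B) (h : X -> C) :
  pf (fun p : A * B * C => F p.1.1 p.1.2 p.2) -> pf f -> pf g -> pf h -> pf (fun x => F (f x) (g x) (h x)).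
Proof. by move=> HF Hf Hg Hh; exact: pf_comp HF (pf_pair (pf_pair Hf Hg) Hh). Qed.

Lemma pf_rev X A {cX : code X} {cA : code A} (f : X -> seq A) : pf f -> pf (fun x => rev (f x)).
Proof.
apply: (pf_comp (g := rev)).
apply: (pf_ext (f := fun l => foldl (fun t a => a :: t) [::] l)); first by move=> l; rewrite foldl_catrev.
apply: (pf_foldl (K := fun l => esz l + 1)); try exact: pf_id; try exact: pf_const.
- by apply: pb_add; [exact: pb_self|exact: pb_const].
- move=> l i; rewrite foldl_catrev; generalize (esz_catrev (take i l) [::]).
  by generalize (esz_take i l); rewrite esz_nil; lia.
- by apply: pf_cons; [exact: pf_snd pf_id|apply: pf_snd; exact: pf_fst pf_id].
Qed.

Lemma pf_cat X A {cX : code X} {cA : code A} (f g : X -> seq A) : pf f -> pf g -> pf (fun x => f x ++ g x).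
Proof.
move=> Hf Hg; apply: (pf_comp (g := fun p => p.1 ++ p.2)) (pf_pair Hf Hg).
apply: (pf_ext (f := fun p : seq A * seq A => foldl (fun t a => a :: t) p.2 (rev p.1))).
  by move=> p; rewrite foldl_catrev catrevE revK.
apply: (pf_foldl (K := fun p => esz p)).
- exact: pb_self.
- move=> p i; rewrite foldl_catrev; generalize (esz_catrev (take i (rev p.1)) p.2).
  by generalize (esz_take i (rev p.1)); rewrite esz_rev; case: p => a b; rewrite esz_pair /=; lia.
- by apply: pf_cons; [exact: pf_snd pf_id|apply: pf_snd; exact: pf_fst pf_id].
- by apply: pf_rev; exact: pf_fst pf_id.
- exact: pf_snd pf_id.
Qed.

Lemma pf_foldr X A B {cX : code X} {cA : code A} {cB : code B} (F : X -> A -> B -> B) (l : X -> seq A) (s : X -> B) K :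
  pb (size_of X) K -> (forall x i, esz (foldr (F x) (s x) (drop i (l x))) <= K x) ->
  pf (fun p : (X * B) * A => F p.1.1 p.2 p.1.2) -> pf l -> pf s ->
  pf (fun x => foldr (F x) (s x) (l x)).
Proof.
move=> H1 H2 H3 H4 H5.
apply: (pf_ext (f := fun x => foldl (fun b a => F x a b) (s x) (rev (l x)))).
  by move=> x; rewrite foldl_rev.
apply: (pf_foldl (K := K)) => //; last by apply: pf_rev.
by move=> x i; rewrite take_rev foldl_rev.
Qed.

Lemma pf_map X A B {cX : code X} {cA : code A} {cB : code B} (F : X -> A -> B) (l : X -> seq A) :
  pf (fun p : X * A => F p.1 p.2) -> pf l -> pf (fun x => map (F x) (l x)).
Proof.
move=> HF Hl; have [kF HkF] := pf_size HF; have Sl := pf_size Hl.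
apply: (pf_ext (f := fun x => foldr (fun a t => F x a :: t) [::] (l x))).
  by move=> x; elim: (l x) => //= a l' ->.
apply: (pf_foldr (K := fun x => esz (l x) * ((esz x + esz (l x) + 3) ^ kF + 1))) => //.
- do ![apply: pb_add|apply: pb_mul|apply: pb_pow|exact: pb_const|exact: pb_self|assumption].
- move=> x i; have -> : foldr (fun a t => F x a :: t) [::] (drop i (l x)) = map (F x) (drop i (l x)).
    by elim: (drop _ _) => //= a l' ->.
  apply: leq_trans (esz_map (m := esz (l x)) (M := (esz x + esz (l x) + 3) ^ kF) _ (esz_drop _ _)) _.
    move=> a Ha; apply: leq_trans (HkF (x, a)) _; rewrite esz_pair.
    by case: (kF) => // k; rewrite leq_exp2r //; lia.
  by rewrite leq_mul2r esz_drop orbT.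
- apply: pf_cons; last by apply: pf_snd; exact: pf_fst pf_id.
  apply: (pf_app2 HF); last exact: pf_snd pf_id.
  by apply: pf_fst; exact: pf_fst pf_id.
- exact: pf_const.
Qed.

Lemma pf_filter X A {cX : code X} {cA : code A} (F : X -> A -> bool) (l : X -> seq A) :
  pf (fun p : X * A => F p.1 p.2) -> pf l -> pf (fun x => filter (F x) (l x)).
Proof.
move=> HF Hl; have Sl := pf_size Hl.
apply: (pf_ext (f := fun x => foldr (fun a t => if F x a then a :: t else t) [::] (l x))).
  by move=> x; elim: (l x) => //= a l' ->.
apply: (pf_foldr (K := fun x => esz (l x))) => //.
- move=> x i; have -> : foldr (fun a t => if F x a then a :: t else t) [::] (drop i (l x)) = filter (F x) (drop i (l x)).
    by elim: (drop _ _) => //= a l' ->.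
  exact: leq_trans (esz_filter _ _) (esz_drop _ _).
- have E : pf (fun p : (X * seq A) * A => p.1.2) by apply: pf_snd; exact: pf_fst pf_id.
  apply: pf_if => //; last by apply: pf_cons => //; exact: pf_snd pf_id.
  apply: (pf_app2 HF); last exact: pf_snd pf_id.
  by apply: pf_fst; exact: pf_fst pf_id.
- exact: pf_const.
Qed.

Lemma pf_has X A {cX : code X} {cA : code A} (F : X -> A -> bool) (l : X -> seq A) :
  pf (fun p : X * A => F p.1 p.2) -> pf l -> pf (fun x => has (F x) (l x)).
Proof.
move=> HF Hl.
apply: (pf_ext (f := fun x => foldr (fun a t => if F x a then true else t) false (l x))).
  by move=> x; elim: (l x) => //= a l' ->.
apply: (pf_foldr (K := fun x => 3)) => //; first exact: pb_const.
- by move=> x i; case: (foldr _ _ _).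
- apply: pf_if; [|exact: pf_const|by apply: pf_snd; exact: pf_fst pf_id].
  apply: (pf_app2 HF); last exact: pf_snd pf_id.
  by apply: pf_fst; exact: pf_fst pf_id.
- exact: pf_const.
Qed.

Lemma pf_all X A {cX : code X} {cA : code A} (F : X -> A -> bool) (l : X -> seq A) :
  pf (fun p : X * A => F p.1 p.2) -> pf l -> pf (fun x => all (F x) (l x)).
Proof.
move=> HF Hl.
apply: (pf_ext (f := fun x => foldr (fun a t => if F x a then t else false) true (l x))).
  by move=> x; elim: (l x) => //= a l' ->.
apply: (pf_foldr (K := fun x => 3)) => //; first exact: pb_const.
- by move=> x i; case: (foldr _ _ _).
- apply: pf_if; [|by apply: pf_snd; exact: pf_fst pf_id|exact: pf_const].
  apply: (pf_app2 HF); last exact: pf_snd pf_id.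
  by apply: pf_fst; exact: pf_fst pf_id.
- exact: pf_const.
Qed.

Lemma pf_flatten X A {cX : code X} {cA : code A} (f : X -> seq (seq A)) : pf f -> pf (fun x => flatten (f x)).
Proof.
apply: (pf_comp (g := flatten)).
apply: (pf_foldr (F := fun _ a b => a ++ b) (s := fun=> [::]) (K := fun l => esz l)).
- exact: pb_self.
- move=> l i; rewrite -/(flatten _); apply: leq_trans (esz_drop i l).
  elim: (drop i l) => // a l' IH; rewrite esz_cons [flatten _]/=.
  by generalize (esz_cat a (flatten l')); lia.
- by apply: pf_cat; [exact: pf_snd pf_id|apply: pf_snd; exact: pf_fst pf_id].
- exact: pf_id.
- exact: pf_const.
Qed.

Lemma pf_eq X (A : eqType) {cX : code X} {cA : code A} (f g : X -> A) : pf f -> pf g -> pf (fun x => f x == g x).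
Proof.
move=> Hf Hg; apply: (pf_comp (g := fun p => p.1 == p.2)) (pf_pair Hf Hg).
by apply: pf_tree polyf_eq _ => -[a b]; rewrite -[teq _]/(enc (enc a == enc b)) (inj_eq enc_inj).
Qed.

Lemma pf_mem X (A : eqType) {cX : code X} {cA : code A} (f : X -> A) (l : X -> seq A) : pf f -> pf l -> pf (fun x => f x \in l x).
Proof.
move=> Hf Hl; apply: (pf_ext (f := fun x => has (fun a => a == f x) (l x))).
  by move=> x; rewrite has_pred1.
apply: pf_has => //; apply: pf_eq; first exact: pf_snd pf_id.
by apply: (pf_comp Hf); exact: pf_fst pf_id.
Qed.

Section Bool.
Context {X : Type} {cX : code X}.
Lemma pf_and (f g : X -> bool) : pf f -> pf g -> pf (fun x => f x && g x).
Proof. by move=> Hf Hg; apply: pf_if => //; exact: pf_const. Qed.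
Lemma pf_or (f g : X -> bool) : pf f -> pf g -> pf (fun x => f x || g x).
Proof. by move=> Hf Hg; apply: pf_if => //; exact: pf_const. Qed.
Lemma pf_not (f : X -> bool) : pf f -> pf (fun x => ~~ f x).
Proof. by move=> Hf; apply: pf_if => //; exact: pf_const. Qed.
Lemma pf_imp (f g : X -> bool) : pf f -> pf g -> pf (fun x => f x ==> g x).
Proof. by move=> Hf Hg; apply: pf_if => //; exact: pf_const. Qed.
End Bool.

Definition lfp (F : eqType) (univ : seq F) (step : seq F -> F -> bool) : seq F :=
  iter (size univ) (fun s => [seq u <- univ | (u \in s) || step s u]) [::].

Lemma pf_lfp X (F : eqType) {cX : code X} {cF : code F} (univ : X -> seq F) (step : X -> seq F -> F -> bool) :
  pf (fun p : (X * seq F) * F => step p.1.1 p.1.2 p.2) -> pf univ ->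
  pf (fun x => lfp (univ x) (step x)).
Proof.
move=> Hs Hu.
pose G x (s : seq F) (_ : F) := [seq u <- univ x | (u \in s) || step x s u].
have E x s l : foldl (G x) s l = iter (size l) (fun s => [seq u <- univ x | (u \in s) || step x s u]) s.
  by elim: l s => // a l IH s; rewrite iterSr -IH.
apply: (pf_ext (f := fun x => foldl (G x) [::] (univ x))); first by move=> x; rewrite E.
apply: (pf_foldl (K := fun x => esz (univ x))) => //.
- exact: pf_size.
- move=> x i; rewrite E; case: (size _) => [|n]; first by rewrite esz_nil; exact: esz_gt0.
  by rewrite iterS; exact: esz_filter.
- have P1 : pf (fun p : (X * seq F) * F => p.1.1) by apply: pf_fst; exact: pf_fst pf_id.
  have P2 : pf (fun p : (X * seq F) * F => p.1.2) by apply: pf_snd; exact: pf_fst pf_id.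
  apply: pf_filter; last exact: pf_comp P1.
  apply: pf_or.
    apply: pf_mem; first exact: pf_snd pf_id.
    by apply: (pf_comp P2); exact: pf_fst pf_id.
  apply: (pf_app3 Hs); last exact: pf_snd pf_id.
    by apply: (pf_comp P1); exact: pf_fst pf_id.
  by apply: (pf_comp P2); exact: pf_fst pf_id.
- exact: pf_const.
Qed.

Fixpoint allsub (A : Type) (l : seq A) : seq (seq A) :=
  if l is a :: l' then allsub l' ++ map (cons a) (allsub l') else [:: [::]].

Lemma size_allsub A (l : seq A) : size (allsub l) = 2 ^ size l.
Proof. by elim: l => //= a l IH; rewrite size_cat size_map IH expnS; lia. Qed.

Lemma esz_allsub A {cA : code A} (l : seq A) : esz (allsub l) <= 2 ^ size l * (esz l + 1) + 1.
Proof.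
elim: l => [|a l IH]; first by rewrite esz_cons esz_nil expn0; lia.
rewrite [allsub _]/=; generalize (esz_cat (allsub l) (map (cons a) (allsub l))).
have -> : esz (map (cons a) (allsub l)) = esz (allsub l) + size (allsub l) * (esz a).+1.
  by elim: (allsub l) => // s t IHt; rewrite [map _ _]/= 3!esz_cons [size _]/= IHt; lia.
rewrite size_allsub [size _]/= esz_cons expnS.
by generalize (esz_gt0 l); set N := 2 ^ _; nia.
Qed.

Lemma bf_allsub X A {cX : code X} {cA : code A} S (l : X -> seq A) :
  pb S (size_of X) -> bf S l -> pb S (fun x => 2 ^ size (l x)) -> bf S (fun x => allsub (l x)).
Proof.
move=> HS Hl H2.
have Sl : pb S (fun x => esz (l x)).
  by have [c [T [H3 H4]]] := Hl; apply: pb_le (pb_add HS H3) _ => x; exact: runs_size H4.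
pose G (x : X) (t : seq (seq A)) a := t ++ map (cons a) t.
have E x s : foldl (G x) [:: [::]] s = allsub (rev s).
  rewrite -{1}[s]revK foldl_rev; by elim: (rev s) => //= a t ->.
apply: (bf_ext (f := fun x => foldl (G x) [:: [::]] (rev (l x)))); first by move=> x; rewrite E revK.
apply: (bf_foldl (K := fun x => 2 ^ size (l x) * (esz (l x) + 1) + 1)) => //.
- have P : pf (fun p : X * seq (seq A) * A => p.1.2) by apply: pf_snd; exact: pf_fst pf_id.
  apply: pf_cat => //; apply: pf_map; last exact: P.
  apply: pf_cons; last exact: pf_snd pf_id.
  by apply: pf_snd; exact: pf_fst pf_id.
- by apply: (bf_comp HS Hl); apply: pf_rev; exact: pf_id.
- by have [c [T [_ H]]] := @pf_const X _ _ _ [:: [::]] ; apply: (bf_comp HS Hl (g := fun _ => [:: [::]])); exact: pf_const.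
- do ![apply: pb_add|apply: pb_mul|apply: pb_pow|exact: pb_const|exact: pb_self|assumption].
- move=> x i; rewrite E take_rev revK; apply: leq_trans (esz_allsub _) _.
  rewrite leq_add2r; apply: leq_mul; last by rewrite leq_add2r esz_drop.
  by rewrite leq_exp2l // size_drop leq_subr.
Qed.

Fixpoint num (k : nat) : tree := if k is k'.+1 then Node Leaf (num k') else Leaf.
Lemma num_inj : injective num.
Proof. by elim=> [|k IH] [|k'] //= [/IH->]. Qed.

Lemma fin_code_inj (T : finType) : injective (fun x : T => num (index x (enum T))).
Proof.
move=> x y /num_inj E; rewrite -(nth_index x (_ : x \in enum T)) ?mem_enum // E.
by rewrite nth_index ?mem_enum.
Qed.
Definition fin_code (T : finType) : code T := Code (@fin_code_inj T).

Lemma tsize_num k : tsize (num k) = (k.*2).+1.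
Proof. by elim: k => //= k IH; rewrite tsizeN IH. Qed.

Lemma pf_cases (X : eqType) Y {cX : code X} {cY : code Y} (f : X -> Y) (l : seq X) :
  (forall x, x \in l) -> pf f.
Proof.
case: l => [H|x0 l H].
  by exists skip, (fun _ => 0); split; [exact: pb_const|move=> x; have := H x].
enough (K : pf (fun x => if x \in l then f x else f x0)).
  apply: (pf_ext _ K) => x; case: ifP => // Hx.
  by have := H x; rewrite inE Hx orbF => /eqP->.
elim: l {H} => [|a l IH]; first exact: pf_const.
apply: (pf_ext (f := fun x => if x == a then f a else if x \in l then f x else f x0)).
  by move=> x; rewrite inE; case: eqVneq => //= ->.
apply: pf_if => //; last exact: pf_const.
by apply: pf_eq; [exact: pf_id|exact: pf_const].
Qed.

Lemma pf_fin (T : finType) Y {cY : code Y} (f : T -> Y) : @pf T Y (fin_code T) cY f.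
Proof. by apply: (@pf_cases T Y (fin_code T) cY f (enum T)) => x; rewrite mem_enum. Qed.

(** * From stack programs to Turing machines *)

Definition fsz (T : finType) := size (enum T).

Section Link.
Variables (I O : finType).
Notation G := (sym I O).
Notation gi := (fun b : bool => inl b : G).
Definition gproj (g : G) : option bool := if g is inl b then Some b else None.

#[local] Instance cI : code I := fin_code I.
#[local] Instance cO : code O := fin_code O.

Definition skipG : com G := Seq (Push RC (inl true)) (Pop _ RC).
Fixpoint pushG (l : seq bool) : com G :=
  if l is b :: l' then Seq (pushG l') (Push RM (inl b)) else skipG.
Lemma run_pushG l m a : runT (pushG l) (m, a, [::], [::]) (size l + 2) (map gi l ++ m, a, [::], [::]).
Proof.
elim: l => [|b l IH] /=.
  by apply: (run_seq (T1 := 1) (T2 := 1)) => //; [exact: run_push|exact: run_pop].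
by apply: run_seq IH (run_push _ _ _ (T := 1) _) _ => //; lia.
Qed.

Definition is_sym (g : G) := fun o : option G => o == Some g.

Fixpoint in_sel (l : seq I) : com G :=
  if l is a :: l' then If RA (is_sym (inr (inl a)))
    (Seq (Pop _ RA) (pushG (true :: str (enc a)))) (in_sel l')
  else skipG.

Lemma run_in_sel l (a : I) m A : a \in l ->
  runT (in_sel l) (m, inr (inl a) :: A, [::], [::]) (size l + esz a + 4)
    (map gi (true :: str (enc a)) ++ m, A, [::], [::]).
Proof.
elim: l => // b l IH; rewrite inE => Hab.
apply: run_weak (run_if _ (T := size l + esz a + 4)) _ => //.
rewrite /is_sym [ohead _]/=; case: eqP => [[Eb]|Hn].
  rewrite -Eb; refine (run_seq (@run_pop _ RA (m, inr (inl a) :: A, [::], [::]) 1 isT) (run_pushG (true :: str (enc a)) m A) _) => //.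
  by change (1 + ((esz a).+1 + 2) <= size l + esz a + 4); lia.
by apply: IH; case/orP: Hab => // /eqP E; case: Hn; rewrite E.
Qed.

(** The last input symbol is on top of [RA], so popping builds the code of the input word from its
    end. *)
Definition in_com : com G := Seq (Push RM (inl false)) (While RA isSome (in_sel (enum I))).

Lemma bound_enc (T : finType) (x : T) : tsize (@enc T (fin_code T) x) <= ((fsz T).*2).+1.
Proof. by rewrite tsize_num ltnS leq_double; exact: index_size. Qed.

Lemma run_in w : runT in_com (stacks0 O w) (size w * (3 * fsz I + 6) + 2)
  (map gi (str (enc w)), [::], [::], [::]).
Proof.
apply: (run_seq (T1 := 1) (T2 := size w * (3 * fsz I + 6) + 1)); last by lia.
  exact: run_push.
rewrite /stacks0 [put _ _ _]/=.
have L v l : runT (While RA isSome (in_sel (enum I)))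
    (map gi (str (enc l)), rev (map (fun a => inr (inl a)) v), [::], [::])
    (size v * (3 * fsz I + 6) + 1) (map gi (str (enc (v ++ l))), [::], [::], [::]).
  elim/last_ind: v l => [|v a IH] l; first by apply: (run_weak (T := 1)) => //; exact: run_wF.
  rewrite map_rcons rev_rcons size_rcons cat_rcons.
  apply: (run_weak (T := (3 * fsz I + 5 + (size v * (3 * fsz I + 6) + 1)).+1)); last by lia.
  apply: (run_wT _ _ (IH (a :: l))) => //.
  have E : map gi (str (enc (a :: l))) = map gi (true :: str (enc a)) ++ map gi (str (enc l)).
    by rewrite -map_cat.
  rewrite E; apply: run_weak (run_in_sel _ _ _) _; first by rewrite mem_enum.
  have H : tsize (@enc I cI a) <= ((fsz I).*2).+1 := bound_enc a. rewrite -/(fsz I); lia.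
by have := L w [::]; rewrite cats0; apply.
Qed.

(** A symbol is coded by its index in unary; each unit consists of two bits, a node and its left
    leaf, hence the two pops. *)
Fixpoint out_sel (l : seq O) : com G :=
  if l is o :: l' then If RM (is_sym (inl true)) (Seq (Pop _ RM) (Seq (Pop _ RM) (out_sel l')))
    (Seq (Pop _ RM) (Push RA (inr (inr o))))
  else skipG.

Lemma run_out_sel l k o m A : onth l k = Some o ->
  runT (out_sel l) (map gi (str (num k)) ++ m, A, [::], [::]) (3 * k + 3) (m, inr (inr o) :: A, [::], [::]).
Proof.
elim: k l => [|k IH] [|b l] //=.
  case=> ->; apply: run_weak (run_if _ (T := 2)) _ => //=.
  by apply: (run_seq (T1 := 1) (T2 := 1)) => //; [exact: run_pop|exact: run_push].
move=> H; apply: run_weak (run_if _ (T := 1 + (1 + (3 * k + 3)))) _; last by lia.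
rewrite /=; apply: run_seq (run_pop _ _ (T := 1) _) _ (leqnn _) => //=.
by apply: run_seq (run_pop _ _ (T := 1) _) _ (leqnn _) => //=; exact: IH.
Qed.

Definition out_com : com G := While RM (is_sym (inl true)) (Seq (Pop _ RM) (out_sel (enum O))).

Lemma run_out (y : seq O) A : runT out_com (map gi (str (enc y)), A, [::], [::])
  (size y * (3 * fsz O + 5) + 1) ([:: inl false], rev (map (@oinj I O) y) ++ A, [::], [::]).
Proof.
elim: y A => [|o y IH] A; first by apply: (run_weak (T := 1)) => //; exact: run_wF.
apply: (run_weak (T := (3 * fsz O + 4 + (size y * (3 * fsz O + 5) + 1)).+1)); last by rewrite /=; lia.
rewrite map_cons rev_cons cat_rcons.
apply: (run_wT _ _ (IH (oinj I o :: A))) => //.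
apply: (run_weak (T := 1 + (3 * index o (enum O) + 3))); last first.
  by have := index_size o (enum O); rewrite -/(fsz O); lia.
have E : onth (enum O) (index o (enum O)) = Some o.
  have Ho : o \in enum O by rewrite mem_enum.
  by elim: (enum O) Ho => //= b l IHl; rewrite inE eq_sym; by case: eqP => [->|_ /IHl].
refine (run_seq (T1 := 1) _ (run_out_sel (map gi (str (enc y))) A E) (leqnn _)).
have -> : map gi (str (num (index o (enum O)))) ++ map gi (str (enc y)) =
  behead (map gi (str (enc (o :: y)))) by rewrite -map_cat.
exact: run_pop.
Qed.

Variable C : com G.

Definition ctl : finType := (pts C + (unit + bool))%type.
Definition cprog (x : ctl) : ins G ctl :=
  match x with
  | inl p => code_of inl (inr (inl tt)) p
  | inr (inl _) => ITest RM (is_sym (inl true)) (inr (inr true)) (inr (inr false))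
  | inr (inr b) => IHalt b
  end.
Definition tm_of : tm I O := machine cprog (inl (entry C)).

Lemma tm_of_run w T s y : runT C (stacks0 O w) T s -> get s RA = rev (map (@oinj I O) y) ->
  forall N, 10 * (size w + T + 2) ^ 2 <= N ->
  [/\ tm_halt (cstate (run tm_of N w)),
      tm_acc (cstate (run tm_of N w)) = is_sym (inl true) (ohead (get s RM)) &
      read (cright (run tm_of N w)) = y].
Proof.
move=> [t Ht He] Hs N HN; set b := is_sym _ _.
have H1 := exec_small He (prog := cprog) (emb := inl) (ex := inr (inl tt)) (fun=> erefl).
have H2 : iter t.+1 (sm_step cprog) (inl (entry C), stacks0 O w) = (inr (inr b), s).
  by rewrite iterS H1 /=; rewrite -/b; case: b.
have Hsz : size y <= size w + t.
  have := exec_tot He; rewrite /tot Hs size_rev size_map /= size_rev size_map; lia.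
have [r [E1 E2]] := machine_run H2 (erefl : cprog (inr (inr b)) = IHalt b) Hs (N := N) ltac:(nia).
by rewrite /run E1 /= E2; split=> //; case: b {H2 E1}.
Qed.
End Link.

(** Brings bounds of the form [(n + 2) ^ k] into the shape that [polytime] and [in_2exptime] use.
    The constant [3 ^ k] covers n = 0 and n = 1; for larger n, n + 2 is at most n squared. *)
Lemma pow_poly n k : (n + 2) ^ k <= n ^ (3 ^ k + 2 * k) + (3 ^ k + 2 * k).
Proof.
case: n => [|[|n]].
- apply: leq_trans (leq_addl _ _); apply: leq_trans (leq_addr _ _).
  by case: k => // k; rewrite leq_exp2r.
- by apply: leq_trans (leq_addl _ _); apply: leq_trans (leq_addr _ _).
apply: leq_trans (leq_addr _ _); apply: leq_trans (_ : n.+2 ^ (2 * k) <= _).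
  by rewrite expnM; case: k => // k; rewrite leq_exp2r // expnS expn1; nia.
by rewrite leq_exp2l // leq_addl.
Qed.

Lemma esz_fin_list (T : finType) (w : seq T) :
  tsize (@enc _ (@code_seq T (fin_code T)) w) <= size w * (2 * fsz T + 2) + 1.
Proof.
elim: w => // a w IH.
have H : tsize (@enc _ (@code_seq T (fin_code T)) (a :: w)) =
  (tsize (@enc _ (fin_code T) a) + tsize (@enc _ (@code_seq T (fin_code T)) w)).+1 by exact: tsizeN.
by rewrite H [size _]/=; have := bound_enc a; lia.
Qed.

Lemma runT_lift (I O : finType) (c : tcode) l T l' : runT c (st l) T (st l') ->
  runT (lift (fun b : bool => inl b : sym I O) (@gproj I O) c)
    (map inl l, [::], [::], [::]) T (map inl l', [::], [::], [::]).
Proof. by move=> [t Ht /(exec_lift (g := @gproj I O) (f := inl) (fun=> erefl)) H]; exists t. Qed.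

Theorem pf_polytime (I O : finType) (f : seq I -> seq O) :
  @pf (seq I) (seq O) (@code_seq I (fin_code I)) (@code_seq O (fin_code O)) f -> polytime f.
Proof.
pose cI := @code_seq I (fin_code I); pose cO := @code_seq O (fin_code O).
move=> Pf; have Sf := pf_size Pf; have [c [T [BT Hc]]] := Pf.
pose sz (w : seq I) := tsize (@enc _ cI w).
pose C := Seq (in_com I O) (Seq (lift (fun b : bool => inl b : sym I O) (@gproj I O) c) (out_com I O)).
pose Tt (w : seq I) := size w * (3 * fsz I + 6) + 2 + (T w + (size (f w) * (3 * fsz O + 5) + 1)).
have HC w : runT C (stacks0 O w) (Tt w) ([:: inl false], rev (map (@oinj I O) (f w)) ++ [::], [::], [::]).
  apply: run_seq (run_in O w) _ (leqnn _).
  apply: run_seq (run_out (f w) [::]) (leqnn _).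
  by have := Hc w [::]; rewrite !cats0; exact: runT_lift.
have Psz : pb size sz.
  apply: pb_le (pb_add (pb_mul (pb_self _) (pb_const _ (2 * fsz I + 2))) (pb_const _ 1)) _ => w.
  exact: esz_fin_list.
have PT : pb sz (fun w => 10 * (size w + Tt w + 2) ^ 2).
  have P1 : pb sz size by apply: pb_le (pb_self _) _ => w; apply: ltnW; exact: (@size_esz I (fin_code I)).
  have P2 : pb sz (fun w => size (f w)).
    by apply: pb_le Sf _ => w; apply: ltnW; exact: (@size_esz O (fin_code O)).
  by do ![apply: pb_pow|apply: pb_add|apply: pb_mul|exact: pb_const|assumption].
have [k Hk] := pb_comp (f := id) PT Psz.
exists (tm_of C), (3 ^ k + 2 * k) => w /=.
have Hget : get ([:: inl false] : seq (sym I O), rev (map (@oinj I O) (f w)) ++ [::], [::], [::]) RA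
    = rev (map (@oinj I O) (f w)) by rewrite /= cats0.
have [H1 _ H3] := tm_of_run (HC w) Hget (leq_trans (Hk w) (pow_poly _ _)).
by split.
Qed.

Theorem bf_in_2exptime (I : finType) (L : seq I -> Prop) (d : seq I -> bool) e :
  @bf (seq I) bool (@code_seq I (fin_code I)) _ (fun w => 2 ^ (2 ^ ((size w + 2) ^ e.+1))) d ->
  (forall w, L w <-> d w) -> in_2exptime L.
Proof.
pose cI := @code_seq I (fin_code I); pose O := (void : finType).
pose S (w : seq I) := 2 ^ (2 ^ ((size w + 2) ^ e.+1)).
move=> [c [T [BT Hc]]] HL.
pose C := Seq (in_com I O) (lift (fun b : bool => inl b : sym I O) (@gproj I O) c).
pose Tt (w : seq I) := size w * (3 * fsz I + 6) + 2 + T w.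
have HC w : runT C (stacks0 O w) (Tt w) (map inl (str (enc (d w))), [::], [::], [::]).
  apply: run_seq (run_in O w) _ (leqnn _).
  by have := Hc w [::]; rewrite !cats0; exact: runT_lift.
have HS (w : seq I) : size w + 2 <= S w.
  apply: leq_trans (_ : 2 ^ ((size w + 2) ^ e.+1) <= _); last by apply: ltnW; exact: ltn_expl.
  apply: leq_trans (_ : (size w + 2) ^ e.+1 <= _); last by apply: ltnW; exact: ltn_expl.
  by rewrite -{1}[_ + 2]expn1; apply: pow_le.
have PT : pb S (fun w => 10 * (size w + Tt w + 2) ^ 2).
  have P1 : pb S size by exists 1 => w; rewrite expn1; have := HS w; lia.
  by do ![apply: pb_pow|apply: pb_add|apply: pb_mul|exact: pb_const|assumption].
have [k Hk] := PT.
pose K := 3 ^ (e.+1 + 2 * k + 1) + 2 * (e.+1 + 2 * k + 1).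
(* A power of the doubly exponential measure is absorbed by adding [2 * k] to its topmost
   exponent. *)
have HT w : 10 * (size w + Tt w + 2) ^ 2 <= 2 ^ (2 ^ (size w ^ K + K)).
  apply: leq_trans (Hk w) _.
  set a := (size w + 2) ^ e.+1.
  have Ha : a + 2 * k <= size w ^ K + K.
    apply: leq_trans (pow_poly _ _); apply: leq_trans (pow_add _ _ _).
    rewrite leq_add2l; apply: leq_trans (ltnW (ltn_expl (2 * k) (isT : 1 < 2))) _.
    by case: (2 * k) => // j; rewrite leq_exp2r // leq_addl.
  apply: leq_trans (_ : 2 ^ (2 ^ (a + 2 * k)) <= _); last by rewrite leq_exp2l // leq_exp2l.
  have H4 : 4 <= S w by rewrite /S (@leq_exp2l 2 2) // (@leq_exp2l 2 1) // expn_gt0 addn2.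
  apply: leq_trans (_ : (S w ^ 2) ^ k <= _).
    by case: (k) => // j; rewrite leq_exp2r //; nia.
  rewrite /S -/a -!expnM leq_exp2l // expnD leq_mul2l; apply/orP; right.
  exact: ltnW (ltn_expl _ _).
have Hget w : get (map inl (str (enc (d w))) : seq (sym I O), [::], [::], [::]) RA
    = rev (map (@oinj I O) [::]) by [].
exists (tm_of C), K => w.
have [H1 H2 _] := tm_of_run (HC w) (Hget w) (HT w).
split; first exact: H1.
apply: (iff_trans (HL w)).
suff -> : d w = tm_acc (cstate (run (tm_of C) (2 ^ (2 ^ (size w ^ K + K))) w)) by [].
by rewrite H2; case: (d w).
Qed.

Fixpoint concept_eqb (C D : concept) : bool :=
  match C, D with
  | CName A, CName B => A == B
  | CTop, CTop => true
  | CNot C, CNot D => concept_eqb C D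
  | CAnd C C', CAnd D D' => concept_eqb C D && concept_eqb C' D'
  | CEx R C, CEx R' D => (R == R') && concept_eqb C D
  | _, _ => false
  end.
Lemma concept_eqbP : Equality.axiom concept_eqb.
Proof.
elim=> [A||C IH|C IHC C' IHC'|R C IH] [B||D|D D'|R' D] /=; try by constructor.
- by apply: (iffP eqP) => [->|[]].
- by apply: (iffP (IH D)) => [->|[]].
- by apply: (iffP andP) => [[/IHC-> /IHC'->]|[/IHC? /IHC'?]].
- by apply: (iffP andP) => [[/eqP-> /IH->]|[/eqP? /IH?]].
Qed.
HB.instance Definition _ := hasDecEq.Build concept concept_eqbP.

Lemma InE (T : eqType) (x : T) s : List.In x s <-> x \in s.
Proof.
elim: s => //= y s IH; rewrite inE IH; split.
  by case=> [->|->]; rewrite ?eqxx ?orbT.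
by case/orP=> [/eqP->|]; [left|right].
Qed.

Lemma ForallE (T : eqType) (P : T -> Prop) s : List.Forall P s <-> forall x, x \in s -> P x.
Proof. by rewrite List.Forall_forall; split=> H x /InE; apply: H. Qed.

(** * Horn concepts *)

Fixpoint neg (C : concept) : bool :=
  match C with
  | CName _ | CTop => true
  | CNot _ => false
  | CAnd D E => neg D && neg E
  | CEx _ D => neg D
  end.

Definition isnot C := if C is CNot _ then true else false.

(** Negation is applied to negation-free concepts only, except in value restrictions, which are
    followed as units just as [occ] does. *)
Fixpoint pos (C : concept) : bool :=
  match C with
  | CName _ | CTop => true
  | CNot (CEx _ (CNot D)) => pos D
  | CNot D => neg D
  | CAnd D E => pos D && pos E
  | CEx _ D => ~~ isnot D && pos D
  end.

Definition hornb (T : tbox) := all (fun i => neg i.1 && pos i.2) T.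

Lemma occ_neg_false X C : neg C -> ~ occ false X C.
Proof.
elim: C => [A||C IH|C IHC D IHD|R C IH] //=; try by move=> _ [[]|].
- by case/andP=> /IHC H1 /IHD H2 [[]|[]].
- by move=> /IH H [[]|].
Qed.

Lemma neg_occP C : neg C <-> forall D, ~ occ true (CNot D) C.
Proof.
elim: C => [A||C IH|C IHC D IHD|R C IH] /=.
- by split=> // _ D [[]|].
- by split=> // _ D [[]|].
- by split=> // H; case: (H C); left.
- split=> [/andP[/IHC H1 /IHD H2] E [[]|[/H1|/H2]] //|H].
  by apply/andP; split; [apply/IHC|apply/IHD] => E HE; apply: (H E); right; [left|right].
- split=> [/IH H D [[]|/H] //|H].
  by apply/IH => D HD; apply: (H D); right.
Qed.

Fixpoint csize C := match C with
  | CName _ | CTop => 1 | CNot D | CEx _ D => (csize D).+1 | CAnd D E => (csize D + csize E).+1 end.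

(** Induction on the size, because a value restriction peels off three constructors at once. *)
Lemma pos_occP C : pos C <->
  (forall D, ~ occ false (CNot D) C) /\ (forall R D, ~ occ true (CEx R (CNot D)) C).
Proof.
have [n] := ubnP (csize C); elim: n C => // n IH [A||C|C D|R C] /=.
- by move=> _; split=> // _; split=> [D|R D] [[]|].
- by move=> _; split=> // _; split=> [D|R D] [[]|].
- move=> Hn.
  have N : (neg C <-> (forall D, ~ ((false /\ CNot D = CNot C) \/ occ true (CNot D) C)) /\
     (forall R D, ~ ((true /\ CEx R (CNot D) = CNot C) \/ occ false (CEx R (CNot D)) C))).
    split=> [H|[H _]].
      split=> [D [[]//|]|R D [[]//|]]; first by move/neg_occP: H; apply.
      exact: occ_neg_false.
    by apply/neg_occP => D HD; apply: (H D); right.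
  case: C Hn N => [A||D|D E|R [A||D|D E|S D]] //= Hn _.
  have {}IH := IH D ltac:(lia); rewrite IH; split=> [[H1 H2]|[H1 H2]]; split.
  + by move=> E [[]//|/H1].
  + by move=> S E [[]//|/H2].
  + by move=> E HE; apply: (H1 E); right.
  + by move=> S E HE; apply: (H2 S E); right.
- move=> Hn; have IH1 := IH C ltac:(lia); have IH2 := IH D ltac:(lia).
  split=> [/andP[/IH1[H1 H2] /IH2[H3 H4]]|[H1 H2]].
    by split=> [E [[]//|[/H1|/H3]]|S E [[]//|[/H2|/H4]]].
  apply/andP; split; [apply/IH1|apply/IH2]; split=> [E HE|S E HE];
    by [apply: (H1 E); right; auto|apply: (H2 S E); right; auto].
- move=> Hn; have {}IH := IH C ltac:(lia); split=> [/andP[HC /IH[H1 H2]]|[H1 H2]].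
    split=> [E [[]//|/H1]|S E [[_ [_ E1]]|/H2]] //.
    by rewrite -E1 in HC.
  apply/andP; split.
    by case: C H2 {Hn IH H1} => //= D H2; case: (H2 R D); left.
  by apply/IH; split=> [E HE|S E HE]; [apply: (H1 E)|apply: (H2 S E)]; right.
Qed.

Lemma hornP T : horn T <-> hornb T.
Proof.
rewrite /horn /occ_tbox; split=> [[H1 H2]|/allP H].
  apply/allP => i Hi; apply/andP; split.
    apply/neg_occP => D HD; apply: (H1 D); apply/List.Exists_exists; exists i.
    by split; [apply/InE|left].
  apply/pos_occP; split=> [D HD|R D HD].
    by apply: (H1 D); apply/List.Exists_exists; exists i; split; [apply/InE|right].
  by apply: (H2 R D); apply/List.Exists_exists; exists i; split; [apply/InE|right].
split=> [C|R C] /List.Exists_exists [i [/InE /H/andP[/= h1 /pos_occP[h2 h3]] [h|h]]].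
- by move/neg_occP: h1 => /(_ C).
- exact: h2 h.
- exact: occ_neg_false h1 h.
- exact: h3 h.
Qed.

(** * Least fixed points *)

Section Lfp.
Variables (F : eqType) (univ : seq F) (step : seq F -> F -> bool).
Let stage n := iter n (fun s => [seq u <- univ | (u \in s) || step s u]) [::].

Lemma stage_mem n u : u \in stage n.+1 = (u \in univ) && ((u \in stage n) || step (stage n) u).
Proof. by rewrite mem_filter andbC. Qed.

Lemma stage_filter n : stage n = [seq u <- univ | u \in stage n].
Proof.
case: n => [|n]; first by elim: (univ).
rewrite {1}/stage iterS; apply: eq_in_filter => u Hu.
by rewrite stage_mem Hu.
Qed.

(** [P] sees the stage at which an element enters. The stage bounds the depth of a derivation, and
    such bounds later fix the number of layers of an ABox and the depth of a query. *)
Lemma lfp_ind (P : nat -> F -> Prop) : (forall n u, P n u -> P n.+1 u) ->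
  (forall n X u, (forall v, v \in X -> P n v) -> u \in univ -> step X u -> P n.+1 u) ->
  forall u, u \in lfp univ step -> P (size univ) u.
Proof.
move=> H1 H2; rewrite /lfp -/(stage _); move: (size univ) => n; elim: n => // n IH u.
rewrite stage_mem => /andP[Hu /orP[/IH/H1//|Hs]].
exact: H2 IH Hu Hs.
Qed.

Lemma lfp_sub u : u \in lfp univ step -> u \in univ.
Proof. by apply: (lfp_ind (P := fun _ u => u \in univ)). Qed.

Lemma count_lt (p q : pred F) : (forall u, p u -> q u) -> forall u, u \in univ -> q u -> ~~ p u ->
  count p univ < count q univ.
Proof.
move=> H u Hu Hq Hp.
have E : count q univ = count p univ + count (predD q p) univ.
  rewrite -count_predUI [X in _ = _ + X](eq_count (a2 := pred0)) ?count_pred0 ?addn0; last first.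
    by move=> v /=; case: (p v).
  by apply: eq_count => v /=; have := H v; case: (p v) => //= ->.
rewrite E -[X in X < _]addn0 ltn_add2l -has_count; apply/hasP; exists u => //=.
by rewrite Hp.
Qed.

(** Elements are never dropped and a round that is not yet closed adds one, so after [size univ]
    rounds nothing is left to add. *)
Lemma lfp_fix u : u \in univ -> step (lfp univ step) u -> u \in lfp univ step.
Proof.
rewrite /lfp -/(stage _).
pose closed n := all (fun u => step (stage n) u ==> (u \in stage n)) univ.
have K n : closed n \/ n <= size (stage n).
  elim: n => [|n IH]; first by right.
  case Hc : (closed n).
    left; have E : stage n.+1 = stage n.
      rewrite [RHS]stage_filter; apply: eq_in_filter => v Hv; rewrite -/(stage n).
      by have /allP/(_ v Hv)/implyP := Hc; case: (step _ _) => [->//|]; rewrite orbF.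
    by rewrite /closed E.
  right; case: IH => [|IH]; first by rewrite Hc.
  move/negbT/allPn: Hc => [v Hv]; rewrite negb_imply => /andP[H1 H2].
  apply: leq_ltn_trans IH _; rewrite stage_filter [X in _ < size X]stage_filter !size_filter.
  apply: (count_lt _ Hv) => //; last by rewrite stage_mem Hv H1 orbT.
  by move=> w Hw; rewrite /= stage_mem Hw andbT; move: Hw; rewrite stage_filter mem_filter => /andP[].
case: (K (size univ)) => [/allP H Hu Hs|H Hu _].
  by move/implyP: (H u Hu); apply.
move: H; rewrite {1}stage_filter size_filter.
rewrite leqNgt; have : count [in stage (size univ)] univ <= size univ by exact: count_size.
case Hin : (u \in stage (size univ)) => // _ /negP[].
rewrite -(count_predT univ); apply: (count_lt _ Hu) => //=.
by rewrite Hin.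
Qed.
End Lfp.

Lemma allsub_filter (A : eqType) (U : seq A) p : [seq C <- U | p C] \in allsub U.
Proof.
elim: U => //= C U IH; rewrite mem_cat; case: ifP => _; last by rewrite IH.
by apply/orP; right; apply/mapP; exists [seq C <- U | p C].
Qed.

Lemma allsub_sub (A : eqType) (U s : seq A) : s \in allsub U -> {subset s <= U}.
Proof.
elim: U s => [|C U IH] s /=; first by rewrite inE => /eqP->.
rewrite mem_cat => /orP[/IH H u /H|/mapP[t /IH H ->] u]; rewrite !inE.
  by move=> ->; rewrite orbT.
by case/orP=> [->//|/H->]; rewrite orbT.
Qed.

(** * Deduction and canonical models *)

Definition CAll R D := CNot (CEx R (CNot D)).
Notation ctype := (seq concept).

Definition clash (X : ctype) := has (fun D => CNot D \in X) X.
Definition seed (U X : ctype) R P := [seq D <- U | (D == P) || (CAll R D \in X)].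

(** The types of successors enter only through [ch], so the same rules serve the closure of a single
    type and the deduction on an ABox. A clash, here or in a required successor, makes every concept
    derivable. *)
Definition rule (T : tbox) (U : ctype) (Rs : seq name) (X : ctype) (ch : name -> concept -> ctype) (C : concept) : bool :=
  [|| C == CTop,
      has (fun i => (i.1 \in X) && (i.2 == C)) T,
      has (fun D => (CAnd C D \in X) || (CAnd D C \in X)) U,
      has (fun D => has (fun E => C == CAnd D E) X) X,
      clash X |
      has (fun R => has (fun P => (CEx R P \in X) &&
        (has (fun D => C == CEx R D) (ch R P) || clash (ch R P))) U) Rs].

Definition look (X : seq (ctype * concept)) (U S : ctype) : ctype := [seq C <- U | (S, C) \in X].

(** All seeds are closed simultaneously, because the closure of one seed consults the closures of
    the seeds of its children. *)
Definition clos (T : tbox) (U : ctype) (Rs : seq name) : seq (ctype * concept) :=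
  lfp [seq (S0, C) | S0 <- allsub U, C <- U] (fun X sc => (sc.2 \in sc.1) ||
    rule T U Rs (look X U sc.1) (fun R P => look X U (seed U (look X U sc.1) R P)) sc.2).

Section Deduction.
Variables (T : tbox) (U : ctype) (Rs : seq name).

Definition cl S := look (clos T U Rs) U S.
Definition child X R P := cl (seed U X R P).
Definition closed_type X :=
  all (fun C => rule T U Rs X (child X) C ==> (C \in X)) U && ~~ clash X.

Definition sats (I : interp) (d : idom I) (X : ctype) := forall C, C \in X -> ext C d.

Section Sound.
Variable I : interp.
Hypothesis HI : model_tbox I T.

Lemma sats_clash d X : sats (I := I) d X -> clash X -> False.
Proof. by move=> H /hasP[D H1 H2]; have := H _ H2; have := H _ H1. Qed.

Lemma rule_sound d X ch C : sats (I := I) d X ->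
  (forall R P, CEx R P \in X -> exists2 e, irol R d e & sats (I := I) e (ch R P)) ->
  rule T U Rs X ch C -> ext C d.
Proof.
move=> Hd Hch /or4P[/eqP->//|/hasP[[E P] HT /= /andP[H1 /eqP<-]]||].
- by have /ForallE/(_ _ HT) := HI; apply; exact: Hd.
- by case/hasP=> D _ /orP[/Hd[]|/Hd[]] //.
case/or3P=> [/hasP[D HD /hasP[E HE /eqP->]]|/(sats_clash Hd)[]|].
- by split; exact: Hd.
case/hasP=> R _ /hasP[P _ /andP[/Hch[e He Hs] /orP[/hasP[D HD /eqP->]|]]].
- by exists e; split=> //; exact: Hs.
- by move/(sats_clash Hs).
Qed.

Lemma seed_sats d X R P : sats (I := I) d X -> CEx R P \in X ->
  exists2 e, irol R d e & sats (I := I) e (seed U X R P).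
Proof.
move=> Hd HE; have [e [He HP]] := Hd _ HE; exists e => // D; rewrite mem_filter.
case/andP=> [/orP[/eqP->//|/Hd /= HA]] _.
by apply: NNPP => HN; apply: HA; exists e.
Qed.

Lemma cl_sound d S : sats (I := I) d S -> sats (I := I) d (cl S).
Proof.
suff K : forall sc, sc \in clos T U Rs -> forall d : idom I, sats d sc.1 -> ext sc.2 d.
  by move=> Hd C; rewrite mem_filter => /andP[/K H _]; exact: H Hd.
apply: (lfp_ind (P := fun _ sc => forall d : idom I, sats d sc.1 -> ext sc.2 d)) => //.
move=> _ X [S1 C] IH _ /= /orP[H|H] e He; first exact: He.
have HX (e' : idom I) S' : sats e' S' -> sats e' (look X U S').
  by move=> He' D; rewrite mem_filter => /andP[/IH H' _]; exact: H'.
apply: rule_sound (HX _ _ He) _ H => R P /(seed_sats (HX _ _ He))[e' H1 H2].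
by exists e' => //; exact: HX.
Qed.

Lemma child_sats d X R P : sats (I := I) d X -> CEx R P \in X ->
  exists2 e, irol R d e & sats (I := I) e (child X R P).
Proof. by move=> Hd /(seed_sats Hd)[e H1 /cl_sound H2]; exists e. Qed.

Lemma all_sats (d e : idom I) X R D : sats d X -> CAll R D \in X -> irol R d e -> ext D e.
Proof. by move=> Hd /Hd /= H1 H2; apply: NNPP => HN; apply: H1; exists e. Qed.

Definition btrue (P : Prop) : bool := if excluded_middle_informative P then true else false.
Lemma btrueP (P : Prop) : reflect P (btrue P).
Proof. by rewrite /btrue; case: excluded_middle_informative => H; constructor. Qed.

Definition type_of (d : idom I) : ctype := [seq C <- U | btrue (ext C d)].

Lemma type_ofE C d : C \in type_of d = btrue (ext C d) && (C \in U).
Proof. by rewrite mem_filter. Qed.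

Lemma sats_type_of d : sats d (type_of d).
Proof. by move=> C; rewrite mem_filter => /andP[/btrueP]. Qed.

Lemma closed_type_of d : closed_type (type_of d).
Proof.
apply/andP; split; last by apply/negP => /(sats_clash (@sats_type_of d)).
apply/allP => C HC; apply/implyP => H; rewrite mem_filter HC andbT; apply/btrueP.
apply: (rule_sound (@sats_type_of d) _ H) => R P; apply: child_sats; exact: sats_type_of.
Qed.
End Sound.

Hypothesis HU : forall C, C \in U -> match C with
  | CName _ | CTop => true | CNot D => D \in U | CAnd D E => (D \in U) && (E \in U)
  | CEx R D => (D \in U) && (R \in Rs) end.
Hypothesis HT : forall i, i \in T -> (i.1 \in U) && (i.2 \in U).

Lemma cl_sub S : {subset cl S <= U}.
Proof. by move=> C; rewrite mem_filter => /andP[]. Qed.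

Lemma cl_allsub S : cl S \in allsub U.
Proof. exact: allsub_filter. Qed.

Lemma seed_allsub X R P : seed U X R P \in allsub U.
Proof. exact: allsub_filter. Qed.

Lemma cl_fix S : S \in allsub U -> {subset S <= cl S} /\
  forall C, C \in U -> rule T U Rs (cl S) (child (cl S)) C -> C \in cl S.
Proof.
move=> HS.
have fixp C : C \in U -> (C \in S) || rule T U Rs (cl S) (child (cl S)) C -> (S, C) \in clos T U Rs.
  move=> HC H; rewrite /clos lfp_fix //.
  by apply/allpairsP; exists (S, C).
split=> [C HC|C HC H]; rewrite mem_filter.
  have HCU := allsub_sub HS HC; rewrite HCU andbT; apply: fixp => //.
  by rewrite HC.
by rewrite HC andbT; apply: fixp => //; rewrite H orbT.
Qed.

Lemma rule_clash X ch C : clash X -> rule T U Rs X ch C.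
Proof. by rewrite /rule => ->; rewrite !orbT. Qed.

(** A clash in the child would make every concept derivable at the parent, which would then contain
    a clash itself. *)
Lemma child_closed X R P : closed_type X -> CEx R P \in X -> CEx R P \in U -> closed_type (child X R P).
Proof.
move=> /andP[/allP HX Hcl] HE HEU.
have [_ H2] := cl_fix (seed_allsub X R P).
apply/andP; split; first by apply/allP => C HC; apply/implyP; exact: H2.
apply/negP => Hch; have /andP[HP HR] := HU HEU.
have Hall C : C \in U -> C \in X.
  move=> HC; apply: (implyP (HX C HC)); rewrite /rule; do 5![apply/orP; right].
  apply/hasP; exists R => //; apply/hasP; exists P => //; rewrite HE /=.
  by rewrite Hch orbT.
move/hasP: Hch => [D HD HN]; case/negP: Hcl; apply/hasP.
by exists D; apply: Hall; apply: cl_sub; eassumption.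
Qed.

Lemma child_mem X R P : P \in U -> P \in child X R P.
Proof.
move=> HP; have [H _] := cl_fix (seed_allsub X R P); apply: H.
by rewrite mem_filter eqxx.
Qed.

Lemma child_all X R P D : D \in U -> CAll R D \in X -> D \in child X R P.
Proof.
move=> HD HA; have [H _] := cl_fix (seed_allsub X R P); apply: H.
by rewrite mem_filter HA orbT HD.
Qed.

(* Types compatible along an R-edge. *)
Definition compat R (X Y : ctype) :=
  all (fun D => ((CAll R D \in X) ==> (D \in Y)) && ((D \in Y) && (CEx R D \in U) ==> (CEx R D \in X))) U.

Lemma compat_type_of I (d e : idom I) R : irol R d e -> compat R (type_of d) (type_of e).
Proof.
move=> Hr; apply/allP => D HD; rewrite !type_ofE; apply/andP; split; apply/implyP.
  case/andP=> /btrueP /= H _; rewrite HD andbT; apply/btrueP; apply: NNPP => HN.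
  by apply: H; exists e.
case/andP=> /andP[/btrueP H _] ->; rewrite andbT; apply/btrueP => /=.
by exists e.
Qed.

Section Canonical.
Variables (rho : nat -> ctype) (er : name -> nat -> nat -> Prop).
Hypothesis rho_sub : forall a, {subset rho a <= U}.
Hypothesis rho_closed : forall a, closed_type (rho a).
Hypothesis er_compat : forall R a b, er R a b -> compat R (rho a) (rho b).

(* Elements are paths of existential restrictions below an individual; a step that does not
   apply repeats the type, so that every element is harmless. *)
Definition cdom := (nat * seq (name * concept))%type.
Fixpoint ptype a (p : seq (name * concept)) : ctype :=
  if p is (R, P) :: p' then
    if CEx R P \in ptype a p' then child (ptype a p') R P else ptype a p'
  else rho a.

Definition canon : interp := @Interp cdom (fun a => (a, [::])) (fun a b => fun E => f_equal fst E)
  (fun A d => CName A \in ptype d.1 d.2)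
  (fun R d e => (d.2 = [::] /\ e.2 = [::] /\ er R d.1 e.1) \/
     (e.1 = d.1 /\ exists2 P, e.2 = (R, P) :: d.2 & CEx R P \in ptype d.1 d.2)).

Lemma ptype_sub a p : {subset ptype a p <= U}.
Proof.
elim: p => [|[R P] p IH] /=; first exact: rho_sub.
by case: ifP => _ //; exact: cl_sub.
Qed.

Lemma ptype_closed a p : closed_type (ptype a p).
Proof.
elim: p => [|[R P] p IH] /=; first exact: rho_closed.
by case: ifP => // H; apply: child_closed => //; exact: ptype_sub H.
Qed.

Lemma ptype_rule a p C : C \in U -> rule T U Rs (ptype a p) (child (ptype a p)) C -> C \in ptype a p.
Proof. by have /andP[/allP H _] := ptype_closed a p; move=> HC; apply/implyP/H. Qed.

Lemma ptype_edge (d e : cdom) R : irol (i := canon) R d e ->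
  (forall D, D \in U -> CAll R D \in ptype d.1 d.2 -> D \in ptype e.1 e.2) /\
  (forall D, D \in ptype e.1 e.2 -> CEx R D \in U -> CEx R D \in ptype d.1 d.2).
Proof.
case: d e => [a p] [b q] /= [[-> [-> /er_compat/allP H]]|[-> [P -> HP]]].
  split=> [D /H/andP[/implyP h _]|D HD HE] //.
  have /andP[HDU _] := HU HE.
  by have /andP[_ /implyP h] := H _ HDU; apply: h; rewrite HD.
rewrite /= HP; split=> [D HD HA|D HD HE]; first exact: child_all.
have /andP[HDU HR] := HU HE; have /andP[HPU _] := HU (ptype_sub HP).
apply: ptype_rule => //; rewrite /rule; do 5![apply/orP; right].
apply/hasP; exists R => //; apply/hasP; exists P => //; rewrite HP /=.
by apply/orP; left; apply/hasP; exists D.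
Qed.

(** The truth of a negation-free concept rests on names and edges of the model; both are recorded in
    the types, and the rules reassemble the concept from them. *)
Lemma canon_neg C : neg C -> C \in U -> forall d : idom canon, ext C d -> C \in ptype d.1 d.2.
Proof.
elim: C => [A||C IH|C IHC D IHD|R C IH] //=.
- by move=> _ HC [a p] _; apply: ptype_rule => //; rewrite /rule eqxx.
- move=> /andP[N1 N2] HC d [H1 H2]; have /andP[HCU HDU] := HU HC.
  apply: ptype_rule => //; rewrite /rule; do 3![apply/orP; right]; apply/orP; left.
  apply/hasP; exists C; first exact: IHC.
  by apply/hasP; exists D => //; exact: IHD.
- move=> N HC d [e [He H]]; have /andP[HCU _] := HU HC.
  by have [_ h] := ptype_edge He; apply: h => //; exact: IH.
Qed.

(** The converse for right-hand sides. A negation holds because, by [canon_neg], the truth of the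
    negated concept would put a clash into the type. *)
Lemma canon_pos C : pos C -> forall d : idom canon, C \in ptype d.1 d.2 -> ext C d.
Proof.
have [n] := ubnP (csize C); elim: n C => // n IH [A||C|C D|R C] //= Hn.
- have N : neg C -> forall d : cdom, CNot C \in ptype d.1 d.2 -> ~ ext (I := canon) C d.
    move=> Nc d Hd Hx; have HC : C \in U by exact: (HU (ptype_sub Hd)).
    have /andP[_ /negP[]] := ptype_closed d.1 d.2; apply/hasP; exists C => //.
    exact: canon_neg.
  case: C Hn N => [A||D|D E|R [A||D|D E|S D]] //= Hn _ Hp d Hd [e [He H]].
  apply: H; apply: IH => //; first lia.
  have HU1 := HU (ptype_sub Hd); have /andP[HU2 _] := HU HU1; have HU3 := HU HU2.
  by have [h _] := ptype_edge He; apply: h.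
- move=> /andP[P1 P2] d Hd; have /andP[HCU HDU] := HU (ptype_sub Hd).
  have R1 E F : E \in U -> F \in U -> (CAnd E F \in ptype d.1 d.2) || (CAnd F E \in ptype d.1 d.2) -> E \in ptype d.1 d.2.
    move=> HE HF H; apply: ptype_rule => //; rewrite /rule; do 2![apply/orP; right]; apply/orP; left.
    by apply/hasP; exists F.
  split; apply: IH => //; try lia.
    by apply: (R1 _ D) => //; rewrite Hd.
  by apply: (R1 _ C) => //; rewrite Hd orbT.
- move=> /andP[_ Pc] d Hd; have /andP[HCU HR] := HU (ptype_sub Hd).
  exists (d.1, (R, C) :: d.2); split; first by right; split=> //; exists C.
  apply: IH => //=; rewrite Hd; exact: child_mem.
Qed.

Lemma canon_model : hornb T -> model_tbox canon T.
Proof.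
move=> /allP HH; apply/ForallE => -[E P] Hi d /= HE.
have /andP[/= N1 N2] := HH _ Hi; have /andP[/= U1 U2] := HT Hi.
apply: canon_pos => //; apply: ptype_rule => //; rewrite /rule; apply/orP; right; apply/orP; left.
by apply/hasP; exists (E, P) => //=; rewrite eqxx andbT; exact: canon_neg.
Qed.
End Canonical.
End Deduction.

(** * The decision procedure: types, states and failures *)

(** A state abstracts an individual: its type in a model of T1, its type in a model of T2, and pairs
    (t, C) claiming that the tree generated by T2 from t is not simulated here, with the member C of
    t as the reason. *)
Notation state := (ctype * ctype * seq (ctype * concept))%type.

Section Alg.
Variables (U : ctype) (S1n S1r S2n S2r : seq name).
Variables (ch1 ch2 : ctype -> name -> concept -> ctype).

(** Collects the pairs (t, s) for which the tree generated by T2 from t is not simulated, over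
    Sigma2, by the tree generated by T1 from s. Simulation is a greatest fixed point, so its failure
    is a least one. *)
Definition na_step (X : seq (ctype * ctype)) (ts : ctype * ctype) : bool :=
  has (fun A => (CName A \in ts.1) && (CName A \notin ts.2)) S2n ||
  has (fun R => has (fun P => (CEx R P \in ts.1) &&
    all (fun P1 => (CEx R P1 \in ts.2) ==> ((ch2 ts.1 R P, ch1 ts.2 R P1) \in X)) U) U) S2r.
Definition na := lfp [seq (t, s) | t <- allsub U, s <- allsub U] na_step.

Definition reach_step Rs (ch : ctype -> name -> concept -> ctype) (X : seq (ctype * ctype)) (ts : ctype * ctype) : bool :=
  (ts.1 == ts.2) ||
  has (fun R => has (fun P => (CEx R P \in ts.1) && ((ch ts.1 R P, ts.2) \in X)) U) Rs.
Definition reach Rs ch := lfp [seq (t, s) | t <- allsub U, s <- allsub U] (reach_step Rs ch).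

Definition dom (N : seq (ctype * concept)) (t : ctype) := has (fun tc => tc.1 == t) N.

(** Verifies a reason as far as names and anonymous successors are concerned; successors inside the
    ABox are left to [edge]. *)
Definition claim (NA : seq (ctype * ctype)) (t1 : ctype) (tc : ctype * concept) : bool :=
  (tc.2 \in tc.1) &&
  (has (fun A => (tc.2 == CName A) && (tc.2 \notin t1)) S2n ||
   has (fun R => has (fun P => (tc.2 == CEx R P) &&
     all (fun P1 => (CEx R P1 \in t1) ==> ((ch2 tc.1 R P, ch1 t1 R P1) \in NA)) U) U) S2r).

Definition edge R (x y : state) : bool :=
  [&& compat U R x.1.1 y.1.1, compat U R x.1.2 y.1.2 &
      all (fun tc => all (fun P => (tc.2 == CEx R P) ==> dom y.2 (ch2 tc.1 R P)) U) x.2].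

(** The types of [Z] must be simulated neither at the individual itself nor at any anonymous element
    below it. *)
Definition avoid (NA R1 : seq (ctype * ctype)) (Z : seq ctype) (x : state) : bool :=
  all (fun z => dom x.2 z && all (fun s => ((x.1.1, s) \in R1) ==> ((z, s) \in NA)) (allsub U)) Z.

Definition dfacts (V : seq state) (X : seq (state * concept)) (x : state) : ctype :=
  [seq C <- U | (x, C) \in X].

Definition labelled (x : state) A := (CName A \in x.1.1) && (CName A \in x.1.2).

(** Deduction with T2 on the largest ABox over [V], which has an R-edge wherever [edge] allows one
    and every label common to both types. More assertions only yield more consequences, so no other
    ABox over these states needs to be tried. *)
Definition d_step T2 Rs (V : seq state) (X : seq (state * concept)) (xC : state * concept) : bool :=
  [|| has (fun A => (xC.2 == CName A) && labelled xC.1 A) S1n,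
      rule T2 U Rs (dfacts V X xC.1) (fun R P => ch2 (dfacts V X xC.1) R P) xC.2 |
      has (fun R => has (fun y =>
        (edge R xC.1 y && has (fun D => (xC.2 == CEx R D) && ((y, D) \in X)) U) ||
        (edge R y xC.1 && ((y, CAll R xC.2) \in X))) V) S1r].
Definition dlfp T2 Rs V := lfp [seq (x, C) | x <- V, C <- U] (d_step T2 Rs V).

Definition touched (V : seq state) (x : state) : bool :=
  has (labelled x) S1n || has (fun R => has (fun y => edge R x y || edge R y x) V) S1r.

(** The first case leads to a query with one answer, and [touched] makes that individual occur in
    the ABox; the second case leads to a Boolean query. *)
Definition fail (R2 : seq (ctype * ctype)) (Z : seq ctype) (V : seq state) (X : seq (state * concept)) : bool :=
  has (fun x => (touched V x && dom x.2 (dfacts V X x)) ||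
                has (fun z => (dfacts V X x, z) \in R2) Z) V.

Definition states : seq state :=
  [seq (ts, N) | ts <- [seq (t, s) | t <- allsub U, s <- allsub U],
                 N <- allsub [seq (t, C) | t <- allsub U, C <- U]].
End Alg.

Definition closed_with T U Rs (ch : ctype -> name -> concept -> ctype) (X : ctype) : bool :=
  all (fun C => rule T U Rs X (fun R P => ch X R P) C ==> (C \in X)) U && ~~ clash X.

Definition okstate T1 T2 U Rs S2n S2r ch1 ch2 (NA : seq (ctype * ctype)) (x : state) : bool :=
  [&& closed_with T1 U Rs ch1 x.1.1, closed_with T2 U Rs ch2 x.1.2 &
      all (claim U S2n S2r ch1 ch2 NA x.1.1) x.2].

Definition nonent T1 T2 U Rs (S1n S1r S2n S2r : seq name) : bool :=
  let ch1 := child T1 U Rs in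
  let ch2 := child T2 U Rs in
  let NA := na U S2n S2r ch1 ch2 in
  let R1 := reach U Rs ch1 in
  let R2 := reach U Rs ch2 in
  has (fun Z => let V := [seq x <- states U | okstate T1 T2 U Rs S2n S2r ch1 ch2 NA x && avoid U NA R1 Z x] in
    fail U S1n S1r ch2 R2 Z V (dlfp U S1n S1r ch2 T2 Rs V)) (allsub (allsub U)).

Section Correct.
Variables (T1 T2 : tbox) (U : ctype) (Rs S1n S1r S2n S2r : seq name).
Hypothesis HU : forall C, C \in U -> match C with
  | CName _ | CTop => true | CNot D => D \in U | CAnd D E => (D \in U) && (E \in U)
  | CEx R D => (D \in U) && (R \in Rs) end.
Hypothesis HT1 : forall i, i \in T1 -> (i.1 \in U) && (i.2 \in U).
Hypothesis HT2 : forall i, i \in T2 -> (i.1 \in U) && (i.2 \in U).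
Hypothesis HS1 : forall A, A \in S1n -> CName A \in U.
Hypotheses (horn1 : hornb T1) (horn2 : hornb T2).

Notation ch1 := (child T1 U Rs).
Notation ch2 := (child T2 U Rs).
Notation NA := (na U S2n S2r ch1 ch2).
Notation R1 := (reach U Rs ch1).
Notation R2 := (reach U Rs ch2).
Notation AS := (allsub U).

Lemma child_AS T X R P : child T U Rs X R P \in AS.
Proof. exact: allsub_filter. Qed.

Lemma pair_AS t s : t \in AS -> s \in AS -> (t, s) \in [seq (t, s) | t <- AS, s <- AS].
Proof. by move=> Ht Hs; apply/allpairsP; exists (t, s). Qed.

Lemma reach_refl T s : s \in AS -> (s, s) \in reach U Rs (child T U Rs).
Proof. by move=> Hs; apply: lfp_fix; [exact: pair_AS|rewrite /reach_step eqxx]. Qed.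

Lemma reach_AS T t s : (t, s) \in reach U Rs (child T U Rs) -> (t \in AS) && (s \in AS).
Proof. by move/lfp_sub/allpairsP=> [[t' s'] /= [H1 H2 [-> ->]]]; rewrite H1 H2. Qed.

Lemma reach_step_r T t s R P : (t, s) \in reach U Rs (child T U Rs) -> CEx R P \in s ->
  (t, child T U Rs s R P) \in reach U Rs (child T U Rs).
Proof.
move E : (t, s) => ts H; rewrite -[t]/(t, s).1 -[s]/(t, s).2 E; move: ts H R P {E t s}.
apply: (lfp_ind (P := fun _ (ts : ctype * ctype) => forall R P, CEx R P \in ts.2 ->
  (ts.1, child T U Rs ts.2 R P) \in reach U Rs (child T U Rs))) => //.
move=> _ X [t s] IH /allpairsP[[t' s'] /= [Ht Hs [-> ->]]] Hst R P HE.
have HEU := allsub_sub Hs HE; have /andP[HP HR] := HU HEU.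
apply: lfp_fix; first by apply: pair_AS => //; exact: child_AS.
rewrite /reach_step /=; apply/orP; right; apply/hasP.
case/orP: Hst => [/eqP /= ->|/hasP[R' HR' /hasP[P' HP' /= /andP[H1 H2]]]].
  by exists R => //; apply/hasP; exists P => //; rewrite HE; apply: reach_refl; exact: child_AS.
by exists R' => //; apply/hasP; exists P' => //; rewrite H1; exact: (IH _ H2).
Qed.

Lemma reach_sats T I t s d : model_tbox I T -> (t, s) \in reach U Rs (child T U Rs) ->
  sats (I := I) d t -> exists d' : idom I, sats d' s.
Proof.
move=> HI; move E : (t, s) => ts H; move: d.
rewrite -[t]/(t, s).1 -[s]/(t, s).2 E; move: ts H {E t s}.
apply: (lfp_ind (P := fun _ (ts : ctype * ctype) => forall d : idom I, sats d ts.1 -> exists d' : idom I, sats d' ts.2)) => //.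
move=> _ X [t' s'] IH _ /orP[/eqP /= ->|/hasP[R _ /hasP[P _ /= /andP[H1 H2]]]] d Hd; first by exists d.
have [e _ He] := child_sats U Rs HI Hd H1.
exact: IH _ H2 e He.
Qed.

(** * Tree queries and bounded simulations *)

Section QSim.
Variable I : interp.

Definition nmatch (t : ctype) (d : idom I) := forall A, A \in S2n -> CName A \in t -> icon A d.

(** The depth bound matches the finite unfolding that [qbody] turns into a conjunctive query. *)
Fixpoint qsim k (t : ctype) (d : idom I) : Prop :=
  nmatch t d /\
  if k is k'.+1 then
    forall R P, R \in S2r -> CEx R P \in t -> exists2 e, irol R d e & qsim k' (ch2 t R P) e
  else True.

Lemma qsim_le j k t d : j <= k -> qsim k t d -> qsim j t d.
Proof.
elim: k j t d => [|k IH] [|j] t d //= Hjk [H1 H2]; split=> // R P HR HP.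
by have [e He /(IH _ _ _ Hjk)] := H2 R P HR HP; exists e.
Qed.

Definition exs := [seq (R, P) | R <- S2r, P <- U].
Definition exnth i := nth ([::], CTop) exs i.
Notation pk := (pickle : seq nat -> nat).

(** The Sigma2-part of the tree generated by T2 from [t], cut at depth [k]. A variable is a path of
    indices into [exs], coded as a number. *)
Fixpoint qbody k (t : ctype) (p : seq nat) : seq (atom var) :=
  [seq AtC A (pk p) | A <- S2n & CName A \in t] ++
  if k is k'.+1 then flatten [seq
    if CEx (exnth i).1 (exnth i).2 \in t
    then AtR (exnth i).1 (pk p) (pk (i :: p)) :: qbody k' (ch2 t (exnth i).1 (exnth i).2) (i :: p)
    else [::] | i <- iota 0 (size exs)]
  else [::].

Lemma indsP (A : abox) a : a \in inds A <-> exists2 at_, List.In at_ A & a \in terms at_.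
Proof.
elim: A => [|at_ A IH]; first by split=> // -[].
rewrite /inds /= mem_cat; split=> [/orP[H|/IH[b H1 H2]]|[b [<-|H1] H2]].
- by exists at_ => //; left.
- by exists b => //; right.
- by rewrite H2.
- by apply/orP; right; apply/IH; exists b.
Qed.

Lemma inds_Forall (A : abox) : List.Forall (fun at_ => {subset terms at_ <= inds A}) A.
Proof. by apply/List.Forall_forall => at_ H a Ha; apply/indsP; exists at_. Qed.

Lemma all_flat (X : Type) (b : pred X) ss : all b (flatten ss) = all (all b) ss.
Proof. by elim: ss => //= s ss IH; rewrite all_cat IH. Qed.

Lemma Forall_cat X (P : X -> Prop) s s' : List.Forall P (s ++ s') <-> List.Forall P s /\ List.Forall P s'.
Proof. exact: List.Forall_app. Qed.

Lemma Forall_flatten X (J : eqType) (P : X -> Prop) (f : J -> seq X) (s : seq J) :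
  List.Forall P (flatten (map f s)) <-> forall i, i \in s -> List.Forall P (f i).
Proof.
elim: s => [|i s IH] /=; first by split=> // _; constructor.
rewrite Forall_cat IH; split=> [[H1 H2] j|H].
  by rewrite inE => /orP[/eqP->|/H2].
by split=> [|j Hj]; apply: H; rewrite inE ?eqxx // Hj orbT.
Qed.

Lemma Forall_map_filter X (J : eqType) (P : X -> Prop) (f : J -> X) (b : pred J) (s : seq J) :
  List.Forall P [seq f i | i <- s & b i] <-> forall i, i \in s -> b i -> P (f i).
Proof.
elim: s => [|i s IH] /=; first by split=> // _; constructor.
case: ifP => Hb /=; rewrite ?List.Forall_cons_iff IH; split.
- by move=> [H1 H2] j; rewrite inE => /orP[/eqP->|/H2].
- by move=> H; split=> [|j Hj]; apply: H; rewrite // inE ?eqxx // Hj orbT.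
- by move=> H j; rewrite inE => /orP[/eqP->|/H //]; rewrite Hb.
- by move=> H j Hj; apply: H; rewrite inE Hj orbT.
Qed.

Lemma qbody_qsim k t p (f : var -> idom I) : t \in AS -> List.Forall (sat f) (qbody k t p) -> qsim k t (f (pk p)).
Proof.
elim: k t p => [|k IH] t p Ht /= /Forall_cat[/Forall_map_filter H1 H2]; split=> //.
move=> R P HR HP; have HPU : P \in U by have /andP[] := HU (allsub_sub Ht HP).
have Hin : (R, P) \in exs by apply/allpairsP; exists (R, P).
move: H2; rewrite Forall_flatten => /(_ (index (R, P) exs)).
rewrite mem_iota index_mem Hin => /(_ isT); rewrite /exnth nth_index //= HP.
move/List.Forall_cons_iff => [H2 H3]; exists (f (pk (index (R, P) exs :: p))) => //.
by apply: IH H3; exact: child_AS.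
Qed.

Lemma qbody_over k t p : all (Defs.over (S2n, S2r)) (qbody k t p).
Proof.
elim: k t p => [|k IH] t p /=; rewrite all_cat; apply/andP; split=> //.
- by rewrite all_map; apply/allP => A /=; rewrite mem_filter => /andP[].
- by rewrite all_map; apply/allP => A /=; rewrite mem_filter => /andP[].
rewrite all_flat all_map; apply/allP => i; rewrite mem_iota /= => Hi.
case: ifP => //= _; rewrite IH andbT.
have /allpairsP[[R P] /= [HR _ E]] := mem_nth ([::], CTop) Hi.
by rewrite /exnth E.
Qed.

Lemma qbody_sat t d k : model_tbox I T2 -> sats (I := I) d t ->
  exists f : var -> idom I, f (pk [::]) = d /\ List.Forall (sat f) (qbody k t [::]).
Proof.
move=> HI Hd.
pose tp := fix tp (p : seq nat) : ctype := if p is i :: p' then ch2 (tp p') (exnth i).1 (exnth i).2 else t.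
pose el := fix el (p : seq nat) : idom I := if p is i :: p' then
  epsilon (inhabits d) (fun e => irol (exnth i).1 (el p') e /\ sats e (tp (i :: p'))) else d.
pose f v := el (odflt [::] (unpickle v)).
have fE p : f (pk p) = el p by rewrite /f pickleK.
exists f; split; first by rewrite fE.
suff H : forall p, sats (el p) (tp p) -> List.Forall (sat f) (qbody k (tp p) p) by exact: (H [::]).
elim: k => [|k IH] p Hp /=; rewrite Forall_cat; split.
- by apply/Forall_map_filter => A _ /Hp /=; rewrite fE.
- by constructor.
- by apply/Forall_map_filter => A _ /Hp /=; rewrite fE.
apply/Forall_flatten => i _; case: ifP => // HE.
have [e He1 He2] := child_sats U Rs HI Hp HE.
have [H1 H2] : irol (exnth i).1 (el p) (el (i :: p)) /\ sats (el (i :: p)) (tp (i :: p)).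
  exact: (epsilon_spec (inhabits d) (fun e => irol (exnth i).1 (el p) e /\ sats e (tp (i :: p))) (ex_intro _ e (conj He1 He2))).
by apply/List.Forall_cons_iff; rewrite /= !fE; split=> //; exact: (IH (i :: p)).
Qed.
End QSim.

Section Canon1.
Variables (rho : nat -> ctype) (er : name -> nat -> nat -> Prop).
Hypothesis rho_sub : forall a, {subset rho a <= U}.
Notation J := (canon T1 U Rs rho er).
Notation pty := (ptype T1 U Rs rho).

(** Restricted to anonymous elements: all their edges come from existential restrictions, whereas an
    individual also has edges of the ABox. The stage at which the pair enters [na] is a depth at
    which the simulation breaks. *)
Lemma na_qsim t s a p : (t, s) \in NA -> p <> [::] -> pty a p = s ->
  ~ qsim (size [seq (t, s) | t <- AS, s <- AS]) t ((a, p) : idom J).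
Proof.
move E : (t, s) => ts H; rewrite -[t]/(t, s).1 -[s]/(t, s).2 E; move: ts H a p {E t s}.
apply: (lfp_ind (P := fun n (ts : ctype * ctype) => forall a p, p <> [::] -> pty a p = ts.2 ->
  ~ qsim n ts.1 ((a, p) : idom J))).
  by move=> n ts H a p Hp Hs Hq; apply: (H a p Hp Hs); exact: (qsim_le (leqnSn n) Hq).
move=> n X [t' s'] IH _ Hst a p Hp /= Hs [H1 H2].
case/orP: Hst => [/hasP[A HA /= /andP[h1 h2]]|/hasP[R HR /hasP[P HP /= /andP[h1 /allP h2]]]].
  by case/negP: h2; rewrite -Hs; exact: (H1 A HA h1).
have [[b q] He Hq] := H2 R P HR h1.
case: He => [[Hp' _]|[Eb [P1 Eq HE]]]; first by case: Hp.
move: Eb Eq HE Hq => /= -> -> HE Hq.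
have /andP[HP1U _] := HU (ptype_sub rho_sub HE).
have := h2 P1 HP1U; rewrite -Hs HE /= => Hin.
by apply: (IH _ Hin a ((R, P1) :: p) _ _ Hq) => //=; rewrite HE.
Qed.
End Canon1.

(** * From a failure to an ABox *)

Section Layered.
Variables (Z : seq ctype).
Hypothesis HZ : {subset Z <= AS}.
Notation V := [seq x <- states U | okstate T1 T2 U Rs S2n S2r ch1 ch2 NA x && avoid U NA R1 Z x].
Notation X := (dlfp U S1n S1r ch2 T2 Rs V).
Notation D := (dfacts U V X).
Variables (x0 : state) (x0V : x0 \in V).

(** The ABox has [m] layers, each a copy of all states, with edges only from a layer to the next. A
    reason handed on along an edge therefore climbs and cannot run in a circle. Deductions have at
    most [n] stages and move one layer per stage; with [m] equal to 2n + 3, level n + 1 has more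
    than [n] layers on either side. *)
Let n := size [seq (x, C) | x <- V, C <- U].
Let m := n.*2.+3.
Let lam a := nth x0 V (a %/ m).
Let lvl a := a %% m.
Let num x i := index x V * m + i.
Let er R a b := [/\ R \in S1r, edge U ch2 R (lam a) (lam b) & lvl b = (lvl a).+1].

Lemma m_gt0 : 0 < m. Proof. by []. Qed.

Lemma lvl_num x i : i < m -> lvl (num x i) = i.
Proof. by move=> Hi; rewrite /lvl /num modnMDl modn_small. Qed.

Lemma lam_num x i : x \in V -> i < m -> lam (num x i) = x.
Proof. by move=> Hx Hi; rewrite /lam /num divnMDl // divn_small // addn0 nth_index. Qed.

Lemma num_lt x i : x \in V -> i < m -> num x i < size V * m.
Proof.
move=> Hx Hi; rewrite /num; have : (index x V).+1 * m <= size V * m by rewrite leq_mul2r index_mem Hx orbT.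
by rewrite mulSn; lia.
Qed.

Lemma lamV a : lam a \in V.
Proof.
rewrite /lam; case: (ltnP (a %/ m) (size V)) => H; first exact: mem_nth.
by rewrite nth_default.
Qed.

Lemma stateV x : x \in V -> [/\ x.1.1 \in AS, x.1.2 \in AS & okstate T1 T2 U Rs S2n S2r ch1 ch2 NA x /\ avoid U NA R1 Z x].
Proof.
rewrite mem_filter => /andP[/andP[H1 H2] /allpairsP[[ts N] /= [/allpairsP[[t s] /= [Ht Hs E1]] _ E]]].
by rewrite E E1 in H1 H2 *.
Qed.

Definition labox : abox :=
  flatten [seq [seq AtC A a | A <- S1n & labelled (lam a) A] | a <- iota 0 (size V * m)] ++
  flatten [seq flatten [seq [seq AtR R a b | R <- S1r & edge U ch2 R (lam a) (lam b) && (lvl b == (lvl a).+1)]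
     | b <- iota 0 (size V * m)] | a <- iota 0 (size V * m)].

Lemma labox_model (I : interp) : model_abox I labox <->
  (forall A a, a < size V * m -> A \in S1n -> labelled (lam a) A -> icon A (iind I a)) /\
  (forall R a b, a < size V * m -> b < size V * m -> er R a b -> irol R (iind I a) (iind I b)).
Proof.
rewrite /model_abox Forall_cat Forall_flatten Forall_flatten; split=> -[H1 H2]; split.
- move=> A a Ha HA Hl; have := H1 a; rewrite mem_iota /= => /(_ Ha)/Forall_map_filter; exact.
- move=> R a b Ha Hb [HR He Hlv]; have := H2 a; rewrite mem_iota /= => /(_ Ha)/Forall_flatten/(_ b).
  rewrite mem_iota /= => /(_ Hb)/Forall_map_filter/(_ R HR); apply.
  by rewrite He Hlv eqxx.
- by move=> a; rewrite mem_iota /= => Ha; apply/Forall_map_filter => A HA Hl; exact: H1.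
- move=> a; rewrite mem_iota /= => Ha; apply/Forall_flatten => b; rewrite mem_iota /= => Hb.
  by apply/Forall_map_filter => R HR /andP[He /eqP Hlv]; apply: H2.
Qed.

Lemma labox_over : all (Defs.over (S1n, S1r)) labox.
Proof.
rewrite /labox all_cat !all_flat !all_map; apply/andP; split; apply/allP => a _ /=.
  by rewrite all_map; apply/allP => A /=; rewrite mem_filter => /andP[].
rewrite all_flat all_map; apply/allP => b _ /=; rewrite all_map; apply/allP => R /=.
by rewrite mem_filter => /andP[].
Qed.

Lemma edge_compat R a b : er R a b -> compat U R (lam a).1.1 (lam b).1.1 /\ compat U R (lam a).1.2 (lam b).1.2.
Proof. by case=> _ /and3P[H1 H2 _] _. Qed.

Let rho1 a := (lam a).1.1.
Let rho2 a := (lam a).1.2.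
Notation J1 := (canon T1 U Rs rho1 er).
Notation J2 := (canon T2 U Rs rho2 er).

Lemma rho1_sub a : {subset rho1 a <= U}.
Proof. by have [H _ _] := stateV (lamV a); exact: allsub_sub. Qed.
Lemma rho2_sub a : {subset rho2 a <= U}.
Proof. by have [_ H _] := stateV (lamV a); exact: allsub_sub. Qed.

Lemma J1_model : model_tbox J1 T1.
Proof.
apply: canon_model => //; first exact: rho1_sub.
- by move=> a; have [_ _ [/and3P[H _ _] _]] := stateV (lamV a).
- by move=> R a b /edge_compat[].
Qed.

Lemma J2_model : model_tbox J2 T2.
Proof.
apply: canon_model => //; first exact: rho2_sub.
- by move=> a; have [_ _ [/and3P[_ H _] _]] := stateV (lamV a).
- by move=> R a b /edge_compat[].
Qed.

Lemma J1_abox : model_abox J1 labox.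
Proof.
apply/labox_model; split=> [A a _ _ /andP[H _]|R a b _ _ H]; first exact: H.
by left.
Qed.
Lemma J2_abox : model_abox J2 labox.
Proof.
apply/labox_model; split=> [A a _ _ /andP[_ H]|R a b _ _ H]; first exact: H.
by left.
Qed.

(** A fact of stage j is forced at every level with j further levels below and above it, because one
    deduction step looks only at the neighbouring levels. *)
Lemma dlfp_certain (I : interp) a : model_tbox I T2 -> model_abox I labox ->
  a < size V * m -> n < lvl a -> lvl a + n < m.-1.+1 -> sats (iind I a) (D (lam a)).
Proof.
move=> HI /labox_model[HA1 HA2] Ha Hn1 Hn2.
suff K : forall xC, xC \in X -> forall a, a < size V * m -> lam a = xC.1 -> n <= lvl a -> lvl a + n < m ->
    ext xC.2 (iind I a).
  by move=> C; rewrite mem_filter => /andP[H _]; apply: (K _ H) => //; move: Hn1 Hn2; clear; lia.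
apply: (lfp_ind (P := fun j (xC : state * concept) => forall a, a < size V * m -> lam a = xC.1 ->
    j <= lvl a -> lvl a + j < m -> ext xC.2 (iind I a))).
  by move=> j u IH b Hb Hl H1 H2; apply: IH => //; move: H1 H2; clear; lia.
move=> j Y [x C] IH Hu Hst b Hb /= Hlx H1 H2.
have Hs : sats (iind I b) (dfacts U V Y x).
  by move=> E; rewrite mem_filter => /andP[HE _]; apply: (IH _ HE) => //; move: H1 H2; clear; lia.
have Hbm : lvl b < m by rewrite ltn_mod.
case/or3P: Hst => [/hasP[A HA /= /andP[/eqP-> Hlab]]|Hr|].
- by apply: HA1 => //; rewrite Hlx.
- by refine (rule_sound HI Hs _ Hr) => R P; exact: child_sats.
case/hasP=> R HR /hasP[y Hy /orP[/andP[He /hasP[E HE /= /andP[/eqP-> HYE]]]|/= /andP[He HYE]]].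
- pose c := num y (lvl b).+1; have Hlc : (lvl b).+1 < m by move: H1 H2; clear; lia.
  exists (iind I c); split.
    apply: HA2; rewrite ?num_lt //; split=> //; first by rewrite /c lam_num // Hlx.
    by rewrite /c lvl_num.
  by apply: (IH _ HYE); rewrite ?num_lt ?lam_num ?lvl_num //; move: H1 H2 Hbm; clear; lia.
- pose c := num y (lvl b).-1; have Hlc : (lvl b).-1 < m by move: H1 H2 Hbm; clear; lia.
  have Hc : ext (CAll R C) (iind I c).
    by apply: (IH _ HYE); rewrite ?num_lt ?lam_num ?lvl_num //; move: H1 H2 Hbm; clear; lia.
  apply: NNPP => HN; apply: Hc; exists (iind I b); split=> //.
  apply: HA2; rewrite ?num_lt //; split=> //; first by rewrite /c lam_num // Hlx.
  by rewrite /c lvl_num //; move: H1; clear; lia.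
Qed.

Let a0 := num x0 n.+1.
Lemma a0_lt : n.+1 < m. Proof. by rewrite /m; lia. Qed.
Lemma a0_bound : a0 < size V * m. Proof. exact: num_lt x0V a0_lt. Qed.
Lemma lam_a0 : lam a0 = x0. Proof. exact: lam_num x0V a0_lt. Qed.
Lemma lvl_a0 : lvl a0 = n.+1. Proof. exact: lvl_num a0_lt. Qed.

Lemma a0_certain (I : interp) : model_tbox I T2 -> model_abox I labox -> sats (iind I a0) (D x0).
Proof.
move=> H1 H2; have := dlfp_certain H1 H2 a0_bound; rewrite lam_a0 lvl_a0; apply; rewrite /m; clear; lia.
Qed.

(** The derived facts hold in [J2], which is a model since every state carries a clash-free type
    closed under T2. *)
Lemma dfacts_noclash : ~~ clash (D x0).
Proof. by apply/negP => /(sats_clash (a0_certain J2_model J2_abox)). Qed.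

Let nNA := size [seq (t, s) | t <- AS, s <- AS].

(** By induction on the distance to the top layer. A reason [CEx R P] passes along edges of the ABox
    to the next layer; along anonymous edges it ends in [na], which breaks within [nNA] further
    steps. *)
Lemma dom_qsim a t : dom (lam a).2 t -> t \in AS -> ~ qsim (m - lvl a + nNA) t (iind J1 a).
Proof.
move: {2}(m - lvl a) (erefl (m - lvl a)) => k; elim: k a t => [|k IH] a t Hk Hd Ht.
  by have := ltn_pmod a m_gt0; rewrite -/(lvl a); move: Hk; clear; lia.
have [_ _ [/and3P[_ _ /allP Hcl] _]] := stateV (lamV a).
case/hasP: Hd => [[t' C] Htc /= /eqP Et]; subst t'.
have /andP[/= HC] := Hcl _ Htc.
rewrite Hk addSn => Hor [H1 H2].
case/orP: Hor => [/hasP[A HA /andP[/eqP EC /negP Hn]]|/hasP[R HR /hasP[P HP /andP[/eqP EC /allP Hna]]]].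
  by apply: Hn; rewrite EC in HC *; exact: H1.
rewrite EC in HC; have [[b q] He Hq'] := H2 R P HR HC.
have Hq : qsim (k + nNA) (ch2 t R P) ((b, q) : idom J1) := Hq'; clear Hq' H2.
case: He => [[_ [Eq [HR1 Hed Hlv]]]|[Eb [P1 Eq HE]]].
  move: Eq Hed Hlv => /= Eq /and3P[_ _ /allP/(_ _ Htc)/allP/(_ _ HP)] /=; subst q.
  rewrite EC eqxx /= => Hdom Hlv.
  have Ek : m - lvl b = k by move: Hk Hlv; clear; lia.
  by apply: (IH b (ch2 t R P)); rewrite ?Ek //; exact: child_AS.
move: Eb Eq HE => /= Eb Eq HE; subst b q.
have /andP[HP1U _] := HU (rho1_sub HE).
have := Hna P1 HP1U; rewrite HE /= => Hin.
have Ep : ptype T1 U Rs rho1 a [:: (R, P1)] = ch1 (lam a).1.1 R P1 by rewrite /= HE.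
by refine (na_qsim rho1_sub Hin _ Ep (qsim_le _ Hq)); rewrite // leq_addl.
Qed.

Lemma ptype_reach a p : (rho1 a, ptype T1 U Rs rho1 a p) \in R1.
Proof.
elim: p => [|[R P] p IH] /=; first by apply: reach_refl; have [] := stateV (lamV a).
by case: ifP => // H; exact: reach_step_r.
Qed.

Let k := m + nNA.

Lemma avoid_qsim z (d : idom J1) : z \in Z -> ~ qsim k z d.
Proof.
move=> Hz; case: d => a p Hq.
have [_ _ [_ /allP/(_ z Hz)/andP[Hd /allP Hav]]] := stateV (lamV a).
case: p Hq => [|e p] Hq.
  apply: (dom_qsim Hd (HZ Hz)); apply: qsim_le Hq; rewrite /k; clear; lia.
have Hr := ptype_reach a (e :: p); have /andP[_ HS] := reach_AS Hr.
have := Hav _ HS; rewrite Hr /= => Hna.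
by refine (na_qsim (p := e :: p) rho1_sub Hna _ (erefl _) (qsim_le _ Hq)); rewrite // leq_addl.
Qed.

Lemma layered_nonent : (touched U S1n S1r ch2 V x0 && dom x0.2 (D x0)) || has (fun z => (D x0, z) \in R2) Z ->
  ~ cq_entails ((S1n, S1r), (S2n, S2r)) T1 T2.
Proof.
move=> Hfail Hent.
have C1 : consistent T1 labox by exists J1; split; [exact: J1_model|exact: J1_abox].
have C2 : consistent T2 labox by exists J2; split; [exact: J2_model|exact: J2_abox].
have DAS : D x0 \in AS by exact: allsub_filter.
case/orP: Hfail => [/andP[Ht Hd]|/hasP[z Hz Hr]].
(* The type derived at [x0] is not simulated there: its tree query, with the root as answer
   variable, separates the TBoxes. *)
- pose q := CQ [:: pickle ([::] : seq nat)] (qbody k (D x0) [::]).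
  (* [touched] provides a label or a neighbour of [x0]; the neighbour is taken on level n + 2 or n,
     according to the direction of the edge. *)
  have Ha0 : {subset [:: a0] <= inds labox}.
    move=> a; rewrite inE => /eqP->.
    have := inds_Forall labox; move: (inds labox) => L.
    rewrite Forall_cat !Forall_flatten => -[H1 H2].
    have Hi c : c < size V * m -> c \in iota 0 (size V * m) by rewrite mem_iota.
    have Ha := a0_bound.
    case/orP: Ht => [/hasP[A HA HL]|/hasP[R HR /hasP[y Hy /orP[He|He]]]].
    - move: (H1 _ (Hi _ Ha)); rewrite Forall_map_filter => /(_ A HA).
      by rewrite lam_a0 => /(_ HL); apply; rewrite inE.
    - have Hm : n.+2 < m by rewrite /m; clear; lia.
      move: (H2 _ (Hi _ Ha)); rewrite Forall_flatten => /(_ _ (Hi _ (num_lt Hy Hm))).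
      rewrite Forall_map_filter => /(_ R HR); rewrite lam_a0 lam_num // lvl_a0 lvl_num // He eqxx.
      by move=> /(_ isT); apply; rewrite inE eqxx.
    - have Hm : n < m by rewrite /m; clear; lia.
      move: (H2 _ (Hi _ (num_lt Hy Hm))); rewrite Forall_flatten => /(_ _ (Hi _ Ha)).
      rewrite Forall_map_filter => /(_ R HR); rewrite lam_a0 lam_num // lvl_a0 lvl_num // He eqxx.
      by move=> /(_ isT); apply; rewrite !inE eqxx orbT.
  have [f [Ef Hf]] := Hent labox labox_over C1 C2 q isT (qbody_over k _ _) [:: a0] erefl Ha0
    (fun I H1 H2 => let: ex_intro f (conj h1 h2) := qbody_sat k H1 (a0_certain H1 H2) in
       ex_intro _ f (conj (f_equal (fun v => [:: v]) h1) h2)) J1 J1_model J1_abox.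
  case: Ef => Ef; have := qbody_qsim DAS Hf; rewrite Ef.
  have Hd' : dom (lam a0).2 (D x0) by rewrite lam_a0.
  move=> Hq; refine (dom_qsim Hd' DAS (qsim_le _ Hq)); rewrite /k; clear; lia.
(* A type of [Z] is generated below [x0]: its tree query without answer variables separates the
   TBoxes. *)
- have /andP[_ HzAS] := reach_AS Hr.
  pose q := CQ [::] (qbody k z [::]).
  have [f [_ Hf]] : holds J1 q [::].
    apply: (Hent labox labox_over C1 C2 q isT (qbody_over k _ _) [::]) => //; last exact: J1_abox; last exact: J1_model.
    move=> I H1 H2; have [d Hd] := reach_sats H1 Hr (a0_certain H1 H2).
    by have [f [_ Hf]] := qbody_sat k H1 Hd; exists f.
  exact: avoid_qsim Hz (qbody_qsim HzAS Hf).
Qed.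
End Layered.

(** * From a counterexample to a failure *)

Section Complete.
Variables (A : abox) (I1 I2 : interp).
Hypotheses (HA : all (Defs.over (S1n, S1r)) A).
Hypotheses (HI1 : model_tbox I1 T1) (HA1 : model_abox I1 A).
Hypotheses (HI2 : model_tbox I2 T2) (HA2 : model_abox I2 A).

(* The greatest simulation of the types of T2 by the elements of I1. *)
Definition gsim (t : ctype) (d : idom I1) := exists Q : ctype -> idom I1 -> Prop, Q t d /\
  forall t d, Q t d -> nmatch t d /\
    forall R P, R \in S2r -> CEx R P \in t -> exists2 e, irol R d e & Q (ch2 t R P) e.

Lemma gsim_out t d : gsim t d -> nmatch t d /\
  forall R P, R \in S2r -> CEx R P \in t -> exists2 e, irol R d e & gsim (ch2 t R P) e.
Proof.
move=> [Q [HQ H]]; have [H1 H2] := H _ _ HQ; split=> // R P HR HP.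
by have [e He Hq] := H2 R P HR HP; exists e => //; exists Q.
Qed.

Definition reason (d : idom I1) (tc : ctype * concept) : Prop :=
  tc.2 \in tc.1 /\
  match tc.2 with
  | CName B => B \in S2n /\ ~ icon B d
  | CEx R P => R \in S2r /\ forall e, irol R d e -> ~ gsim (ch2 tc.1 R P) e
  | _ => False
  end.

(** Adding the single pair (t, d) to the greatest simulation gives a simulation again, as no member
    of t gives a reason against it. *)
Lemma gsim_in t d : (forall C, ~ reason d (t, C)) -> gsim t d.
Proof.
move=> H; exists (fun t' d' => gsim t' d' \/ (t' = t /\ d' = d)); split; first by right.
move=> t' d' [/gsim_out[H1 H2]|[-> ->]].
  by split=> // R P HR HP; have [e He Hs] := H2 R P HR HP; exists e => //; left.
split=> [B HB HBt|R P HR HP].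
  by apply: NNPP => HN; apply: (H (CName B)).
apply: NNPP => HN; apply: (H (CEx R P)); split=> //; split=> // e He Hs.
by apply: HN; exists e => //; left.
Qed.

(** The complement of [na] is closed under the conditions of a simulation, and [child_sats] realises
    its anonymous T1-successors in any model of T1. *)
Lemma na_gsim t s d : t \in AS -> s \in AS -> (t, s) \notin NA -> sats (I := I1) d s -> gsim t d.
Proof.
move=> Ht Hs Hn Hd.
exists (fun t d => exists2 s, [/\ t \in AS, s \in AS & (t, s) \notin NA] & sats d s); split; first by exists s.
move=> {t s d Ht Hs Hn Hd} t d [s [Ht Hs Hn] Hd].
have Hst : ~~ na_step U S2n S2r ch1 ch2 NA (t, s).
  by apply: contra Hn => H; apply: lfp_fix => //; exact: pair_AS.
split=> [B HB HBt|R P HR HP].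
  apply: (Hd (CName B)); apply/negPn/negP => HN; case/negP: Hst; apply/orP; left.
  by apply/hasP; exists B => //=; rewrite HBt HN.
have HPU : P \in U by have /andP[] := HU (allsub_sub Ht HP).
have : ~~ all (fun P1 => (CEx R P1 \in s) ==> ((ch2 t R P, ch1 s R P1) \in NA)) U.
  apply: contra Hst => H; apply/orP; right; apply/hasP; exists R => //; apply/hasP; exists P => //=.
  by rewrite HP.
case/allPn=> P1 HP1; rewrite negb_imply => /andP[HE HN].
have [e He Hse] := child_sats U Rs HI1 Hd HE; exists e => //.
by exists (ch1 s R P1) => //; split=> //; exact: child_AS.
Qed.

(** The state that the two models realise at an individual, with all true reasons. *)
Definition clam (a : nat) : state := ((type_of U (iind I1 a), type_of U (iind I2 a)),
  [seq tc <- [seq (t, C) | t <- AS, C <- U] | btrue (reason (iind I1 a) tc)]).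

Lemma domP a t : t \in AS -> dom (clam a).2 t <-> ~ gsim t (iind I1 a).
Proof.
move=> Ht; split=> [/hasP[[t' C]]|HN].
  rewrite mem_filter => /andP[/btrueP[/= HC Hr] _] /= /eqP E; subst t' => /gsim_out[H1 H2].
  case: C HC Hr => // [B HB [HBs Hn]|R P HP [HR Hn]]; first by apply: Hn; exact: H1.
  by have [e He Hs] := H2 R P HR HP; exact: Hn Hs.
have [C HC] : exists C, reason (iind I1 a) (t, C).
  by apply: NNPP => H; apply: HN; apply: gsim_in => C HC; apply: H; exists C.
apply/hasP; exists (t, C) => //; rewrite mem_filter; apply/andP; split; first by apply/btrueP.
apply/allpairsP; exists (t, C); split=> //=.
by apply: (allsub_sub Ht); case: HC.
Qed.

Lemma clam_states a : clam a \in states U.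
Proof.
apply/allpairsP; exists ((type_of U (iind I1 a), type_of U (iind I2 a)), (clam a).2).
by split=> //=; [apply: pair_AS; exact: allsub_filter|exact: allsub_filter].
Qed.

Lemma clam_ok a : okstate T1 T2 U Rs S2n S2r ch1 ch2 NA (clam a).
Proof.
apply/and3P; split; [exact: closed_type_of HI1 _|exact: closed_type_of HI2 _|].
apply/allP => -[t C]; rewrite mem_filter => /andP[/btrueP[/= HC Hr] /allpairsP[[t' C'] /= [Ht HCU [Et EC]]]].
subst t' C'; rewrite /claim /= HC /=.
case: C HC HCU Hr => // [B HB HBU [HBs Hn]|R P HP HPU [HR Hn]].
  apply/orP; left; apply/hasP; exists B => //; rewrite eqxx type_ofE HBU andbT /=.
  by apply/negP => /btrueP.
apply/orP; right; apply/hasP; exists R => //; apply/hasP; exists P; first by have /andP[] := HU HPU.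
rewrite eqxx /=; apply/allP => P1 HP1; apply/implyP => HE; apply/negPn/negP => HN.
have [e He Hs] := child_sats U Rs HI1 (@sats_type_of U I1 _) HE.
by apply: (Hn e He); apply: na_gsim HN Hs; exact: child_AS.
Qed.

Definition cZ := [seq z <- AS | btrue (forall d : idom I1, ~ gsim z d)].

Lemma clam_avoid a : avoid U NA R1 cZ (clam a).
Proof.
apply/allP => z; rewrite mem_filter => /andP[/btrueP Hz HzA]; apply/andP; split.
  by apply/domP => //; exact: Hz.
apply/allP => s Hs; apply/implyP => Hr; apply/negPn/negP => HN.
have [d Hd] := reach_sats HI1 Hr (@sats_type_of U I1 (iind I1 a)).
by apply: (Hz d); exact: na_gsim HN Hd.
Qed.

Notation V := [seq x <- states U | okstate T1 T2 U Rs S2n S2r ch1 ch2 NA x && avoid U NA R1 cZ x].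
Notation X := (dlfp U S1n S1r ch2 T2 Rs V).
Notation D := (dfacts U V X).

Lemma clamV a : clam a \in V.
Proof. by rewrite mem_filter clam_ok clam_avoid clam_states. Qed.

Definition aer R a b := List.In (AtR R a b) A.

Lemma in_over at_ : List.In at_ A -> Defs.over (S1n, S1r) at_.
Proof. by elim: A HA => //= b B IH /andP[Hb HB] [<-|/(IH HB)]. Qed.

Lemma aer_irol R a b : aer R a b -> irol R (iind I1 a) (iind I1 b) /\ irol R (iind I2 a) (iind I2 b).
Proof.
move=> H; have /List.Forall_forall/(_ _ H) := HA1.
by have /List.Forall_forall/(_ _ H) := HA2.
Qed.

Lemma aer_edge R a b : aer R a b -> edge U ch2 R (clam a) (clam b).
Proof.
move=> /aer_irol[H1 H2]; apply/and3P; split; [exact: compat_type_of|exact: compat_type_of|].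
apply/allP => -[t C]; rewrite mem_filter => /andP[/btrueP[/= HC Hr] _].
apply/allP => P HP; apply/implyP => /eqP /= EC; subst C.
by apply/domP; [exact: child_AS|apply: (proj2 Hr)].
Qed.

Lemma dlfp_fix x C : x \in V -> C \in U -> d_step U S1n S1r ch2 T2 Rs V X (x, C) -> C \in D x.
Proof.
move=> Hx HC Hst; rewrite mem_filter HC andbT; apply: lfp_fix => //.
by apply/allpairsP; exists (x, C).
Qed.

(** These facts may exceed what [A] entails, as they come from the largest ABox over [V]. They still
    give a model of T2 and [A], and the entailed query can be evaluated there. *)
Let rho a := D (clam a).
Notation JA := (canon T2 U Rs rho aer).
Notation pty := (ptype T2 U Rs rho).

Lemma rho_sub a : {subset rho a <= U}.
Proof. by move=> C; rewrite mem_filter => /andP[]. Qed.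

Lemma cZ_sub : {subset cZ <= AS}.
Proof. by move=> z; rewrite mem_filter => /andP[]. Qed.

(** Freedom from clashes is borrowed from the layered ABox built over the same set of states. *)
Lemma rho_closed a : closed_type T2 U Rs (rho a).
Proof.
apply/andP; split; last exact: (dfacts_noclash (clamV a)).
apply/allP => C HC; apply/implyP => H; apply: dlfp_fix; [exact: clamV|by []|].
by apply/or3P; apply: Or32.
Qed.

Lemma rho_compat R a b : aer R a b -> compat U R (rho a) (rho b).
Proof.
move=> Hab; have HR : R \in S1r by exact: (in_over Hab).
apply/allP => E HE; apply/andP; split; apply/implyP.
  rewrite mem_filter => /andP[HX _]; apply: dlfp_fix; [exact: clamV|by []|].
  apply/or3P; apply: Or33; apply/hasP; exists R => //; apply/hasP; exists (clam a); first exact: clamV.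
  by apply/orP; right; rewrite (aer_edge Hab) HX.
move=> /andP[]; rewrite mem_filter => /andP[HX _] HEU; apply: dlfp_fix; [exact: clamV|by []|].
apply/or3P; apply: Or33; apply/hasP; exists R => //; apply/hasP; exists (clam b); first exact: clamV.
apply/orP; left; rewrite (aer_edge Hab) /=; apply/hasP; exists E => //.
by rewrite eqxx HX.
Qed.

Lemma labelled_clam B a : List.In (AtC B a) A -> labelled (clam a) B.
Proof.
move=> H; have HB : CName B \in U by apply: HS1; exact: (in_over H).
have /List.Forall_forall/(_ _ H) /= h1 := HA1; have /List.Forall_forall/(_ _ H) /= h2 := HA2.
by rewrite /labelled !type_ofE HB !andbT; apply/andP; split; apply/btrueP.
Qed.

Lemma JA_model : model_tbox JA T2.
Proof. by apply: canon_model => //; [exact: rho_sub|exact: rho_closed|exact: rho_compat]. Qed.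

Lemma JA_abox : model_abox JA A.
Proof.
apply/List.Forall_forall => -[B a|R a b] H /=; last by left.
have HB : B \in S1n by exact: (in_over H).
apply: dlfp_fix; [exact: clamV|exact: HS1|].
apply/or3P; apply: Or31; apply/hasP; exists B => //=.
by rewrite eqxx labelled_clam.
Qed.

Hypothesis nofail : ~~ fail U S1n S1r ch2 R2 cZ V X.

Lemma touched_clam a : a \in inds A -> touched U S1n S1r ch2 V (clam a).
Proof.
move/indsP=> [[B b|R b c] H]; rewrite !inE; last first.
  have HR : R \in S1r by exact: (in_over H).
  move=> Hor; apply/orP; right; apply/hasP; exists R => //; apply/hasP.
  case/orP: Hor => /eqP E; subst a.
    by exists (clam c); [exact: clamV|rewrite (aer_edge H)].
  by exists (clam b); [exact: clamV|rewrite (aer_edge H) orbT].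
move=> /eqP E; subst a; apply/orP; left; apply/hasP; exists B; first exact: (in_over H).
exact: labelled_clam.
Qed.

Lemma rho_gsim a : a \in inds A -> gsim (rho a) (iind I1 a).
Proof.
move=> Ha; apply: NNPP => HN; case/negP: nofail; apply/hasP; exists (clam a); first exact: clamV.
apply/orP; left; rewrite touched_clam //=.
by apply/domP => //; exact: allsub_filter.
Qed.

Lemma pty_reach a p : (rho a, pty a p) \in R2.
Proof.
elim: p => [|[R P] p IH] /=; first by apply: reach_refl; exact: allsub_filter.
by case: ifP => // H; exact: reach_step_r.
Qed.

Lemma pty_gsim a p : exists d, gsim (pty a p) d.
Proof.
apply: NNPP => HN; case/negP: nofail; apply/hasP; exists (clam a); first exact: clamV.
apply/orP; right; apply/hasP; exists (pty a p); last exact: pty_reach.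
have /andP[_ HS] := reach_AS (pty_reach a p).
rewrite mem_filter HS andbT; apply/btrueP => d Hd; apply: HN; by exists d.
Qed.

(** Along a role of Sigma2 the image must be a successor of the previous image. Below a role outside
    Sigma2, and for individuals that do not occur in [A], any element simulating the type will do;
    the choice of [cZ] guarantees that one exists. *)
Fixpoint hmap a (p : seq (name * concept)) : idom I1 :=
  match p with
  | [::] => if a \in inds A then iind I1 a else epsilon (inhabits (iind I1 0)) (gsim (rho a))
  | (R, P) :: p' =>
      if (CEx R P \in pty a p') && (R \in S2r)
      then epsilon (inhabits (iind I1 0)) (fun e => irol R (hmap a p') e /\ gsim (pty a p) e)
      else epsilon (inhabits (iind I1 0)) (gsim (pty a p))
  end.

Lemma hmap_gsim a p : gsim (pty a p) (hmap a p) /\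
  (if p is (R, P) :: p' then CEx R P \in pty a p' -> R \in S2r -> irol R (hmap a p') (hmap a p) else True).
Proof.
elim: p => [|[R P] p [IH _]].
  split=> //=; case: ifP => Ha; first exact: rho_gsim.
  by apply: epsilon_spec; exact: (pty_gsim a [::]).
rewrite [hmap a (_ :: _)]/=; case: ifP => [/andP[HE HR]|HN].
  have [e He Hg] := (proj2 (gsim_out IH)) R P HR HE.
  have Hg' : gsim (pty a ((R, P) :: p)) e by rewrite /= HE.
  have [H1 H2] := epsilon_spec (inhabits (iind I1 0))
    (fun e => irol R (hmap a p) e /\ gsim (pty a ((R, P) :: p)) e) (ex_intro _ e (conj He Hg')).
  by split.
split; last by move=> HE HR; rewrite HE HR in HN.
by apply: epsilon_spec; exact: (pty_gsim a ((R, P) :: p)).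
Qed.

Lemma complete_holds q a : all (Defs.over (S2n, S2r)) (body q) -> {subset a <= inds A} ->
  holds JA q a -> holds I1 q a.
Proof.
move=> Hover Ha [f [Hans Hbody]].
pose g v := hmap (f v).1 (f v).2; exists g; split.
  have -> : map g (ans q) = map (fun d : cdom => hmap d.1 d.2) (map f (ans q)) by rewrite -map_comp.
  rewrite Hans -map_comp; apply/eq_in_map => b /Ha /= Hb.
  by rewrite Hb.
apply/List.Forall_forall => at_ Hat; have /List.Forall_forall/(_ _ Hat) := Hbody.
have : Defs.over (S2n, S2r) at_.
  by elim: (body q) Hover Hat => //= b B IH /andP[Hb HB] [<-|/(IH HB)].
case: at_ {Hat} => [B v|R v w] /= Hs; rewrite /g.
  by have [/gsim_out[H _] _] := hmap_gsim (f v).1 (f v).2; exact: H.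
case: (f v) (f w) => [b p] [c p'] /= [[-> [-> Hbc]]|[-> [P -> HP]]].
  have [H1 H2] : b \in inds A /\ c \in inds A.
    by split; apply/indsP; exists (AtR R b c) => //; rewrite !inE eqxx ?orbT.
  by rewrite /= H1 H2; exact: (proj1 (aer_irol Hbc)).
by have [_ H] := hmap_gsim b ((R, P) :: p); exact: H.
Qed.
End Complete.

Theorem nonentP : nonent T1 T2 U Rs S1n S1r S2n S2r <-> ~ cq_entails ((S1n, S1r), (S2n, S2r)) T1 T2.
Proof.
split=> [/hasP[Z HZ /hasP[x Hx Hf]]|HN].
  exact: (layered_nonent (allsub_sub HZ) Hx Hf).
apply/negPn/negP => Hno; apply: HN => A HA [J [HJ HJA]] [I2 [HI2 HA2]] q Hu Hq a Hsz Ha Hcert I1 HI1 HA1.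
have Hnf : ~~ fail U S1n S1r ch2 R2 (cZ I1) [seq x <- states U | okstate T1 T2 U Rs S2n S2r ch1 ch2 NA x && avoid U NA R1 (cZ I1) x]
    (dlfp U S1n S1r ch2 T2 Rs [seq x <- states U | okstate T1 T2 U Rs S2n S2r ch1 ch2 NA x && avoid U NA R1 (cZ I1) x]).
  by apply: contra Hno => H; apply/hasP; exists (cZ I1) => //; exact: allsub_filter.
apply: (complete_holds HA HI1 HA1 HI2 HA2 Hnf Hq Ha).
apply: Hcert; first exact: JA_model HA HI1 HA1 HI2 HA2.
exact: JA_abox HA HI1 HA1 HI2 HA2.
Qed.

End Correct.

(** * The procedure is polynomial in its tables *)

#[export] Instance code_name : code name := code_seq.

Fixpoint ctree (C : concept) : tree :=
  match C with
  | CName A => Node (num 0) (enc A)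
  | CTop => Node (num 1) Leaf
  | CNot D => Node (num 2) (ctree D)
  | CAnd D E => Node (num 3) (Node (ctree D) (ctree E))
  | CEx R D => Node (num 4) (Node (enc R) (ctree D))
  end.
Lemma ctree_inj : injective ctree.
Proof.
elim=> [A||C IH|C IHC D IHD|R C IH] [B||C'|C' D'|R' C'] //=.
- by case=> E; congr CName; apply: (@enc_inj name code_name).
- by case=> /IH->.
- by case=> /IHC-> /IHD->.
- by case=> E /IH->; congr CEx; apply: (@enc_inj name code_name).
Qed.
#[export] Instance code_concept : code concept := Code ctree_inj.

#[export] Instance code_token : code token := fin_code token.

Section Constructors.
Context {X : Type} {cX : code X}.

Lemma pf_tag (k : nat) Y Z {cY : code Y} {cZ : code Z} (g : Y -> Z) (f : X -> Y) :
  (forall y, enc (g y) = Node (num k) (enc y)) -> pf f -> pf (fun x => g (f x)).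
Proof.
move=> E Hf; apply: pf_comp Hf.
apply: (pf_tree (g := fun t => Node (num k) t)); last by move=> y; rewrite E.
by apply: polyf_node; [exact: polyf_const|exact: pf_id].
Qed.

Lemma pf_CName (f : X -> name) : pf f -> pf (fun x => CName (f x)).
Proof. exact: (pf_tag (k := 0)). Qed.
Lemma pf_CNot (f : X -> concept) : pf f -> pf (fun x => CNot (f x)).
Proof. exact: (pf_tag (k := 2)). Qed.
Lemma pf_CAnd (f g : X -> concept) : pf f -> pf g -> pf (fun x => CAnd (f x) (g x)).
Proof. by move=> Hf Hg; apply: (pf_tag (k := 3) (g := fun p => CAnd p.1 p.2)) (pf_pair Hf Hg). Qed.
Lemma pf_CEx (f : X -> name) (g : X -> concept) : pf f -> pf g -> pf (fun x => CEx (f x) (g x)).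
Proof. by move=> Hf Hg; apply: (pf_tag (k := 4) (g := fun p => CEx p.1 p.2)) (pf_pair Hf Hg). Qed.
Lemma pf_CAll (f : X -> name) (g : X -> concept) : pf f -> pf g -> pf (fun x => CAll (f x) (g x)).
Proof. by move=> Hf Hg; apply: pf_CNot; apply: pf_CEx => //; apply: pf_CNot. Qed.

Lemma pf_rcons Y {cY : code Y} (f : X -> seq Y) (g : X -> Y) : pf f -> pf g -> pf (fun x => rcons (f x) (g x)).
Proof.
move=> Hf Hg; apply: (pf_ext (f := fun x => f x ++ [:: g x])); first by move=> x; rewrite cats1.
by apply: pf_cat => //; apply: pf_cons => //; exact: pf_const.
Qed.

Lemma pf_head Y {cY : code Y} (y0 : Y) (f : X -> seq Y) : pf f -> pf (fun x => head y0 (f x)).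
Proof.
move=> Hf; apply: (pf_ext (f := fun x => if ohead (f x) is Some y then y else y0)).
  by move=> x; case: (f x).
by apply: (pf_ocase (f := fun _ y => y)); [exact: pf_ohead|exact: pf_snd pf_id|exact: pf_const].
Qed.

Lemma pf_allpairs Y Z W {cY : code Y} {cZ : code Z} {cW : code W}
    (h : X -> Y -> Z -> W) (f : X -> seq Y) (g : X -> seq Z) :
  pf (fun p : X * Y * Z => h p.1.1 p.1.2 p.2) -> pf f -> pf g ->
  pf (fun x => [seq h x y z | y <- f x, z <- g x]).
Proof.
move=> Hh Hf Hg; apply: pf_flatten; apply: pf_map => //; apply: (pf_map (F := fun p z => h p.1 p.2 z)) => //.
by apply: (pf_comp Hg); exact: pf_fst pf_id.
Qed.

Lemma pf_app4 A B C D E {cA : code A} {cB : code B} {cC : code C} {cD : code D} {cE : code E}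
    (F : A -> B -> C -> D -> E) (f : X -> A) (g : X -> B) (h : X -> C) (k : X -> D) :
  pf (fun p : A * B * C * D => F p.1.1.1 p.1.1.2 p.1.2 p.2) -> pf f -> pf g -> pf h -> pf k ->
  pf (fun x => F (f x) (g x) (h x) (k x)).
Proof. by move=> HF Hf Hg Hh Hk; exact: pf_comp HF (pf_pair (pf_pair (pf_pair Hf Hg) Hh) Hk). Qed.
End Constructors.

Ltac pfs := repeat first
  [ exact: pf_id | exact: pf_const | assumption
  | apply: pf_fst | apply: pf_snd | apply: pf_pair
  | apply: pf_CName | apply: pf_CNot | apply: pf_CAnd | apply: pf_CEx | apply: pf_CAll
  | apply: pf_and | apply: pf_or | apply: pf_not | apply: pf_imp | apply: pf_eq | apply: pf_mem
  | apply: pf_has | apply: pf_all | apply: pf_filter | apply: pf_allpairs | apply: pf_map | apply: pf_rcons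
  | apply: pf_cons | apply: pf_cat | apply: pf_flatten | apply: pf_behead | apply: pf_if
  | match goal with
    | H : pf (fun p => ?F p.1.1.1 p.1.1.2 p.1.2 p.2) |- _ => apply: (pf_app4 (F := F) H)
    | H : pf (fun p => ?F p.1.1 p.1.2 p.2) |- _ => apply: (pf_app3 (F := F) H)
    | H : pf (fun p => ?F p.1 p.2) |- _ => apply: (pf_app2 (F := F) H)
    | H : pf ?f |- _ => apply: (pf_comp (g := f) H)
    end ].

Section PfAlg.
Context {X : Type} {cX : code X}.

Lemma pf_look (K : X -> seq (ctype * concept)) (U s : X -> ctype) :
  pf K -> pf U -> pf s -> pf (fun x => look (K x) (U x) (s x)).
Proof. by move=> HK HU Hs; rewrite /look; pfs. Qed.

Lemma pf_seed (U t : X -> ctype) R P : pf U -> pf t -> pf R -> pf P ->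
  pf (fun x => seed (U x) (t x) (R x) (P x)).
Proof. by move=> HU Ht HR HP; rewrite /seed; pfs. Qed.

Lemma pf_clash (t : X -> ctype) : pf t -> pf (fun x => clash (t x)).
Proof. by move=> Ht; rewrite /clash; pfs. Qed.

Lemma pf_rule (T : X -> tbox) (U : X -> ctype) (Rs : X -> seq name) (t : X -> ctype)
    (ch : X -> name -> concept -> ctype) (C : X -> concept) :
  pf T -> pf U -> pf Rs -> pf t -> pf (fun p : X * name * concept => ch p.1.1 p.1.2 p.2) -> pf C ->
  pf (fun x => rule (T x) (U x) (Rs x) (t x) (ch x) (C x)).
Proof.
by move=> HT HU HR Ht Hch HC; rewrite /rule /clash; pfs.
Qed.

End PfAlg.

Section PfClos.
Context {X : Type} {cX : code X}.

(** The variants with suffix [_in] receive the power sets as arguments, so that everything except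
    building those sets is polynomial in the size of the arguments. *)
Definition clos_in (AS : seq ctype) (T : tbox) (U : ctype) (Rs : seq name) : seq (ctype * concept) :=
  lfp [seq (S0, C) | S0 <- AS, C <- U] (fun X sc => (sc.2 \in sc.1) ||
    rule T U Rs (look X U sc.1) (fun R P => look X U (seed U (look X U sc.1) R P)) sc.2).

Lemma pf_clos_in (AS : X -> seq ctype) (T : X -> tbox) (U : X -> ctype) (Rs : X -> seq name) :
  pf AS -> pf T -> pf U -> pf Rs -> pf (fun x => clos_in (AS x) (T x) (U x) (Rs x)).
Proof.
move=> HA HT HU HR; apply: pf_lfp; last by pfs.
apply: pf_or; first by pfs.
by apply: pf_rule; pfs; apply: pf_look; pfs.
Qed.
End PfClos.

Section PfAlg2.
Context {X : Type} {cX : code X}.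
Variables (U : X -> ctype) (AS : X -> seq ctype) (Rs S1n S1r S2n S2r : X -> seq name).
Variables (T1 T2 : X -> tbox) (ch1 ch2 : X -> ctype -> name -> concept -> ctype).
Hypotheses (HU : pf U) (HAS : pf AS) (HRs : pf Rs) (HS1n : pf S1n) (HS1r : pf S1r) (HS2n : pf S2n) (HS2r : pf S2r).
Hypotheses (HT1 : pf T1) (HT2 : pf T2).
Hypotheses (Hch1 : pf (fun p : X * ctype * name * concept => ch1 p.1.1.1 p.1.1.2 p.1.2 p.2))
  (Hch2 : pf (fun p : X * ctype * name * concept => ch2 p.1.1.1 p.1.1.2 p.1.2 p.2)).

Definition na_in (x : X) := lfp [seq (t, s) | t <- AS x, s <- AS x]
  (na_step (U x) (S2n x) (S2r x) (ch1 x) (ch2 x)).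
Lemma pf_na : pf na_in.
Proof. by apply: pf_lfp; rewrite /na_step; pfs. Qed.

Definition reach_in (ch : X -> ctype -> name -> concept -> ctype) x := lfp [seq (t, s) | t <- AS x, s <- AS x]
  (reach_step (U x) (Rs x) (ch x)).
Lemma pf_reach1 : pf (reach_in ch1).
Proof. by apply: pf_lfp; rewrite /reach_step; pfs. Qed.
Lemma pf_reach2 : pf (reach_in ch2).
Proof. by apply: pf_lfp; rewrite /reach_step; pfs. Qed.

Lemma pf_dom Y {cY : code Y} (N : Y -> seq (ctype * concept)) t : pf N -> pf t -> pf (fun y => dom (N y) (t y)).
Proof. by move=> HN Ht; rewrite /dom; pfs. Qed.

Definition claim_in (p : X * state) tc := claim (U p.1) (S2n p.1) (S2r p.1) (ch1 p.1) (ch2 p.1) (na_in p.1) p.2.1.1 tc.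
Lemma pf_claim : pf (fun p : X * state * (ctype * concept) => claim_in p.1 p.2).
Proof. by have Hna := pf_na; rewrite /claim_in /claim; pfs. Qed.

Lemma pf_compat Y {cY : code Y} (V : Y -> ctype) R t s : pf V -> pf R -> pf t -> pf s ->
  pf (fun y => compat (V y) (R y) (t y) (s y)).
Proof. by move=> H1 H2 H3 H4; rewrite /compat; pfs. Qed.

Definition edge_in (x : X) (R : name) (y z : state) := edge (U x) (ch2 x) R y z.
Lemma pf_edge : pf (fun p : X * name * state * state => edge_in p.1.1.1 p.1.1.2 p.1.2 p.2).
Proof.
rewrite /edge_in /edge; do 2![apply: pf_and; first by apply: pf_compat; pfs].
apply: pf_all; last by pfs.
by apply: pf_all; [apply: pf_imp; [pfs|apply: pf_dom; pfs]|pfs].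
Qed.

Definition avoid_in (x : X) (Z : seq ctype) (y : state) := all (fun z => dom y.2 z && all (fun s =>
  ((y.1.1, s) \in reach_in ch1 x) ==> ((z, s) \in na_in x)) (AS x)) Z.
Lemma pf_avoid : pf (fun p : X * seq ctype * state => avoid_in p.1.1 p.1.2 p.2).
Proof.
have H1 := pf_na; have H2 := pf_reach1; rewrite /avoid_in.
by apply: pf_all; last pfs; apply: pf_and; [apply: pf_dom; pfs|pfs].
Qed.

Lemma pf_closed_with (T : X -> tbox) (ch : X -> ctype -> name -> concept -> ctype) : pf T ->
  pf (fun p : X * ctype * name * concept => ch p.1.1.1 p.1.1.2 p.1.2 p.2) ->
  pf (fun p : X * ctype => closed_with (T p.1) (U p.1) (Rs p.1) (ch p.1) p.2).
Proof.
move=> HT Hch; rewrite /closed_with; apply: pf_and; last by apply: pf_not; apply: pf_clash; pfs.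
by apply: pf_all; last pfs; apply: pf_imp; last pfs; apply: pf_rule; pfs.
Qed.

Definition ok_in (x : X) (y : state) := okstate (T1 x) (T2 x) (U x) (Rs x) (S2n x) (S2r x) (ch1 x) (ch2 x) (na_in x) y.
Lemma pf_ok : pf (fun p : X * state => ok_in p.1 p.2).
Proof.
have H1 := pf_closed_with HT1 Hch1; have H2 := pf_closed_with HT2 Hch2; have H3 := pf_claim.
have F : pf (fun p : X * state => (p.1, p.2.1.1)) by pfs.
have G : pf (fun p : X * state => (p.1, p.2.1.2)) by pfs.
apply: pf_and; first exact: pf_comp H1 F.
apply: pf_and; first exact: pf_comp H2 G.
by apply: pf_all; [exact: H3|pfs].
Qed.

Definition dfacts_in (x : X) (F : seq (state * concept)) (y : state) := [seq C <- U x | (y, C) \in F].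
Lemma pf_dfacts : pf (fun p : X * seq (state * concept) * state => dfacts_in p.1.1 p.1.2 p.2).
Proof. by rewrite /dfacts_in; pfs. Qed.

Lemma pf_dstep : pf (fun p : X * seq state * seq (state * concept) * (state * concept) =>
  d_step (U p.1.1.1) (S1n p.1.1.1) (S1r p.1.1.1) (ch2 p.1.1.1) (T2 p.1.1.1) (Rs p.1.1.1) p.1.1.2 p.1.2 p.2).
Proof.
have H1 := pf_dfacts; have H2 := pf_edge.
apply: pf_or; first by rewrite /labelled; pfs.
apply: pf_or; first by apply: pf_rule; rewrite /dfacts; pfs.
apply: pf_has; last by pfs.
apply: pf_has; last by pfs.
by apply: pf_or; (apply: pf_and; first by apply: (pf_app4 H2); pfs); pfs.
Qed.

Definition dlfp_in (x : X) (V : seq state) := lfp [seq (y, C) | y <- V, C <- U x]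
  (d_step (U x) (S1n x) (S1r x) (ch2 x) (T2 x) (Rs x) V).
Lemma pf_dlfp : pf (fun p : X * seq state => dlfp_in p.1 p.2).
Proof.
have H := pf_dstep; apply: pf_lfp; last by pfs.
by apply: (pf_app4 (F := fun x V F u => d_step (U x) (S1n x) (S1r x) (ch2 x) (T2 x) (Rs x) V F u) H); pfs.
Qed.

Definition fail_in (x : X) (Z : seq ctype) (V : seq state) := fail (U x) (S1n x) (S1r x) (ch2 x) (reach_in ch2 x) Z V (dlfp_in x V).
Lemma pf_fail : pf (fun p : X * seq ctype * seq state => fail_in p.1.1 p.1.2 p.2).
Proof.
have H1 := pf_dfacts; have H2 := pf_edge; have H3 := pf_reach2; have H4 := pf_dlfp.
rewrite /fail_in /fail; apply: pf_has; last by pfs.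
apply: pf_or; last by rewrite /dfacts; pfs.
apply: pf_and; last by apply: pf_dom; rewrite /dfacts; pfs.
rewrite /touched; apply: pf_or; first by rewrite /labelled; pfs.
apply: pf_has; last by pfs.
apply: pf_has; last by pfs.
by apply: pf_or; apply: (pf_app4 H2); pfs.
Qed.

Variables (PS : X -> seq (seq (ctype * concept))) (CS : X -> seq (seq ctype)).
Hypotheses (HPS : pf PS) (HCS : pf CS).

Definition states_in (x : X) : seq state :=
  [seq (ts, N) | ts <- [seq (t, s) | t <- AS x, s <- AS x], N <- PS x].

Definition nonent_in (x : X) := has (fun Z =>
  let V := [seq y <- states_in x | ok_in x y && avoid_in x Z y] in fail_in x Z V) (CS x).
Lemma pf_nonent : pf nonent_in.
Proof.
have H1 := pf_ok; have H2 := pf_avoid; have H3 := pf_fail.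
apply: pf_has => //; apply: (pf_app3 H3); try by pfs.
apply: pf_filter; last by rewrite /states_in; pfs.
by apply: pf_and; [apply: (pf_app2 H1)|apply: (pf_app3 H2)]; pfs.
Qed.
End PfAlg2.

Lemma nonent_inE X (U : X -> ctype) (Rs S1n S1r S2n S2r : X -> seq name) (T1 T2 : X -> tbox) x :
  nonent (T1 x) (T2 x) (U x) (Rs x) (S1n x) (S1r x) (S2n x) (S2r x) =
  nonent_in U (fun x => allsub (U x)) Rs S1n S1r S2n S2r T1 T2
    (fun x t R P => look (clos_in (allsub (U x)) (T1 x) (U x) (Rs x)) (U x) (seed (U x) t R P))
    (fun x t R P => look (clos_in (allsub (U x)) (T2 x) (U x) (Rs x)) (U x) (seed (U x) t R P))
    (fun x => allsub [seq (t, C) | t <- allsub (U x), C <- U x]) (fun x => allsub (allsub (U x))) x.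
Proof. by []. Qed.

Lemma pf_fincase X (T : finType) Y {cX : code X} {cY : code Y} (F : T -> X -> Y) :
  (forall t, pf (F t)) -> @pf (X * T) Y (@code_prod X T cX (fin_code T)) cY (fun p => F p.2 p.1).
Proof.
pose cT := fin_code T; move=> H.
have K (l : seq T) : l != [::] -> exists2 G : X * T -> Y, pf G & forall p, p.2 \in l -> G p = F p.2 p.1.
  elim: l => // a [|b l] IH _.
    by exists (fun p => F a p.1) => [|p]; [exact: pf_comp (H a) (pf_fst pf_id)|rewrite inE => /eqP->].
  have [G HG E] := IH isT.
  exists (fun p => if p.2 == a then F a p.1 else G p).
    apply: pf_if => //; last exact: pf_comp (H a) (pf_fst pf_id).
    by apply: pf_eq; [exact: pf_snd pf_id|exact: pf_const].
  by move=> p; rewrite inE; case: eqP => [->|_] //= /E.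
case E : (enum T) => [|a l].
  exists skip, (fun _ => 0); split; first exact: pb_const.
  by move=> [x t]; have := mem_enum T t; rewrite E.
have [//|G HG HE] := K (a :: l); apply: (pf_ext (f := G)) => // p.
by rewrite HE // -E mem_enum.
Qed.

(** * Parsing instances *)

Definition cname (C : concept) : name := if C is CName A then A else [::].

Lemma pf_cname X {cX : code X} (f : X -> concept) : pf f -> pf (fun x => cname (f x)).
Proof.
move=> Hf; apply: (pf_comp (g := cname)) Hf.
apply: (pf_tree (g := fun t => if isnode (tfst t) then Leaf else tsnd t)).
  by apply: pf_if; [exact: pf_comp pf_isnode polyf_fst|exact: polyf_const|exact: polyf_snd].
by case.
Qed.

Definition isname (C : concept) : bool := C == CName (cname C).

(** Success flag, stack of groups of concepts, and all concepts formed so far. *)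
Notation pstate := (bool * seq ctype * ctype)%type.

Definition push (s : pstate) (b : bool) (n : nat) (C : concept) : pstate :=
  (s.1.1 && b, (C :: iter n behead (head [::] s.1.2)) :: behead s.1.2, C :: s.2).

(** Words are read from the right, so that prefix notation becomes a stack discipline: the operands
    are on the current group when the operator arrives. [KEnd] opens a group, and a name grows from
    its separator bit by bit. *)
Definition pstep (k : token) (s : pstate) : pstate :=
  let g := head [::] s.1.2 in
  let C := head CTop g in
  let D := head CTop (behead g) in
  match k with
  | KEnd => (s.1.1, [::] :: s.1.2, s.2)
  | KSep => push s (s.1.2 != [::]) 0 (CName [::])
  | KBit b => push s (isname C) 1 (CName (b :: cname C))
  | KTop => push s (s.1.2 != [::]) 0 CTop
  | KNot => push s (g != [::]) 1 (CNot C)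
  | KAnd => push s (behead g != [::]) 2 (CAnd C D)
  | KEx => push s ((behead g != [::]) && isname C) 2 (CEx (cname C) D)
  end.

Definition parse (w : seq token) : pstate := foldr pstep (true, [::], [::]) w.

Definition enc_group (g : ctype) : seq token := rcons (flatten (map enc_concept g)) KEnd.
Definition enc_groups (gs : seq ctype) : seq token := flatten (map enc_group gs).

Lemma parse_cat w w' : parse (w ++ w') = foldr pstep (parse w') w.
Proof. exact: foldr_cat. Qed.

Definition parsed (gs : seq ctype) (s : pstate) := s.1.1 /\ s.1.2 = gs.

Lemma parsed_name A g gs s : parsed (g :: gs) s -> parsed ((CName A :: g) :: gs) (foldr pstep s (enc_name A)).
Proof.
move=> [H1 H2]; rewrite /enc_name; elim: A => [|b A [IH1 IH2]] /=; split=> //=.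
- by rewrite H1 H2.
- by rewrite /push /= H2.
- by rewrite IH1 IH2 /= /isname eqxx.
- by rewrite /push /= IH2.
Qed.

Lemma parsed_concept C g gs s : parsed (g :: gs) s -> parsed ((C :: g) :: gs) (foldr pstep s (enc_concept C)).
Proof.
elim: C g gs s => [A||C IH|C IHC D IHD|R C IH] g gs s Hs /=.
- exact: parsed_name.
- by case: Hs => [H1 H2]; split; rewrite /= ?H1 ?H2.
- by have [H1 H2] := IH _ _ _ Hs; split; rewrite /= ?H1 ?H2.
- rewrite foldr_cat; have [H1 H2] := IHC _ _ _ (IHD _ _ _ Hs).
  by split; rewrite /= ?H1 ?H2.
- rewrite foldr_cat; have [H1 H2] := parsed_name R (IH _ _ _ Hs).
  by split; rewrite /= ?H1 ?H2 //= /isname eqxx.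
Qed.

Lemma parsed_groups gs : parsed gs (parse (enc_groups gs)).
Proof.
elim: gs => // g gs IH; rewrite /enc_groups /= /enc_group -cats1 -catA parse_cat.
move: IH => /=; rewrite -/(enc_groups gs); move: (parse _) => s [H1 H2].
elim: g => [|C g IH] /=; first by split; rewrite /= ?H1 ?H2.
by rewrite foldr_cat; exact: parsed_concept.
Qed.

Lemma enc_group_cons C g gs : enc_groups ((C :: g) :: gs) = enc_concept C ++ enc_groups (g :: gs).
Proof. by rewrite /enc_groups /= /enc_group -!cats1 /= -!catA. Qed.

Lemma isnameP C : isname C -> C = CName (cname C). Proof. by move/eqP. Qed.

(** The flag records every missing operand or group, so an accepted word can be rebuilt token by
    token. *)
Lemma parse_enc w : (parse w).1.1 -> w = enc_groups (parse w).1.2.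
Proof.
elim: w => // k w IH; rewrite [parse _]/= -/(parse w).
case: (parse w) IH => [[ok gs] U] /= IH.
case: k => [b||||||] /=.
- case/andP=> /IH-> /isnameP; case: gs {IH} => [|[|C g] gs] //= -> /=.
  by rewrite !enc_group_cons.
- by case/andP=> /IH->; case: gs {IH} => // g gs _; rewrite enc_group_cons.
- by case/andP=> /IH->; case: gs {IH} => // g gs _; rewrite enc_group_cons.
- by case/andP=> /IH->; case: gs {IH} => [|[|C g] gs] // _; rewrite !enc_group_cons.
- by case/andP=> /IH->; case: gs {IH} => [|[|C [|D g]] gs] // _; rewrite /= !enc_group_cons /= -!catA.
- case/andP=> /IH->; case: gs {IH} => [|[|C [|D g]] gs] //= /isnameP->.
  by rewrite !enc_group_cons /= -!catA.
- by move=> /IH->.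
Qed.

Definition pok1 (U : ctype) (Rs : seq name) (C : concept) :=
  match C with
  | CNot D => D \in U
  | CAnd D E => (D \in U) && (E \in U)
  | CEx R D => (R \in Rs) && (D \in U)
  | _ => true
  end.
Definition pok (U : ctype) (Rs : seq name) := forall C, C \in U -> pok1 U Rs C.

(** Operands are always concepts formed earlier, so the list of formed concepts is closed under
    subconcepts and can serve as the universe of types. *)
Lemma parse_sub w : (parse w).1.1 -> pok (parse w).2 (map cname (parse w).2) /\
  forall g C, g \in (parse w).1.2 -> C \in g -> C \in (parse w).2.
Proof.
elim: w => // k w IH; rewrite [parse _]/= -/(parse w).
case: (parse w) IH => [[ok gs] U] /= IH.
have mono1 C D : pok1 U (map cname U) D -> pok1 (C :: U) (map cname (C :: U)) D.
  case: D => //= [D|D E|R D]; rewrite ?inE; first by move=> ->; rewrite orbT.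
  - by case/andP=> -> ->; rewrite !orbT.
  - by case/andP=> -> ->; rewrite !orbT.
have mono C : pok U (map cname U) -> pok1 U (map cname U) C -> pok (C :: U) (map cname (C :: U)).
  by move=> H HC D; rewrite inE => /orP[/eqP->|/H]; exact: mono1.
have pushP n (b : bool) C : (pok U (map cname U) /\ (forall g C, g \in gs -> C \in g -> C \in U) ->
   b -> pok1 U (map cname U) C) -> (push (ok, gs, U) b n C).1.1 ->
   pok (push (ok, gs, U) b n C).2 (map cname (push (ok, gs, U) b n C).2) /\
    forall g D, g \in (push (ok, gs, U) b n C).1.2 -> D \in g -> D \in (push (ok, gs, U) b n C).2.
  move=> H /=; case/andP=> /IH[H1 H2] /H{}H; split; first by apply: mono => //; exact: H.
  move=> g D; rewrite !inE => /orP[/eqP->|].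
    rewrite inE => /orP[->//|HD]; apply/orP; right.
    have sub : {subset iter n behead (head [::] gs) <= head [::] gs}.
      elim: (n) => //= m IHm E; case: (iter m _ _) IHm => //= a l IHm HE.
      by apply: IHm; rewrite inE HE orbT.
    move: HD => /sub; case: (gs) H2 => //= g0 gs' H2.
    by apply: H2; exact: mem_head.
  by move=> Hg HD; rewrite (H2 g D) ?orbT //; case: (gs) Hg => //= a l; rewrite inE => ->; rewrite orbT.
case: k => [b||||||]; last first.
  by move=> /IH[H1 H2]; split=> // g C; rewrite inE => /orP[/eqP->//|]; exact: H2.
all: rewrite /pstep; apply: pushP => -[_ H] //=.
- case: (gs) H => [|[|C [|D g]] gs'] //= H _.
  apply/andP; split; last by apply: (H [:: C, D & g]); rewrite !inE eqxx ?orbT.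
  by apply: map_f; apply: (H [:: C, D & g]); rewrite !inE eqxx ?orbT.
- case: (gs) H => [|[|C [|D g]] gs'] //= H _.
  by apply/andP; split; apply: (H [:: C, D & g]); rewrite !inE eqxx ?orbT.
- case: (gs) H => [|[|C g] gs'] //= H _.
  by apply: (H (C :: g)); exact: mem_head.
Qed.

Lemma esz_CName A : esz (CName A) = (esz A).+2.
Proof. by rewrite [enc (CName _)]/= tsizeN. Qed.
Lemma esz_ncons b (A : name) : esz (b :: A : name) = (esz b + esz A).+1.
Proof. exact: esz_cons. Qed.
Lemma esz_nnil : esz ([::] : name) = 1. Proof. by []. Qed.
Lemma esz_cname C : esz (cname C) <= esz C.
Proof.
case: C => [A||D|D E|R D]; try exact: tsize_gt0.
by rewrite esz_CName; exact: (leq_trans (leqnSn _) (leqnSn _)).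
Qed.

Lemma esz_pstep k (s : pstate) : esz (pstep k s).1.2 <= esz s.1.2 + 60 /\
  esz (pstep k s).2 <= esz s.2 + esz s.1.2 + 60.
Proof.
case: s => [[ok gs] U]; have E1 : (ok, gs, U).1.2 = gs by []; have E2 : (ok, gs, U).2 = U by [].
rewrite E1 E2; have P n b C : esz C <= esz gs + 40 ->
  esz C + esz (iter n behead (head [::] gs)) <= esz (head [::] gs) + 40 ->
  esz (push (ok, gs, U) b n C).1.2 <= esz gs + 60 /\ esz (push (ok, gs, U) b n C).2 <= esz U + esz gs + 60.
  move=> H1 H2.
  have -> : (push (ok, gs, U) b n C).1.2 = (C :: iter n behead (head [::] gs)) :: behead gs by [].
  have -> : (push (ok, gs, U) b n C).2 = C :: U by [].
  rewrite !esz_cons; split; last by lia.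
  move: (iter _ _ _) H1 H2 => l; clear.
  case: gs => [|g gs]; rewrite [head _ _]/= [behead _]/= ?esz_cons ?esz_nil; lia.
have T1 : esz CTop = 5 by [].
have T0 : esz (CName [::]) = 3 by [].
have TN D : esz (CNot D) = esz D + 6 by have -> : enc (CNot D) = Node (num 2) (enc D) by []; rewrite tsizeN tsize_num; lia.
have TA D E : esz (CAnd D E) = esz D + esz E + 9 by have -> : enc (CAnd D E) = Node (num 3) (Node (enc D) (enc E)) by []; rewrite tsizeN tsize_num tsizeN; lia.
have TE R D : esz (CEx R D) = esz R + esz D + 11 by have -> : enc (CEx R D) = Node (num 4) (Node (enc R) (enc D)) by []; rewrite tsizeN tsize_num tsizeN; lia.
have Tb (b : bool) : esz b <= 3 by case: b.
have TC b D : esz (CName (b :: cname D)) <= esz D + 8.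
  by rewrite esz_CName esz_ncons; generalize (esz_cname D) (Tb b); lia.
have TD := esz_cname.
case: k => [b||||||]; rewrite /pstep ?E1 ?E2; last first.
  have -> : (ok, [::] :: gs, U).1.2 = [::] :: gs by [].
  by rewrite esz_cons esz_nil; split; [lia|rewrite -addnA; exact: leq_addr].
all: apply: P; rewrite ?TN ?TA ?TE.
all: case: (gs) => [|[|C [|D g]] gs']; rewrite ?[head _ _]/= ?[behead _]/= ?[iter _ _ _]/= ?esz_cons ?esz_nil ?T0 ?T1.
all: try (generalize (TC b C)); try (generalize (TC b CTop)); try (generalize (TD C)); try (generalize (TD CTop)).
all: rewrite ?T1 ?esz_nnil; clear; try lia.
Qed.

Lemma esz_parse w : esz (parse w).1.2 <= 60 * size w + 1 /\ esz (parse w).2 <= size w * (60 * size w + 61) + 1.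
Proof.
elim: w => [|k w [IH1 IH2]]; first by rewrite /= !esz_nil.
rewrite [parse _]/= -/(parse w); generalize (esz_pstep k (parse w)); move=> [H1 H2].
rewrite [size _]/=; lia.
Qed.

Lemma pf_pstep : pf (fun p : pstate * token => pstep p.2 p.1).
Proof.
apply: pf_fincase => k.
have Hg : pf (fun s : pstate => head [::] s.1.2) by apply: pf_head; pfs.
have HC : pf (fun s : pstate => head CTop (head [::] s.1.2)) by apply: pf_head.
have HD : pf (fun s : pstate => head CTop (behead (head [::] s.1.2))) by apply: pf_head; apply: pf_behead.
have Hn : pf (fun s : pstate => cname (head CTop (head [::] s.1.2))) by apply: pf_cname.
have P n (b : pstate -> bool) (C : pstate -> concept) : pf b -> pf C -> pf (fun s => push s (b s) n (C s)).
  move=> Hb HC'; rewrite /push; apply: pf_pair; last by pfs.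
  apply: pf_pair; first by pfs.
  apply: pf_cons; last by pfs.
  apply: pf_cons => //; elim: n => [|n IH]; first exact: Hg.
  exact: pf_behead IH.
case: k => [b||||||]; rewrite /pstep /isname; first [apply: P|idtac]; by pfs.
Qed.

Lemma pf_parse : pf parse.
Proof.
apply: (pf_foldr (K := fun w : seq token => (size w + 1) * (60 * size w + 61) + 100 * size w + 100)).
- have E : pb (fun w : seq token => esz w) (fun w => size w).
    by apply: pb_le (pb_self _) _ => w; apply: ltnW; exact: size_esz.
  do ![apply: pb_add|apply: pb_mul|exact: pb_const|exact: E].
- move=> w i; rewrite -/(parse (drop i w)).
  generalize (esz_parse (drop i w)).
  have Hs : size (drop i w) <= size w by rewrite size_drop leq_subr.
  move: (parse _) Hs => [[ok gs] U]; rewrite ![(_, _).1]/= ![(_, _).2]/= !esz_pair.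
  have Hb : esz ok <= 3 by case: ok.
  move: (size (drop i w)) (size w) => a b Hab [H1 H2].
  have : a * (60 * a + 61) <= b * (60 * b + 61) by rewrite leq_mul // leq_add2r leq_mul.
  by lia.
- have H := pf_pstep.
  have E : pf (fun p : seq token * pstate * token => (p.1.2, p.2)) by pfs.
  exact: pf_comp H E.
- exact: pf_id.
- exact: pf_const.
Qed.

(** * Horn conditions as fixed points over a closed list *)

Section HornList.
Variables (U : seq concept) (Ns : seq name).
Hypothesis HU : pok U Ns.

(** [neg] and [pos] recurse on concepts; as fixed points over [U] they take the form that [pf_lfp]
    shows to be polynomial. *)
Definition neg_step (X : seq concept) (C : concept) := [|| C == CTop, C == CName (cname C),
  has (fun D => has (fun E => C == CAnd D E) X) X | has (fun D => has (fun R => C == CEx R D) Ns) X].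
Definition negs := lfp U neg_step.

Definition pos_step (X : seq concept) (C : concept) := [|| C == CTop, C == CName (cname C),
  has (fun D => C == CNot D) negs, has (fun D => has (fun R => C == CAll R D) Ns) X,
  has (fun D => has (fun E => C == CAnd D E) X) X |
  has (fun D => has (fun R => C == CEx R D) Ns && ~~ has (fun E => D == CNot E) U) X].
Definition poss := lfp U pos_step.

Lemma negsE C : C \in U -> (C \in negs) = neg C.
Proof.
move=> HC; apply/idP/idP.
  apply: (lfp_ind (P := fun _ C => neg C)) => // n X D IH _ /or4P[/eqP->//|/eqP->//|/hasP[E HE]|/hasP[E HE]].
    by case/hasP=> F HF /eqP->; rewrite /= (IH _ HE) (IH _ HF).
  by case/hasP=> R HR /eqP->; exact: IH HE.
elim: C HC => [A||C IH|C IHC D IHD|R C IH] HC //= H; apply: lfp_fix => //; apply/or4P.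
- by apply: Or42; exact: eqxx.
- apply: Or43; have /andP[H1 H2] := HU HC; case/andP: H => HN1 HN2.
  by apply/hasP; exists C; [exact: IHC|apply/hasP; exists D; [exact: IHD|]].
- apply: Or44; have /andP[H1 H2] := HU HC.
  by apply/hasP; exists C; [exact: IH|apply/hasP; exists R].
Qed.

Lemma possE C : C \in U -> (C \in poss) = pos C.
Proof.
move=> HC; apply/idP/idP.
  move=> H; suff /andP[] : (C \in U) && pos C by [].
  move: C H {HC}; apply: (lfp_ind (P := fun _ C => (C \in U) && pos C)) => [n D|n X D IH HD] //.
  rewrite HD /=; rewrite /pos_step => /orP[/eqP->//|/orP[/eqP->//|/or4P[/hasP[E HE]|/hasP[E HE]|/hasP[E HE]|/hasP[E HE]]]].
  - move=> /eqP HDE; have HEU := lfp_sub HE; move: HE; rewrite negsE // HDE.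
    by case: (E) => //= R [].
  - by case/hasP=> R HR /eqP->; case/andP: (IH _ HE).
  - case/hasP=> F HF /eqP->; case/andP: (IH _ HE) => _ /= ->; by case/andP: (IH _ HF).
  - case/andP=> /hasP[R HR /eqP->] /= /hasPn HN; case/andP: (IH _ HE) => HEU ->; rewrite andbT.
    case: (E) HN HEU => //= F HN HF; have := HN F; rewrite eqxx => H.
    by have /= HFU := HU HF; have := H HFU.
have [n] := ubnP (csize C); elim: n C HC => // n IH C HC Hn H; apply: lfp_fix => //.
have N D : C = CNot D -> neg D -> pos_step poss C.
  move=> E HD; rewrite /pos_step; apply/orP; right; apply/orP; right; apply/or4P; apply: Or41.
  have HDU : D \in U by have := HU HC; rewrite E.
  by apply/hasP; exists D; rewrite ?negsE // E.
rewrite /pos_step; case: C HC Hn H N => [A||C|C D|R C] HC Hn H N.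
- by rewrite eqxx orbT.
- by rewrite eqxx.
- case: C HC Hn H N => [A||D|D E|R [A||D|D E|S D]] HC Hn H N; try exact: (N _ erefl).
  apply/orP; right; apply/orP; right; apply/or4P; apply: Or42.
  have HC1 := HU HC; have /andP[HR HC2] := HU HC1; have HD := HU HC2.
  by apply/hasP; exists D; [apply: IH => //; move: Hn => /=; lia|apply/hasP; exists R].
- case/andP: H => H1 H2; have /andP[HC1 HC2] := HU HC; move: Hn => /= Hn.
  apply/or4P; apply: Or43.
  apply/hasP; exists C; first by apply: IH => //; lia.
  by apply/hasP; exists D => //; apply: IH => //; lia.
- case/andP: H => H1 H2; have /andP[HR HC1] := HU HC; move: Hn => /= Hn.
  apply/or4P; apply: Or44.
  apply/hasP; exists C; first by apply: IH => //; lia.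
  apply/andP; split; first by apply/hasP; exists R.
  by apply/hasPn => E _; apply: contraNN H1 => /eqP->.
Qed.

Lemma hornbE (T : tbox) : (forall i, i \in T -> (i.1 \in U) && (i.2 \in U)) ->
  all (fun i => (i.1 \in negs) && (i.2 \in poss)) T = hornb T.
Proof.
move=> HT; apply: eq_in_all => i /HT/andP[H1 H2].
by rewrite negsE // possE.
Qed.
End HornList.

(** * Instances and their groups *)

Notation incl := (seq (concept * concept)).
Definition pair_step (C : concept) (s : ctype * incl) : ctype * incl :=
  if s.1 is D :: _ then ([::], (C, D) :: s.2) else ([:: C], s.2).
Definition pairup (l : ctype) : tbox := (foldr pair_step ([::], [::]) l).2.
Definition unpair (T : tbox) : ctype := flatten [seq [:: i.1; i.2] | i <- T].

Lemma unpairK : cancel unpair pairup.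
Proof.
move=> T; rewrite /pairup; suff -> : foldr pair_step ([::], [::]) (unpair T) = ([::], T) by [].
by elim: T => //= -[C D] T ->.
Qed.

Notation code_word := (@code_seq token (fin_code token)).

Definition inst_of (gs : seq ctype) : instance :=
  let g k := head [::] (iter k behead gs) in
  (pairup (g 0), pairup (g 1), ((map cname (g 2), map cname (g 3)), (map cname (g 4), map cname (g 5)))).

Definition inst_groups (x : instance) : seq ctype :=
  [:: unpair x.1.1; unpair x.1.2; map CName x.2.1.1; map CName x.2.1.2; map CName x.2.2.1; map CName x.2.2.2].

Lemma cnameK : cancel CName cname. Proof. by []. Qed.

Lemma inst_groupsK : cancel inst_groups inst_of.
Proof.
by move=> [[T1 T2] [[A B] [C D]]]; rewrite /inst_of /inst_groups /= !unpairK -!map_comp !map_id.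
Qed.

Lemma enc_instanceE x : enc_instance x = enc_groups (inst_groups x).
Proof.
have E T : flatten [seq enc_concept i.1 ++ enc_concept i.2 | i <- T] = flatten (map enc_concept (unpair T)).
  by elim: T => //= i T ->; rewrite catA.
case: x => [[T1 T2] [[A B] [C D]]]; rewrite /enc_groups /inst_groups /= cats0.
by rewrite /enc_signature /enc_tbox /enc_list /enc_group /= !E -!map_comp -!catA.
Qed.

Lemma enc_instance_inj : injective enc_instance.
Proof.
move=> x y; rewrite !enc_instanceE => E; apply: (can_inj inst_groupsK).
by have [_ <-] := parsed_groups (inst_groups x); have [_ <-] := parsed_groups (inst_groups y); rewrite E.
Qed.

Lemma pf_pairup : pf pairup.
Proof.
apply: (pf_snd (f := fun l => foldr pair_step ([::], [::]) l)).
apply: (pf_foldr (F := fun _ => pair_step) (K := fun l : ctype => esz l + 2)).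
- by apply: pb_add; [exact: pb_self|exact: pb_const].
- move=> l i; apply: (@leq_trans (esz (drop i l) + 2)); last by rewrite leq_add2r esz_drop.
  move: (drop i l) => {i}l; rewrite [foldr _ _ _]surjective_pairing esz_pair.
  enough (H : esz (foldr pair_step ([::], [::]) l).1 + esz (foldr pair_step ([::], [::]) l).2 <= esz l + 1) by lia.
  elim: l => [|C l IH]; first by rewrite !esz_nil.
  rewrite [foldr _ _ _]/=; move: (foldr _ _ l) IH => [[|D p] t].
    have -> : pair_step C ([::], t) = ([:: C], t) by [].
    have [-> ->] : ([::] : ctype, t).1 = [::] /\ ([::] : ctype, t).2 = t by [].
    have [-> ->] : ([:: C], t).1 = [:: C] /\ ([:: C], t).2 = t by [].
    by rewrite !esz_cons esz_nil; lia.
  have -> : pair_step C (D :: p, t) = ([::], (C, D) :: t) by [].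
  have [-> ->] : (D :: p, t).1 = D :: p /\ (D :: p, t).2 = t by [].
  have [-> ->] : ([::] : ctype, (C, D) :: t).1 = [::] /\ ([::] : ctype, (C, D) :: t).2 = (C, D) :: t by [].
  by rewrite !esz_cons esz_nil esz_pair; generalize (esz_gt0 p); lia.
- apply: (pf_ext (f := fun p : ctype * (ctype * incl) * concept =>
    if ohead p.1.2.1 is Some D then ([::], (p.2, D) :: p.1.2.2) else ([:: p.2], p.1.2.2))).
    by move=> [[l [[|D q] t]] C].
  apply: (pf_ocase (f := fun (p : ctype * (ctype * incl) * concept) D => ([::], (p.2, D) :: p.1.2.2))); last by pfs.
    by apply: pf_ohead; pfs.
  by pfs.
- exact: pf_id.
- exact: pf_const.
Qed.

Section HornListPf.
Context {X : Type} {cX : code X}.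

Lemma pf_negs (U : X -> ctype) (N : X -> seq name) : pf U -> pf N -> pf (fun x => negs (U x) (N x)).
Proof.
move=> HU HN; apply: pf_lfp; last by pfs.
apply: pf_or; first by pfs.
apply: pf_or; first by apply: pf_eq; [|apply: pf_CName; apply: pf_cname]; pfs.
by pfs.
Qed.

Lemma pf_poss (U : X -> ctype) (N : X -> seq name) : pf U -> pf N -> pf (fun x => poss (U x) (N x)).
Proof.
move=> HU HN; have H := pf_negs HU HN; apply: pf_lfp; last by pfs.
apply: pf_or; first by pfs.
apply: pf_or; first by apply: pf_eq; [|apply: pf_CName; apply: pf_cname]; pfs.
apply: pf_or; last by pfs.
apply: pf_has; first by pfs.
by apply: (pf_comp H); pfs.
Qed.

Lemma pf_horn_list (T : X -> tbox) (U : X -> ctype) (N : X -> seq name) : pf T -> pf U -> pf N ->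
  pf (fun x => all (fun i => (i.1 \in negs (U x) (N x)) && (i.2 \in poss (U x) (N x))) (T x)).
Proof.
move=> HT HU HN; have Hn := pf_negs HU HN; have Hp := pf_poss HU HN.
apply: pf_all => //; apply: pf_and; apply: pf_mem; by pfs.
Qed.
End HornListPf.

(** * Membership in 2ExpTime *)

Section Decide.
Notation X := (seq token).
Definition gs (w : X) := (parse w).1.2.
Definition UU (w : X) : ctype := CTop :: (parse w).2.
Definition NN (w : X) : seq name := map cname (UU w).
Definition TA w := (inst_of (gs w)).1.1.
Definition TB w := (inst_of (gs w)).1.2.
Definition N1 w := (inst_of (gs w)).2.1.1.
Definition R1 w := (inst_of (gs w)).2.1.2.
Definition N2 w := (inst_of (gs w)).2.2.1.
Definition R2 w := (inst_of (gs w)).2.2.2.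

Lemma pf_gs : pf gs. Proof. exact: pf_snd (pf_fst pf_parse). Qed.
Lemma pf_UU : pf UU. Proof. by apply: pf_cons; [exact: pf_const|exact: pf_snd pf_parse]. Qed.
Lemma pf_NN : pf NN.
Proof. by apply: pf_map; [apply: pf_cname; exact: pf_snd pf_id|exact: pf_UU]. Qed.
Lemma pf_group k : pf (fun w => head [::] (iter k behead (gs w))).
Proof. by apply: pf_head; elim: k => [|k IH]; [exact: pf_gs|exact: pf_behead]. Qed.
Lemma pf_names k : pf (fun w => map cname (head [::] (iter k behead (gs w)))).
Proof. by apply: pf_map; [apply: pf_cname; exact: pf_snd pf_id|exact: pf_group]. Qed.
Lemma pf_TA : pf TA. Proof. exact: pf_comp pf_pairup (pf_group 0). Qed.
Lemma pf_TB : pf TB. Proof. exact: pf_comp pf_pairup (pf_group 1). Qed.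
Lemma pf_N1 : pf N1. Proof. exact: pf_names 2. Qed.
Lemma pf_R1 : pf R1. Proof. exact: pf_names 3. Qed.
Lemma pf_N2 : pf N2. Proof. exact: pf_names 4. Qed.
Lemma pf_R2 : pf R2. Proof. exact: pf_names 5. Qed.

Definition hornin (T : X -> tbox) w :=
  all (fun i => (i.1 \in negs (UU w) (NN w)) && (i.2 \in poss (UU w) (NN w))) (T w).

Lemma pf_hornin T : pf T -> pf (hornin T).
Proof.
by move=> HT; rewrite /hornin; exact: pf_horn_list HT pf_UU pf_NN.
Qed.

Definition nonent_word w := nonent (TA w) (TB w) (UU w) (NN w) (N1 w) (R1 w) (N2 w) (R2 w).

(** Rebuilding the groups from the instance read off them rejects a wrong number of groups, an odd
    number of concepts in a TBox, and signature entries that are not names. *)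
Definition checks w := [&& (parse w).1.1, gs w == inst_groups (inst_of (gs w)), hornin TA w & hornin TB w].

Lemma pf_checks : pf checks.
Proof.
have HA := pf_hornin pf_TA; have HB := pf_hornin pf_TB; have Hp := pf_parse; have HG := pf_gs.
have [H1 [H2 [H3 [H4 [H5 H6]]]]] := (pf_TA, (pf_TB, (pf_N1, (pf_R1, (pf_N2, pf_R2))))).
apply: pf_and; first exact: pf_fst (pf_fst Hp).
apply: pf_and; last exact: pf_and HA HB.
apply: pf_eq; first by [].
have HC (N : seq token -> seq name) : pf N -> pf (fun w => map CName (N w)) by move=> HN; pfs.
have HT (T : seq token -> tbox) : pf T -> pf (fun w => unpair (T w)) by move=> HT; rewrite /unpair; pfs.
exact: pf_cons (HT _ H1) (pf_cons (HT _ H2) (pf_cons (HC _ H3) (pf_cons (HC _ H4)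
  (pf_cons (HC _ H5) (pf_cons (HC _ H6) (pf_const _)))))).
Qed.

Lemma UU_closed w : (parse w).1.1 -> pok (UU w) (NN w).
Proof.
move=> /parse_sub[H _] C; rewrite inE => /orP[/eqP->//|/H].
by case: C => //= [D|D E|R D]; rewrite ?inE; [move=> ->|case/andP=> -> ->|case/andP=> -> ->]; rewrite !orbT.
Qed.

Lemma UU_group w k C : (parse w).1.1 -> C \in head [::] (iter k behead (gs w)) -> C \in UU w.
Proof.
move=> /parse_sub[_ H] HC; rewrite inE; apply/orP; right.
have sub l : {subset iter k behead l <= (l : seq ctype)}.
  elim: k {HC} => //= k IH E; case: (iter k _ _) IH => //= a l' IH HE.
  by apply: IH; rewrite inE HE orbT.
move: (iter k behead _) HC (@sub (gs w)) => [|g l] //= HC Hg.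
by apply: H HC; apply: Hg; exact: mem_head.
Qed.

Lemma in_pairup l i : i \in pairup l -> (i.1 \in l) && (i.2 \in l).
Proof.
rewrite /pairup; suff H : {subset (foldr pair_step ([::], [::]) l).1 <= l} /\
    forall i, i \in (foldr pair_step ([::], [::]) l).2 -> (i.1 \in l) && (i.2 \in l).
  by case: H => _; exact.
elim: l => //= C l [IH1 IH2]; move: (foldr _ _ l) IH1 IH2 => [[|D p] t] /= IH1 IH2.
  split=> [E|j /IH2/andP[H1 H2]]; first by rewrite !inE => ->.
  by rewrite !inE H1 H2 !orbT.
split=> // j; rewrite !inE => /orP[/eqP->|/IH2/andP[-> ->]]; last by rewrite !orbT.
by rewrite /= eqxx (IH1 D) ?mem_head ?orbT.
Qed.

Lemma TA_U w i : (parse w).1.1 -> i \in TA w -> (i.1 \in UU w) && (i.2 \in UU w).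
Proof. by move=> H /in_pairup/andP[H1 H2]; rewrite !(UU_group (k := 0)). Qed.
Lemma TB_U w i : (parse w).1.1 -> i \in TB w -> (i.1 \in UU w) && (i.2 \in UU w).
Proof. by move=> H /in_pairup/andP[H1 H2]; rewrite !(UU_group (k := 1)). Qed.

Lemma checksP w : checks w <-> exists x, [/\ w = enc_instance x, hornb x.1.1, hornb x.1.2 & x = inst_of (gs w)].
Proof.
have HH T : (parse w).1.1 -> (forall i, i \in T w -> (i.1 \in UU w) && (i.2 \in UU w)) -> hornin T w = hornb (T w).
  by move=> /UU_closed H1 H2; exact: hornbE.
split=> [/and4P[H1 /eqP H2 H3 H4]|[x [Hw HA HB E]]].
  exists (inst_of (gs w)); split=> //; first by rewrite enc_instanceE -H2; exact: parse_enc.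
    by rewrite HH // in H3 => i; exact: TA_U.
  by rewrite HH // in H4 => i; exact: TB_U.
have [H1 H2] : parsed (inst_groups x) (parse w) by rewrite Hw enc_instanceE; exact: parsed_groups.
rewrite /checks H1 -E -{1}H2 eqxx /= !HH //; try by move=> i; first [exact: TA_U|exact: TB_U].
by rewrite /TA /TB -E HA.
Qed.

Lemma languageP w : language horn_cq_entailment w <-> checks w && ~~ nonent_word w.
Proof.
have HN : checks w -> nonent_word w <-> ~ cq_entails (inst_of (gs w)).2 (inst_of (gs w)).1.1 (inst_of (gs w)).1.2.
  move=> Hc; have /and4P[H1 /eqP H2 _ _] := Hc; have /checksP[x [_ HA HB E]] := Hc.
  rewrite E in HA HB; have HU := UU_closed H1.
  have -> : (inst_of (gs w)).2 = ((N1 w, R1 w), (N2 w, R2 w)) by rewrite /N1 /R1 /N2 /R2 -!surjective_pairing.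
  apply: nonentP => //.
  - move=> C /HU; by case: C => //= R D; rewrite andbC.
  - by move=> i; exact: TA_U.
  - by move=> i; exact: TB_U.
  - move=> A HA1; apply: (UU_group (k := 2)) => //.
    have -> : head [::] (iter 2 behead (gs w)) = map CName (N1 w) by rewrite {1}H2.
    exact: map_f.
split=> [[[[T1 T2] Th] [[/hornP H1 /hornP H2 H3] Hw]]|/andP[Hc Hn]].
  have Ew : (T1, T2, Th) = inst_of (gs w).
    by have [_] := parsed_groups (inst_groups (T1, T2, Th)); rewrite -enc_instanceE -Hw /gs => ->; rewrite inst_groupsK.
  have Hc : checks w by apply/checksP; exists (T1, T2, Th).
  by rewrite Hc /=; apply/negP => /(HN Hc); rewrite -Ew.
have /checksP[[[T1 T2] Th] [Hw H1 H2 E]] := Hc.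
exists (T1, T2, Th); split=> //; split; [exact/hornP|exact/hornP|].
by apply: NNPP => H; move/negP: Hn; apply; apply/(HN Hc); rewrite -E.
Qed.

(** The environment consists of the word, the types, the sets of pairs of a type and a concept, and
    the sets of types. *)
Lemma pf_nonent_env : pf (fun p : X * seq ctype * (seq (seq (ctype * concept)) * seq (seq ctype)) =>
  nonent_in (fun p => UU p.1.1) (fun p => p.1.2) (fun p => NN p.1.1) (fun p => N1 p.1.1) (fun p => R1 p.1.1)
    (fun p => N2 p.1.1) (fun p => R2 p.1.1) (fun p => TA p.1.1) (fun p => TB p.1.1)
    (fun p t R P => look (clos_in p.1.2 (TA p.1.1) (UU p.1.1) (NN p.1.1)) (UU p.1.1) (seed (UU p.1.1) t R P))
    (fun p t R P => look (clos_in p.1.2 (TB p.1.1) (UU p.1.1) (NN p.1.1)) (UU p.1.1) (seed (UU p.1.1) t R P))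
    (fun p => p.2.1) (fun p => p.2.2) p).
Proof.
pose E := (X * seq ctype * (seq (seq (ctype * concept)) * seq (seq ctype)))%type.
have L Y (cY : code Y) (f : X -> Y) : pf f -> pf (fun p : E => f p.1.1).
  by move=> Hf; apply: (pf_comp Hf); pfs.
have HA : pf (fun p : E => p.1.2) by pfs.
have HP : pf (fun p : E => p.2.1) by pfs.
have HC : pf (fun p : E => p.2.2) by pfs.
have Hch (T U : E -> _) (N : E -> seq name) : pf T -> pf U -> pf N ->
    pf (fun q : E * ctype * name * concept =>
      look (clos_in q.1.1.1.1.2 (T q.1.1.1) (U q.1.1.1) (N q.1.1.1)) (U q.1.1.1) (seed (U q.1.1.1) q.1.1.2 q.1.2 q.2)).
  move=> HT HU HN; have Hcl := pf_clos_in HA HT HU HN.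
  apply: pf_look; [|by pfs|by apply: pf_seed; pfs].
  by apply: (pf_comp Hcl); pfs.
have [HU [HN [HTA [HTB [H1 [H2 [H3 H4]]]]]]] := (L _ _ _ pf_UU, (L _ _ _ pf_NN, (L _ _ _ pf_TA, (L _ _ _ pf_TB,
  (L _ _ _ pf_N1, (L _ _ _ pf_R1, (L _ _ _ pf_N2, L _ _ _ pf_R2))))))).
exact: (pf_nonent HU HA HN H1 H2 H3 H4 HTA HTB (Hch _ _ _ HTA HU HN) (Hch _ _ _ HTB HU HN) HP HC).
Qed.

Lemma esz_word (w : X) : esz w <= size w * (2 * fsz token + 2) + 1.
Proof. exact: esz_fin_list. Qed.

Lemma size_UU w : size (UU w) <= size w * (60 * size w + 61) + 1.
Proof. by generalize (esz_parse w) (size_esz (parse w).2); move=> [_ H1] H2; rewrite [size _]/=; lia. Qed.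

Theorem horn_in_2exptime : in_2exptime (language horn_cq_entailment).
Proof.
have [e He] : pb (fun w : X => size w) (fun w => size (UU w) + size (UU w)).
  have H : pb (fun w : X => size w) (fun w => size w * (60 * size w + 61) + 1).
    by do ![apply: pb_add|apply: pb_mul|exact: pb_const|exact: pb_self].
  by apply: pb_le (pb_add H H) _ => w; exact: leq_add (size_UU w) (size_UU w).
pose s (w : X) := 2 ^ (2 ^ ((size w + 2) ^ e.+1)).
(* Twice the size of the universe U: there are at most 2 ^ |U| types, and the pairs of a type and a
   concept number at most 2 ^ |U| times |U|, which is below 2 ^ (|U| + |U|). *)
have Hm w : size (UU w) + size (UU w) <= (size w + 2) ^ e.+1.
  by apply: leq_trans (He w) _; apply: pow_le.
have Hs w : (size w + 2) ^ e.+1 <= s w.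
  by apply: ltnW; apply: ltn_trans (ltn_expl _ _) (ltn_expl _ _).
have Bs : pb s (size_of X).
  have H : pb s (fun w => s w * (2 * fsz token + 2) + 1).
    by do ![apply: pb_add|apply: pb_mul|exact: pb_const|exact: pb_self].
  apply: pb_le H _ => w; apply: leq_trans (esz_word w) _; rewrite leq_add2r leq_mul2r.
  apply/orP; right; apply: leq_trans (Hs w); apply: leq_trans (leq_addr 2 _) _.
  by rewrite -{1}[_ + 2]expn1; apply: pow_le.
have P0 Y (cY : code Y) (f : X -> Y) : pf f -> bf s f.
  by move=> [c [T [B Hf]]]; exists c, T; split=> //; exact: (pb_comp (f := id)) B Bs.
have BU := P0 _ _ _ pf_UU.
have BA : bf s (fun w => allsub (UU w)).
  apply: bf_allsub => //; apply: pb_le (pb_self _) _ => w; rewrite leq_exp2l //.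
  by apply: leq_trans (leq_trans (leq_addr _ _) (Hm w)) _; apply: ltnW; exact: ltn_expl.
have BP : bf s (fun w => allsub [seq (t, C) | t <- allsub (UU w), C <- UU w]).
  apply: (bf_allsub (l := fun w => [seq (t, C) | t <- allsub (UU w), C <- UU w])) => //.
    apply: (bf_comp (g := fun p : seq ctype * ctype => [seq (t, C) | t <- p.1, C <- p.2]) Bs (bf_pair Bs BA BU)).
    by pfs.
  apply: pb_le (pb_self _) _ => w; rewrite size_allpairs size_allsub leq_exp2l //.
  apply: leq_trans (_ : 2 ^ size (UU w) * 2 ^ size (UU w) <= _).
    by rewrite leq_mul2l (ltnW (ltn_expl _ _)) // orbT.
  by rewrite -expnD leq_exp2l.
have BC : bf s (fun w => allsub (allsub (UU w))).
  apply: (bf_allsub (l := fun w => allsub (UU w))) => //.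
  apply: pb_le (pb_self _) _ => w; rewrite size_allsub !leq_exp2l //.
  exact: leq_trans (leq_addr _ _) (Hm w).
have BN : bf s nonent_word.
  have B1 : pf (fun w : X => w) by exact: pf_id.
  have BE := bf_comp Bs (bf_pair Bs (bf_pair Bs (P0 _ _ _ B1) BA) (bf_pair Bs BP BC)) pf_nonent_env.
  exact: (bf_ext _ BE).
apply: (bf_in_2exptime (d := fun w => checks w && ~~ nonent_word w) (e := e)) languageP.
have G : pf (fun p : bool * bool => p.1 && ~~ p.2) by pfs.
exact: (bf_comp Bs (bf_pair Bs (P0 _ _ _ pf_checks) BN) G).
Qed.
End Decide.

(** * Bits of numbers and walks *)

Section Bits.
Definition bit (i m : nat) := odd (m %/ 2 ^ i).

(** An increment flips bit i exactly when all lower bits are one, that is, when 2 ^ i divides the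
    successor: divisibility expresses the carry. *)
Lemma bitS i m : bit i m.+1 = bit i m (+) (2 ^ i %| m.+1).
Proof. by rewrite /bit divnS ?expn_gt0 // oddD addbC; case: (_ %| _). Qed.

Lemma dvdn_bit i m : (2 ^ i.+1 %| m) = (2 ^ i %| m) && ~~ bit i m.
Proof.
rewrite /bit expnSr; apply/idP/idP => [/dvdnP[q ->]|/andP[/dvdnP[q ->]]].
  by rewrite mulnCA mulnA [2 ^ i * q]mulnC -mulnA [2 ^ i * _]mulnC mulnA dvdn_mull //= mulnK ?expn_gt0 // oddM andbF.
by rewrite mulnK ?expn_gt0 // mulnC -dvdn2 => Hq; rewrite dvdn_mul.
Qed.

Lemma bit_mod mu i m : i < mu -> bit i (m %% 2 ^ mu) = bit i m.
Proof.
move=> Hi; rewrite {2}(divn_eq m (2 ^ mu)) /bit.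
have -> : 2 ^ mu = 2 ^ (mu - i.+1) * 2 * 2 ^ i by rewrite -expnSr -expnD; congr (2 ^ _); lia.
by rewrite mulnA divnMDl ?expn_gt0 // oddD mulnA oddM andbF.
Qed.

Lemma bit_inj mu m m' : m < 2 ^ mu -> m' < 2 ^ mu -> (forall i, i < mu -> bit i m = bit i m') -> m = m'.
Proof.
elim: mu m m' => [|mu IH] m m'; first by rewrite expn0; lia.
rewrite expnS => H1 H2 H.
have E i k : bit i.+1 k = bit i (k %/ 2) by rewrite /bit expnS divnMA.
have : m %/ 2 = m' %/ 2.
  apply: IH => [||i Hi]; rewrite ?ltn_divLR // ?[_ * 2]mulnC //.
  by rewrite -!E; exact: H.
have := H 0 isT; rewrite /bit expn0 !divn1 => H0 H3.
by rewrite (divn_eq m 2) (divn_eq m' 2) H3 !modn2 H0.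
Qed.
End Bits.

Lemma all_In T (p : pred T) l x : all p l -> List.In x l -> p x.
Proof. by elim: l => //= y l IH /andP[Hy Hl] [<-|/(IH Hl)]. Qed.

Section Walk.
Variables (D : Type) (R : D -> D -> Prop).

Fixpoint walk n x y := if n is n'.+1 then exists2 z, R x z & walk n' z y else x = y.

Lemma walk_cat n m x y z : walk n x y -> walk m y z -> walk (n + m) x z.
Proof. by elim: n x => [x -> //|n IH x [v Hv /IH H] /H Hw]; exists v. Qed.

Lemma walk_rcons n x y z : walk n x y -> R y z -> walk n.+1 x z.
Proof. by move=> H1 H2; rewrite -addn1; apply: walk_cat H1 _; exists z. Qed.

Lemma walk_fun n x y : walk n x y <-> exists f : nat -> D, [/\ f 0 = x, f n = y & forall i, i < n -> R (f i) (f i.+1)].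
Proof.
elim: n x => [|n IH] x.
  split=> [->|[f [<- <- //]]]; by exists (fun _ => y).
split=> [[z Hz /IH[f [H1 H2 H3]]]|[f [<- H2 H]]].
  exists (fun i => if i is j.+1 then f j else x); split=> // -[_|i /H3 //].
  by rewrite H1.
exists (f 1); first exact: H.
by apply: (proj2 (IH (f 1))); exists (fun i => f i.+1); split=> // i Hi; exact: H.
Qed.
End Walk.

(** * A TBox that checks derivation trees of words *)

Definition pairsym : Type := (bool * bool)%type.
Definition ix (a : pairsym) : nat := a.1.*2 + a.2.
Lemma ix_lt a : ix a < 4. Proof. by case: a => [[] []]. Qed.
Lemma ix_inj : injective ix. Proof. by case=> [[] []] [[] []]. Qed.
Notation d0 := (false, false).

Section Reduction.
Variables (Q : eqType) (Op Te Kp : finType).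
Variables (init : Op -> Te -> Kp) (delta : Kp -> pairsym -> pairsym -> Kp) (acc : Kp -> bool).
Definition rule_of : eqType := (Q * Te * seq (Op * Q))%type.
Notation rul := (Q * Te * seq (Op * Q))%type.
Notation nsym := ((nat * nat) + ((Kp * rul) + (rul + Op * Q)))%type.
Variables (nm : nsym -> name) (nm_inj : injective nm).
Variables (mu : nat) (mu_ge2 : 1 < mu) (rules : seq rul) (op0 : Op) (q0 : Q).

Notation L := (2 ^ mu).
Notation K := (2 ^ (mu - 2)).

Lemma L4K : L = 4 * K.
Proof. by rewrite -[4]/(2 ^ 2) -expnD; congr (2 ^ _); lia. Qed.
Lemma K_gt0 : 0 < K. Proof. by rewrite expn_gt0. Qed.

Definition krun k (old new : seq pairsym) := foldl (fun k x => delta k x.1 x.2) k (zip old new).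

(** A derivation tree whose nodes carry words: [new] is the word of the node and [old] that of its
    parent. The automaton reads both in parallel and checks the relation [op] between them together
    with the test of the rule. *)
Inductive Qd : Op -> Q -> seq pairsym -> seq pairsym -> Prop :=
  QdI op (r : rul) old new (nw : Op * Q -> seq pairsym) :
    r \in rules -> size old = K -> size new = K -> acc (krun (init op r.1.2) old new) ->
    (forall c, c \in r.2 -> Qd c.1 c.2 new (nw c)) -> Qd op r.1.1 old new.

Lemma Qd_size op q old new : Qd op q old new -> size old = K /\ size new = K.
Proof. by case. Qed.

(** A block of [L] nodes along [nR] stores a pair of words, four nodes per letter. [yS] marks the
    node that names the letter of [new]; [yE] marks the three nodes that do not name the letter of
    [old]. In the next block [old] should repeat the present [new], so a [yS] with a [yE] exactly
    [L] steps later betrays a copying error. *)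
Notation yT k i := (inl (k, i) : nsym).
Notation yS := (yT 0 0). Notation yE := (yT 0 1). Notation yRoot := (yT 0 2).
Notation yStart := (yT 0 3). Notation yW := (yT 0 4).
Notation ySt k r := (inr (inl (k, r)) : nsym).
Notation yEnd r := (inr (inr (inl r)) : nsym).
Notation yQ op q := (inr (inr (inr (op, q))) : nsym).
Definition cn (s : nsym) := CName (nm s).
Notation cC i := (cn (yT 1 i)). Notation cN i := (cn (yT 2 i)). Notation cO i := (cn (yT 3 i)).
Notation cB i := (cn (yT 4 i)). Notation cZ i := (cn (yT 5 i)).
Definition nR : name := [::].
Definition nX : name := [:: true].

Definition lab (o n : pairsym) j C := CAnd (if ix n == j then cn yS else CTop)
  (CAnd (if ix o == j then CTop else cn yE) C).
Definition cellc o n C := lab o n 0 (CEx nR (lab o n 1 (CEx nR (lab o n 2 (CEx nR (lab o n 3 C)))))).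

(** A counter modulo [L] along [nR]. Of the bits below i, [cC i] says that all are one, [cN i] that
    some is zero, [cO i] that all are zero; [cB i] and [cZ i] give bit i itself. *)
Definition tb_count i : tbox := [:: (cn yStart, cZ i);
  (CAnd (cC i) (cB i), cC i.+1); (CAnd (cC i) (cZ i), cN i.+1); (cN i, cN i.+1);
  (CAnd (cO i) (cZ i), cO i.+1);
  (CAnd (cC i) (cZ i), CAll nR (cB i)); (CAnd (cC i) (cB i), CAll nR (cZ i));
  (CAnd (cN i) (cZ i), CAll nR (cZ i)); (CAnd (cN i) (cB i), CAll nR (cB i));
  (CAnd (cB i) (cZ i), CNot CTop)].
(** Once the root judgement is derived at a root, a fresh chain appears: [yS] at its start, [L]
    steps counted by [yW], then [yE]. It imitates a copying error. *)
Definition tb_fix : tbox := [:: (cn yRoot, cn yStart); (CTop, cC 0); (CTop, cO 0);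
  (CAnd (cn yRoot) (cn (yQ op0 q0)), CEx nX (CAnd (cn yS) (CAnd (cn yW) (cn yStart))));
  (CAnd (cn yW) (cN mu), CEx nR (cn yW)); (CAnd (cn yW) (cC mu), CEx nR (cn yE))].
(** The automaton is derived backwards: state [k] before a cell follows from the state after it, and
    in the last cell from acceptance together with [yEnd r]. *)
Definition tb_cell (r : rul) (x : Kp * pairsym * pairsym) : tbox :=
  let k' := delta x.1.1 x.1.2 x.2 in
  (cellc x.1.2 x.2 (CAnd (cN mu) (CEx nR (cn (ySt k' r)))), cn (ySt x.1.1 r)) ::
  if acc k' then [:: (cellc x.1.2 x.2 (CAnd (cC mu) (cn (yEnd r))), cn (ySt x.1.1 r))] else [::].
Definition tb_rule (r : rul) : tbox :=
  (foldr (fun c => CAnd (CEx nR (cn (yQ c.1 c.2)))) CTop r.2, cn (yEnd r)) ::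
  [seq (CAnd (cO mu) (cn (ySt (init op r.1.2) r)), cn (yQ op r.1.1)) | op <- enum Op] ++
  flatten [seq tb_cell r x | x <- enum ((Kp * (bool * bool) * (bool * bool))%type : finType)].
Definition tb : tbox := tb_fix ++ flatten [seq tb_count i | i <- iota 0 mu] ++ flatten [seq tb_rule r | r <- rules].

Lemma hornb_tb : hornb tb.
Proof.
rewrite /hornb /tb !all_cat; apply/and3P; split; first by [].
  by apply/allP => i /flattenP[l /mapP[k _ ->]]; rewrite !inE => /or4P[|||/or4P[|||/or4P[|||]]] => [/eqP->|/eqP->|/eqP->|/eqP->|/eqP->|/eqP->|/eqP->|/eqP->|/eqP->|/eqP->].
apply/allP => i /flattenP[l /mapP[r _ ->]]; rewrite inE mem_cat => /or3P[/eqP->|/mapP[op _ ->]//|].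
  by rewrite /= andbT; elim: r.2.
case/flattenP=> l' /mapP[[[k o] n] _ ->]; rewrite inE => /orP[/eqP->|].
  by rewrite /= /lab; do !case: ifP => _ //.
by case: ifP => // _; rewrite inE => /eqP->; rewrite /= /lab; do !case: ifP => _ //.
Qed.

Section Model.
Variables (I : interp) (HI : model_tbox I tb).

Lemma tb_in C D d : (C, D) \in tb -> ext C d -> ext D (d : idom I).
Proof. by move: HI => /ForallE H /H; exact. Qed.

Lemma tb_fixin i : i \in tb_fix -> i \in tb. Proof. by rewrite mem_cat => ->. Qed.
Lemma tb_countin i k : k < mu -> i \in tb_count k -> i \in tb.
Proof.
move=> Hk Hi; rewrite !mem_cat; apply/orP; right; apply/orP; left; apply/flattenP.
by exists (tb_count k) => //; apply: map_f; rewrite mem_iota.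
Qed.
Lemma tb_rulein i r : r \in rules -> i \in tb_rule r -> i \in tb.
Proof.
move=> Hr Hi; rewrite !mem_cat; apply/orP; right; apply/orP; right; apply/flattenP.
by exists (tb_rule r) => //; apply: map_f.
Qed.

Definition at_pos (x : idom I) m := forall k, k < mu -> ext (if bit k m then cB k else cZ k) x.

Lemma pos_carry x m i : at_pos x m -> i <= mu -> ext (if 2 ^ i %| m.+1 then cC i else cN i) x.
Proof.
move=> H; elim: i => [|i IH] Hi; first by rewrite dvd1n; apply: (@tb_in CTop) => //; apply: tb_fixin; rewrite !inE eqxx ?orbT.
have := IH (ltnW Hi); have := H i Hi; rewrite dvdn_bit bitS.
case: (2 ^ i %| _); case: (bit i m) => /= H1 H2.
- by apply: (@tb_in (CAnd (cC i) (cB i)) (cC i.+1)) => //; apply: (tb_countin Hi); rewrite !inE eqxx ?orbT.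
- by apply: (@tb_in (CAnd (cC i) (cZ i)) (cN i.+1)) => //; apply: (tb_countin Hi); rewrite !inE eqxx ?orbT.
- by apply: (@tb_in (cN i) (cN i.+1)) => //; apply: (tb_countin Hi); rewrite !inE eqxx ?orbT.
- by apply: (@tb_in (cN i) (cN i.+1)) => //; apply: (tb_countin Hi); rewrite !inE eqxx ?orbT.
Qed.

Lemma at_pos_step x y m : at_pos x m -> irol nR x y -> at_pos y (m.+1 %% L).
Proof.
move=> H HR k Hk; rewrite bit_mod // bitS.
have HA C D : (C, CAll nR D) \in tb -> ext C x -> ext D y.
  by move=> HC Hx; have := tb_in HC Hx; move=> /= HH; apply: NNPP => HD; apply: HH; exists y.
have := H k Hk; have := pos_carry H (ltnW Hk).
case: (2 ^ k %| _); case: (bit k m) => /= H1 H2.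
- by apply: (HA (CAnd (cC k) (cB k)) (cZ k)) => //; apply: (tb_countin Hk); rewrite !inE eqxx ?orbT.
- by apply: (HA (CAnd (cC k) (cZ k)) (cB k)) => //; apply: (tb_countin Hk); rewrite !inE eqxx ?orbT.
- by apply: (HA (CAnd (cN k) (cB k)) (cB k)) => //; apply: (tb_countin Hk); rewrite !inE eqxx ?orbT.
- by apply: (HA (CAnd (cN k) (cZ k)) (cZ k)) => //; apply: (tb_countin Hk); rewrite !inE eqxx ?orbT.
Qed.

Lemma pos_start x : ext (cn yStart) x -> at_pos x 0.
Proof.
move=> H k Hk; have -> : bit k 0 = false by rewrite /bit div0n.
by apply: (@tb_in (cn yStart)) => //; apply: (tb_countin Hk); rewrite !inE eqxx ?orbT.
Qed.

Lemma pos_root x : ext (cn yRoot) x -> at_pos x 0.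
Proof. by move=> H; apply: pos_start; apply: tb_in H; apply: tb_fixin; rewrite !inE eqxx ?orbT. Qed.

Lemma pos_zeros x : at_pos x 0 -> ext (cO mu) x.
Proof.
move=> H; have : forall i, i <= mu -> ext (cO i) x; last exact.
elim=> [|i IH] Hi; first by apply: (@tb_in CTop) => //; apply: tb_fixin; rewrite !inE eqxx ?orbT.
have := H i Hi; have -> : bit i 0 = false by rewrite /bit div0n.
move=> H1; apply: (@tb_in (CAnd (cO i) (cZ i))); last by split=> //; exact: IH (ltnW Hi).
by apply: (tb_countin Hi); rewrite !inE eqxx ?orbT.
Qed.

Lemma pos_uniq x m m' : m < L -> m' < L -> at_pos x m -> at_pos x m' -> m = m'.
Proof.
move=> H1 H2 P1 P2; apply: (bit_inj H1 H2) => i Hi; have := P1 i Hi; have := P2 i Hi.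
have N : ext (cB i) x -> ext (cZ i) x -> False.
  move=> HB HZ; have := @tb_in (CAnd (cB i) (cZ i)) (CNot CTop) x; move=> /= H; apply: H => //.
  by apply: (tb_countin Hi); rewrite !inE eqxx ?orbT.
by case: (bit i m); case: (bit i m') => // A B; case: N.
Qed.

Lemma pos_ones x m : m < L -> at_pos x m -> ext (if m.+1 == L then cC mu else cN mu) x.
Proof.
move=> Hm H; have := pos_carry H (leqnn _); case: eqP => [->|Hne]; first by rewrite dvdnn.
by rewrite gtnNdvd // ltn_neqAle Hm andbT; apply/eqP.
Qed.

Lemma path_walk x : ext (cn yW) x -> at_pos x 0 -> exists2 y, walk (@irol I nR) L x y & ext (cn yE) y.
Proof.
move=> HW HP; have HL : 0 < L by rewrite expn_gt0.
have K' m : m < L -> exists y, [/\ walk (@irol I nR) m x y, ext (cn yW) y & at_pos y m].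
  elim: m => [|m IH] Hm; first by exists x.
  have [y [H1 H2 H3]] := IH (ltnW Hm).
  have := pos_ones (ltnW Hm) H3; rewrite ltn_eqF // => HN.
  have [|z [/= HR Hz]] := @tb_in (CAnd (cn yW) (cN mu)) (CEx nR (cn yW)) y _ (conj H2 HN).
    by apply: tb_fixin; rewrite !inE eqxx ?orbT.
  exists z; split=> //; first exact: walk_rcons H1 HR.
  by have := at_pos_step H3 HR; rewrite modn_small.
have [|y [H1 H2 H3]] := K' L.-1; first by rewrite prednK.
have := @pos_ones y L.-1; rewrite prednK // eqxx => /(_ (leqnn _) H3) HC.
have [|z [/= HR Hz]] := @tb_in (CAnd (cn yW) (cC mu)) (CEx nR (cn yE)) y _ (conj H2 HC).
  by apply: tb_fixin; rewrite !inE eqxx ?orbT.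
by exists z => //; have := walk_rcons H1 HR; rewrite prednK.
Qed.

Lemma ext_cell o n C x : ext (cellc o n C) x <-> exists y : nat -> idom I,
  [/\ y 0 = x, forall j, j < 3 -> irol nR (y j) (y j.+1), ext (cn yS) (y (ix n)),
      forall j, j < 4 -> j != ix o -> ext (cn yE) (y j) & ext C (y 3)].
Proof.
have labP j (D : concept) (z : idom I) : ext (lab o n j D) z <->
    [/\ (ix n = j -> ext (cn yS) z), (j != ix o -> ext (cn yE) z) & ext D z].
  rewrite /lab /=; rewrite [j == _]eq_sym; case: (ix n =P j); case: (ix o == j) => /=; split=> [[H1 [H2 H3]]|[H1 H2 H3]]; do ?split=> //.
  - exact: H1.
  - exact: H1.
  - exact: H2.
  exact: H2.
have exP R D (z : idom I) : ext (CEx R D) z -> exists2 e, irol R z e & ext D e by case=> e []; exists e.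
rewrite /cellc; split=> [/labP[S0 E0 /exP[x1 R0 /labP[S1 E1 /exP[x2 R1 /labP[S2 E2 /exP[x3 R2 /labP[S3 E3 HC]]]]]]]|[y [<- HR HS HE HC]]].
  exists (nth x [:: x; x1; x2; x3]); split=> //.
  - by case=> [|[|[|]]].
  - by move: (ix_lt n); case E : (ix n) => [|[|[|[|]]]] // _ /=; [exact: (S0 E)|exact: (S1 E)|exact: (S2 E)|exact: (S3 E)].
  - by case=> [|[|[|[|]]]].
apply: (proj2 (labP _ _ _)); split=> [E||]; [by move: HS; rewrite E|exact: (HE 0 isT)|].
exists (y 1); split; first exact: HR.
apply: (proj2 (labP _ _ _)); split=> [E||]; [by move: HS; rewrite E|exact: (HE 1 isT)|].
exists (y 2); split; first exact: HR.
apply: (proj2 (labP _ _ _)); split=> [E||]; [by move: HS; rewrite E|exact: (HE 2 isT)|].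
exists (y 3); split; first exact: HR.
by apply: (proj2 (labP _ _ _)); split=> [E||] //; [move: HS; rewrite E|exact: (HE 3 isT)].
Qed.
End Model.

Definition sg : signature := ([:: nm yS; nm yE; nm yRoot], [:: nR]).

(** * A countermodel over an arbitrary ABox *)

Section Canon.
Variables (A : abox) (mis : Prop).
Definition Ac s x := List.In (AtC (nm s) x) A.
Definition Ar x y := List.In (AtR nR x y) A.
Definition PA x m := exists d, (exists2 z, Ac yRoot z & walk Ar d z x) /\ m = d %% L.
Hypothesis PA_uniq : forall x m m', PA x m -> PA x m' -> m = m'.
Hypothesis Hmis : mis \/ (forall x y, Ac yS x -> Ac yE y -> ~ walk Ar L x y) /\ ~ exists old new, Qd op0 q0 old new.

Definition Eok (os : seq pairsym) x := forall c j, c < size os -> j < 4 -> j != ix (nth d0 os c) ->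
  exists2 y, walk Ar (4 * c + j) x y & Ac yE y.
Definition Sok c0 (ns : seq pairsym) z := forall c, c < size ns ->
  exists y e, [/\ Ac yS y, walk Ar e y z & e + (4 * (c0 + c) + ix (nth d0 ns c)).+1 = L].
Definition MQ op q x := exists old new, Qd op q old new /\ Eok old x.
Definition MEnd (r : rul) z := forall c, c \in r.2 -> exists2 x, Ar z x & MQ c.1 c.2 x.
(** From [x], at the start of cell c, the ABox spells the remaining letters up to the end [z] of the
    block. [Sok] measures distances from [yS] to [z], since the walk of length [L] goes on from
    there into every child block. *)
Definition MSt k r x := forall c, c < K -> PA x (4 * c) -> exists os ns z,
  [/\ size os = K - c, size ns = K - c & acc (krun k os ns)] /\
  [/\ Eok os x, Sok c ns z, (exists2 e, walk Ar e x z & e + (4 * c).+1 = L) & MEnd r z].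

Definition PJ (d : nat + nat) m := match d with inl x => PA x m | inr i => [/\ mis, i <= L & m = i %% L] end.

(** With [mis], all judgements hold at individuals and the chain [inr 0], ..., [inr L] is present.
    Without it, a judgement holds where the ABox describes a derivation. Elements [inr i] always
    satisfy [yEnd r], as a rule without premises derives it everywhere. *)
Definition sem (s : nsym) (d : nat + nat) : Prop :=
  match s with
  | inl (0, 0) => match d with inl x => Ac yS x | inr j => mis /\ j = 0 end
  | inl (0, 1) => match d with inl x => Ac yE x | inr j => mis /\ j = L end
  | inl (0, 2) => match d with inl x => Ac yRoot x | inr _ => False end
  | inl (0, 3) => PJ d 0
  | inl (0, _) => match d with inl _ => False | inr j => mis /\ j < L end
  | inl (1, i) => i = 0 \/ exists2 m, PJ d m & 2 ^ i %| m.+1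
  | inl (2, i) => exists2 m, PJ d m & ~~ (2 ^ i %| m.+1)
  | inl (3, i) => i = 0 \/ exists2 m, PJ d m & 2 ^ i %| m
  | inl (4, i) => exists2 m, PJ d m & bit i m
  | inl (_, i) => exists2 m, PJ d m & ~~ bit i m
  | inr (inl (k, r)) => mis \/ match d with inl x => MSt k r x | inr _ => False end
  | inr (inr (inl r)) => mis \/ match d with inl x => MEnd r x | inr _ => True end
  | inr (inr (inr (op, q))) => mis \/ match d with inl x => MQ op q x | inr _ => False end
  end.

Definition rolJ RN (d e : nat + nat) : Prop :=
  (RN = nR /\ match d, e with
    | inl x, inl y => Ar x y | inr i, inr j => [/\ mis, j = i.+1 & i < L] | _, _ => False end)
  \/ [/\ RN = nX, mis & e = inr 0].

Lemma inl_inj : injective (@inl nat nat). Proof. by move=> x y []. Qed.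
Definition Jint : interp := Interp inl_inj (fun B d => exists2 s, B = nm s & sem s d) rolJ.

Lemma semE s (d : idom Jint) : ext (cn s) d <-> sem s d.
Proof. by split=> [[s' /nm_inj-> //]|H]; exists s. Qed.

Lemma rolE d e : rolJ nR d e -> match d, e with
    | inl x, inl y => Ar x y | inr i, inr j => [/\ mis, j = i.+1 & i < L] | _, _ => False end.
Proof. by case=> [[]//|[]]. Qed.

Lemma L_gt0 : 0 < L. Proof. by rewrite expn_gt0. Qed.

Lemma PA_walk e x y m : walk Ar e x y -> PA x m -> PA y ((m + e) %% L).
Proof.
move=> Hw [d [[z Hz Hd] ->]]; exists (d + e); split; last by rewrite modnDml.
by exists z => //; exact: walk_cat Hd Hw.
Qed.

Lemma PJ_uniq d m m' : PJ d m -> PJ d m' -> m = m'.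
Proof. by case: d => [x|i]; [exact: PA_uniq|case=> _ _ -> [_ _ ->]]. Qed.

Lemma PJ_lt d m : PJ d m -> m < L.
Proof. by case: d => [x [e [_ ->]]|i [_ _ ->]]; rewrite ltn_mod L_gt0. Qed.

Lemma PJ_step d e m : rolJ nR d e -> PJ d m -> PJ e (m.+1 %% L).
Proof.
move/rolE; case: d e => [x|i] [y|j] //= H; first by move=> HP; rewrite -addn1; apply: PA_walk HP; exists y.
by case: H => Hm -> Hi [_ _ ->]; split=> //; rewrite -addn1 modnDml addn1.
Qed.

Lemma allJ B C (d : idom Jint) : (forall e, rolJ nR d e -> ext C d -> ext (cn B) (e : idom Jint)) ->
  ext C d -> ext (CAll nR (cn B)) d.
Proof. by move=> H HC [e [HR HN]]; apply: HN; exact: H. Qed.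

Lemma count_ok i p (d : idom Jint) : i < mu -> p \in tb_count i -> ext p.1 d -> ext p.2 d.
Proof.
have cE j (e : idom Jint) m : PJ e m -> ext (cC j) e -> 2 ^ j %| m.+1.
  by move=> Hm /semE[->|[m' Hm' H]]; [rewrite dvd1n|rewrite (PJ_uniq Hm Hm')].
have zE j (e : idom Jint) : ext (cZ j) e -> exists2 m, PJ e m & ~~ bit j m by move/semE.
have bE j (e : idom Jint) : ext (cB j) e -> exists2 m, PJ e m & bit j m by move/semE.
have nE j (e : idom Jint) m : PJ e m -> ext (cN j) e -> ~~ (2 ^ j %| m.+1).
  by move=> Hm /semE[m' Hm' H]; rewrite (PJ_uniq Hm Hm').
have stepB (e : idom Jint) m : i < mu -> rolJ nR d e -> PJ d m -> bit i m.+1 -> ext (cB i) e.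
  by move=> Hi HR Hm Hb; apply/semE; exists (m.+1 %% L); [exact: PJ_step Hm|rewrite bit_mod].
have stepZ (e : idom Jint) m : i < mu -> rolJ nR d e -> PJ d m -> ~~ bit i m.+1 -> ext (cZ i) e.
  by move=> Hi HR Hm Hb; apply/semE; exists (m.+1 %% L); [exact: PJ_step Hm|rewrite bit_mod].
move=> Hi; rewrite !inE => /or4P[|||/or4P[|||/or4P[|||]]]; move/eqP->; rewrite ?[(_, _).1]/= ?[(_, _).2]/=.
- by move/semE => H; apply/semE; exists 0 => //; rewrite /bit div0n.
- case=> HC /bE[m Hm Hb]; apply/semE; right; exists m => //.
  by rewrite dvdn_bit bitS (cE _ _ _ Hm HC) Hb.
- case=> HC /zE[m Hm Hb]; apply/semE; exists m => //.
  by rewrite dvdn_bit bitS (cE _ _ _ Hm HC) (negbTE Hb).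
- move/semE=> [m Hm Hn]; apply/semE; exists m => //.
  by apply: contra Hn => H; rewrite dvdn_bit in H; case/andP: H.
- case=> /semE HO /zE[m Hm Hb]; apply/semE; right; exists m => //.
  rewrite dvdn_bit Hb andbT; case: HO => [->|[m' Hm' H]]; first by rewrite dvd1n.
  by rewrite (PJ_uniq Hm Hm').
- apply: allJ => e HR [HC /zE[m Hm Hb]]; apply: (stepB _ m) => //.
  by rewrite bitS (cE _ _ _ Hm HC) (negbTE Hb).
- apply: allJ => e HR [HC /bE[m Hm Hb]]; apply: (stepZ _ m) => //.
  by rewrite bitS (cE _ _ _ Hm HC) Hb.
- apply: allJ => e HR [HC /zE[m Hm Hb]]; apply: (stepZ _ m) => //.
  by rewrite bitS (negbTE (nE _ _ _ Hm HC)) (negbTE Hb).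
- apply: allJ => e HR [HC /bE[m Hm Hb]]; apply: (stepB _ m) => //.
  by rewrite bitS (negbTE (nE _ _ _ Hm HC)) Hb.
- case=> /bE[m Hm Hb] /zE[m' Hm' Hb']; exfalso.
  by rewrite (PJ_uniq Hm Hm') in Hb; rewrite Hb in Hb'.
Qed.

Lemma mu_neq0 : mu <> 0. Proof. by move: mu_ge2; case: (mu). Qed.

Lemma fix_ok p (d : idom Jint) : p \in tb_fix -> ext p.1 d -> ext p.2 d.
Proof.
rewrite !inE => /or4P[|||/or3P[]]; move/eqP->; rewrite ?[(_, _).1]/= ?[(_, _).2]/=.
- move/semE => H; apply/semE; case: d H => //= x H; exists 0; split; last by rewrite mod0n.
  by exists x.
- by move=> _; apply/semE; left.
- by move=> _; apply/semE; left.
- case=> /semE HR /semE HQ; case: d HR HQ => //= x HR HQ.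
  (* Without [mis] the judgement at the root would come from a derivation tree, and by [Hmis] there
     is none. *)
  have Hm : mis.
    case: HQ => // -[old [new [HQ _]]]; case: Hmis => // -[_ N].
    by case: N; exists old, new.
  exists (inr 0); split; first by right.
  split; first by apply/semE.
  by split; apply/semE; split=> //; rewrite ?L_gt0 ?mod0n.
- case=> /semE HW /semE[m Hm HN]; case: d HW Hm => //= j [Hmi Hj] [_ _ E].
  have Hj1 : j.+1 < L.
    rewrite ltn_neqAle Hj andbT; apply: contra HN => /eqP HE.
    by rewrite E modn_small // HE dvdnn.
  by exists (inr j.+1); split; [left; split|apply/semE; split].
- case=> /semE HW /semE[/mu_neq0//|[m Hm HN]]; case: d HW Hm => //= j [Hmi Hj] [_ _ E].
  have Hj1 : j.+1 = L.
    by apply/eqP; rewrite eqn_leq Hj /=; apply: dvdn_leq => //; move: HN; rewrite E modn_small.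
  by exists (inr j.+1); split; [left; split|apply/semE; split].
Qed.

Lemma walk_seg (x : nat -> nat) n i j : (forall k, k < n -> Ar (x k) (x k.+1)) -> i + j <= n -> walk Ar j (x i) (x (i + j)).
Proof.
move=> H; elim: j i => [|j IH] i Hn; first by rewrite addn0.
by exists (x i.+1); [apply: H; lia|rewrite -addSnnS; apply: IH; lia].
Qed.

(** In the absence of copying errors the old words read in the child blocks coincide with the new
    word of this block, so the pieces fit together into one derivation tree. *)
Lemma Qd_rule op (r : rul) x : r \in rules -> ~ mis -> PA x 0 -> MSt (init op r.1.2) r x -> MQ op r.1.1 x.
Proof.
move=> Hr Hnm HP HS; have [//|[Hno _]] := Hmis.
have [|os [ns [z [[S1 S2 Hacc] [HE HSo _ HEnd]]]]] := HS 0 K_gt0; first by rewrite muln0.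
rewrite subn0 in S1 S2; exists os, ns; split=> //.
have Hc c : exists w, c \in r.2 -> Qd c.1 c.2 ns w.
  case Hcr : (c \in r.2); last by exists [::].
  have [x' HR [old [new [HQ HE']]]] := HEnd _ Hcr.
  have [So Sn] := Qd_size HQ.
  (* At a letter where they differ, the [yS] of this block and a [yE] of the child block would be
     exactly [L] steps apart. *)
  have E : old = ns.
    apply: (@eq_from_nth _ d0); rewrite ?So ?S2 // => i Hi; apply: ix_inj.
    apply: NNPP => Hne; have [|y [e [Hy He1 He2]]] := HSo i; first by rewrite S2.
    have [||y' Hw' Hy'] := HE' i (ix (nth d0 ns i)) _ (ix_lt _); first by rewrite So.
      by apply/eqP => H; apply: Hne.
    apply: (Hno _ _ Hy Hy').
    have := walk_cat (walk_rcons He1 HR) Hw'; congr (walk _ _ _ _); rewrite add0n in He2; lia.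
  by exists new; rewrite -E.
pose nw c := proj1_sig (constructive_indefinite_description _ (Hc c)).
by apply: (@QdI _ _ _ _ nw) => // c Hcr; apply: (proj2_sig (constructive_indefinite_description _ (Hc c))).
Qed.

Lemma cell_ok r p x (d : idom Jint) : p \in tb_cell r x -> ext p.1 d -> ext p.2 d.
Proof.
have [Hm|Hnm] := classic mis.
  by rewrite /tb_cell inE => /orP[/eqP->|]; [|case: ifP => // _; rewrite inE => /eqP->] => _; apply/semE; left.
case: x => [[k o] n].
have xs C : ext (cellc o n C) d -> exists x : nat -> nat, [/\ d = inl (x 0),
    (forall j, j < 3 -> Ar (x j) (x j.+1)), Ac yS (x (ix n)),
    (forall j, j < 4 -> j != ix o -> Ac yE (x j)) & ext C (inl (x 3) : idom Jint)].
  move/ext_cell=> [y [E HR HS HE HC]].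
  have R' j : j < 3 -> exists a b, [/\ y j = inl a, y j.+1 = inl b & Ar a b].
    by move=> /HR/rolE; case: (y j) (y j.+1) => [a|i] [b|l] // H; [exists a, b|case: H].
  pose x j := if y j is inl a then a else 0.
  have yx j : j < 4 -> y j = inl (x j).
    rewrite /x; case: j => [|j] Hj; first by have [a [b [-> _ _]]] := R' 0 isT.
    by have [a [b [_ -> _]]] := R' j Hj.
  exists x; split.
  - by rewrite -E yx.
  - by move=> j Hj; have := rolE (HR j Hj); rewrite !yx // ltnW.
  - by move/semE: HS; rewrite yx // ix_lt.
  - by move=> j Hj Ho; have /semE := HE j Hj Ho; rewrite yx.
  by rewrite -yx.
have E4 (a : nat -> nat) os : (forall j, j < 4 -> Ar (a j) (a j.+1)) ->
    (forall j, j < 4 -> j != ix o -> Ac yE (a j)) -> Eok os (a 4) -> Eok (o :: os) (a 0).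
  move=> HR HE HEo [|c] j Hc Hj Ho.
    by exists (a j); [rewrite muln0 add0n; apply: (walk_seg (i := 0) HR); lia|exact: HE].
  have [y Hw Hy] := HEo c j Hc Hj Ho; exists y => //.
  by have := walk_cat (walk_seg (i := 0) (j := 4) HR isT) Hw; rewrite addnA -mulnS.
rewrite /tb_cell inE => /orP[/eqP->|].
  rewrite ![(_, _).1]/= ![(_, _).2]/= => /xs[x [-> HR HS HE [/semE[m Hm HN] [y [HRy /semE HSy]]]]].
  have {}HRy := rolE (HRy : rolJ nR (inl (x 3)) y); case: y HRy HSy => //= x4 HRy [//|HSy].
  apply/semE; right => c Hc HP.
  have HP3 := PA_walk (walk_seg (i := 0) (j := 3) HR isT) HP.
  have Lc : 4 * c + 3 < L by rewrite L4K; lia.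
  rewrite add0n modn_small // in HP3.
  rewrite (PA_uniq Hm HP3) in HN.
  have Hc1 : c.+1 < K.
    rewrite ltn_neqAle Hc andbT; apply: contra HN => /eqP HK.
    by rewrite L4K -HK; have -> : (4 * c + 3).+1 = 4 * c.+1 by lia.
  have HP4 : PA x4 (4 * c.+1).
    have := PA_walk (e := 1) _ HP3; move=> /(_ x4) HH.
    have -> : 4 * c.+1 = (4 * c + 3 + 1) %% L by rewrite modn_small ?L4K; lia.
    by apply: HH; exists x4.
  have [os [ns [z [[S1 S2 Hacc] [HEo HSo [e He1 He2] HEnd]]]]] := HSy _ Hc1 HP4.
  pose a j := if j == 4 then x4 else x j.
  have HRa j : j < 4 -> Ar (a j) (a j.+1).
    by rewrite /a; case: j => [|[|[|[|]]]] //= _; exact: HR.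
  exists (o :: os), (n :: ns), z; split; first by split=> //=; lia.
  split=> //.
  - apply: (E4 a) => // j Hj Ho; rewrite /a; case: eqP => [E|_]; [by rewrite E in Hj|exact: HE].
  - case=> [|c'] Hc'.
      have := ix_lt n => Hn.
      exists (x (ix n)), (4 - ix n + e); split=> //; last by rewrite /=; lia.
      apply: walk_cat He1.
      have := walk_seg (i := ix n) (j := 4 - ix n) HRa _; rewrite subnKC ?(ltnW Hn) // => /(_ (leqnn _)).
      by rewrite /a /=; case: eqP => // E; rewrite E in Hn.
    have [y [e' [H1 H2 H3]]] := HSo c' Hc'; exists y, e'; split=> //.
    by rewrite -H3 /=; lia.
  by exists (4 + e); [exact: walk_cat (walk_seg (i := 0) (j := 4) HRa isT) He1|lia].
case: ifP => // Hacc; rewrite inE => /eqP->.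
rewrite ![(_, _).1]/= ![(_, _).2]/= => /xs[x [-> HR HS HE [/semE[/mu_neq0//|[m Hm HN]] /semE HEnd]]].
case: HEnd => // HEnd; apply/semE; right => c Hc HP.
have HP3 := PA_walk (walk_seg (i := 0) (j := 3) HR isT) HP.
have Lc : 4 * c + 3 < L by rewrite L4K; lia.
rewrite add0n modn_small // in HP3.
rewrite (PA_uniq Hm HP3) in HN.
have HcK : 4 * c + 4 = L.
  by apply/eqP; rewrite eqn_leq; apply/andP; split; [lia|apply: dvdn_leq; [lia|have -> : 4 * c + 4 = (4 * c + 3).+1 by lia]].
have E1 : K - c = 1 by move: HcK; rewrite L4K; lia.
exists [:: o], [:: n], (x 3); rewrite E1; split=> //.
split=> //.
- case=> [|//] j _ Hj Ho; exists (x j); last exact: HE.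
  by rewrite muln0 add0n; apply: (walk_seg (i := 0) HR); lia.
- case=> [|//] _; exists (x (ix n)), (3 - ix n); have := ix_lt n => Hn; split=> //; last by rewrite /=; lia.
  by have := walk_seg (i := ix n) (j := 3 - ix n) HR; rewrite subnKC; [apply|]; lia.
by exists 3; [exact: (walk_seg (i := 0) (j := 3) HR isT)|lia].
Qed.

Lemma rule_ok r p (d : idom Jint) : r \in rules -> p \in tb_rule r -> ext p.1 d -> ext p.2 d.
Proof.
move=> Hr; rewrite inE mem_cat => /or3P[/eqP->|/mapP[op _ ->]|/flattenP[l /mapP[x _ ->]]]; last exact: cell_ok.
  rewrite ![(_, _).1]/= ![(_, _).2]/= => H; apply/semE; have [Hm|Hnm] := classic mis; first by left.
  right; case: d H => // x H c; elim: r.2 H => // c' l IH [[e [HR /semE HQ]] H]; have {}HR := rolE (HR : rolJ nR (inl x) e).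
  rewrite inE => /orP[/eqP->|]; last exact: IH.
  by case: e HR HQ => // y HR [//|HQ]; exists y.
rewrite ![(_, _).1]/= ![(_, _).2]/= => -[/semE[/mu_neq0//|[m Hm Hd]] /semE HS]; apply/semE.
have [Hmi|Hnm] := classic mis; first by left.
right; case: d Hm HS => [x|i] /= Hm; last by case: Hm.
case=> // HS; apply: Qd_rule HS => //.
by have /PJ_lt Hl := Hm : PJ (inl x) m; move: Hd; rewrite /dvdn modn_small // => /eqP <-.
Qed.

Lemma Jint_model : model_tbox Jint tb.
Proof.
apply/ForallE => p Hp d; move: Hp; rewrite !mem_cat => /or3P[|/flattenP[l /mapP[i Hi ->]]|/flattenP[l /mapP[r Hr ->]]].
- exact: fix_ok.
- by move=> Hp; apply: count_ok Hp; move: Hi; rewrite mem_iota.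
- exact: rule_ok.
Qed.

Lemma Jint_abox : all (Defs.over sg) A -> model_abox Jint A.
Proof.
move=> HA; apply/List.Forall_forall => -[B x|R x y] Hin.
  have := all_In HA Hin; rewrite /= !inE => HB.
  have [s Hs Es] : exists2 s, s \in [:: yS; yE; yRoot] & B = nm s.
    by case/or3P: HB => /eqP->; [exists yS|exists yE|exists yRoot]; rewrite ?inE ?eqxx ?orbT.
  by exists s => //; rewrite Es in Hin; move: Hs Hin; rewrite !inE => /or3P[] /eqP->.
have := all_In HA Hin; rewrite /= inE => /eqP ER; left; split=> //.
by rewrite ER in Hin.
Qed.
End Canon.

(** The query is evaluated in [Jint] and pulled back to an arbitrary model of the ABox: individuals
    stay where they are, and the chain, present only if the ABox contains an error, folds onto that
    error. *)
Lemma Qd_entails : ~ (exists old new, Qd op0 q0 old new) -> cq_entails (sg, sg) [::] tb.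
Proof.
move=> HN A HA _ [I2 [HI2 HA2]] q Hu Hq a Hsz Ha Hc I1 _ HA1.
pose mis := exists x y, [/\ Ac A yS x, Ac A yE y & walk (Ar A) L x y].
have Hmis : mis \/ (forall x y, Ac A yS x -> Ac A yE y -> ~ walk (Ar A) L x y) /\ ~ exists old new, Qd op0 q0 old new.
  have [H|H] := classic mis; [by left|right; split=> // x y H1 H2 H3].
  by apply: H; exists x, y.
have Hin J (HJ : model_abox J A) b : List.In b A -> sat (@iind J) b by move: HJ => /List.Forall_forall; exact.
have pos d z x m : at_pos (@iind I2 z) m -> walk (Ar A) d z x -> at_pos (@iind I2 x) ((m + d) %% L).
  elim: d z m => [|d IH] z m Hm; first by move=> <- k Hk; rewrite addn0 bit_mod //; exact: Hm.
  case=> y Hy /IH H; have := H _ (at_pos_step HI2 Hm (Hin _ HA2 _ Hy)).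
  by rewrite modnDml addSnnS.
have Huniq x m m' : PA A x m -> PA A x m' -> m = m'.
  have HP n : PA A x n -> n < L /\ at_pos (@iind I2 x) n.
    case=> d [[z Hz Hw] ->]; split; first by rewrite ltn_mod L_gt0.
    by have := pos _ _ _ _ (pos_root HI2 (Hin _ HA2 _ Hz)) Hw.
  by move=> /HP[H1 H2] /HP[H3 H4]; exact: (pos_uniq HI2 H1 H3 H2 H4).
have [f [Hans Hbody]] := Hc _ (Jint_model Huniq Hmis) (Jint_abox mis HA).
have [w Hw] : exists w : nat -> nat, mis -> [/\ Ac A yS (w 0), Ac A yE (w L) & forall i, i < L -> Ar A (w i) (w i.+1)].
  have [[x [y [H1 H2 /walk_fun[w [E1 E2 H]]]]]|H] := classic mis; last by exists id.
  by exists w; rewrite E1 E2.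
pose g (d : nat + nat) := match d with inl x => iind I1 x | inr i => iind I1 (w i) end.
exists (fun v => g (f v)); split.
  have -> : map (fun v => g (f v)) (ans q) = map g (map f (ans q)) by rewrite -map_comp.
  by rewrite Hans -map_comp.
apply/List.Forall_forall => b Hb; have Hs : sat f b by move: Hbody => /List.Forall_forall; exact.
have := all_In Hq Hb; case: b {Hb} Hs => [B v|R v v'] /=.
  case=> s -> Hs; rewrite !inE !(inj_eq nm_inj) => Hs'.
  case: (f v) Hs => [x|i] Hs.
    by apply: (Hin _ HA1 (AtC (nm s) x)); move: Hs' Hs => /or3P[] /eqP->.
  move: Hs' Hs => /or3P[] /eqP-> //= -[/Hw[H1 H2 H3] ->].
    exact: (Hin _ HA1 (AtC (nm yS) (w 0))).
  exact: (Hin _ HA1 (AtC (nm yE) (w L))).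
move=> HR; rewrite inE => /eqP ER; rewrite {}ER in HR *; have {HR} := rolE HR.
case: (f v) (f v') => [x|i] [y|j] //= H; first exact: (Hin _ HA1 (AtR nR x y)).
by case: H => /Hw[_ _ H] -> /H H3; exact: (Hin _ HA1 (AtR nR (w i) (w i.+1))).
Qed.

(** * The ABox of all words *)

Section Words.
Notation word := (K.-tuple (bool * bool)%type).
(** One node for each pair of words and each position. The end of block (o, n) leads to the start of
    every block (n, n'), so all derivation trees are present at once and no copying error occurs. *)
Notation V := (word * word * 'I_L)%type.
Definition idx (v : V) : nat := enum_rank v.
Lemma idx_inj v v' : idx v = idx v' -> v = v'.
Proof. by move=> H; apply: enum_rank_inj; exact: val_inj. Qed.
Definition isS (v : V) := ix (nth d0 v.1.2 (v.2 %/ 4)) == v.2 %% 4.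
Definition isE (v : V) := ix (nth d0 v.1.1 (v.2 %/ 4)) != v.2 %% 4.
Definition vedge (v v' : V) : bool := if v.2.+1 < L then (v'.1 == v.1) && (v'.2 == v.2.+1 :> nat)
  else (v'.1.1 == v.1.2) && (v'.2 == 0 :> nat).
Definition opt (T : Type) (b : bool) (x : T) := if b then [:: x] else [::].
Definition atoms (v : V) : abox :=
  opt (isS v) (AtC (nm yS) (idx v)) ++ opt (isE v) (AtC (nm yE) (idx v)) ++
  opt (v.2 == 0 :> nat) (AtC (nm yRoot) (idx v)) ++
  flatten [seq opt (vedge v v') (AtR nR (idx v) (idx v')) | v' <- enum {: V}].
Definition AW : abox := flatten [seq atoms v | v <- enum {: V}].

Lemma In_cat (T : Type) (b : T) l1 l2 : List.In b (l1 ++ l2) <-> List.In b l1 \/ List.In b l2.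
Proof. by elim: l1 => [|a l IH] /=; [split=> [|[]]; auto|rewrite IH; tauto]. Qed.

Lemma In_flat (T : eqType) (B : Type) (h : T -> seq B) l b : List.In b (flatten (map h l)) <-> exists2 x, x \in l & List.In b (h x).
Proof.
elim: l => [|x l IH]; first by split=> // -[].
split=> [/In_cat[H|/IH[y Hy H]]|[y]].
- by exists x; rewrite ?mem_head.
- by exists y => //; rewrite inE Hy orbT.
rewrite inE => /orP[/eqP->|Hy] H; apply/In_cat; [by left|right].
by apply/IH; exists y.
Qed.

Lemma In_opt (T : Type) b (x y : T) : List.In y (opt b x) <-> b /\ y = x.
Proof. by rewrite /opt; case: b => /=; split=> [[]|[]] //; left. Qed.

Lemma In_AW b : List.In b AW <-> exists v, [\/ isS v /\ b = AtC (nm yS) (idx v), isE v /\ b = AtC (nm yE) (idx v),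
  v.2 = 0 :> nat /\ b = AtC (nm yRoot) (idx v) | exists2 v', vedge v v' & b = AtR nR (idx v) (idx v')].
Proof.
split=> [/In_flat[v _]|[v H]].
  move=> H; exists v; move: H => /In_cat[/In_opt|/In_cat[/In_opt|/In_cat[/In_opt[/eqP]|/In_flat[v' _ /In_opt[]]]]].
  - by constructor 1.
  - by constructor 2.
  - by constructor 3.
  - by constructor 4; exists v'.
apply/In_flat; exists v; rewrite ?mem_enum //.
case: H => [H|H|[/eqP H E]|[v' H E]]; apply/In_cat.
- by left; apply/In_opt.
- by right; apply/In_cat; left; apply/In_opt.
- by right; apply/In_cat; right; apply/In_cat; left; apply/In_opt.
- right; apply/In_cat; right; apply/In_cat; right; apply/In_flat; exists v'; first by rewrite mem_enum.
  by apply/In_opt.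
Qed.

Lemma AW_S x : Ac AW yS x -> exists2 v, x = idx v & isS v.
Proof.
by case/In_AW=> v [[H [->]]|[_ [/nm_inj]]|[_ [/nm_inj]]|[]] //; exists v.
Qed.
Lemma AW_E x : Ac AW yE x -> exists2 v, x = idx v & isE v.
Proof. by case/In_AW=> v [[_ [/nm_inj]]|[H [->]]|[_ [/nm_inj]]|[]] //; exists v. Qed.
Lemma AW_root x : Ac AW yRoot x -> exists2 v, x = idx v & v.2 = 0 :> nat.
Proof. by case/In_AW=> v [[_ [/nm_inj]]|[_ [/nm_inj]]|[H [->]]|[]] //; exists v. Qed.
Lemma AW_R v y : Ar AW (idx v) y -> exists2 v', y = idx v' & vedge v v'.
Proof. by case/In_AW=> u [[_ ]|[_ ]|[_ ]|[v' H [/idx_inj-> ->]]] //; exists v'. Qed.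

Lemma AW_pos e v y : walk (Ar AW) e (idx v) y -> exists2 v', y = idx v' & v'.2 = (v.2 + e) %% L :> nat.
Proof.
elim: e v => [|e IH] v; first by move=> <-; exists v; rewrite ?addn0 ?modn_small.
case=> z /AW_R[v1 -> Hv1] /IH[v' -> E]; exists v' => //; rewrite E; move: Hv1; rewrite /vedge.
have := ltn_ord v.2 => Hv; case: ifP => Hlt /andP[_ /eqP->]; first by rewrite addSnnS.
have -> : v.2 + e.+1 = L + e by lia.
by rewrite modnDl.
Qed.

Lemma AW_next e v y : walk (Ar AW) e (idx v) y -> exists2 v', y = idx v' &
  (v.2 + e < L -> v'.1 = v.1 /\ v'.2 = v.2 + e :> nat) /\
  (L <= v.2 + e < L + L -> v'.1.1 = v.1.2 /\ v'.2 + L = v.2 + e).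
Proof.
elim: e v => [|e IH] v.
  by move=> <-; exists v => //; rewrite addn0; split=> //; have := ltn_ord v.2; lia.
case=> z /AW_R[v1 -> Hv1] /IH[v' -> [H1 H2]]; exists v' => //; move: Hv1; rewrite /vedge.
have := ltn_ord v.2 => Hv; case: ifP => Hlt /andP[/eqP E1 /eqP E2].
  by rewrite E1 E2 addSnnS in H1 H2; split.
rewrite E2 in H1.
split=> H; first by lia.
have [|H3 H4] := H1; first by lia.
by split; [rewrite H3|lia].
Qed.

Lemma AW_nomis x y : Ac AW yS x -> Ac AW yE y -> ~ walk (Ar AW) L x y.
Proof.
move=> /AW_S[v -> HS] /AW_E[v' -> HE] /AW_next[v2 /idx_inj<- [_]].
have := ltn_ord v.2 => Hv; case=> [|E1 E2]; first by lia.
have E : v'.2 = v.2 :> nat by lia.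
by move: HE; rewrite /isE E1 E => /negP; apply.
Qed.

Definition nd (o n : word) i : V := (o, n, insubd (Ordinal L_gt0) i).
Lemma ndE o n i : i < L -> (nd o n i).2 = i :> nat.
Proof. by move=> Hi; rewrite /nd /= val_insubd Hi. Qed.

Section InModel.
Variables (I : interp) (HI : model_tbox I tb) (HA : model_abox I AW).
Let x v : idom I := iind I (idx v).

Lemma AW_sat b : List.In b AW -> sat (@iind I) b.
Proof. by move: HA => /List.Forall_forall; exact. Qed.
Lemma x_S v : isS v -> ext (cn yS) (x v).
Proof. by move=> H; apply: (AW_sat (b := AtC _ _)); apply/In_AW; exists v; constructor 1. Qed.
Lemma x_E v : isE v -> ext (cn yE) (x v).
Proof. by move=> H; apply: (AW_sat (b := AtC _ _)); apply/In_AW; exists v; constructor 2. Qed.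
Lemma x_root (v : V) : v.2 = 0 :> nat -> ext (cn yRoot) (x v).
Proof. by move=> H; apply: (AW_sat (b := AtC _ _)); apply/In_AW; exists v; constructor 3. Qed.
Lemma x_R v v' : vedge v v' -> irol nR (x v) (x v').
Proof. by move=> H; apply: (AW_sat (b := AtR _ _ _)); apply/In_AW; exists v; constructor 4; exists v'. Qed.

Lemma nd_edge o n i : i.+1 < L -> vedge (nd o n i) (nd o n i.+1).
Proof. by move=> Hi; rewrite /vedge !ndE // ?(ltnW Hi) // Hi /= !eqxx. Qed.

Lemma x_pos o n i : i < L -> at_pos (x (nd o n i)) i.
Proof.
elim: i => [|i IH] Hi; first by apply: (pos_root HI); apply: x_root; rewrite ndE.
by have := at_pos_step HI (IH (ltnW Hi)) (x_R (nd_edge o n Hi)); rewrite modn_small.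
Qed.

Lemma x_St (o n : word) r c os ns k : r \in rules -> os != [::] -> drop c o = os -> drop c n = ns -> acc (krun k os ns) ->
  ext (cn (yEnd r)) (x (nd o n L.-1)) -> ext (cn (ySt k r)) (x (nd o n (4 * c))).
Proof.
move=> Hr; elim: os ns c k => // a os IH [|b ns] c k _ Eo En Hacc HEnd.
  by have := congr1 size Eo; have := congr1 size En; rewrite !size_drop !size_tuple /=; lia.
have So : size (a :: os) = K - c by rewrite -Eo size_drop size_tuple.
rewrite /= in So; have L4 := L4K.
have Na : nth d0 o c = a by rewrite -[c]addn0 -nth_drop Eo.
have Nb : nth d0 n c = b by rewrite -[c]addn0 -nth_drop En.
have Hcell C : ext C (x (nd o n (4 * c + 3))) -> ext (cellc a b C) (x (nd o n (4 * c))).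
  move=> HC; apply/ext_cell; exists (fun j => x (nd o n (4 * c + j))); split=> //.
  - by rewrite addn0.
  - by move=> j Hj; rewrite addnS; apply: x_R; apply: nd_edge; lia.
  - apply: x_S; have := ix_lt b => Hb; rewrite /isS ndE /=; last by lia.
    by rewrite [4 * c]mulnC divnMDl // divn_small // addn0 Nb modnMDl modn_small.
  - move=> j Hj Hne; apply: x_E; rewrite /isE ndE /=; last by lia.
    by rewrite [4 * c]mulnC divnMDl // divn_small // addn0 Na modnMDl modn_small // eq_sym.
have Hin p : p \in tb_cell r (k, a, b) -> p \in tb.
  move=> Hp; apply: (tb_rulein Hr); rewrite inE !mem_cat; apply/orP; right; apply/orP; right.
  by apply/flattenP; exists (tb_cell r (k, a, b)) => //; apply: map_f; rewrite mem_enum.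
case: os IH Eo So Hacc => [|a' os] IH Eo So Hacc.
  apply: (@tb_in _ HI (cellc a b (CAnd (cC mu) (cn (yEnd r))))).
    apply: Hin; rewrite /tb_cell inE; apply/orP; right.
    have /= -> : acc (delta k a b) by move: Hacc; rewrite /krun /=; case: (ns).
    by rewrite mem_head.
  apply: Hcell; rewrite /= in So; have -> : 4 * c + 3 = L.-1 by lia.
  split=> //; have := pos_ones HI (m := L.-1) _ (@x_pos o n L.-1 _).
  by rewrite prednK ?L_gt0 // eqxx; apply.
apply: (@tb_in _ HI (cellc a b (CAnd (cN mu) (CEx nR (cn (ySt (delta k a b) r)))))).
  by apply: Hin; rewrite /tb_cell inE eqxx.
apply: Hcell; rewrite /= in So; split.
  have Hlt : 4 * c + 3 < L by lia.
  by have := pos_ones HI Hlt (x_pos o n Hlt); rewrite ifF //; apply/eqP; lia.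
exists (x (nd o n (4 * c.+1))); split.
  have -> : 4 * c.+1 = (4 * c + 3).+1 by lia.
  by apply: x_R; apply: nd_edge; lia.
apply: (IH ns) => //.
- by rewrite -add1n -drop_drop Eo /= ?drop0.
- by rewrite -add1n -drop_drop En /= ?drop0.
Qed.

Lemma Qd_sound op q old new : Qd op q old new -> forall o n : word, old = o -> new = n ->
  ext (cn (yQ op q)) (x (nd o n 0)).
Proof.
elim=> {}op r {}old {}new nw Hr So Sn Hacc HQ IH o n Eo En.
apply: (@tb_in _ HI (CAnd (cO mu) (cn (ySt (init op r.1.2) r)))).
  apply: (tb_rulein Hr); rewrite inE mem_cat; apply/orP; right; apply/orP; left.
  by apply/mapP; exists op; rewrite ?mem_enum.
split; first by apply: (pos_zeros HI); exact: x_pos L_gt0.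
rewrite -(muln0 4); apply: (x_St (os := o) (ns := n)); rewrite ?drop0 // -?Eo -?En //.
  by rewrite -size_eq0 So -lt0n K_gt0.
apply: (@tb_in _ HI (foldr (fun c => CAnd (CEx nR (cn (yQ c.1 c.2)))) CTop r.2)).
  by apply: (tb_rulein Hr); rewrite mem_head.
elim: r.2 HQ IH => //= c l IHl HQ IH; split; last first.
  by apply: IHl => c' Hc'; [apply: HQ|apply: IH]; rewrite inE Hc' orbT.
have [_ /eqP Sw] := Qd_size (HQ c (mem_head _ _)).
exists (x (nd n (Tuple Sw) 0)); split; last by apply: (IH c (mem_head _ _)).
apply: x_R; have HL := L_gt0; rewrite /vedge !ndE ?prednK // ltnn /= !eqxx //.
Qed.
End InModel.

(** The separating query is a [yS] with a walk of [L] steps to a [yE]. The TBox enforces it through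
    the fresh chain, while the ABox alone contains no such walk ([AW_nomis]). *)
Lemma Qd_nonentails old new : Qd op0 q0 old new -> ~ cq_entails (sg, sg) [::] tb.
Proof.
move=> HQ Hent.
have [/eqP So /eqP Sn] := Qd_size HQ.
(* The ABox read as an interpretation with no further facts. *)
pose IA := Interp (@inj_id nat) (fun B x => List.In (AtC B x) AW) (fun R x y => List.In (AtR R x y) AW).
have HIA : model_abox IA AW by apply/List.Forall_forall => -[].
have HT0 I : model_tbox I [::] by constructor.
have Hover : all (Defs.over sg) AW.
  have K2 b : List.In b AW -> Defs.over sg b.
    by case/In_AW=> v [[_ ->]|[_ ->]|[_ ->]|[v' _ ->]]; rewrite /= !inE eqxx ?orbT.
  by elim: AW K2 {HIA IA} => //= b l IH H; rewrite H ?IH //; [move=> c Hc; apply: H; right|left].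
pose q := CQ [::] (AtC (nm yS) 0 :: AtC (nm yE) L :: [seq AtR nR i i.+1 | i <- iota 0 L]).
have Hq : all (Defs.over sg) (body q).
  rewrite /q [body _]/= [all _ _]/= !inE !eqxx !orbT /= all_map; apply/allP => i _ /=.
  by rewrite inE eqxx.
have Huniq x m m' : PA AW x m -> PA AW x m' -> m = m'.
  have HP k : PA AW x k -> exists2 v : V, x = idx v & v.2 = k :> nat.
    case=> d [[z /AW_root[v -> Hv] Hw] ->]; have [v' -> E] := AW_pos Hw.
    by exists v'; rewrite // E Hv.
  by move=> /HP[v E1 <-] /HP[v' E2 <-]; rewrite E1 in E2; rewrite (idx_inj E2).
have Hc : certain tb AW q [::].
  move=> I HI HA; have HQQ := Qd_sound HI HA HQ (o := Tuple So) (n := Tuple Sn) erefl erefl.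
  have HR : ext (cn yRoot) (iind I (idx (nd (Tuple So) (Tuple Sn) 0))) by apply: x_root => //; rewrite ndE ?L_gt0.
  have [|y [/= HX [HS [HW HSt]]]] := tb_in HI (C := CAnd (cn yRoot) (cn (yQ op0 q0)))
      (D := CEx nX (CAnd (cn yS) (CAnd (cn yW) (cn yStart)))) _ (conj HR HQQ).
    by apply: tb_fixin; rewrite !inE eqxx ?orbT.
  have [z /walk_fun[f [E1 E2 H]] HE] := path_walk HI HW (pos_start HI HSt).
  exists f; split=> //; constructor; first by rewrite /= E1.
  constructor; first by rewrite /= E2.
  apply/List.Forall_forall => b; have : {subset iota 0 L <= gtn L} by move=> i; rewrite mem_iota.
  elim: (iota 0 L) => //= i l IH Hl [<-|Hb]; first by apply: H; exact: Hl (mem_head _ _).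
  by apply: IH => // k Hk; apply: Hl; rewrite inE Hk orbT.
(* With [mis] true, [Jint] is a model whether or not the judgement is derivable; it shows
   consistency. *)
have HJ : model_tbox (Jint AW True) tb by apply: Jint_model => //; left.
have HJA : model_abox (Jint AW True) AW by exact: Jint_abox.
have Hcons1 : consistent [::] AW by exists IA.
have Hcons2 : consistent tb AW by exists (Jint AW True).
have [//|f [_ Hf]] := Hent AW Hover Hcons1 Hcons2 q isT Hq [::] erefl _ Hc IA (HT0 IA) HIA.
move: Hf => /List.Forall_forall Hf.
apply: (AW_nomis (x := f 0) (y := f L)).
- by apply: (Hf (AtC _ _)); left.
- by apply: (Hf (AtC _ _)); right; left.
apply/walk_fun; exists f; split=> // i Hi; apply: (Hf (AtR _ _ _)); right; right.
have : i \in iota 0 L by rewrite mem_iota.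
elim: (iota 0 L) => //= k l IH; rewrite inE => /orP[/eqP->|/IH]; by [left|right].
Qed.
End Words.
End Reduction.

(** * Comparing numbers by a finite automaton *)

Notation cop := (bool * bool * bool)%type.
Notation cs := (bool * bool * bool * bool)%type.
Notation test := (bool * (bool * bool * bool))%type.
Notation kap := (cs * cs * (test * (bool * bool * bool)))%type.

(** A [cop] (free, swap, c) demands nothing if free; otherwise that the second number is the first
    plus c, or with swap the first the second plus c. Each of the two tracks gets such a comparison,
    started with carry c. *)
Definition kinit (op : cop * cop) (te : test) : kap :=
  ((op.1.1.1, op.1.1.2, true, op.1.2), (op.2.1.1, op.2.1.2, true, op.2.2), (te, (true, true, false))).
Definition cstep (s : cs) (x y : bool) : cs :=
  let: (fr, sw, ok, c) := s in
  let a := if sw then y else x in let b := if sw then x else y in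
  (fr, sw, ok && (b == a (+) c), a && c).
(** Flags over the new word: the first track is zero so far; the second is zero before the current
    letter; the current bit of the second. Words are little-endian, so at the end the third flag is
    the top bit and the comparison with 2 ^ (K - 1) can be read off. *)
Definition fstep (f : bool * bool * bool) (n : bool * bool) :=
  (f.1.1 && ~~ n.1, f.1.2 && ~~ f.2, n.2).
Definition kdelta (k : kap) (o n : bool * bool) : kap :=
  (cstep k.1.1 o.1 n.1, cstep k.1.2 o.2 n.2, (k.2.1, fstep k.2.2 n)).
Definition cacc (s : cs) := let: (fr, _, ok, c) := s in fr || ok && ~~ c.
Definition facc (te : test) (f : bool * bool * bool) :=
  (te.1 ==> f.1.1) && (if f.2 then if f.1.2 then te.2.1.2 else te.2.2 else te.2.1.1).
Definition kacc (k : kap) := [&& cacc k.1.1, cacc k.1.2 & facc k.2.1 k.2.2].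

Definition val2 (s : seq bool) : nat := foldr (fun (b : bool) v => b + v.*2) 0 s.
Fixpoint bits n m : seq bool := if n is n'.+1 then odd m :: bits n' m./2 else [::].

Lemma size_bits n m : size (bits n m) = n.
Proof. by elim: n m => //= n IH m; rewrite IH. Qed.
Lemma val_bits n m : m < 2 ^ n -> val2 (bits n m) = m.
Proof.
elim: n m => [|n IH] m; first by rewrite expn0; case: m.
by rewrite expnS => H; rewrite /= IH ?odd_double_half //; lia.
Qed.
Lemma val_lt s : val2 s < 2 ^ size s.
Proof. by elim: s => //= b s IH; rewrite expnS; case: b; lia. Qed.
Lemma val_rcons s b : val2 (rcons s b) = val2 s + b * 2 ^ size s.
Proof. by elim: s => [|a s IH] /=; rewrite ?expn0 ?IH ?expnS; case: (b); lia. Qed.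

Definition cok (c : cop) (a b : nat) : bool := c.1.1 || (if c.1.2 then a == b + c.2 else b == a + c.2).

Lemma crun_acc (s : cs) xs ys : size xs = size ys ->
  cacc (foldl (fun s x => cstep s x.1 x.2) s (zip xs ys)) =
  s.1.1.1 || s.1.2 && (if s.1.1.2 then val2 xs == val2 ys + s.2 else val2 ys == val2 xs + s.2).
Proof.
elim: xs ys s => [|x xs IH] [|y ys] [[[fr sw] ok] c] //= Hs.
  by case: sw; case: c; rewrite ?andbF ?andbT.
case: Hs => /IH->; rewrite /cstep /=; congr (_ || _); rewrite -andbA; congr (_ && _).
by case: sw; case: x; case: y; case: c => /=; apply/idP/idP => /eqP H; apply/eqP; move: H => /=; lia.
Qed.

Section Numbers.
Variables (Q : eqType) (K : nat) (K_gt0 : 0 < K).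
Notation Op := (cop * cop)%type.
Notation rul := (Q * test * seq (Op * Q))%type.
Variables (rules : seq rul) (mu : nat) (KE : K = 2 ^ (mu - 2)).
Notation Off := (2 ^ K.-1).
Notation tv := (fun w : seq (bool * bool) => val2 (map fst w)).
Notation pv := (fun w : seq (bool * bool) => val2 (map snd w)).

Definition tok (te : test) (t p : nat) : bool := (te.1 ==> (t == 0)) &&
  (if p < Off then te.2.1.1 else if p == Off then te.2.1.2 else te.2.2).

Lemma zip_map (o n : seq (bool * bool)) : size o = size n ->
  zip (map fst o) (map fst n) = [seq (x.1.1, x.2.1) | x <- zip o n] /\
  zip (map snd o) (map snd n) = [seq (x.1.2, x.2.2) | x <- zip o n] :> seq (bool * bool).
Proof. by elim: o n => [|x o IH] [|y n] //= [/IH[-> ->]]. Qed.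

Lemma krunE k (o n : seq (bool * bool)) : size o = size n -> krun kdelta k o n =
  (foldl (fun s x => cstep s x.1 x.2) k.1.1 (zip (map fst o) (map fst n)),
   foldl (fun s x => cstep s x.1 x.2) k.1.2 (zip (map snd o) (map snd n)), (k.2.1, foldl fstep k.2.2 n)).
Proof.
rewrite /krun; elim: o n k => [|x o IH] [|y n] [[k1 k2] [te f]] //= [/IH->] //.
Qed.

Lemma frunP n : let f := foldl fstep (true, true, false) n in
  f.1.1 = (tv n == 0) /\ f.1.2 && ~~ f.2 = (pv n == 0).
Proof.
elim/last_ind: n => [|n x [IH1 IH2]] //=; rewrite foldl_rcons {1 3 4}/fstep /= IH1 IH2 !map_rcons !val_rcons.
have := expn_gt0 2 (size (map fst n)); have := expn_gt0 2 (size (map snd n)) => /= H1 H2.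
by split; case: x => [[] []] /=; rewrite ?mul1n ?mul0n ?addn0 ?andbT ?andbF //; symmetry; apply/negbTE; lia.
Qed.

Lemma kaccE op te o n : size o = K -> size n = K ->
  kacc (krun kdelta (kinit op te) o n) = [&& cok op.1 (tv o) (tv n), cok op.2 (pv o) (pv n) & tok te (tv n) (pv n)].
Proof.
move=> So Sn; rewrite krunE ?So //= /kacc /= !crun_acc ?size_map ?So // /cok /=.
do 2!congr (_ && _); rewrite /tok /facc.
case/lastP: n Sn => [|n x]; first by have := K_gt0; move=> /[swap] <-.
rewrite size_rcons => Sn; have [-> _] := frunP (rcons n x); congr (_ && _).
rewrite foldl_rcons /fstep /=; have [_ ->] := frunP n.
rewrite !map_rcons val_rcons size_map -Sn /=; have := val_lt (map snd n); rewrite size_map => Hlt.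
case: x.2; first by rewrite mul1n ltnNge leq_addl /= -[X in _ + _ == X]add0n eqn_add2r.
by rewrite mul0n addn0 Hlt.
Qed.

(** The derivations of [Qd] with words replaced by the numbers they denote: t on the first track, p
    on the second. Tests apply to the conclusion, and a [cop] relates its numbers to those of a
    premise. *)
Inductive prov : Q -> nat -> nat -> Prop :=
  provI (r : rul) t p (nt np : Op * Q -> nat) : r \in rules -> t < 2 ^ K -> p < 2 ^ K -> tok r.1.2 t p ->
    (forall c, c \in r.2 -> cok c.1.1 t (nt c) && cok c.1.2 p (np c)) ->
    (forall c, c \in r.2 -> prov c.2 (nt c) (np c)) -> prov r.1.1 t p.

Lemma prov_lt q t p : prov q t p -> t < 2 ^ K /\ p < 2 ^ K.
Proof. by case. Qed.

Lemma prov_rule (r : rul) t p : r \in rules -> t < 2 ^ K -> p < 2 ^ K -> tok r.1.2 t p ->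
  (forall c, c \in r.2 -> exists t' p', [/\ cok c.1.1 t t', cok c.1.2 p p' & prov c.2 t' p']) -> prov r.1.1 t p.
Proof.
move=> Hr Ht Hp Htok H.
have Hc c : exists x : nat * nat, c \in r.2 -> [/\ cok c.1.1 t x.1, cok c.1.2 p x.2 & prov c.2 x.1 x.2].
  case Hcr : (c \in r.2); last by exists (0, 0).
  by have [t' [p' H']] := H _ Hcr; exists (t', p').
pose f c := proj1_sig (constructive_indefinite_description _ (Hc c)).
have Hf c : c \in r.2 -> [/\ cok c.1.1 t (f c).1, cok c.1.2 p (f c).2 & prov c.2 (f c).1 (f c).2].
  exact: (proj2_sig (constructive_indefinite_description _ (Hc c))).
by apply: (@provI r t p (fun c => (f c).1) (fun c => (f c).2)) => // c /Hf[] // -> ->.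
Qed.

Notation Qd := (Qd kinit kdelta kacc mu rules).

Lemma Qd_prov op q o n : Qd op q o n -> [/\ cok op.1 (tv o) (tv n), cok op.2 (pv o) (pv n) & prov q (tv n) (pv n)].
Proof.
elim=> {}op r {}o {}n nw Hr So Sn Hacc _ IH.
rewrite -KE in So Sn; move: Hacc; rewrite kaccE // => /and3P[-> -> Ht]; split=> //.
apply: (@provI r _ _ (fun c => tv (nw c)) (fun c => pv (nw c))) => //.
- by have := val_lt (map fst n); rewrite size_map Sn.
- by have := val_lt (map snd n); rewrite size_map Sn.
- by move=> c /IH[-> ->].
- by move=> c /IH[].
Qed.

Lemma prov_Qd q t p : prov q t p -> forall op o n, size o = K -> size n = K -> tv n = t -> pv n = p ->
  cok op.1 (tv o) t -> cok op.2 (pv o) p -> Qd op q o n.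
Proof.
elim=> r {}t {}p nt np Hr Ht Hp Htok Hc Hpr IH op o n So Sn Et Ep H1 H2.
pose nw c := zip (bits K (nt c)) (bits K (np c)).
have Hnw c : c \in r.2 -> [/\ size (nw c) = K, tv (nw c) = nt c & pv (nw c) = np c].
  move=> /Hpr/prov_lt[L1 L2]; rewrite -!/(unzip1 _) -!/(unzip2 _) unzip1_zip ?unzip2_zip ?size_bits //.
  by rewrite !val_bits // size_zip !size_bits minnn.
apply: (@QdI _ _ _ _ _ _ _ _ _ _ r o n nw) => //; rewrite -?KE // ?kaccE ?Et ?Ep ?H1 ?H2 //.
move=> c Hcr; have [E1 E2 E3] := Hnw _ Hcr; have /andP[C1 C2] := Hc _ Hcr.
by apply: (IH c Hcr) => //; rewrite ?Et ?Ep.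
Qed.

Lemma Qd_free q : (exists o n, Qd ((true, false, false), (true, false, false)) q o n) <-> exists t p, prov q t p.
Proof.
split=> [[o [n /Qd_prov[_ _ H]]]|[t [p H]]]; first by exists (tv n), (pv n).
have [L1 L2] := prov_lt H; exists (nseq K (false, false)), (zip (bits K t) (bits K p)).
apply: (prov_Qd H) => //; rewrite ?size_nseq ?size_zip ?size_bits ?minnn //.
  by rewrite -!/(unzip1 _) unzip1_zip ?val_bits // !size_bits.
by rewrite -!/(unzip2 _) unzip2_zip ?val_bits // !size_bits.
Qed.
End Numbers.

(** * Judgements describing a run *)

Section Machine.
Variables (I : finType) (M : tm I void) (w : seq I).
Notation St := (tm_state M).
Notation C := (option (I + void + tm_aux M)).
Notation F := (St + C)%type.
Notation Q := (nat * seq F)%type.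
Notation Op := (cop * cop)%type.
Notation rul := (Q * test * seq (Op * Q))%type.
Notation fr := (true, false, false).
Notation same := (false, false, false).
Notation inc := (false, false, true).
Notation dec := (false, true, true).

(** Judgements at time t and position p. Positions are relative to the head, which always stands at
    [Off], so the tape is what moves. [jX]: state and scanned symbol; [jV]: content of cell p;
    [jJ u c]: content c at time 0 when the tape reads u from [Off] on; [jAcc]: some reachable
    configuration halts without accepting. *)
Definition jX (s : St) (a : C) : Q := (0, [:: inl s; inr a]).
Definition jV (c : C) : Q := (1, [:: inr c]).
Definition jEQ : Q := (2, [::]).
Definition jNE : Q := (3, [::]).
Definition jJ (u : seq F) (c : C) : Q := (4, inr c :: u).
Definition jAcc : Q := (5, [::]).
Definition any : bool * bool * bool := (true, true, true).

Definition mstep (s : St) (a : C) : St * C * move := if tm_halt s then (s, a, Stay) else tm_step s a.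
Definition mvop (m : move) : cop := match m with GoLeft => dec | Stay => same | GoRight => inc end.

Definition tails (T : Type) (s : seq T) : seq (seq T) := foldr (fun a l => (a :: head [::] l) :: l) [:: [::]] s.

Definition cells : seq C := enum {: C}.
Definition tape0 : seq F := [seq inr (Some (inl (inl x))) | x <- w].
Definition hd (u : seq F) : C := if u is inr c :: _ then c else None.

Definition rules_fix : seq rul :=
  [:: (jEQ, (false, (false, true, false)), [::]); (jNE, (false, (true, false, true)), [::])] ++
  [seq (jX (tm_init M) a, (true, (false, true, false)), [:: ((same, same), jV a)]) | a <- cells] ++
  [seq (jX (mstep x.1.1 x.1.2).1.1 x.2, (false, (false, true, false)),
     [:: ((dec, fr), jX x.1.1 x.1.2); ((same, same), jV x.2)]) | x <- enum {: St * C * C}] ++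
  [seq (jV x.2, (false, any), [:: ((dec, fr), jX x.1.1 x.1.2); ((dec, mvop (mstep x.1.1 x.1.2).2), jV x.2);
     ((dec, mvop (mstep x.1.1 x.1.2).2), jNE)]) | x <- enum {: St * C * C}] ++
  [seq (jV (mstep x.1 x.2).1.2, (false, any), [:: ((dec, fr), jX x.1 x.2); ((dec, mvop (mstep x.1 x.2).2), jEQ)])
     | x <- enum {: St * C}] ++
  [seq (jAcc, (false, any), [:: ((fr, fr), jX x.1 x.2)]) | x <- enum {: St * C} & tm_halt x.1 && ~~ tm_acc x.1].
(** The initial tape is read by walking from position p down to [Off] while dropping symbols, so
    only suffixes of the input occur. *)
Definition rules_in (t0 : seq F) : seq rul :=
  [seq (jV c, (true, any), [:: ((same, same), jJ t0 c)]) | c <- cells] ++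
  [seq (jJ u None, (false, (true, false, false)), [::]) | u <- tails t0] ++
  [seq (jJ u (hd u), (false, (false, true, false)), [::]) | u <- tails t0] ++
  flatten [seq [seq (jJ u c, (false, (false, false, true)), [:: ((same, dec), jJ (behead u) c)]) | c <- cells] | u <- tails t0].
Definition rules : seq rul := rules_fix ++ rules_in tape0.

Section Correct.
Variables (K : nat) (K_gt0 : 0 < K).
Notation Off := (2 ^ K.-1).
Notation prv := (prov K rules).

Definition cfg t := Defs.run M t w.
Definition tape_at (c : config M) p : C := if p < Off then nth None (cleft c) (Off - p.+1) else nth None (cright c) (p - Off).

Lemma cellat_head c : tape_at c Off = head None (cright c).
Proof. by rewrite /tape_at ltnn subnn nth0. Qed.

Lemma Off_gt0 : 0 < Off. Proof. by rewrite expn_gt0. Qed.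

Lemma Off_K : Off + Off = 2 ^ K.
Proof. by rewrite addnn -mul2n -expnS prednK. Qed.

(** With a fixed head, a move to the left raises the position of every cell by one and a move to the
    right lowers it; [q] is the position before the move. *)
Lemma next_cell c p q : cok (mvop (mstep (cstate c) (tape_at c Off)).2) p q ->
  tape_at (Defs.next c) p = (if q == Off then (mstep (cstate c) (tape_at c Off)).1.2 else tape_at c q) /\
  cstate (Defs.next c) = (mstep (cstate c) (tape_at c Off)).1.1.
Proof.
rewrite /mstep /Defs.next cellat_head; case: (tm_halt (cstate c)) => /=.
  by rewrite /cok /= addn0 => /eqP->; case: eqP => // ->; rewrite cellat_head.
case: (tm_step _ _) => [[s b] m] /=; case: c => s0 l r /=; have := Off_gt0; case: m; rewrite /cok /tape_at /=; set o := Off => Ho Hq; split=> //.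
- have {Hq}-> : p = q.+1 by move/eqP: Hq; lia.
  have [E|E] := eqVneq q o.
    by rewrite E ltnNge leqnSn /= subSn // subnn.
  case: (ltnP q.+1 o) => H.
    by rewrite (ltnW H) nth_behead; congr nth; lia.
  case: (ltnP q o) => H'.
    have -> : q.+1 - o = 0 by lia.
    have -> : o - q.+1 = 0 by lia.
    by rewrite nth0.
  have -> : q.+1 - o = (q - o.+1).+2 by lia.
  by rewrite /= nth_behead; congr nth; lia.
- have {Hq}-> : q = p by move/eqP: Hq; lia.
  have [->|E] := eqVneq p o; first by rewrite ltnn subnn.
  case: ltnP => // H; have -> : p - o = (p - o.+1).+1 by lia.
  by rewrite /= nth_behead.
- have {Hq}-> : q = p.+1 by move/eqP: Hq; lia.
  have [E|E] := eqVneq p.+1 o.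
    by rewrite -E ltnSn subnn.
  case: (ltnP p o) => H.
    rewrite ifT; last by lia.
    by have -> : o - p.+1 = (o - p.+2).+1 by lia.
  rewrite ifF; last by lia.
  by rewrite nth_behead; congr nth; lia.
Qed.

Definition mean (q : Q) t p : Prop :=
  match q with
  | (0, [:: inl s; inr a]) => [/\ p = Off, cstate (cfg t) = s & tape_at (cfg t) Off = a]
  | (1, [:: inr c]) => tape_at (cfg t) p = c
  | (2, _) => p = Off
  | (3, _) => p <> Off
  | (4, inr c :: u) => p < Off /\ c = None \/ Off <= p /\ c = hd (drop (p - Off) u)
  | (5, _) => exists t', tm_halt (cstate (cfg t')) && ~~ tm_acc (cstate (cfg t'))
  | _ => True
  end.

Lemma cfgS t : cfg t.+1 = Defs.next (cfg t). Proof. by []. Qed.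

Lemma hd_tape0 n : hd (drop n tape0) = nth None [seq Some (inl (inl x)) | x <- w] n.
Proof. by rewrite /tape0; elim: w n => [|x u IH] [|n] //=; rewrite -IH ?drop0. Qed.

Lemma cok_dec t t' : cok dec t t' -> t = t'.+1.
Proof. by rewrite /cok /= => /eqP; lia. Qed.
Lemma cok_same t t' : cok same t t' -> t' = t.
Proof. by rewrite /cok /= => /eqP; lia. Qed.

Lemma mv_uniq m p q q' : cok (mvop m) p q -> cok (mvop m) p q' -> q = q'.
Proof. by case: m; rewrite /cok /= => /eqP H /eqP H'; lia. Qed.

Lemma mem_snd (T : eqType) (a b : T) l : b \in [:: a, b & l].
Proof. by rewrite !inE eqxx orbT. Qed.
Lemma mem_thd (T : eqType) (a b c : T) l : c \in [:: a, b, c & l].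
Proof. by rewrite !inE eqxx !orbT. Qed.

Lemma next_state c : cstate (Defs.next c) = (mstep (cstate c) (tape_at c Off)).1.1.
Proof.
have H p q (Hc : cok (mvop (mstep (cstate c) (tape_at c Off)).2) p q) := proj2 (next_cell Hc).
case E : (mstep (cstate c) (tape_at c Off)).2; rewrite E in H.
- exact: (H 1 0 isT).
- exact: (H 0 0 isT).
- exact: (H 0 1 isT).
Qed.

Lemma tok_eq t p : tok K (false, (false, true, false)) t p -> p = Off.
Proof. by rewrite /tok /=; case: ltngtP. Qed.

(** Soundness of the rules. As the run is deterministic, what holds at the next time follows from
    positive information alone, and no negated judgement is required beyond [jNE]. *)
Lemma prov_mean q t p : prv q t p -> mean q t p.
Proof.
elim=> r {}t {}p nt np; rewrite /rules mem_cat => Hr _ _ Htok Hc _ IH.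
case/orP: Hr Htok Hc IH; rewrite ?mem_cat.
  case/orP; first rewrite !inE.
    case/orP=> /eqP-> /=; first by move/tok_eq.
    by move=> H _ _ E; move: H; rewrite E /tok /= ltnn eqxx.
  case/orP=> [/mapP[a _ ->]|].
    rewrite /= => H Hc IH; have /andP[/cok_same Et /cok_same Ep] := Hc _ (mem_head _ _).
    have /= := IH _ (mem_head _ _); rewrite Et Ep.
    move: H; rewrite /tok /= => /andP[/eqP-> H].
    by have -> : p = Off by case: ltngtP H.
  case/orP=> [/mapP[[[s a] a'] _ ->]|].
    rewrite /= => /tok_eq Hp Hc IH.
    have /andP[/cok_dec Et _] := Hc _ (mem_head _ _); have /andP[/cok_same Et' /cok_same Ep] := Hc _ (mem_snd _ _ _).
    have /= [H1 H2 H3] := IH _ (mem_head _ _); have /= H4 := IH _ (mem_snd _ _ _).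
    rewrite Et' Ep Hp in H4; split=> //; move: Et H2 H3; move: (nt _) => t1 -> H2 H3.
    by rewrite cfgS next_state H2 H3.
  case/orP=> [/mapP[[[s a] c] _ ->]|].
    rewrite /= => _ Hc IH.
    have /andP[/cok_dec Et _] := Hc _ (mem_head _ _); have /andP[/cok_dec Et' Hp] := Hc _ (mem_snd _ _ _).
    have /andP[/cok_dec Et2 Hp2] := Hc _ (mem_thd _ _ _ _).
    have /= [H1 H2 H3] := IH _ (mem_head _ _); have /= H4 := IH _ (mem_snd _ _ _); have /= H5 := IH _ (mem_thd _ _ _ _).
    move: Et Et' Et2 Hp Hp2 H1 H2 H3 H4 H5; move: (nt _) (nt _) (nt _) (np _) (np _) => t1 t2 t3 p2 p3.
    move=> -> [->] _ Hp Hp2 _ H2 H3 H4 H5; rewrite -H2 -H3 in Hp Hp2.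
    rewrite cfgS; have [-> _] := next_cell Hp; case: eqP => // E.
    by case: H5; rewrite -(mv_uniq Hp Hp2).
  case/orP=> [/mapP[[s a] _ ->]|/mapP[[s a]]].
    rewrite /= => _ Hc IH.
    have /andP[/cok_dec Et _] := Hc _ (mem_head _ _); have /andP[/cok_dec Et' Hp] := Hc _ (mem_snd _ _ _).
    have /= [H1 H2 H3] := IH _ (mem_head _ _); have /= H4 := IH _ (mem_snd _ _ _).
    move: Et Et' Hp H1 H2 H3 H4; move: (nt _) (nt _) (np _) => t1 t2 p2.
    move=> -> [->] Hp _ H2 H3 H4; rewrite -H2 -H3 in Hp *.
    by rewrite cfgS; have [-> _] := next_cell Hp; rewrite H4 eqxx.
  rewrite mem_filter => /andP[Ha _] -> /= _ _ IH.
  by have /= [H1 H2 H3] := IH _ (mem_head _ _); exists (nt (fr, fr, jX s a)); rewrite H2.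
case/orP=> [/mapP[c _ ->]|].
  rewrite /= => H Hc IH; have /andP[/cok_same Et /cok_same Ep] := Hc _ (mem_head _ _).
  have /= := IH _ (mem_head _ _); rewrite Ep; move: H => /andP[/eqP-> _].
  rewrite /tape_at /cfg /=; case=> [[H ->]|[H ->]]; first by rewrite H nth_nil.
  by rewrite ltnNge H /= hd_tape0.
case/orP=> [/mapP[u _ ->]|].
  by rewrite /= /tok /= => H _ _; left; case: ltngtP H.
case/orP=> [/mapP[u _ ->]|/flattenP[l /mapP[u _ ->] /mapP[c _ ->]]].
  by rewrite /= => /tok_eq-> _ _; right; rewrite subnn drop0.
rewrite /= => H Hc IH; have /andP[_ /cok_dec Ep] := Hc _ (mem_head _ _).
have Hp : Off < p by move: H; rewrite /tok /=; case: ltngtP.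
have /= := IH _ (mem_head _ _); move: (np _) Ep => p2 Ep; rewrite Ep in Hp *; case=> [[H' _]|[H' ->]]; first by lia.
by right; split; [exact: leqW|rewrite subSn // -drop1 drop_drop addn1].
Qed.

Lemma mstep_halt t t' : tm_halt (cstate (cfg t)) -> t <= t' -> cfg t' = cfg t.
Proof.
move=> H; elim: t' => [|t' IH]; first by rewrite leqn0 => /eqP->.
rewrite leq_eqVlt => /orP[/eqP-> //|/IH E].
by rewrite cfgS E /Defs.next H.
Qed.

Lemma tailsE (u : seq F) : exists l, tails u = u :: l.
Proof. by elim: u => [|a u [l IH]]; [exists [::]|exists (u :: l); rewrite /= -/(tails u) IH]. Qed.

Lemma tails_head (u : seq F) : u \in tails u.
Proof. by have [l ->] := tailsE u; exact: mem_head. Qed.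

Lemma tails_behead (u v : seq F) : u \in tails v -> behead u \in tails v.
Proof.
elim: v => [|a v IH]; first by rewrite !inE => /eqP->.
rewrite /= -/(tails v) !inE => /orP[/eqP->|/IH ->]; last by rewrite orbT.
by have [l E] := tailsE v; rewrite E /= mem_head orbT.
Qed.

Lemma rules_in_V0 c : (jV c, (true, any), [:: ((same, same), jJ tape0 c)]) \in rules.
Proof. by rewrite mem_cat [in X in _ || X]mem_cat map_f ?orbT // mem_enum. Qed.

Lemma prov_J u p t : u \in tails tape0 -> p < 2 ^ K -> t < 2 ^ K ->
  prv (jJ u (if p < Off then None else hd (drop (p - Off) u))) t p.
Proof.
have R1 v : v \in tails tape0 -> (jJ v None, (false, (true, false, false)), [::]) \in rules.
  by move=> Hv; rewrite /rules /rules_in mem_cat; apply/orP; right; rewrite !mem_cat; apply/orP; right;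
    apply/orP; left; exact: (map_f (fun u => (jJ u None, (false, (true, false, false)), [::]))).
have R2 v : v \in tails tape0 -> (jJ v (hd v), (false, (false, true, false)), [::]) \in rules.
  by move=> Hv; rewrite /rules /rules_in mem_cat; apply/orP; right; rewrite !mem_cat; apply/orP; right; apply/orP; right;
    apply/orP; left; exact: (map_f (fun u => (jJ u (hd u), (false, (false, true, false)), [::]))).
have R3 v c : v \in tails tape0 -> (jJ v c, (false, (false, false, true)), [:: ((same, dec), jJ (behead v) c)]) \in rules.
  move=> Hv; rewrite /rules /rules_in mem_cat; apply/orP; right; rewrite !mem_cat; do 3![apply/orP; right].
  apply/flattenP; eexists; first by apply/mapP; exists v.
  by apply/mapP; exists c => //; rewrite mem_enum.
move=> Hu Hp Ht; case: ltnP => H.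
  by apply: (prov_rule (r := (jJ u None, (false, (true, false, false)), [::]))) => //; [exact: R1|rewrite /tok /= H].
elim: p u Hu Hp H => [|p IH] u Hu Hp H; first by have := Off_gt0; rewrite lt0n => /eqP; move: H; rewrite leqn0 => /eqP.
move: H; rewrite leq_eqVlt => /orP[/eqP E|H].
  rewrite -E subnn drop0.
  by apply: (prov_rule (r := (jJ u (hd u), (false, (false, true, false)), [::]))) => //;
    [exact: R2|rewrite -E in Hp|rewrite /tok /= ltnn eqxx].
pose c := hd (drop (p.+1 - Off) u).
apply: (prov_rule (r := (jJ u c, (false, (false, false, true)), [:: ((same, dec), jJ (behead u) c)]))) => //; first exact: R3.
  by rewrite /tok /=; case: ltngtP H.
move=> d; rewrite inE => /eqP->; exists t, p; split; rewrite /cok /= ?addn0 ?addn1 //.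
have -> : c = hd (drop (p - Off) (behead u)) by rewrite /c -drop1 drop_drop addn1 subSn.
by apply: IH => //; [exact: tails_behead|exact: ltnW].
Qed.

(** Positions are bounded by 2 ^ K and a cell shifts by at most one per step; the margins of width t
    keep its whole history in range. *)
Lemma prov_cell t : (forall p, t <= p -> p + t < 2 ^ K -> prv (jV (tape_at (cfg t) p)) t p) /\
  (t <= Off -> Off + t < 2 ^ K -> prv (jX (cstate (cfg t)) (tape_at (cfg t) Off)) t Off).
Proof.
elim: t => [|t [IHV IHX]].
  have HV p : p < 2 ^ K -> prv (jV (tape_at (cfg 0) p)) 0 p.
    move=> Hp; set c := tape_at _ _.
    apply: (prov_rule (r := (jV c, (true, any), [:: ((same, same), jJ tape0 c)]))) => //; rewrite ?expn_gt0 //.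
    + exact: rules_in_V0.
    + by rewrite /tok /=; do 2?case: ifP.
    move=> d; rewrite inE => /eqP->; exists 0, p; split; rewrite /cok /= ?addn0 //.
    have -> : c = if p < Off then None else hd (drop (p - Off) tape0).
      by rewrite /c /tape_at /cfg /= nth_nil hd_tape0.
    by apply: prov_J; rewrite ?tails_head ?expn_gt0.
  split=> [p _|_]; rewrite addn0; first exact: HV.
  move=> Ho; apply: (prov_rule (r := (jX (tm_init M) (tape_at (cfg 0) Off), (true, (false, true, false)),
    [:: ((same, same), jV (tape_at (cfg 0) Off))]))) => //; rewrite ?expn_gt0 //.
  + rewrite /rules /rules_fix !mem_cat; apply/orP; left; apply/orP; right; apply/orP; left.
    by apply: (map_f (fun a => (jX (tm_init M) a, (true, (false, true, false)), [:: ((same, same), jV a)]))); rewrite mem_enum.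
  + by rewrite /tok /= ltnn eqxx.
  by move=> d; rewrite inE => /eqP->; exists 0, Off; split; rewrite /cok /= ?addn0 //; exact: HV.
set s := cstate (cfg t) in IHX; set a := tape_at (cfg t) Off in IHX.
have HV p : t.+1 <= p -> p + t.+1 < 2 ^ K -> prv (jV (tape_at (cfg t.+1) p)) t.+1 p.
  move=> H1 H2.
  have HX : prv (jX s a) t Off by apply: IHX; have := Off_K; move: (Off) => o; lia.
  pose q := match (mstep s a).2 with GoLeft => p.-1 | Stay => p | GoRight => p.+1 end.
  have Hq : cok (mvop (mstep s a).2) p q by rewrite /q /cok; case: (mstep s a).2 => /=; apply/eqP; lia.
  have Hqb : t <= q /\ q + t < 2 ^ K by rewrite /q; case: (mstep s a).2; lia.
  have HVq : prv (jV (tape_at (cfg t) q)) t q by apply: IHV; lia.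
  rewrite cfgS; have [-> _] := next_cell Hq; case: (q =P Off) => E.
    apply: (prov_rule (r := (jV (mstep s a).1.2, (false, any),
      [:: ((dec, fr), jX s a); ((dec, mvop (mstep s a).2), jEQ)]))) => //; try lia.
    + rewrite /rules /rules_fix !mem_cat; apply/orP; left; do 4![apply/orP; right]; apply/orP; left.
      by apply/mapP; exists (s, a); rewrite ?mem_enum.
    + by rewrite /tok /=; do 2?case: ifP.
    move=> d; rewrite !inE => /orP[]/eqP->; first by exists t, Off; split=> //; rewrite /cok /= addn1.
    exists t, q; split=> //; first by rewrite /cok /= addn1.
    apply: (prov_rule (r := (jEQ, (false, (false, true, false)), [::]))) => //; try lia.
      by rewrite E /tok /= ltnn eqxx.
  apply: (prov_rule (r := (jV (tape_at (cfg t) q), (false, any),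
     [:: ((dec, fr), jX s a); ((dec, mvop (mstep s a).2), jV (tape_at (cfg t) q)); ((dec, mvop (mstep s a).2), jNE)]))) => //; try lia.
  + rewrite /rules /rules_fix !mem_cat; apply/orP; left; do 3![apply/orP; right]; apply/orP; left.
    by apply/mapP; exists (s, a, tape_at (cfg t) q); rewrite ?mem_enum.
  + by rewrite /tok /=; do 2?case: ifP.
  move=> d; rewrite !inE => /or3P[]/eqP->; first by exists t, Off; split=> //; rewrite /cok /= addn1.
    by exists t, q; split=> //; rewrite /cok /= addn1.
  exists t, q; split=> //; first by rewrite /cok /= addn1.
  apply: (prov_rule (r := (jNE, (false, (true, false, true)), [::]))) => //; try lia.
  by rewrite /tok /=; case: ltngtP E.
split=> // H1 H2.
have HX : prv (jX s a) t Off by apply: IHX; lia.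
rewrite cfgS next_state -/s -/a -cfgS; set a' := tape_at _ _.
apply: (prov_rule (r := (jX (mstep s a).1.1 a', (false, (false, true, false)),
     [:: ((dec, fr), jX s a); ((same, same), jV a')]))) => //; try lia.
+ rewrite /rules /rules_fix !mem_cat; apply/orP; left; do 2![apply/orP; right]; apply/orP; left.
  by apply/mapP; exists (s, a, a'); rewrite ?mem_enum.
+ by rewrite /tok /= ltnn eqxx.
move=> d; rewrite !inE => /orP[]/eqP->; first by exists t, Off; split=> //; rewrite /cok /= addn1.
by exists t.+1, Off; split; rewrite /cok /= ?addn0 //; exact: HV.
Qed.

(** Since [T] is below [Off], the scanned cell at time [T] lies within those margins. A halted
    configuration never changes, so a rejecting one at any time is the one at [T]. *)
Lemma prov_reject T (L : Prop) : T < Off -> tm_halt (cstate (cfg T)) -> (L <-> tm_acc (cstate (cfg T))) ->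
  (exists t p, prv jAcc t p) <-> ~ L.
Proof.
move=> HT Hh HL; split=> [[t [p /prov_mean[t' /andP[H1 H2]]]] /HL H|HN].
  have E : cfg t' = cfg T.
    by case: (leqP t' T) => Hle; [rewrite (mstep_halt H1 Hle)|rewrite (mstep_halt Hh (ltnW Hle))].
  by rewrite E H in H2.
have HK := Off_K; exists 0, 0.
apply: (prov_rule (r := (jAcc, (false, any), [:: ((fr, fr), jX (cstate (cfg T)) (tape_at (cfg T) Off))]))); rewrite ?expn_gt0 //.
+ rewrite /rules /rules_fix !mem_cat; apply/orP; left; do 5![apply/orP; right].
  apply/mapP; exists (cstate (cfg T), tape_at (cfg T) Off) => //.
  by rewrite mem_filter mem_enum /= Hh andbT; apply/negP => /HL.
+ by rewrite /tok /=; do 2?case: ifP.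
move=> d; rewrite inE => /eqP->; exists T, Off; split=> //.
by apply: (proj2 (prov_cell T)); lia.
Qed.
End Correct.
End Machine.

(** * Generating the TBox in polynomial time *)

#[export] Instance code_nat : code nat := Code num_inj.

Lemma code_sum_inj X Y {cX : code X} {cY : code Y} :
  injective (fun x : X + Y => match x with inl a => Node (num 0) (enc a) | inr b => Node (num 1) (enc b) end).
Proof. by move=> [a|b] [a'|b'] //= [] E; rewrite (enc_inj E). Qed.
#[export] Instance code_sum X Y {cX : code X} {cY : code Y} : code (X + Y) := Code (@code_sum_inj X Y cX cY).

Section Basics.
Context {X : Type} {cX : code X}.

Lemma pf_inl Y Z {cY : code Y} {cZ : code Z} (f : X -> Y) : pf f -> pf (fun x => inl (f x) : Y + Z).
Proof. exact: (pf_tag (k := 0)). Qed.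
Lemma pf_inr Y Z {cY : code Y} {cZ : code Z} (f : X -> Z) : pf f -> pf (fun x => inr (f x) : Y + Z).
Proof. exact: (pf_tag (k := 1)). Qed.

Lemma pf_succ (f : X -> nat) : pf f -> pf (fun x => (f x).+1).
Proof. exact: (pf_tag (k := 0)). Qed.

End Basics.

Section Lists.
Context {X : Type} {cX : code X}.

Lemma pf_len Y {cY : code Y} (f : X -> seq Y) : pf f -> pf (fun x => size (f x)).
Proof.
move=> Hf; apply: (pf_ext (f := fun x => foldr (fun _ n => n.+1) 0 (f x))).
  by move=> x; elim: (f x) => //= a l ->.
have E l : foldr (fun (_ : Y) n => n.+1) 0 l = size l by elim: l => //= a l ->.
apply: (pf_foldr (F := fun _ _ n => n.+1) (K := fun x => 2 * esz (f x))) => //.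
- by apply: pb_mul; [exact: pb_const|exact: pf_size].
- move=> x i; rewrite E; have -> : esz (size (drop i (f x))) = (size (drop i (f x))).*2.+1 by exact: tsize_num.
  by generalize (size_esz (f x)); rewrite size_drop; lia.
- by apply: pf_succ; exact: pf_snd (pf_fst pf_id).
- exact: pf_const.
Qed.

Lemma pf_iota Y {cY : code Y} (f : X -> seq Y) : pf f -> pf (fun x => iota 0 (size (f x))).
Proof.
move=> Hf; have E (l : seq Y) : foldr (fun _ s => 0 :: map S s) [::] l = iota 0 (size l).
  by elim: l => //= a l ->; rewrite (iotaDl 1 0).
apply: (pf_ext (f := fun x => foldr (fun _ s => 0 :: map S s) [::] (f x))); first by move=> x; rewrite E.
have B m n : esz (iota m n) <= n * (2 * (m + n) + 2) + 1.
  elim: n m => [|n IH] m; first by rewrite esz_nil.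
  have -> : iota m n.+1 = m :: iota m.+1 n by [].
  rewrite esz_cons; have -> : esz m = m.*2.+1 by exact: tsize_num.
  by generalize (IH m.+1); nia.
apply: (pf_foldr (F := fun _ _ s => 0 :: map S s) (K := fun x => esz (f x) * (2 * esz (f x) + 2) + 1)) => //.
- have H := pf_size Hf.
  by do ![apply: pb_add|apply: pb_mul|exact: pb_const|exact: H].
- move=> x i; rewrite E; apply: leq_trans (B _ _) _; generalize (size_esz (f x)); rewrite size_drop add0n.
  by move: (size (f x)) (esz (f x)) => a b H; rewrite leq_add2r leq_mul //; lia.
- apply: pf_cons; first exact: pf_const.
  by apply: pf_map; [apply: pf_succ; exact: pf_snd pf_id|exact: pf_snd (pf_fst pf_id)].
- exact: pf_const.
Qed.

Lemma pf_tails Y {cY : code Y} (f : X -> seq Y) : pf f -> pf (fun x => tails (f x)).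
Proof.
move=> Hf; have HS := pf_size Hf.
have B (l : seq Y) : esz (tails l) <= (esz l + 1) * (esz l + 1) + 2.
  elim: l => [|a l IH].
    by have -> : tails ([::] : seq Y) = [:: [::]] by []; rewrite esz_cons !esz_nil; lia.
  have E : head [::] (tails l) = l by elim: l {IH} => //= b l ->.
  have -> : tails (a :: l) = (a :: l) :: tails l by rewrite /= -/(tails l) E.
  rewrite !esz_cons; revert IH; generalize (esz_gt0 a); generalize (esz a) (esz l) (esz (tails l)).
  by clear => x y z; nia.
apply: (pf_foldr (F := fun _ a l => (a :: head [::] l) :: l) (K := fun x => (esz (f x) + 1) * (esz (f x) + 1) + 2)) => //.
- by do ![apply: pb_add|apply: pb_mul|exact: pb_const|exact: HS].
- move=> x i; apply: leq_trans (B _) _; generalize (esz_drop i (f x)).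
  by generalize (esz (drop i (f x))) (esz (f x)) => a b H; rewrite leq_add2r leq_mul // leq_add2r.
- apply: pf_cons; last by pfs.
  by apply: pf_cons; [pfs|apply: pf_head; pfs].
- exact: pf_const.
Qed.

(** A list of length [size s ^ k]: the number of counter bits is passed around in unary. *)
Fixpoint powlist (s : seq X) k : seq bool := if k is k'.+1 then flatten [seq powlist s k' | _ <- s] else [:: true].
Lemma size_powlist s k : size (powlist s k) = size s ^ k.
Proof.
elim: k => //= k IH; rewrite size_flatten /shape -map_comp sumnE big_map big_const_seq count_predT iter_addn_0 /= IH.
by rewrite expnSr.
Qed.
End Lists.

Lemma pf_powlist X Y {cX : code X} {cY : code Y} (f : X -> seq Y) k : pf f -> pf (fun x => powlist (f x) k).
Proof.
move=> Hf; elim: k => [|k IH]; first exact: pf_const.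
apply: pf_flatten; apply: (pf_map (F := fun x _ => powlist (f x) k)) => //.
by apply: (pf_comp IH); exact: pf_fst pf_id.
Qed.

Definition body (T : tbox) : seq token := flatten [seq enc_concept i.1 ++ enc_concept i.2 | i <- T].
Lemma body_cat T1 T2 : body (T1 ++ T2) = body T1 ++ body T2.
Proof. by rewrite /body map_cat flatten_cat. Qed.
Lemma body_flatten (A : Type) (h : A -> tbox) l : body (flatten (map h l)) = flatten [seq body (h a) | a <- l].
Proof. by elim: l => //= a l IH; rewrite body_cat IH. Qed.

(** Only the token words have to be computed, so it is the encodings of concepts and of TBoxes that
    are shown to be polynomial. *)
Notation tf f := (pf (fun x => enc_concept (f x))).
Notation bd f := (pf (fun x => body (f x))).

Lemma enc_conj (A : Type) (g : A -> concept) l :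
  enc_concept (foldr (fun c => CAnd (g c)) CTop l) = flatten [seq KAnd :: enc_concept (g c) | c <- l] ++ [:: KTop].
Proof. by elim: l => //= c l ->; rewrite -catA. Qed.

Section Tokens.
Context {X : Type} {cX : code X}.

Lemma tf_top : tf (fun _ : X => CTop). Proof. exact: pf_const. Qed.
Lemma tf_not (C : X -> concept) : tf C -> tf (fun x => CNot (C x)).
Proof. by move=> H; apply: pf_cons; [exact: pf_const|]. Qed.
Lemma tf_and (C D : X -> concept) : tf C -> tf D -> tf (fun x => CAnd (C x) (D x)).
Proof. by move=> H1 H2; apply: pf_cons; [exact: pf_const|exact: pf_cat]. Qed.
Lemma tf_ex R (C : X -> concept) : tf C -> tf (fun x => CEx R (C x)).
Proof. by move=> H; apply: pf_cons; [exact: pf_const|apply: pf_cat => //; exact: pf_const]. Qed.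
Lemma tf_all R (C : X -> concept) : tf C -> tf (fun x => CAll R (C x)).
Proof. by move=> H; apply: tf_not; apply: tf_ex; exact: tf_not. Qed.

Lemma bd_nil : bd (fun _ : X => [::]). Proof. exact: pf_const. Qed.
Lemma bd_cons (C D : X -> concept) (l : X -> tbox) : tf C -> tf D -> bd l -> bd (fun x => (C x, D x) :: l x).
Proof. by move=> H1 H2 H3; apply: pf_cat H3; exact: pf_cat. Qed.
Lemma bd_cat (l l' : X -> tbox) : bd l -> bd l' -> bd (fun x => l x ++ l' x).
Proof. by move=> H1 H2; apply: (pf_ext _ (pf_cat H1 H2)) => x; rewrite body_cat. Qed.
Lemma bd_flat (A : Type) {cA : code A} (h : X -> A -> tbox) (l : X -> seq A) :
  bd (fun p : X * A => h p.1 p.2) -> pf l -> bd (fun x => flatten [seq h x a | a <- l x]).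
Proof.
move=> Hh Hl; apply: (pf_ext (f := fun x => flatten [seq body (h x a) | a <- l x])).
  by move=> x; rewrite body_flatten.
by apply: pf_flatten; apply: pf_map.
Qed.
End Tokens.

Lemma pf_finite (A : finType) Y {cA : code A} {cY : code Y} (f : A -> Y) : pf f.
Proof. by apply: (@pf_cases A Y cA cY f (enum A)) => a; rewrite mem_enum. Qed.

Section Generate.
Variables (Q : eqType) (Op Te Kp : finType).
Context {cQ : code Q} {cOp : code Op} {cTe : code Te} {cKp : code Kp}.
Variables (init : Op -> Te -> Kp) (delta : Kp -> pairsym -> pairsym -> Kp) (acc : Kp -> bool).
Notation rul := (Q * Te * seq (Op * Q))%type.
Notation nsym := ((nat * nat) + ((Kp * rul) + (rul + Op * Q)))%type.

Definition nmc (s : nsym) : name := str (enc s).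
Lemma nmc_inj : injective nmc.
Proof.
move=> s s' E; apply: (@enc_inj nsym _); apply: (proj1 (@str_inj _ _ [::] [::] _)).
by rewrite !cats0.
Qed.

Section Env.
Context {X : Type} {cX : code X}.

Lemma pf_nmc (s : X -> nsym) : pf s -> pf (fun x => nmc (s x)).
Proof. by apply: pf_comp; exact: pf_tree polyf_flat _. Qed.

Lemma tf_cn (s : X -> nsym) : pf s -> tf (fun x => cn nmc (s x)).
Proof.
move=> Hs; apply: pf_rcons; last exact: pf_const.
apply: pf_map; last exact: pf_nmc.
have H : pf KBit.
  by apply: (pf_ext (f := fun b : bool => if b then KBit true else KBit false)); [case|apply: pf_if; [exact: pf_id|exact: pf_const|exact: pf_const]].
by apply: (pf_comp H); exact: pf_snd pf_id.
Qed.

Lemma tf_yT k (i : X -> nat) : pf i -> tf (fun x => cn nmc (inl (k, i x))).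
Proof. by move=> Hi; apply: tf_cn; apply: pf_inl; apply: pf_pair => //; exact: pf_const. Qed.
Lemma tf_yC k i : tf (fun _ : X => cn nmc (inl (k, i))).
Proof. exact: pf_const. Qed.
Lemma tf_ySt (k : X -> Kp) (r : X -> rul) : pf k -> pf r -> tf (fun x => cn nmc (inr (inl (k x, r x)))).
Proof. by move=> Hk Hr; apply: tf_cn; apply: pf_inr; apply: pf_inl; exact: pf_pair. Qed.
Lemma tf_yEnd (r : X -> rul) : pf r -> tf (fun x => cn nmc (inr (inr (inl (r x))))).
Proof. by move=> Hr; apply: tf_cn; apply: pf_inr; apply: pf_inr; apply: pf_inl. Qed.
Lemma tf_yQ (o : X -> Op) (q : X -> Q) : pf o -> pf q -> tf (fun x => cn nmc (inr (inr (inr (o x, q x))))).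
Proof. by move=> Ho Hq; apply: tf_cn; do 3!apply: pf_inr; exact: pf_pair. Qed.

Lemma bd_count (i : X -> nat) : pf i -> bd (fun x => tb_count nmc (i x)).
Proof.
move=> Hi; have HS := pf_succ Hi; rewrite /tb_count.
have Z k : tf (fun x => cn nmc (inl (k, i x))) by exact: tf_yT.
have S k : tf (fun x => cn nmc (inl (k, (i x).+1))) by exact: tf_yT.
have A k l := tf_and (Z k) (Z l); have R k := tf_all nR (Z k).
exact: (bd_cons (tf_yC 0 3) (Z 5) (bd_cons (A 1 4) (S 1) (bd_cons (A 1 5) (S 2) (bd_cons (Z 2) (S 2)
  (bd_cons (A 3 5) (S 3) (bd_cons (A 1 5) (R 4) (bd_cons (A 1 4) (R 5) (bd_cons (A 2 5) (R 5)
  (bd_cons (A 2 4) (R 4) (bd_cons (A 4 5) (tf_not tf_top) bd_nil)))))))))).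
Qed.

Lemma bd_fix (m : X -> nat) op0 q0 : pf m -> bd (fun x => tb_fix nmc (m x) op0 q0).
Proof.
move=> Hm; rewrite /tb_fix.
have Z k : tf (fun x => cn nmc (inl (k, m x))) by exact: tf_yT.
have Y k i : tf (fun _ : X => cn nmc (inl (k, i))) by exact: tf_yC.
have Hq : tf (fun _ : X => cn nmc (inr (inr (inr (op0, q0))))) by exact: pf_const.
exact: (bd_cons (Y 0 2) (Y 0 3) (bd_cons tf_top (Y 1 0) (bd_cons tf_top (Y 3 0)
  (bd_cons (tf_and (Y 0 2) Hq) (tf_ex nX (tf_and (Y 0 0) (tf_and (Y 0 4) (Y 0 3))))
  (bd_cons (tf_and (Y 0 4) (Z 2)) (tf_ex nR (Y 0 4)) (bd_cons (tf_and (Y 0 4) (Z 1)) (tf_ex nR (Y 0 1)) bd_nil)))))).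
Qed.

Notation trip := (Kp * (bool * bool) * (bool * bool))%type.

Lemma tf_cell (x : X -> trip) (C : X -> concept) : pf x -> tf C -> tf (fun y => cellc nmc (x y).1.2 (x y).2 (C y)).
Proof.
move=> Hx HC.
have Hl j D : tf D -> tf (fun y => lab nmc (x y).1.2 (x y).2 j (D y)).
  move=> HD; rewrite /lab.
  have H (f : trip -> concept) : tf (fun y => f (x y)).
    exact: (pf_comp (pf_finite (fun t : trip => enc_concept (f t))) Hx).
  apply: tf_and; first exact: (H (fun t => if ix t.2 == j then _ else _)).
  by apply: tf_and => //; exact: (H (fun t => if ix t.1.2 == j then _ else _)).
by rewrite /cellc; do 3![apply: (Hl); apply: tf_ex]; exact: Hl.
Qed.

Lemma bd_cell (m : X -> nat) (r : X -> rul) (x : X -> trip) : pf m -> pf r -> pf x ->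
  bd (fun y => tb_cell delta acc nmc (m y) (r y) (x y)).
Proof.
move=> Hm Hr Hx; rewrite /tb_cell.
have Hd : pf (fun y => delta (x y).1.1 (x y).1.2 (x y).2).
  exact: (pf_comp (pf_finite (fun t : trip => delta t.1.1 t.1.2 t.2)) Hx).
have Hk : pf (fun y => (x y).1.1) by exact: pf_fst (pf_fst Hx).
apply: bd_cons.
- apply: tf_cell => //; apply: tf_and; first exact: tf_yT.
  by apply: tf_ex; exact: tf_ySt.
- exact: tf_ySt.
apply: (pf_ext (f := fun y => if acc (delta (x y).1.1 (x y).1.2 (x y).2) then
  body [:: (cellc nmc (x y).1.2 (x y).2 (CAnd (cn nmc (inl (1, m y))) (cn nmc (inr (inr (inl (r y)))))), cn nmc (inr (inl ((x y).1.1, r y))))]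
  else body [::])).
  by move=> y; case: ifP.
apply: pf_if; [|apply: bd_cons|exact: pf_const].
- exact: pf_comp (pf_finite acc) Hd.
- by apply: tf_cell => //; apply: tf_and; [exact: tf_yT|exact: tf_yEnd].
- exact: tf_ySt.
exact: bd_nil.
Qed.
End Env.

Section Env2.
Context {X : Type} {cX : code X}.

Lemma tf_prems (l : X -> seq (Op * Q)) : pf l ->
  tf (fun x => foldr (fun c => CAnd (CEx nR (cn nmc (inr (inr (inr (c.1, c.2))))))) CTop (l x)).
Proof.
move=> Hl; apply: (pf_ext (f := fun x => flatten [seq KAnd :: enc_concept (CEx nR (cn nmc (inr (inr (inr (c.1, c.2)))))) | c <- l x] ++ [:: KTop])).
  by move=> x; rewrite enc_conj.
apply: pf_cat; last exact: pf_const.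
apply: pf_flatten; apply: pf_map => //.
apply: pf_cons; first exact: pf_const.
by apply: (tf_ex nR); apply: tf_yQ; [exact: pf_fst (pf_snd pf_id)|exact: pf_snd (pf_snd pf_id)].
Qed.

Lemma bd_rule (m : X -> nat) (r : X -> rul) : pf m -> pf r -> bd (fun x => tb_rule init delta acc nmc (m x) (r x)).
Proof.
move=> Hm Hr; rewrite /tb_rule; apply: bd_cons.
- by apply: tf_prems; exact: pf_snd Hr.
- exact: tf_yEnd.
have P1 A (cA : code A) (h : X -> A) : pf h -> pf (fun p : X * Op => h p.1).
  by move=> Hh; apply: (pf_comp Hh); exact: pf_fst pf_id.
have P2 A (cA : code A) (h : X -> A) : pf h -> pf (fun p : X * (Kp * (bool * bool) * (bool * bool)) => h p.1).
  by move=> Hh; apply: (pf_comp Hh); exact: pf_fst pf_id.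
apply: bd_cat.
  apply: (pf_ext (f := fun x => body (flatten [seq [:: (CAnd (cn nmc (inl (3, m x))) (cn nmc (inr (inl (init op (r x).1.2, r x)))), cn nmc (inr (inr (inr (op, (r x).1.1)))))] | op <- enum Op]))).
    by move=> x; congr body; elim: (enum Op) => //= a l ->.
  apply: bd_flat; last exact: pf_const.
  have Hr' := P1 _ _ _ Hr; apply: bd_cons; last exact: bd_nil.
    apply: tf_and; first by apply: tf_yT; exact: P1.
    have H0 : pf (fun p : X * Op => (p.2, (r p.1).1.2)) by exact: pf_pair (pf_snd pf_id) (pf_snd (pf_fst Hr')).
    by apply: tf_ySt => //; exact: (pf_comp (pf_finite (fun t : Op * Te => init t.1 t.2)) H0).
  by apply: tf_yQ; [exact: pf_snd pf_id|exact: pf_fst (pf_fst Hr')].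
apply: bd_flat; last exact: pf_const.
by apply: bd_cell; [exact: P2|exact: P2|exact: pf_snd pf_id].
Qed.
End Env2.

Lemma bd_tb X {cX : code X} (m : X -> nat) (rs : X -> seq rul) op0 q0 : pf m -> pf (fun x => iota 0 (m x)) -> pf rs ->
  bd (fun x => tb init delta acc nmc (m x) (rs x) op0 q0).
Proof.
move=> Hm Hi Hr; rewrite /tb; apply: bd_cat; first exact: bd_fix.
apply: bd_cat; apply: bd_flat => //.
  by apply: bd_count; exact: pf_snd pf_id.
by apply: bd_rule; [apply: (pf_comp Hm); exact: pf_fst pf_id|exact: pf_snd pf_id].
Qed.
End Generate.

(** * Hardness for 2ExpTime *)

Section Hardness.
Variables (I : finType) (M : tm I void) (k : nat).
Notation St := (tm_state M).
Notation C := (option (I + void + tm_aux M)).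
Notation F := (St + C)%type.
Notation Q := (nat * seq F)%type.
Notation Op := (bool * bool * bool * (bool * bool * bool))%type.
Notation Te := (bool * (bool * bool * bool))%type.
Notation rul := (Q * Te * seq (Op * Q))%type.
#[local] Instance cdI : code I := fin_code I.
#[local] Instance cF : code F := fin_code F.
#[local] Instance cC : code C := fin_code C.

(** With n ^ k + k + 4 counter bits a word has K = 2 ^ (n ^ k + k + 2) letters, and 2 ^ (K - 1)
    exceeds the running time 2 ^ (2 ^ (n ^ k + k)). *)
Definition mulist (w : seq I) := powlist w k ++ nseq (k + 4) true.
Definition muw w := size (mulist w).
Lemma muwE w : muw w = size w ^ k + k + 4.
Proof. by rewrite /muw /mulist size_cat size_powlist size_nseq addnA. Qed.

Lemma pf_jJ (X : Type) {cX : code X} (u : X -> seq F) (c : X -> C) : pf u -> pf c -> pf (fun x => jJ (u x) (c x)).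
Proof.
move=> Hu Hc; apply: pf_pair; first exact: pf_const.
by apply: pf_cons => //; exact: (pf_comp (pf_finite (fun c : C => inr c : F)) Hc).
Qed.
Lemma pf_jV (X : Type) {cX : code X} (c : X -> C) : pf c -> pf (fun x => jV (c x)).
Proof.
move=> Hc; apply: pf_pair; first exact: pf_const.
by apply: pf_cons; [exact: (pf_comp (pf_finite (fun c : C => inr c : F)) Hc)|exact: pf_const].
Qed.
Lemma pf_hd (X : Type) {cX : code X} (u : X -> seq F) : pf u -> pf (fun x => hd (u x)).
Proof.
move=> Hu; pose g (x : F) : C := if x is inr c then c else None.
apply: (pf_ext (f := fun x => g (head (inr None) (u x)))); first by move=> x; case: (u x) => [|[]].
by apply: (pf_comp (pf_finite g)); exact: pf_head.
Qed.

Lemma pf_rules : pf (fun w : seq I => rules M w).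
Proof.
have Ht : pf (fun w : seq I => tape0 M w).
  apply: pf_map; last exact: pf_id.
  by apply: (pf_comp (pf_finite (fun x : I => inr (Some (inl (inl x))) : F))); exact: pf_snd pf_id.
rewrite /rules; apply: pf_cat; first exact: pf_const.
have H : pf (fun t0 : seq F => rules_in t0).
  have T1 : pf (fun t0 : seq F => tails t0) by exact: pf_tails pf_id.
  have P1 : pf (fun p : seq F * C => p.1) by exact: pf_fst pf_id.
  have P2 : pf (fun p : seq F * C => p.2) by exact: pf_snd pf_id.
  have S2 : pf (fun p : seq F * seq F => p.2) by exact: pf_snd pf_id.
  have U1 : pf (fun p : seq F * seq F * C => p.1.2) by exact: pf_snd (pf_fst pf_id).
  have U2 : pf (fun p : seq F * seq F * C => p.2) by exact: pf_snd pf_id.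
  have D (X Y : Type) (cX : code X) (cY : code Y) (y : Y) : pf (fun _ : X => y) by exact: pf_const.
  rewrite /rules_in; apply: pf_cat.
    apply: pf_map; last exact: pf_const.
    exact: pf_pair (pf_pair (pf_jV P2) (D _ _ _ _ _)) (pf_cons (pf_pair (D _ _ _ _ _) (pf_jJ P1 P2)) (D _ _ _ _ _)).
  apply: pf_cat.
    by apply: pf_map T1; exact: pf_pair (pf_pair (pf_jJ S2 (D _ _ _ _ _)) (D _ _ _ _ _)) (D _ _ _ _ _).
  apply: pf_cat.
    by apply: pf_map T1; exact: pf_pair (pf_pair (pf_jJ S2 (pf_hd S2)) (D _ _ _ _ _)) (D _ _ _ _ _).
  apply: pf_flatten; apply: pf_map T1; apply: pf_map; last exact: pf_const.
  exact: pf_pair (pf_pair (pf_jJ U1 U2) (D _ _ _ _ _)) (pf_cons (pf_pair (D _ _ _ _ _) (pf_jJ (pf_behead U1) U2)) (D _ _ _ _ _)).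
exact: (pf_comp H Ht).
Qed.

Definition free : cop := (true, false, false).
Definition nmI := nmc (Q := (nat * seq F)%type) (Op := Op) (Te := Te) (Kp := kap).
Lemma nmI_inj : injective nmI.
Proof. exact: nmc_inj. Qed.

Definition T2 (w : seq I) : tbox := tb kinit kdelta kacc nmI (muw w) (rules M w) (free, free) (jAcc M).
Definition sgI := sg nmI.
Definition reduct (w : seq I) : instance := ([::], T2 w, (sgI, sgI)).

Lemma pf_T2 : bd T2.
Proof.
have Hm : pf (fun w : seq I => mulist w).
  by apply: pf_cat; [apply: pf_powlist; exact: pf_id|exact: pf_const].
have H1 := pf_len Hm; have H2 := pf_iota Hm.
exact: (bd_tb (Q := (nat * seq F)%type) kinit kdelta kacc (free, free) (jAcc M) H1 H2 pf_rules).
Qed.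

Lemma pf_reduct : pf (fun w => enc_instance (reduct w)).
Proof.
apply: (pf_ext (f := fun w => KEnd :: (body (T2 w) ++ [:: KEnd]) ++ enc_signature sgI ++ enc_signature sgI)).
  by move=> w; rewrite cats1.
apply: pf_cons; first exact: pf_const.
by apply: pf_cat; [apply: pf_cat; [exact: pf_T2|exact: pf_const]|exact: pf_const].
Qed.

(** Entailment fails iff [jAcc], the judgement of rejection, has a derivation; so acceptance
    corresponds to entailment. *)
Lemma reduct_correct (L : seq I -> Prop) : decides M L (fun n => 2 ^ (2 ^ (n ^ k + k))) ->
  forall w, L w <-> horn_cq_entailment (reduct w).
Proof.
move=> Hdec w; have [Hh HL] := Hdec w.
set T := 2 ^ (2 ^ _) in Hh HL.
pose K := 2 ^ (muw w - 2).
have HK : 0 < K by rewrite expn_gt0.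
have Hmu : 1 < muw w by rewrite muwE; lia.
have HT : T < 2 ^ K.-1.
  rewrite ltn_exp2l // /K muwE.
  have -> : size w ^ k + k + 4 - 2 = (size w ^ k + k).+2 by lia.
  by rewrite !expnS; have := expn_gt0 2 (size w ^ k + k) => /= H; lia.
have HQ := Qd_free HK (rules M w) (erefl : K = 2 ^ (muw w - 2)) (jAcc M).
have HP := prov_reject HK HT Hh HL.
have Hent : cq_entails (sgI, sgI) [::] (T2 w) <-> L w.
  split=> [H|H].
    apply: NNPP => HN; have /HQ[old [new Hd]] := proj2 HP HN.
    have H' := Qd_nonentails nmI_inj Hmu Hd. exact: (H' H).
  by apply: (Qd_entails nmI_inj Hmu) => /HQ/HP.
split=> [H|[_ _ /Hent //]].
split; last exact/Hent; first by apply/hornP.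
by apply/hornP; exact: hornb_tb.
Qed.
End Hardness.

(** The reduction only produces instances with an empty first TBox and equal signatures, so one
    proof serves the general problem and its restriction. *)
Lemma horn_hard (P : instance -> Prop) : (forall S T, P ([::], T, (S, S)) <-> horn_cq_entailment ([::], T, (S, S))) ->
  hard_2exptime (language P).
Proof.
move=> HP I L [M [k Hdec]]; exists (fun w => enc_instance (reduct M k w)); split.
  by apply: pf_polytime; exact: pf_reduct.
move=> w; rewrite (reduct_correct Hdec w); split=> [H|[x [H /enc_instance_inj E]]].
  by exists (reduct M k w); split=> //; exact/HP.
by apply/HP; rewrite -/(reduct M k w) E.
Qed.

Theorem theorem13 :
  complete_2exptime (language horn_cq_entailment) /\
  hard_2exptime (language (fun x => horn_cq_entailment x /\ same_signature x)).
Proof.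
split; first by split; [exact: horn_in_2exptime|exact: horn_hard].
by apply: horn_hard => S T; split=> [[]|].
Qed.
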